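(* Consider the system $$x'=y,\qquad y'=\rho z^2\cos x+(z^2+\kappa)\sin x\cos x-\sin x-\varepsilon y,\qquad z'=\alpha(\cos x-\beta)$$ with $\rho=0$, regarded as a family with parameter $\varepsilon$. Fix $\beta\in(0,1)$, $\alpha>0$ and $\kappa\in[0,1)$, and let $\varepsilon_c=2\alpha\beta^{3/2}(1-\kappa\beta)^{1/2}$. If $l_1(\beta,\alpha,0,\kappa)\neq0$, then the family has a transversal Hopf point at $P_0$ for $\varepsilon=\varepsilon_c$. Moreover: (a) if $l_1<0$, then at $\varepsilon=\varepsilon_c$ the equilibrium $P_0$ is asymptotically stable, and for each $\varepsilon<\varepsilon_c$ sufficiently close to $\varepsilon_c$ there is a stable periodic orbit near the unstable equilibrium $P_0$; (b) if $l_1>0$, then at $\varepsilon=\varepsilon_c$ the equilibrium $P_0$ is unstable, and for each $\varepsilon>\varepsilon_c$ sufficiently close to $\varepsilon_c$ there is an unstable periodic orbit near the asymptotically stable equilibrium $P_0$.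
   Context: For $\rho=0$ the equilibrium is $P_0=(\arccos\beta,0,(1/\beta-\kappa)^{1/2})$. Set $\omega_0=\omega_1=\sqrt{(1-\beta^2)/\beta}$. At $\varepsilon=\varepsilon_c$, the Jacobian $A=Df(P_0)$ has eigenvalues $-\varepsilon_c$ and $\pm i\omega_0$. First Lyapunov coefficient. Let $B$ and $C$ be the second- and third-derivative multilinear forms of the vector field $f$ at $P_0$ (at $\varepsilon=\varepsilon_c$). Take $q=(-i,\omega_0,\alpha\beta^{1/2}\omega_1/\omega_0)$, and let $p$ satisfy $A^{\top}p=-i\omega_0p$ and $\sum_i\bar p_iq_i=1$. Set $$G_{21}=\langle p,C(q,q,\bar q)+B(\bar q,(2i\omega_0I-A)^{-1}B(q,q))-2B(q,A^{-1}B(q,\bar q))\rangle.$$ Then $l_1(\beta,\alpha,0,\kappa)=\operatorname{Re}G_{21}/(2\omega_0)$. A Hopf point is an equilibrium whose Jacobian has eigenvalues $\pm i\omega_0$, $\omega_0>0$, and no other eigenvalues on the imaginary axis. It is transversal if the real part of the continued complex eigenvalue pair has nonzero derivative in $\varepsilon$. *)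

(* Defs.v *)
From Stdlib Require Import Reals.
From Coquelicot Require Import Coquelicot.
Open Scope R_scope.

Definition R3 : Type := (R * R * R)%type.
Definition coord (i : nat) (v : R3) : R :=
  match i with 0%nat => fst (fst v) | 1%nat => snd (fst v) | _ => snd v end.
Definition upd (i : nat) (v : R3) (t : R) : R3 :=
  match i with
  | 0%nat => (t, snd (fst v), snd v)
  | 1%nat => (fst (fst v), t, snd v)
  | _ => (fst (fst v), snd (fst v), t)
  end.
Definition dist3 (u v : R3) : R :=
  sqrt ((coord 0 u - coord 0 v) ^ 2 + (coord 1 u - coord 1 v) ^ 2
        + (coord 2 u - coord 2 v) ^ 2).

Definition pd (j : nat) (g : R3 -> R) (x : R3) : R :=
  Derive (fun t => g (upd j x t)) (coord j x).
Definition jac (F : R3 -> R3) (x : R3) (i j : nat) : R :=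
  pd j (fun v => coord i (F v)) x.
Definition d2 (F : R3 -> R3) (x : R3) (i j k : nat) : R :=
  pd j (fun w => pd k (fun v => coord i (F v)) w) x.
Definition d3 (F : R3 -> R3) (x : R3) (i j k l : nat) : R :=
  pd j (fun u => pd k (fun w => pd l (fun v => coord i (F v)) w) u) x.

(* ---------- complex linear algebra in C^3 (indices 0,1,2) ---------- *)
Definition CV : Type := nat -> C.
Definition sum3 (g : nat -> C) : C := Cplus (Cplus (g 0%nat) (g 1%nat)) (g 2%nat).
Definition CM : Type := nat -> nat -> C.
Definition realM (A : nat -> nat -> R) : CM := fun i j => RtoC (A i j).
Definition mv (M : CM) (v : CV) : CV := fun i => sum3 (fun j => Cmult (M i j) (v j)).
Definition trM (M : CM) : CM := fun i j => M j i.
Definition cscal (c : C) (v : CV) : CV := fun i => Cmult c (v i).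
Definition cvadd (u v : CV) : CV := fun i => Cplus (u i) (v i).
Definition cvopp (u : CV) : CV := fun i => Copp (u i).
Definition cconjv (v : CV) : CV := fun i => Cconj (v i).
Definition cinner (p v : CV) : C := sum3 (fun i => Cmult (Cconj (p i)) (v i)).
Definition det3 (M : CM) : C :=
  Cplus (Cminus
    (Cmult (M 0 0)%nat (Cminus (Cmult (M 1 1)%nat (M 2 2)%nat) (Cmult (M 1 2)%nat (M 2 1)%nat)))
    (Cmult (M 0 1)%nat (Cminus (Cmult (M 1 0)%nat (M 2 2)%nat) (Cmult (M 1 2)%nat (M 2 0)%nat))))
    (Cmult (M 0 2)%nat (Cminus (Cmult (M 1 0)%nat (M 2 1)%nat) (Cmult (M 1 1)%nat (M 2 0)%nat))).
(* inverse matrix via the adjugate (cyclic cofactor formula for 3x3) *)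
Definition inv3 (M : CM) : CM := fun i j =>
  let i1 := Nat.modulo (i + 1) 3 in let i2 := Nat.modulo (i + 2) 3 in
  let j1 := Nat.modulo (j + 1) 3 in let j2 := Nat.modulo (j + 2) 3 in
  Cdiv (Cminus (Cmult (M j1 i1) (M j2 i2)) (Cmult (M j1 i2) (M j2 i1))) (det3 M).
Definition idM : CM := fun i j => if Nat.eqb i j then RtoC 1 else RtoC 0.
Definition cMadd (M N : CM) : CM := fun i j => Cplus (M i j) (N i j).
Definition cMscal (c : C) (M : CM) : CM := fun i j => Cmult c (M i j).
Definition cMopp (M : CM) : CM := fun i j => Copp (M i j).

Definition is_eigenvalue (A : nat -> nat -> R) (lam : C) : Prop :=
  exists v : CV, (exists i, (i < 3)%nat /\ v i <> RtoC 0) /\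
    forall i, (i < 3)%nat -> mv (realM A) v i = Cmult lam (v i).

Definition Bform (F : R3 -> R3) (x : R3) (u v : CV) : CV := fun i =>
  sum3 (fun j => sum3 (fun k => Cmult (RtoC (d2 F x i j k)) (Cmult (u j) (v k)))).
Definition Cform (F : R3 -> R3) (x : R3) (u v w : CV) : CV := fun i =>
  sum3 (fun j => sum3 (fun k => sum3 (fun l =>
    Cmult (RtoC (d3 F x i j k l)) (Cmult (u j) (Cmult (v k) (w l)))))).

Definition equilibrium (F : R3 -> R3) (x0 : R3) : Prop := F x0 = (0, 0, 0).

Definition is_fsol (F : R3 -> R3) (phi : R -> R3) : Prop :=
  forall t, 0 <= t -> forall i, (i < 3)%nat ->
    is_derive (fun s => coord i (phi s)) t (coord i (F (phi t))).
Definition is_sol (F : R3 -> R3) (phi : R -> R3) : Prop :=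
  forall t i, (i < 3)%nat -> is_derive (fun s => coord i (phi s)) t (coord i (F (phi t))).

Definition lyap_stable (F : R3 -> R3) (x0 : R3) : Prop :=
  forall e, 0 < e -> exists d, 0 < d /\ forall phi, is_fsol F phi ->
    dist3 (phi 0) x0 < d -> forall t, 0 <= t -> dist3 (phi t) x0 < e.
Definition asympt_stable (F : R3 -> R3) (x0 : R3) : Prop :=
  lyap_stable F x0 /\ exists d, 0 < d /\ forall phi, is_fsol F phi ->
    dist3 (phi 0) x0 < d -> is_lim (fun t => dist3 (phi t) x0) p_infty 0.
Definition unstable_eq (F : R3 -> R3) (x0 : R3) : Prop := ~ lyap_stable F x0.

(* non-constant T-periodic solution (its range is the periodic orbit) *)
Definition periodic_orbit (F : R3 -> R3) (gam : R -> R3) (T : R) : Prop :=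
  0 < T /\ is_sol F gam /\ (forall t, gam (t + T) = gam t) /\ (exists t, gam t <> gam 0).
Definition near_orbit (gam : R -> R3) (x : R3) (e : R) : Prop :=
  exists s, dist3 x (gam s) < e.
Definition orbit_stable (F : R3 -> R3) (gam : R -> R3) : Prop :=
  forall e, 0 < e -> exists d, 0 < d /\ forall phi, is_fsol F phi ->
    near_orbit gam (phi 0) d -> forall t, 0 <= t -> near_orbit gam (phi t) e.
Definition orbit_asympt_stable (F : R3 -> R3) (gam : R -> R3) : Prop :=
  orbit_stable F gam /\ exists d, 0 < d /\ forall phi, is_fsol F phi ->
    near_orbit gam (phi 0) d ->
    forall e, 0 < e -> exists T0, forall t, T0 <= t -> near_orbit gam (phi t) e.
Definition orbit_unstable (F : R3 -> R3) (gam : R -> R3) : Prop := ~ orbit_stable F gam.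

Definition hopf_point (Fam : R -> R3 -> R3) (eps0 : R) (x0 : R3) : Prop :=
  equilibrium (Fam eps0) x0 /\
  exists w0, 0 < w0 /\
    is_eigenvalue (jac (Fam eps0) x0) (0, w0) /\
    is_eigenvalue (jac (Fam eps0) x0) (0, - w0) /\
    forall lam, is_eigenvalue (jac (Fam eps0) x0) lam -> Re lam = 0 ->
      lam = (0, w0) \/ lam = (0, - w0).

Definition transversal_hopf_point (Fam : R -> R3 -> R3) (eps0 : R) (x0 : R3) : Prop :=
  hopf_point Fam eps0 x0 /\
  exists w0 dl (mu om : R -> R), 0 < w0 /\ 0 < dl /\
    is_eigenvalue (jac (Fam eps0) x0) (0, w0) /\
    mu eps0 = 0 /\ om eps0 = w0 /\
    (forall e, Rabs (e - eps0) < dl ->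
       equilibrium (Fam e) x0 /\ continuous mu e /\ continuous om e /\
       is_eigenvalue (jac (Fam e) x0) (mu e, om e)) /\
    ex_derive mu eps0 /\ Derive mu eps0 <> 0.

Definition fam (alpha beta kappa rho : R) (eps : R) (v : R3) : R3 :=
  let x := coord 0 v in let y := coord 1 v in let z := coord 2 v in
  (y,
   rho * z ^ 2 * cos x + (z ^ 2 + kappa) * sin x * cos x - sin x - eps * y,
   alpha * (cos x - beta)).

Definition P0 (beta kappa : R) : R3 := (acos beta, 0, sqrt (1 / beta - kappa)).
Definition eps_c (alpha beta kappa : R) : R :=
  2 * alpha * (beta * sqrt beta) * sqrt (1 - kappa * beta).
Definition omega0 (beta : R) : R := sqrt ((1 - beta ^ 2) / beta).

(* q = (-i, w0, alpha beta^(1/2) w1 / w0) with w1 = w0 *)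
Definition qvec (alpha beta : R) : CV := fun i =>
  match i with
  | 0%nat => Copp Ci
  | 1%nat => RtoC (omega0 beta)
  | _ => RtoC (alpha * sqrt beta * omega0 beta / omega0 beta)
  end.

Definition Amat (alpha beta kappa : R) : nat -> nat -> R :=
  jac (fam alpha beta kappa 0 (eps_c alpha beta kappa)) (P0 beta kappa).

Definition G21 (alpha beta kappa : R) (p : CV) : C :=
  let F := fam alpha beta kappa 0 (eps_c alpha beta kappa) in
  let x0 := P0 beta kappa in
  let A := realM (Amat alpha beta kappa) in
  let w0 := omega0 beta in
  let q := qvec alpha beta in
  let qb := cconjv q in
  let h20 := mv (inv3 (cMadd (cMscal (Cmult (RtoC (2 * w0)) Ci) idM) (cMopp A)))
                (Bform F x0 q q) in
  let h11 := mv (inv3 A) (Bform F x0 q qb) in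
  cinner p (cvadd (cvadd (Cform F x0 q q qb) (Bform F x0 qb h20))
                  (cvopp (cscal (RtoC 2) (Bform F x0 q h11)))).

Definition adjoint_normalized (alpha beta kappa : R) (p : CV) : Prop :=
  (forall i, (i < 3)%nat ->
     mv (trM (realM (Amat alpha beta kappa))) p i
     = Cmult (Copp (Cmult (RtoC (omega0 beta)) Ci)) (p i)) /\
  cinner p (qvec alpha beta) = RtoC 1.

Definition l1 (alpha beta kappa : R) (p : CV) : R :=
  Re (G21 alpha beta kappa p) / (2 * omega0 beta).

(* Main.v *)
(* At [eps_c] the Jacobian has the eigenvalues [- eps_c] and [+- i om]. In coordinates [(u, v, S)] adapted to the
   eigenspaces, with [S] measured from the quadratic part of the centre manifold, a function
   [W = (u^2 + v^2)/2 + cubic + quartic] satisfies [W' = n mu1 r^2 + a r^4 + ...] with [n = eps - eps_c], [mu1 < 0]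
   and [a = Re G21 / 8]. The function [W +- K S^2] then decides the stability of the equilibrium, for [n = 0] by the
   sign of [a] and for small [n <> 0] by the sign of [n mu1].

   For the periodic orbit put [n = +- d^2] and scale [(u, v, S)] by [(d, d, d^2)]. In polar coordinates a closed orbit
   is a pair of 2 pi-periodic functions (the radial variable and [S]) of the angle, and these solve a fixed point
   equation for the Green operators of [y' = - k y + g], contracting for small [d]. The squared deviation from this
   closed curve serves as a Lyapunov function, or as a Chetaev function when [a > 0]. All of this is carried back to
   the original system by a conjugacy; global existence and uniqueness of its solutions come from Picard iteration. *)
Require Import Defs.
From Stdlib Require Import Reals Lra Lia Psatz FunctionalExtensionality.
From Coquelicot Require Import Coquelicot.
Open Scope R_scope.

(** * Differential inequalities *)

(** No normal form theorem, centre manifold theorem or return map is invoked. [W] alone carries the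
    normal form: its cubic and quartic parts solve homological equations for the rotation, which
    cancel everything in [W'] up to weight 4 except averages and the coupling to [S]. [S] must be
    measured from the quadratic part of the centre manifold because [S] times a quadratic form in
    [(u, v)] has the weight of [r^4]: in a plain linear coordinate the manifold itself would change
    [a], whereas after the shift [S] is forced only at weight 3 and its coupling is absorbed by
    [K S^2]. The scaling balances [n mu1 r^2] against [a r^4], so the scaled cycle stays near a
    fixed radius; but its radial rate is of order [d^2] while that of [S] is of order 1, and every
    smallness constant has to respect this disparity. The bridge to [l1] is an identity of rational
    functions, within reach of [field] because [sqrt beta], [omega0] and [z0] are handled as
    variables with polynomial relations and the Taylor coefficients as free symbols. *)

Lemma is_derive_eq (f : R -> R) (t l l' : R) : is_derive f t l' -> l' = l -> is_derive f t l.
Proof. intros H <-; exact H. Qed.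

Lemma der_ext (f g : R -> R) (t l : R) : (forall x : R, f x = g x) -> is_derive f t l -> is_derive g t l.
Proof. intros E. apply is_derive_ext. exact E. Qed.

Lemma der_mult (f g : R -> R) (t a b : R) : is_derive f t a -> is_derive g t b ->
  is_derive (fun x => f x * g x) t (a * g t + f t * b).
Proof. intros Hf Hg. exact (is_derive_mult f g t a b Hf Hg Rmult_comm). Qed.

Lemma der_plus (f g : R -> R) (t a b : R) : is_derive f t a -> is_derive g t b ->
  is_derive (fun x => f x + g x) t (a + b).
Proof. intros Hf Hg. exact (is_derive_plus f g t a b Hf Hg). Qed.

Lemma der_minus (f g : R -> R) (t a b : R) : is_derive f t a -> is_derive g t b ->
  is_derive (fun x => f x - g x) t (a - b).
Proof. intros Hf Hg. exact (is_derive_minus f g t a b Hf Hg). Qed.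

Lemma der_const (c t : R) : is_derive (fun _ : R => c) t 0.
Proof. exact (is_derive_const c t). Qed.

Lemma der_scal (f : R -> R) (t a c : R) : is_derive f t a -> is_derive (fun x => c * f x) t (c * a).
Proof. intros Hf. exact (is_derive_scal f t c a Hf). Qed.

Lemma der_comp (f g : R -> R) (t a b : R) : is_derive f (g t) a -> is_derive g t b ->
  is_derive (fun x => f (g x)) t (a * b).
Proof. intros Hf Hg. rewrite Rmult_comm. exact (is_derive_comp f g t a b Hf Hg). Qed.

Lemma der_shift (f : R -> R) (c t a : R) : is_derive f (t + c) a -> is_derive (fun x => f (x + c)) t a.
Proof.
  intros H. eapply is_derive_eq.
  - apply (der_comp f (fun x => x + c) t a 1); [exact H|].
    auto_derive; [exact I | ring].
  - ring.
Qed.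

Lemma der_exp (f : R -> R) (t a : R) : is_derive f t a -> is_derive (fun x => exp (f x)) t (a * exp (f t)).
Proof.
  intros H. rewrite Rmult_comm. apply (der_comp exp f); auto.
  apply is_derive_Reals. apply derivable_pt_lim_exp.
Qed.

Lemma der_cos (f : R -> R) (t a : R) : is_derive f t a -> is_derive (fun x => cos (f x)) t (- sin (f t) * a).
Proof.
  intros H. apply (der_comp cos f); auto. apply is_derive_Reals. apply derivable_pt_lim_cos.
Qed.

Lemma der_sin (f : R -> R) (t a : R) : is_derive f t a -> is_derive (fun x => sin (f x)) t (cos (f t) * a).
Proof.
  intros H. apply (der_comp sin f); auto. apply is_derive_Reals. apply derivable_pt_lim_sin.
Qed.

Lemma is_derive_continuous (f : R -> R) (t l : R) : is_derive f t l -> continuous f t.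
Proof. intros H. apply (ex_derive_continuous f t). exists l; exact H. Qed.

Lemma mvt (f df : R -> R) (a b : R) : a <= b ->
  (forall t, a <= t <= b -> is_derive f t (df t)) ->
  exists c, a <= c <= b /\ f b - f a = df c * (b - a).
Proof.
  intros Hab H.
  destruct (MVT_gen f a b df) as [c [Hc E]].
  - intros x Hx; rewrite Rmin_left, Rmax_right in Hx by lra; apply H; lra.
  - intros x Hx; rewrite Rmin_left, Rmax_right in Hx by lra.
    apply continuity_pt_filterlim.
    exact (is_derive_continuous _ _ _ (H x Hx)).
  - rewrite Rmin_left, Rmax_right in Hc by lra. exists c; split; auto.
Qed.

Lemma mvt_lipschitz (f df : R -> R) (C : R) :
  (forall t, is_derive f t (df t)) -> (forall t, Rabs (df t) <= C) ->
  forall a b, Rabs (f a - f b) <= C * Rabs (a - b).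
Proof.
  intros H HC.
  assert (K : forall a b, a <= b -> Rabs (f a - f b) <= C * Rabs (a - b)).
  { intros a b Hab. destruct (mvt f df a b Hab) as [c [_ E]]; [auto|].
    rewrite (Rabs_minus_sym (f a)), E, Rabs_mult, (Rabs_minus_sym b).
    apply Rmult_le_compat_r; [apply Rabs_pos | auto]. }
  intros a b; destruct (Rle_dec a b) as [h|h]; auto.
  rewrite Rabs_minus_sym, (Rabs_minus_sym a). apply K; lra.
Qed.

Lemma derive_nonpos (f df : R -> R) (a b : R) : a <= b ->
  (forall t, a <= t <= b -> is_derive f t (df t)) ->
  (forall t, a <= t <= b -> df t <= 0) -> f b <= f a.
Proof.
  intros Hab H Hn. destruct (mvt f df a b Hab H) as [c [Hc E]].
  specialize (Hn c Hc). nra.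
Qed.

Lemma derive_zero_const (f : R -> R) (a b : R) : a <= b ->
  (forall t, a <= t <= b -> is_derive f t 0) -> f b = f a.
Proof.
  intros Hab H. destruct (mvt f (fun _ => 0) a b Hab H) as [c [Hc E]]. lra.
Qed.

Lemma derive_lower (f df : R -> R) (m a b : R) : a <= b ->
  (forall t, a <= t <= b -> is_derive f t (df t)) ->
  (forall t, a <= t <= b -> m <= df t) -> f a + m * (b - a) <= f b.
Proof.
  intros Hab H Hn. destruct (mvt f df a b Hab H) as [c [Hc E]].
  specialize (Hn c Hc). nra.
Qed.

(** The integrating factor [exp (- c (t - a))] makes [V] times it nonincreasing; only a one-sided
    differential inequality is needed, and [c] may have either sign. *)
Lemma gronwall_le (V dV : R -> R) (c a b : R) : a <= b ->
  (forall t, a <= t <= b -> is_derive V t (dV t)) ->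
  (forall t, a <= t <= b -> dV t <= c * V t) -> V b <= V a * exp (c * (b - a)).
Proof.
  intros Hab H Hn.
  assert (K : V b * exp (- c * (b - a)) <= V a * exp (- c * (a - a))).
  { apply (derive_nonpos (fun t => V t * exp (- c * (t - a)))
             (fun t => (dV t - c * V t) * exp (- c * (t - a))) a b Hab).
    - intros t Ht. eapply is_derive_eq.
      + apply (der_mult V (fun t => exp (- c * (t - a)))).
        * apply H; auto.
        * apply (der_exp (fun t => - c * (t - a)) t (- c)). auto_derive; [exact I | ring].
      + ring.
    - intros t Ht. specialize (Hn t Ht). pose proof (exp_pos (- c * (t - a))). nra. }
  replace (- c * (a - a)) with 0 in K by ring. rewrite exp_0 in K.
  apply (Rmult_le_compat_r (exp (c * (b - a)))) in K; [|left; apply exp_pos].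
  rewrite Rmult_assoc, <- exp_plus in K.
  replace (- c * (b - a) + c * (b - a)) with 0 in K by ring. rewrite exp_0 in K. lra.
Qed.

Lemma gronwall_ge (V dV : R -> R) (c a b : R) : a <= b ->
  (forall t, a <= t <= b -> is_derive V t (dV t)) ->
  (forall t, a <= t <= b -> c * V t <= dV t) -> V a * exp (c * (b - a)) <= V b.
Proof.
  intros Hab H Hn.
  pose proof (gronwall_le (fun t => - V t) (fun t => - dV t) c a b Hab) as K.
  assert (- V b <= - V a * exp (c * (b - a))); [|lra].
  apply K.
  - intros t Ht. exact (is_derive_opp V t _ (H t Ht)).
  - intros t Ht. specialize (Hn t Ht). lra.
Qed.

Lemma continuous_eps (f : R -> R) (t : R) : continuous f t ->
  forall e, 0 < e -> exists d, 0 < d /\ forall x, Rabs (x - t) < d -> Rabs (f x - f t) < e.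
Proof.
  intros H e He.
  destruct (H (fun y => Rabs (y - f t) < e)) as [d Hd].
  - exists (mkposreal e He). intros y Hy. exact Hy.
  - exists d; split; [apply cond_pos|]. intros x Hx. apply Hd. exact Hx.
Qed.

Lemma continuous_of_eps (f : R -> R) (t : R) :
  (forall e, 0 < e -> exists d, 0 < d /\ forall x, Rabs (x - t) < d -> Rabs (f x - f t) < e) ->
  continuous f t.
Proof.
  intros H P [e HP]. destruct (H e (cond_pos e)) as [d [Hd K]].
  exists (mkposreal d Hd). intros x Hx. apply HP. apply K. exact Hx.
Qed.

Lemma continuous_lipschitz (f : R -> R) (C t : R) :
  (forall x, Rabs (f x - f t) <= C * Rabs (x - t)) -> continuous f t.
Proof.
  intros H. apply continuous_of_eps. intros e He.
  exists (e / (Rabs C + 1)). pose proof (Rabs_pos C). split; [apply Rdiv_lt_0_compat; lra|].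
  intros x Hx. apply Rle_lt_trans with (1 := H x).
  pose proof (Rle_abs C). pose proof (Rabs_pos (x - t)).
  apply (Rmult_lt_compat_r (Rabs C + 1)) in Hx; [|lra].
  unfold Rdiv in Hx; rewrite Rmult_assoc, Rinv_l, Rmult_1_r in Hx by lra. nra.
Qed.

(* The bootstrap principle: a bound that improves itself on every initial interval persists. *)
Lemma first_exit (f : R -> R) :
  (forall t, 0 <= t -> continuous f t) -> f 0 < 0 ->
  (forall T, 0 <= T -> (forall t, 0 <= t <= T -> f t <= 0) -> f T < 0) ->
  forall t, 0 <= t -> f t < 0.
Proof.
  intros Hc H0 HI t1 Ht1. destruct (Rlt_dec (f t1) 0) as [|Hn]; [assumption|exfalso].
  (* [T] is the supremum of the times up to which [f] stays negative. Continuity gives [f T <= 0],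
     the self-improvement makes this strict, and strictness carries the sign past [T], which is only
     consistent with [T = t1]. *)
  set (E := fun x => 0 <= x <= t1 /\ forall t, 0 <= t <= x -> f t < 0).
  destruct (completeness E) as [T [Hub Hlub]].
  { exists t1. intros x [Hx _]; lra. }
  { exists 0. split; [lra|]. intros t Ht. replace t with 0 by lra; auto. }
  assert (HT0 : 0 <= T).
  { apply Hub. split; [lra|]. intros t Ht. replace t with 0 by lra; auto. }
  assert (HT1 : T <= t1) by (apply Hlub; intros x [Hx _]; lra).
  assert (Hlt : forall t, 0 <= t < T -> f t < 0).
  { intros t Ht. destruct (Rlt_dec (f t) 0) as [|Hf]; [assumption|exfalso].
    assert (T <= t); [|lra]. apply Hlub. intros x [Hx Hx'].
    destruct (Rle_dec x t); [assumption|]. exfalso; apply Hf, Hx'; lra. }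
  assert (HTle : f T <= 0).
  { destruct (Rle_dec (f T) 0) as [|Hp]; [assumption|exfalso].
    destruct (Req_dec T 0) as [->|HTn]; [lra|].
    destruct (continuous_eps f T (Hc T HT0) (f T)) as [d [Hd Hd']]; [lra|].
    set (x := Rmax 0 (T - d / 2)).
    assert (0 <= x < T) by (unfold x; split; [apply Rmax_l | apply Rmax_lub_lt; lra]).
    assert (T - d / 2 <= x) by (unfold x; apply Rmax_r).
    specialize (Hlt x H). specialize (Hd' x). rewrite Rabs_left in Hd' by lra.
    specialize (Hd' ltac:(lra)). apply Rabs_def2 in Hd'. lra. }
  assert (HfT : f T < 0).
  { apply HI; auto. intros t Ht. destruct (Req_dec t T) as [->|]; auto.
    left; apply Hlt; lra. }
  destruct (continuous_eps f T (Hc T HT0) (- f T)) as [d [Hd Hd']]; [lra|].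
  destruct (Req_dec T t1) as [->|HTn]; [lra|].
  set (x := Rmin t1 (T + d / 2)).
  assert (Hx : T < x) by (unfold x; apply Rmin_glb_lt; lra).
  assert (E x) as Ex; [|specialize (Hub x Ex); lra].
  assert (x <= T + d / 2) by (unfold x; apply Rmin_r).
  split; [split; [lra|unfold x; apply Rmin_l]|].
  intros t Ht. destruct (Rlt_dec t T); [apply Hlt; lra|].
  specialize (Hd' t). rewrite Rabs_right in Hd' by lra. specialize (Hd' ltac:(lra)).
  apply Rabs_def2 in Hd'; lra.
Qed.

(** * Bounded Lipschitz functions of three variables and weighted orders *)

(** One constant serves both as bound and as Lipschitz constant, so each algebraic operation costs a
    single estimate. The sum metric keeps the three coordinates separate, which suits variables of
    different weights. *)
Definition BL (D : R -> R -> R -> Prop) (C : R) (f : R -> R -> R -> R) : Prop :=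
  (forall x y z, D x y z -> Rabs (f x y z) <= C) /\
  (forall x y z x' y' z', D x y z -> D x' y' z' ->
     Rabs (f x y z - f x' y' z') <= C * (Rabs (x - x') + Rabs (y - y') + Rabs (z - z'))).

Lemma dist1_pos (x y z x' y' z' : R) : 0 <= Rabs (x - x') + Rabs (y - y') + Rabs (z - z').
Proof. pose proof (Rabs_pos (x - x')). pose proof (Rabs_pos (y - y')). pose proof (Rabs_pos (z - z')). lra. Qed.

Lemma BL_weaken D C C' f : BL D C f -> C <= C' -> BL D C' f.
Proof.
  intros [H1 H2] HC. split; intros.
  - specialize (H1 x y z H); lra.
  - specialize (H2 x y z x' y' z' H H0). pose proof (dist1_pos x y z x' y' z'). nra.
Qed.

Lemma BL_sub (D D' : R -> R -> R -> Prop) C f :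
  BL D C f -> (forall x y z, D' x y z -> D x y z) -> BL D' C f.
Proof. intros [H1 H2] HD; split; intros; auto. Qed.

Lemma BL_ext D C f g : BL D C f -> (forall x y z, D x y z -> f x y z = g x y z) -> BL D C g.
Proof.
  intros [H1 H2] E; split; intros.
  - rewrite <- E; auto.
  - rewrite <- !E; auto.
Qed.

Lemma BL_const D c : BL D (Rabs c) (fun _ _ _ => c).
Proof.
  split; intros; [lra|]. rewrite Rminus_diag, Rabs_R0.
  apply Rmult_le_pos; [apply Rabs_pos|apply dist1_pos].
Qed.

Lemma BL_add D C C' f g : BL D C f -> BL D C' g -> BL D (C + C') (fun x y z => f x y z + g x y z).
Proof.
  intros [H1 H2] [K1 K2]; split; intros.
  - eapply Rle_trans; [apply Rabs_triang|]. specialize (H1 _ _ _ H); specialize (K1 _ _ _ H); lra.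
  - replace (f x y z + g x y z - (f x' y' z' + g x' y' z'))
      with (f x y z - f x' y' z' + (g x y z - g x' y' z')) by ring.
    eapply Rle_trans; [apply Rabs_triang|].
    specialize (H2 _ _ _ _ _ _ H H0); specialize (K2 _ _ _ _ _ _ H H0); lra.
Qed.

Lemma BL_opp D C f : BL D C f -> BL D C (fun x y z => - f x y z).
Proof.
  intros [H1 H2]; split; intros.
  - rewrite Rabs_Ropp; auto.
  - replace (- f x y z - - f x' y' z') with (- (f x y z - f x' y' z')) by ring.
    rewrite Rabs_Ropp; auto.
Qed.

(** The Leibniz splitting of a difference of products yields [C * C'] twice; the factor 2 is there
    for the Lipschitz half. *)
Lemma BL_mult D C C' f g : BL D C f -> BL D C' g ->
  BL D (2 * (C * C')) (fun x y z => f x y z * g x y z).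
Proof.
  intros [H1 H2] [K1 K2]; split; intros.
  - rewrite Rabs_mult. specialize (H1 _ _ _ H); specialize (K1 _ _ _ H).
    pose proof (Rabs_pos (f x y z)). pose proof (Rabs_pos (g x y z)).
    assert (Rabs (f x y z) * Rabs (g x y z) <= C * C') by (apply Rmult_le_compat; auto).
    assert (0 <= C * C') by (apply Rmult_le_pos; lra). lra.
  - replace (f x y z * g x y z - f x' y' z' * g x' y' z')
      with (f x y z * (g x y z - g x' y' z') + (f x y z - f x' y' z') * g x' y' z') by ring.
    eapply Rle_trans; [apply Rabs_triang|]. rewrite !Rabs_mult.
    specialize (H2 _ _ _ _ _ _ H H0); specialize (K2 _ _ _ _ _ _ H H0).
    specialize (H1 _ _ _ H); specialize (K1 _ _ _ H0).
    set (dd := Rabs (x - x') + Rabs (y - y') + Rabs (z - z')) in *.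
    assert (Rabs (f x y z) * Rabs (g x y z - g x' y' z') <= C * (C' * dd))
      by (apply Rmult_le_compat; auto; apply Rabs_pos).
    assert (Rabs (f x y z - f x' y' z') * Rabs (g x' y' z') <= C * dd * C')
      by (apply Rmult_le_compat; auto; apply Rabs_pos).
    lra.
Qed.

Lemma BL_inv D C m f : 0 < m -> BL D C f -> (forall x y z, D x y z -> m <= f x y z) ->
  BL D (/ m + C / (m * m)) (fun x y z => / f x y z).
Proof.
  intros Hm [H1 H2] Hf; split; intros.
  - pose proof (Hf _ _ _ H) as Hl. pose proof (H1 _ _ _ H) as Hu. pose proof (Rabs_pos (f x y z)).
    rewrite Rabs_inv, Rabs_right by lra.
    assert (/ f x y z <= / m) by (apply Rinv_le_contravar; lra).
    assert (0 <= C / (m * m)); [|lra].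
    apply Rmult_le_pos; [lra|]. left; apply Rinv_0_lt_compat; nra.
  - pose proof (Hf _ _ _ H) as Ha. pose proof (Hf _ _ _ H0) as Hb.
    specialize (H2 _ _ _ _ _ _ H H0). pose proof (dist1_pos x y z x' y' z') as Hd.
    set (dd := Rabs (x - x') + Rabs (y - y') + Rabs (z - z')) in *.
    replace (/ f x y z - / f x' y' z')
      with (- (f x y z - f x' y' z') * / (f x y z * f x' y' z')) by (field; lra).
    rewrite Rabs_mult, Rabs_Ropp, (Rabs_right (/ _)).
    2:{ left; apply Rinv_0_lt_compat; apply Rmult_lt_0_compat; lra. }
    assert (/ (f x y z * f x' y' z') <= / (m * m)).
    { apply Rinv_le_contravar; [nra|]. apply Rmult_le_compat; lra. }
    assert (0 < / (f x y z * f x' y' z')) by (apply Rinv_0_lt_compat; nra).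
    apply Rle_trans with (C * dd * / (m * m)).
    + apply Rmult_le_compat; auto using Rabs_pos; lra.
    + assert (0 < / m) by (apply Rinv_0_lt_compat; lra).
      assert (0 <= / m * dd) by (apply Rmult_le_pos; lra). unfold Rdiv. nra.
Qed.

Lemma BL_comp (D D' : R -> R -> R -> Prop) C K f (m1 m2 m3 : R -> R -> R -> R) :
  BL D C f -> 0 <= C -> 1 <= K ->
  (forall x y z, D' x y z -> D (m1 x y z) (m2 x y z) (m3 x y z)) ->
  (forall x y z x' y' z', D' x y z -> D' x' y' z' ->
     Rabs (m1 x y z - m1 x' y' z') + Rabs (m2 x y z - m2 x' y' z') + Rabs (m3 x y z - m3 x' y' z')
     <= K * (Rabs (x - x') + Rabs (y - y') + Rabs (z - z'))) ->
  BL D' (C * K) (fun x y z => f (m1 x y z) (m2 x y z) (m3 x y z)).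
Proof.
  intros [H1 H2] HC HK Hm HL; split; intros.
  - eapply Rle_trans; [apply H1; auto|]. nra.
  - eapply Rle_trans; [apply H2; auto|]. rewrite Rmult_assoc.
    apply Rmult_le_compat_l; auto.
Qed.

Definition box (b x y z : R) : Prop := Rabs x <= b /\ Rabs y <= b /\ Rabs z <= b.

(* [f] is of weighted order [k] when [nu], [u], [v], [S] have the weights [wn], [1], [1], [wS],
   together with its Lipschitz constants in the rescaled variables. *)
Definition Ord (wn wS k : nat) (f : R -> R -> R -> R -> R) : Prop :=
  forall b, 0 < b -> exists C, 0 <= C /\ forall dl tau, 0 < dl <= 1 -> Rabs tau <= 1 ->
    BL (box b) (C * dl ^ k) (fun p q s => f (tau * dl ^ wn) (dl * p) (dl * q) (dl ^ wS * s)).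

Section OrdAlgebra.
Variables wn wS : nat.
Notation O := (Ord wn wS).

Lemma ord_ext k f g : O k f -> (forall n u v S, f n u v S = g n u v S) -> O k g.
Proof.
  intros H E b Hb. destruct (H b Hb) as [C [HC K]]. exists C; split; auto.
  intros dl tau Hd Ht. apply (BL_ext _ _ _ _ (K dl tau Hd Ht)). intros; apply E.
Qed.

Lemma pow_le_1_decr (d : R) (j k : nat) : 0 < d <= 1 -> (j <= k)%nat -> d ^ k <= d ^ j.
Proof.
  intros Hd Hjk. replace k with (j + (k - j))%nat by lia. rewrite pow_add.
  assert (0 < d ^ j) by (apply pow_lt; lra).
  assert (d ^ (k - j) <= 1) by (rewrite <- (pow1 (k - j)); apply pow_incr; lra). nra.
Qed.

Lemma ord_le j k f : (j <= k)%nat -> O k f -> O j f.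
Proof.
  intros Hjk H b Hb. destruct (H b Hb) as [C [HC K]]. exists C; split; auto.
  intros dl tau Hd Ht. apply (BL_weaken _ _ _ _ (K dl tau Hd Ht)).
  apply Rmult_le_compat_l; auto. apply pow_le_1_decr; auto.
Qed.

Lemma ord_const c : O 0 (fun _ _ _ _ => c).
Proof.
  intros b Hb. exists (Rabs c); split; [apply Rabs_pos|]. intros. simpl. rewrite Rmult_1_r.
  apply BL_const.
Qed.

Lemma ord_nu : O wn (fun n _ _ _ => n).
Proof.
  intros b Hb. exists 1; split; [lra|]. intros dl tau Hd Ht.
  apply (BL_weaken _ _ _ _ (BL_const _ _)).
  rewrite Rabs_mult, (Rabs_right (dl ^ wn)); [|apply Rle_ge, pow_le; lra].
  apply Rmult_le_compat_r; auto. apply pow_le; lra.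
Qed.

Let ord_coord (f : R -> R -> R -> R) (w : nat) :
  (forall b x y z, box b x y z -> Rabs (f x y z) <= b) ->
  (forall x y z x' y' z', Rabs (f x y z - f x' y' z') <= Rabs (x - x') + Rabs (y - y') + Rabs (z - z')) ->
  forall b, 0 < b -> exists C, 0 <= C /\ forall dl tau : R, 0 < dl <= 1 -> Rabs tau <= 1 ->
    BL (box b) (C * dl ^ w) (fun p q s => dl ^ w * f p q s).
Proof.
  intros H1 H2 b Hb. exists (b + 1); split; [lra|]. intros dl tau Hd Ht.
  assert (0 <= dl ^ w) by (apply pow_le; lra).
  split; intros.
  - rewrite Rabs_mult, (Rabs_right (dl ^ w)) by lra. specialize (H1 _ _ _ _ H0). nra.
  - rewrite <- Rmult_minus_distr_l, Rabs_mult, (Rabs_right (dl ^ w)) by lra.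
    specialize (H2 x y z x' y' z'). pose proof (dist1_pos x y z x' y' z').
    apply Rle_trans with (dl ^ w * (Rabs (x - x') + Rabs (y - y') + Rabs (z - z'))).
    + apply Rmult_le_compat_l; auto.
    + apply Rmult_le_compat_r; [lra|]. nra.
Qed.

Lemma ord_u : O 1 (fun _ u _ _ => u).
Proof.
  intros b Hb. destruct (ord_coord (fun p _ _ => p) 1) with (b := b) as [C [HC K]]; auto.
  - intros c x y z [H _]; auto.
  - intros. pose proof (Rabs_pos (y - y')). pose proof (Rabs_pos (z - z')). lra.
  - exists C; split; auto. intros. apply (BL_ext _ _ _ _ (K _ _ H H0)). intros; simpl; ring.
Qed.

Lemma ord_v : O 1 (fun _ _ v _ => v).
Proof.
  intros b Hb. destruct (ord_coord (fun _ q _ => q) 1) with (b := b) as [C [HC K]]; auto.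
  - intros c x y z [_ [H _]]; auto.
  - intros. pose proof (Rabs_pos (x - x')). pose proof (Rabs_pos (z - z')). lra.
  - exists C; split; auto. intros. apply (BL_ext _ _ _ _ (K _ _ H H0)). intros; simpl; ring.
Qed.

Lemma ord_S : O wS (fun _ _ _ S => S).
Proof.
  intros b Hb. destruct (ord_coord (fun _ _ s => s) wS) with (b := b) as [C [HC K]]; auto.
  - intros c x y z [_ [_ H]]; auto.
  - intros. pose proof (Rabs_pos (x - x')). pose proof (Rabs_pos (y - y')). lra.
  - exists C; split; auto.
Qed.

Lemma ord_add k f g : O k f -> O k g -> O k (fun n u v S => f n u v S + g n u v S).
Proof.
  intros H1 H2 b Hb. destruct (H1 b Hb) as [C1 [HC1 K1]]. destruct (H2 b Hb) as [C2 [HC2 K2]].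
  exists (C1 + C2); split; [lra|]. intros dl tau Hd Ht. rewrite Rmult_plus_distr_r.
  apply BL_add; auto.
Qed.

Lemma ord_opp k f : O k f -> O k (fun n u v S => - f n u v S).
Proof.
  intros H1 b Hb. destruct (H1 b Hb) as [C1 [HC1 K1]].
  exists C1; split; [lra|]. intros dl tau Hd Ht. apply BL_opp; auto.
Qed.

Lemma ord_sub k f g : O k f -> O k g -> O k (fun n u v S => f n u v S - g n u v S).
Proof. intros H1 H2. apply (ord_add k f (fun n u v S => - g n u v S)); auto. apply ord_opp; auto. Qed.

Lemma ord_mult j k f g : O j f -> O k g -> O (j + k) (fun n u v S => f n u v S * g n u v S).
Proof.
  intros H1 H2 b Hb. destruct (H1 b Hb) as [C1 [HC1 K1]]. destruct (H2 b Hb) as [C2 [HC2 K2]].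
  exists (2 * (C1 * C2)); split; [nra|]. intros dl tau Hd Ht. rewrite pow_add.
  replace (2 * (C1 * C2) * (dl ^ j * dl ^ k)) with (2 * ((C1 * dl ^ j) * (C2 * dl ^ k))) by ring.
  apply (BL_mult (box b) _ _ _ _ (K1 dl tau Hd Ht) (K2 dl tau Hd Ht)).
Qed.

Lemma ord_scal k c f : O k f -> O k (fun n u v S => c * f n u v S).
Proof. intros H. apply (ord_mult 0 k (fun _ _ _ _ => c) f); auto. apply ord_const. Qed.

Lemma ord_scalr k c f : O k f -> O k (fun n u v S => f n u v S * c).
Proof. intros H. apply (ord_ext k (fun n u v S => c * f n u v S)); [apply ord_scal; auto|intros; ring]. Qed.

Lemma ord_pow k f (m : nat) : O k f -> O (m * k) (fun n u v S => f n u v S ^ m).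
Proof.
  intros H. induction m as [|m IH].
  - exact (ord_const 1).
  - apply (ord_mult k (m * k)); auto.
Qed.

(** A Lipschitz constant of size [M ^ k] on [[-M, M]] is the mark of a Taylor remainder vanishing to
    order [k + 1]. An argument of order 1 is confined to [M = C1 dl] and itself varies at rate
    [C1 dl], which produces [dl ^ (k + 1)] in both halves of the bound. *)
Lemma ord_comp (k : nat) (g : R -> R) (C : R) f : 0 <= C -> g 0 = 0 ->
  (forall M x y, Rabs x <= M -> Rabs y <= M -> Rabs (g x - g y) <= C * M ^ k * Rabs (x - y)) ->
  O 1 f -> O (S k) (fun n u v S => g (f n u v S)).
Proof.
  intros HC H0 Hg H b Hb. destruct (H b Hb) as [C1 [HC1 K1]].
  assert (HCk : 0 <= C1 ^ k) by (apply pow_le; auto).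
  exists (C * C1 ^ k * C1); split.
  { apply Rmult_le_pos; auto. apply Rmult_le_pos; auto. }
  intros dl tau Hd Ht. destruct (K1 dl tau Hd Ht) as [L1 L2]. simpl in L1, L2. rewrite Rmult_1_r in L1, L2.
  assert (Hdk : 0 <= dl ^ k) by (apply pow_le; lra).
  assert (E : forall d, C * (C1 * dl) ^ k * (C1 * dl * d) = C * C1 ^ k * C1 * dl ^ S k * d).
  { intros d. rewrite Rpow_mult_distr. simpl. ring. }
  assert (P : 0 <= C * (C1 * dl) ^ k).
  { apply Rmult_le_pos; auto. apply pow_le. apply Rmult_le_pos; lra. }
  split; intros.
  - pose proof (Hg (C1 * dl) (f (tau * dl ^ wn) (dl * x) (dl * y) (dl ^ wS * z)) 0 (L1 _ _ _ H1)) as K.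
    rewrite Rabs_R0 in K. specialize (K ltac:(apply Rmult_le_pos; lra)).
    rewrite H0, !Rminus_0_r in K. eapply Rle_trans; [apply K|].
    rewrite <- (Rmult_1_r (C * C1 ^ k * C1 * dl ^ S k)), <- E, Rmult_1_r.
    apply Rmult_le_compat_l; auto.
  - eapply Rle_trans; [apply (Hg (C1 * dl)); auto|].
    rewrite <- E. apply Rmult_le_compat_l; auto.
Qed.

Lemma ord_add_min j k f g : O j f -> O k g -> O (Nat.min j k) (fun n u v S => f n u v S + g n u v S).
Proof. intros H1 H2. apply ord_add; [apply ord_le with j|apply ord_le with k]; auto; lia. Qed.

Lemma ord_sub_min j k f g : O j f -> O k g -> O (Nat.min j k) (fun n u v S => f n u v S - g n u v S).
Proof. intros H1 H2. apply ord_sub; [apply ord_le with j|apply ord_le with k]; auto; lia. Qed.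

End OrdAlgebra.

(* Computes a weighted order of a polynomial expression, taking known orders from the context. *)
Ltac ord_rec :=
  lazymatch goal with
  | |- Ord _ _ _ (fun _ _ _ _ => ?c) => apply ord_const
  | |- Ord _ _ _ (fun n u v S => n) => apply ord_nu
  | |- Ord _ _ _ (fun n u v S => u) => apply ord_u
  | |- Ord _ _ _ (fun n u v S => v) => apply ord_v
  | |- Ord _ _ _ (fun n u v S => S) => apply ord_S
  | |- Ord ?a ?b _ (fun n u v S => @?f n u v S + @?g n u v S) => refine (ord_add_min a b _ _ f g _ _); ord_rec
  | |- Ord ?a ?b _ (fun n u v S => @?f n u v S - @?g n u v S) => refine (ord_sub_min a b _ _ f g _ _); ord_rec
  | |- Ord ?a ?b _ (fun n u v S => - @?f n u v S) => refine (ord_opp a b _ f _); ord_rec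
  | |- Ord ?a ?b _ (fun n u v S => @?f n u v S * @?g n u v S) => refine (ord_mult a b _ _ f g _ _); ord_rec
  | |- Ord ?a ?b _ (fun n u v S => @?f n u v S / ?c) => refine (ord_scalr a b _ (/ c) f _); ord_rec
  | |- Ord ?a ?b _ (fun n u v S => @?f n u v S ^ ?m) => refine (ord_pow a b _ f m _); ord_rec
  | |- Ord _ _ _ _ => eassumption
  end.
Ltac ord := eapply ord_le; [|ord_rec]; cbn; lia.

(** * Periodic solutions by contraction *)

Lemma pow2_neq0 (n : nat) : 2 ^ n <> 0.
Proof. apply pow_nonzero; lra. Qed.

(** With [e n = 2 r / 2 ^ n] the intervals [[x n - e n, x n + e n]] are nested, and [l] is the
    supremum of their left ends. The sigma type lets the limit be used as a function of a further
    parameter without a choice principle. *)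
Lemma geometric_limit (x : nat -> R) (r : R) :
  (forall n, Rabs (x (S n) - x n) <= r / 2 ^ n) ->
  {l | forall n, Rabs (x n - l) <= 2 * r / 2 ^ n}.
Proof.
  intros H.
  set (e := fun n => 2 * r / 2 ^ n).
  assert (He : forall n, e (S n) = e n - r / 2 ^ n).
  { intros n; unfold e; simpl. field. apply pow2_neq0. }
  assert (Hlo : forall n m, (n <= m)%nat -> x n - e n <= x m - e m).
  { intros n m Hnm; induction Hnm as [|m _ IH]; [lra|].
    rewrite He. specialize (H m). apply Rabs_le_between in H. lra. }
  assert (Hhi : forall n m, (n <= m)%nat -> x m + e m <= x n + e n).
  { intros n m Hnm; induction Hnm as [|m _ IH]; [lra|].
    rewrite He. specialize (H m). apply Rabs_le_between in H. lra. }
  assert (Hr : 0 <= r).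
  { specialize (H 0%nat). pose proof (Rabs_pos (x 1%nat - x 0%nat)). simpl in H. lra. }
  assert (Hep : forall n, 0 <= e n).
  { intros n; unfold e. apply Rmult_le_pos; [lra|]. left; apply Rinv_0_lt_compat, pow_lt; lra. }
  destruct (completeness (fun y => exists n, y = x n - e n)) as [l [Hub Hlub]].
  { exists (x 0%nat + e 0%nat). intros y [n ->]. specialize (Hhi 0%nat n ltac:(lia)).
    specialize (Hep n). lra. }
  { exists (x 0%nat - e 0%nat), 0%nat; reflexivity. }
  exists l. intros n. fold (e n). apply Rabs_le_between. split.
  - assert (l <= x n + e n); [|lra]. apply Hlub. intros y [m ->].
    destruct (Nat.le_ge_cases n m) as [h|h].
    + specialize (Hhi n m h). specialize (Hep m). lra.
    + specialize (Hlo m n h). specialize (Hep n). lra.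
  - assert (x n - e n <= l); [|lra]. apply Hub. exists n; reflexivity.
Qed.

Lemma pow_half_small (r e : R) : 0 < e -> exists n, r / 2 ^ n < e.
Proof.
  intros He. destruct (Rle_dec r 0) as [h|h].
  - exists 0%nat. simpl. lra.
  - destruct (pow_lt_1_zero (/ 2)) with (y := e / r) as [N HN].
    + rewrite Rabs_right; lra.
    + apply Rdiv_lt_0_compat; lra.
    + exists N. specialize (HN N ltac:(lia)).
      rewrite pow_inv in HN. rewrite Rabs_right in HN.
      2:{ left; apply Rinv_0_lt_compat, pow_lt; lra. }
      apply (Rmult_lt_compat_l r) in HN; [|lra].
      replace (r * (e / r)) with e in HN by (field; lra). exact HN.
Qed.

Lemma uniform_limit_continuous (f : nat -> R -> R) (g : R -> R) (r t : R) :
  (forall n s, Rabs (f n s - g s) <= r / 2 ^ n) -> (forall n, continuous (f n) t) -> continuous g t.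
Proof.
  intros H Hc. apply continuous_of_eps. intros e He.
  destruct (pow_half_small r (e / 3)) as [n Hn]; [lra|].
  destruct (continuous_eps _ _ (Hc n) (e / 3)) as [d [Hd Hd']]; [lra|].
  exists d; split; auto. intros x Hx. specialize (Hd' x Hx).
  pose proof (H n x) as H1. pose proof (H n t) as H2.
  apply Rabs_le_between in H1. apply Rabs_le_between in H2. apply Rabs_def2 in Hd'.
  apply Rabs_def1; lra.
Qed.

(* The unique periodic solution of [y' = - k y + g], for either sign of [k]. *)
Definition green (k : R) (g : R -> R) (th : R) : R :=
  exp (- k * th) / (exp (k * (2 * PI)) - 1) * RInt (fun t => exp (k * t) * g t) th (th + 2 * PI).

Section Green.
Variable k : R.
Hypothesis Hk : k <> 0.

Let E1 : exp (k * (2 * PI)) - 1 <> 0.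
Proof.
  intros H. assert (exp (k * (2 * PI)) = exp 0) as E by (rewrite exp_0; lra).
  apply exp_inv in E. pose proof PI_RGT_0. apply Hk. nra.
Qed.

Let cont_exp_mult (g : R -> R) : (forall t, continuous g t) -> forall t, continuous (fun t => exp (k * t) * g t) t.
Proof.
  intros Hg t. apply (continuous_mult (fun t => exp (k * t)) g); auto.
  eapply is_derive_continuous. apply (der_exp (fun x => k * x)).
  apply (der_scal (fun x => x)). apply is_derive_id.
Qed.

Let ex_int (g : R -> R) (a b : R) : (forall t, continuous g t) -> ex_RInt (fun t => exp (k * t) * g t) a b.
Proof. intros Hg. apply (ex_RInt_continuous (V := R_CompleteNormedModule)). intros; apply cont_exp_mult; auto. Qed.

(** Written with a primitive [J], the integral is [J (th + 2 PI) - J th]. By periodicity of [g] its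
    derivative is [(exp (2 PI k) - 1) exp (k th) g th], which the prefactor turns into [g th]
    exactly. *)
Lemma green_derive (g : R -> R) (th : R) :
  (forall t, continuous g t) -> (forall t, g (t + 2 * PI) = g t) ->
  is_derive (green k g) th (- k * green k g th + g th).
Proof.
  intros Hg Hp.
  set (f := fun t => exp (k * t) * g t).
  set (J := fun x => RInt f 0 x).
  assert (HJ : forall x, is_derive J x (f x)).
  { intros x. apply (is_derive_RInt f J 0 x).
    - apply filter_forall. intros y. apply (RInt_correct (V := R_CompleteNormedModule)). apply ex_int; auto.
    - apply cont_exp_mult; auto. }
  apply (is_derive_ext (fun x => exp (- k * x) / (exp (k * (2 * PI)) - 1) * (J (x + 2 * PI) - J x))).
  { intros x. unfold green, J. fold f. f_equal.
    pose proof (RInt_Chasles (V := R_CompleteNormedModule) f 0 x (x + 2 * PI)) as K.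
    rewrite <- K by (apply ex_int; auto). unfold plus; simpl. ring. }
  replace (green k g th) with (exp (- k * th) / (exp (k * (2 * PI)) - 1) * (J (th + 2 * PI) - J th)).
  2:{ unfold green, J. fold f. f_equal.
    pose proof (RInt_Chasles (V := R_CompleteNormedModule) f 0 th (th + 2 * PI)) as K.
    rewrite <- K by (apply ex_int; auto). unfold plus; simpl. ring. }
  eapply is_derive_eq.
  - apply (der_mult (fun x => exp (- k * x) / (exp (k * (2 * PI)) - 1)) (fun x => J (x + 2 * PI) - J x)).
    + apply (der_mult (fun x => exp (- k * x)) (fun _ => / (exp (k * (2 * PI)) - 1))).
      * apply (der_exp (fun x => - k * x)). apply (der_scal (fun x => x)). apply is_derive_id.
      * apply der_const.
    + apply der_minus; [apply der_shift, HJ | apply HJ].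
  - unfold f, one; simpl. rewrite Hp, Rmult_plus_distr_l, exp_plus.
    replace (- k * th) with (- (k * th)) by ring. rewrite exp_Ropp.
    pose proof (exp_pos (k * th)). field. split; auto. lra.
Qed.

Lemma green_periodic (g : R -> R) (th : R) :
  (forall t, continuous g t) -> (forall t, g (t + 2 * PI) = g t) ->
  green k g (th + 2 * PI) = green k g th.
Proof.
  intros Hg Hp. unfold green.
  set (f := fun t => exp (k * t) * g t).
  assert (K : RInt f (th + 2 * PI) (th + 2 * PI + 2 * PI) = exp (k * (2 * PI)) * RInt f th (th + 2 * PI)).
  { pose proof (RInt_comp_lin (V := R_CompleteNormedModule) f 1 (2 * PI) th (th + 2 * PI)) as E.
    rewrite !Rmult_1_l in E. rewrite <- E by (apply ex_int; auto).
    rewrite <- (RInt_scal (V := R_CompleteNormedModule) f) by (apply ex_int; auto).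
    apply RInt_ext. intros x _. unfold f, scal; simpl. unfold mult; simpl.
    rewrite !Rmult_1_l, Hp, Rmult_plus_distr_l, exp_plus. ring. }
  rewrite K. rewrite Rmult_plus_distr_l, exp_plus.
  replace (- k * (2 * PI)) with (- (k * (2 * PI))) by ring. rewrite exp_Ropp.
  pose proof (exp_pos (k * (2 * PI))). field. split; auto. lra.
Qed.

(** The kernel has constant sign and its integral over one period is exactly [1 / k], whichever sign
    [k] has. This is why a radial rate of order [d^2] is harmless as long as the forcing is of order
    [d^2] too. *)
Lemma green_bound (g : R -> R) (M th : R) :
  (forall t, continuous g t) -> (forall t, Rabs (g t) <= M) -> Rabs (green k g th) <= M / Rabs k.
Proof.
  intros Hg HM. unfold green. pose proof PI_RGT_0.
  set (f := fun t => exp (k * t) * g t).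
  assert (I : is_RInt (fun t => M * exp (k * t)) th (th + 2 * PI)
                (M / k * exp (k * (th + 2 * PI)) - M / k * exp (k * th))).
  { apply (is_RInt_derive (V := R_CompleteNormedModule) (fun t => M / k * exp (k * t))).
    - intros x _. eapply is_derive_eq.
      + apply (der_scal (fun t => exp (k * t))). apply (der_exp (fun t => k * t)).
        apply (der_scal (fun x => x)). apply is_derive_id.
      + unfold one; simpl. field; auto.
    - intros x _. eapply is_derive_continuous. apply (der_scal (fun t => exp (k * t))).
      apply (der_exp (fun t => k * t)). apply (der_scal (fun x => x)). apply is_derive_id. }
  assert (B : Rabs (RInt f th (th + 2 * PI)) <= M / k * exp (k * (th + 2 * PI)) - M / k * exp (k * th)).
  { apply (norm_RInt_le (V := R_NormedModule) f (fun t => M * exp (k * t)) th (th + 2 * PI)).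
    - lra.
    - intros x _. unfold norm; simpl. unfold abs; simpl. unfold f.
      rewrite Rabs_mult, Rabs_right by (left; apply exp_pos). pose proof (exp_pos (k * x)).
      specialize (HM x). nra.
    - apply (RInt_correct (V := R_CompleteNormedModule)). apply ex_int; auto.
    - exact I. }
  replace (M / k * exp (k * (th + 2 * PI)) - M / k * exp (k * th))
    with (exp (k * th) * (M * ((exp (k * (2 * PI)) - 1) / k))) in B.
  2:{ rewrite (Rmult_plus_distr_l k th), exp_plus. field; auto. }
  rewrite Rabs_mult. unfold Rdiv at 1. rewrite Rabs_mult, (Rabs_right (exp _)) by (left; apply exp_pos).
  rewrite Rabs_inv.
  assert (P : 0 < (exp (k * (2 * PI)) - 1) / k).
  { destruct (Rlt_dec 0 k) as [h|h].
    - apply Rdiv_lt_0_compat; auto. assert (exp 0 < exp (k * (2 * PI))) by (apply exp_increasing; nra).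
      rewrite exp_0 in *; lra.
    - assert (exp (k * (2 * PI)) < exp 0) by (apply exp_increasing; nra). rewrite exp_0 in *.
      replace ((exp (k * (2 * PI)) - 1) / k) with ((1 - exp (k * (2 * PI))) / (- k)) by (field; lra).
      apply Rdiv_lt_0_compat; lra. }
  replace (Rabs k) with (Rabs (exp (k * (2 * PI)) - 1) / ((exp (k * (2 * PI)) - 1) / k)).
  2:{ rewrite <- (Rabs_right ((exp (k * (2 * PI)) - 1) / k)) by lra. rewrite Rabs_div by auto.
      field. split; apply Rabs_no_R0; auto. }
  pose proof (Rabs_pos_lt _ E1). pose proof (exp_pos (- k * th)).
  apply Rle_trans with (exp (- k * th) * / Rabs (exp (k * (2 * PI)) - 1) *
     (exp (k * th) * (M * ((exp (k * (2 * PI)) - 1) / k)))).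
  - apply Rmult_le_compat_l; auto. left; apply Rmult_lt_0_compat; auto. apply Rinv_0_lt_compat; auto.
  - replace (- k * th) with (- (k * th)) by ring. rewrite exp_Ropp. pose proof (exp_pos (k * th)).
    right. field. repeat split; auto; lra.
Qed.

Lemma green_diff (g g' : R -> R) (M th : R) :
  (forall t, continuous g t) -> (forall t, continuous g' t) ->
  (forall t, Rabs (g t - g' t) <= M) -> Rabs (green k g th - green k g' th) <= M / Rabs k.
Proof.
  intros Hg Hg' HM.
  replace (green k g th - green k g' th) with (green k (fun t => g t - g' t) th).
  - apply green_bound; auto. intros t. apply (continuous_minus g g'); auto.
  - unfold green. rewrite <- Rmult_minus_distr_l. f_equal.
    rewrite <- (RInt_minus (V := R_CompleteNormedModule)) by (apply ex_int; auto).
    apply RInt_ext. intros x _. unfold minus, plus, opp; simpl. ring.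
Qed.

End Green.

Section PeriodicSolution.
Variables (A B E : R -> R -> R -> R) (kw ks w0 rad sig L MA ME cA cB cE m : R).
Hypothesis Hkw : kw <> 0.
Hypothesis Hks : ks <> 0.
Hypothesis Hm : 0 < m.
Hypothesis Hrad : 0 <= rad.
Hypothesis Hsig : 0 <= sig.

Definition tube (th rh s : R) : Prop := Rabs (rh - w0) <= rad /\ Rabs s <= sig.

Hypothesis PA : forall th rh s, A (th + 2 * PI) rh s = A th rh s.
Hypothesis PB : forall th rh s, B (th + 2 * PI) rh s = B th rh s.
Hypothesis PE : forall th rh s, E (th + 2 * PI) rh s = E th rh s.
Hypothesis LA : BL tube L A.
Hypothesis LB : BL tube L B.
Hypothesis LE : BL tube L E.
Hypothesis SA : forall th rh s, tube th rh s -> Rabs (A th rh s) <= MA * Rabs kw.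
Hypothesis SE : forall th rh s, tube th rh s -> Rabs (E th rh s) <= ME.
Hypothesis SAE : MA + ME <= rad.
Hypothesis SB : forall th rh s, tube th rh s -> Rabs (B th rh s) <= sig * Rabs ks.
Hypothesis CA : forall th rh s rh' s', tube th rh s -> tube th rh' s' ->
  Rabs (A th rh s - A th rh' s') <= Rabs kw * (cA * (Rabs (rh - rh') + m * Rabs (s - s'))).
Hypothesis CB : forall th rh s rh' s', tube th rh s -> tube th rh' s' ->
  Rabs (B th rh s - B th rh' s') <= Rabs ks * (cB * (Rabs (rh - rh') + m * Rabs (s - s'))).
Hypothesis CE : forall th rh s rh' s', tube th rh s -> tube th rh' s' ->
  Rabs (E th rh s - E th rh' s') <= cE * (Rabs (rh - rh') + m * Rabs (s - s')).
Hypothesis Hpos : 0 <= cA /\ 0 <= cB /\ 0 <= cE.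
Hypothesis Hc : cA + cE + m * cB <= / 2.

(** Continuity and periodicity are what the Green operator requires of its argument; the tube is the
    region where [A], [B] and [E] are controlled. *)
Let good (f : (R -> R) * (R -> R)) : Prop :=
  (forall t, continuous (fst f) t) /\ (forall t, continuous (snd f) t) /\
  (forall t, fst f (t + 2 * PI) = fst f t) /\ (forall t, snd f (t + 2 * PI) = snd f t) /\
  forall t, tube t (fst f t) (snd f t).

Let cont_comp (G : R -> R -> R -> R) f : BL tube L G -> good f ->
  forall t, continuous (fun t => G t (fst f t) (snd f t)) t.
Proof.
  intros [HG1 HG2] [H1 [H2 [_ [_ H5]]]] t. apply continuous_of_eps. intros e He.
  set (r := e / (3 * (Rabs L + 1))). pose proof (Rabs_pos L) as HL.
  assert (Hr : 0 < r) by (apply Rdiv_lt_0_compat; lra).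
  destruct (continuous_eps _ _ (H1 t) r Hr) as [d1 [Hd1 K1]].
  destruct (continuous_eps _ _ (H2 t) r Hr) as [d2 [Hd2 K2]].
  exists (Rmin r (Rmin d1 d2)). split; [repeat apply Rmin_glb_lt; auto|].
  intros x Hx.
  assert (X1 : Rabs (x - t) < r) by (eapply Rlt_le_trans; [apply Hx|apply Rmin_l]).
  assert (X2 : Rabs (x - t) < Rmin d1 d2) by (eapply Rlt_le_trans; [apply Hx|apply Rmin_r]).
  specialize (K1 x ltac:(eapply Rlt_le_trans; [apply X2|apply Rmin_l])).
  specialize (K2 x ltac:(eapply Rlt_le_trans; [apply X2|apply Rmin_r])).
  eapply Rle_lt_trans; [apply HG2; auto|].
  assert (E3 : e = (Rabs L + 1) * (r + r + r)) by (unfold r; field; lra).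
  rewrite E3. pose proof (Rle_abs L).
  pose proof (dist1_pos x (fst f x) (snd f x) t (fst f t) (snd f t)).
  apply Rle_lt_trans with ((Rabs L + 1) * (Rabs (x - t) + Rabs (fst f x - fst f t) + Rabs (snd f x - snd f t))).
  - apply Rmult_le_compat_r; auto; lra.
  - apply Rmult_lt_compat_l; lra.
Qed.

(** For [w = rh + E] the radial equation is [(w - w0)' = - kw (w - w0) + A]; inverting it with the
    Green operator and solving for [rh] gives the first component. Leaving [E] outside the integral
    avoids differentiating it. *)
Let F (f : (R -> R) * (R -> R)) : (R -> R) * (R -> R) :=
  (fun th => w0 + green kw (fun t => A t (fst f t) (snd f t)) th - E th (fst f th) (snd f th),
   fun th => green ks (fun t => B t (fst f t) (snd f t)) th).

Let comp_periodic (G : R -> R -> R -> R) f : good f -> (forall th rh s, G (th + 2 * PI) rh s = G th rh s) ->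
  forall t, (fun t => G t (fst f t) (snd f t)) (t + 2 * PI) = G t (fst f t) (snd f t).
Proof. intros [_ [_ [H3 [H4 _]]]] P t. simpl. rewrite H3, H4, P. reflexivity. Qed.

Let F_good f : good f -> good (F f).
Proof.
  intros Hf. pose proof (cont_comp A f LA Hf) as ctA. pose proof (cont_comp B f LB Hf) as ctB.
  pose proof (cont_comp E f LE Hf) as ctE. pose proof Hf as [_ [_ [H3 [H4 H5]]]].
  pose proof (comp_periodic A f Hf PA) as pA. pose proof (comp_periodic B f Hf PB) as pB.
  pose proof (fun t => green_derive kw Hkw _ t ctA pA) as dA.
  pose proof (fun t => green_derive ks Hks _ t ctB pB) as dB.
  split; [|split; [|split; [|split]]]; simpl.
  - intros t. apply (continuous_minus (fun th => w0 + green kw (fun t => A t (fst f t) (snd f t)) th));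
      [|apply ctE].
    apply (continuous_plus (fun _ => w0)); [apply continuous_const|].
    exact (is_derive_continuous _ _ _ (dA t)).
  - intros t. exact (is_derive_continuous _ _ _ (dB t)).
  - intros t. rewrite (green_periodic kw Hkw (fun t : R => A t (fst f t) (snd f t)) t ctA pA), H3, H4, PE; reflexivity.
  - intros t. apply (green_periodic ks Hks _ t ctB pB).
  - intros t. pose proof (Rabs_no_R0 _ Hkw). pose proof (Rabs_no_R0 _ Hks). split; simpl.
    + replace (w0 + green kw (fun t => A t (fst f t) (snd f t)) t - E t (fst f t) (snd f t) - w0)
        with (green kw (fun t => A t (fst f t) (snd f t)) t + - E t (fst f t) (snd f t)) by ring.
      eapply Rle_trans; [apply Rabs_triang|]. rewrite Rabs_Ropp.
      pose proof (green_bound kw Hkw (fun t : R => A t (fst f t) (snd f t)) (MA * Rabs kw) t ctA (fun t => SA _ _ _ (H5 t))) as K.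
      replace (MA * Rabs kw / Rabs kw) with MA in K by (field; auto).
      specialize (SE _ _ _ (H5 t)). lra.
    + pose proof (green_bound ks Hks (fun t : R => B t (fst f t) (snd f t)) (sig * Rabs ks) t ctB (fun t => SB _ _ _ (H5 t))) as K.
      replace (sig * Rabs ks / Rabs ks) with sig in K by (field; auto). exact K.
Qed.

Let F_contract f g r : good f -> good g ->
  (forall t, Rabs (fst f t - fst g t) + m * Rabs (snd f t - snd g t) <= r) ->
  forall t, Rabs (fst (F f) t - fst (F g) t) + m * Rabs (snd (F f) t - snd (F g) t) <= r / 2.
Proof.
  intros Hf Hg H t.
  pose proof (proj2 (proj2 (proj2 (proj2 Hf)))) as Tf. pose proof (proj2 (proj2 (proj2 (proj2 Hg)))) as Tg.
  pose proof (Rabs_no_R0 _ Hkw) as n1. pose proof (Rabs_no_R0 _ Hks) as n2.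
  pose proof (Rabs_pos_lt _ Hkw) as p1. pose proof (Rabs_pos_lt _ Hks) as p2.
  destruct Hpos as [P1 [P2 P3]].
  assert (Hr : 0 <= r).
  { specialize (H t). pose proof (Rabs_pos (fst f t - fst g t)). pose proof (Rabs_pos (snd f t - snd g t)). nra. }
  pose proof (green_diff kw Hkw (fun t : R => A t (fst f t) (snd f t)) (fun t : R => A t (fst g t) (snd g t)) (Rabs kw * (cA * r)) t (cont_comp A f LA Hf) (cont_comp A g LA Hg)) as KA.
  pose proof (green_diff ks Hks (fun t : R => B t (fst f t) (snd f t)) (fun t : R => B t (fst g t) (snd g t)) (Rabs ks * (cB * r)) t (cont_comp B f LB Hf) (cont_comp B g LB Hg)) as KB.
  specialize (KA ltac:(intros s; eapply Rle_trans; [apply CA; auto|];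
    apply Rmult_le_compat_l; [lra|]; apply Rmult_le_compat_l; auto)).
  specialize (KB ltac:(intros s; eapply Rle_trans; [apply CB; auto|];
    apply Rmult_le_compat_l; [lra|]; apply Rmult_le_compat_l; auto)).
  replace (Rabs kw * (cA * r) / Rabs kw) with (cA * r) in KA by (field; auto).
  replace (Rabs ks * (cB * r) / Rabs ks) with (cB * r) in KB by (field; auto).
  assert (KE : Rabs (E t (fst f t) (snd f t) - E t (fst g t) (snd g t)) <= cE * r).
  { eapply Rle_trans; [apply CE; auto|]. apply Rmult_le_compat_l; auto. }
  simpl.
  match goal with |- Rabs (w0 + ?x - ?y - (w0 + ?z - ?w)) + _ <= _ =>
    replace (w0 + x - y - (w0 + z - w)) with ((x - z) + - (y - w)) by ring end.
  eapply Rle_trans; [apply Rplus_le_compat_r; apply Rabs_triang|]. rewrite Rabs_Ropp.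
  apply (Rmult_le_compat_l m) in KB; [|lra].
  assert ((cA + cE + m * cB) * r <= / 2 * r) by (apply Rmult_le_compat_r; auto). lra.
Qed.

Let iter (n : nat) : (R -> R) * (R -> R) := Nat.iter n F (fun _ => w0, fun _ => 0).

Let iter_good n : good (iter n).
Proof.
  induction n as [|n IH]; [|exact (F_good _ IH)].
  repeat split; simpl; intros; try apply continuous_const.
  - rewrite Rminus_diag, Rabs_R0; auto.
  - rewrite Rabs_R0; auto.
Qed.

Let r0 := rad + m * sig.

Let iter_step n t : Rabs (fst (iter (S n)) t - fst (iter n) t) + m * Rabs (snd (iter (S n)) t - snd (iter n) t) <= r0 / 2 ^ n.
Proof.
  revert t. induction n as [|n IH]; intros t.
  - destruct (proj2 (proj2 (proj2 (proj2 (iter_good 1)))) t) as [K1 K2]. unfold r0.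
    replace (fst (iter 0) t) with w0 by reflexivity. replace (snd (iter 0) t) with 0 by reflexivity.
    rewrite Rminus_0_r. simpl pow. nra.
  - replace (r0 / 2 ^ S n) with (r0 / 2 ^ n / 2) by (simpl; field; repeat split; first [lra | apply pow2_neq0]).
    apply (F_contract (iter (S n)) (iter n)); auto.
Qed.

Let iter_fst n t : Rabs (fst (iter (S n)) t - fst (iter n) t) <= r0 / 2 ^ n.
Proof. pose proof (iter_step n t). pose proof (Rabs_pos (snd (iter (S n)) t - snd (iter n) t)). nra. Qed.

Let iter_snd n t : Rabs (snd (iter (S n)) t - snd (iter n) t) <= r0 / m / 2 ^ n.
Proof.
  pose proof (iter_step n t). pose proof (Rabs_pos (fst (iter (S n)) t - fst (iter n) t)).
  replace (r0 / m / 2 ^ n) with (r0 / 2 ^ n / m) by (field; repeat split; first [lra | apply pow2_neq0]).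
  apply (Rmult_le_reg_l m); auto. replace (m * (r0 / 2 ^ n / m)) with (r0 / 2 ^ n); [lra|].
  field; repeat split; first [lra | apply pow2_neq0].
Qed.

Let lf t := proj1_sig (geometric_limit (fun n => fst (iter n) t) r0 (fun n => iter_fst n t)).
Let lg t := proj1_sig (geometric_limit (fun n => snd (iter n) t) (r0 / m) (fun n => iter_snd n t)).

Let lf_lim n t : Rabs (fst (iter n) t - lf t) <= 2 * r0 / 2 ^ n.
Proof. exact (proj2_sig (geometric_limit (fun n => fst (iter n) t) r0 (fun n => iter_fst n t)) n). Qed.
Let lg_lim n t : Rabs (snd (iter n) t - lg t) <= 2 * (r0 / m) / 2 ^ n.
Proof. exact (proj2_sig (geometric_limit (fun n => snd (iter n) t) (r0 / m) (fun n => iter_snd n t)) n). Qed.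

Let le_of_half (a b r : R) : (forall n : nat, a <= b + r / 2 ^ n) -> a <= b.
Proof.
  intros H. destruct (Rle_dec a b) as [|h]; auto. exfalso.
  destruct (pow_half_small r (a - b)) as [n Hn]; [lra|]. specialize (H n). lra.
Qed.

Let lim_good : good (lf, lg).
Proof.
  split; [|split; [|split; [|split]]]; simpl.
  - intros t. apply (uniform_limit_continuous (fun n => fst (iter n)) lf (2 * r0)); [intros; apply lf_lim|].
    intros n; apply iter_good.
  - intros t. apply (uniform_limit_continuous (fun n => snd (iter n)) lg (2 * (r0 / m))); [intros; apply lg_lim|].
    intros n; apply iter_good.
  - intros t. apply Rminus_diag_uniq. apply Rabs_eq_0. apply Rle_antisym; [|apply Rabs_pos].
    apply (le_of_half _ _ (4 * r0)). intros n.
    pose proof (lf_lim n t) as K1. pose proof (lf_lim n (t + 2 * PI)) as K2.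
    rewrite (proj1 (proj2 (proj2 (iter_good n)))) in K2.
    replace (4 * r0 / 2 ^ n) with (2 * r0 / 2 ^ n + 2 * r0 / 2 ^ n) by (field; repeat split; first [lra | apply pow2_neq0]).
    apply Rabs_le_between in K1. apply Rabs_le_between in K2. apply Rabs_le_between. lra.
  - intros t. apply Rminus_diag_uniq. apply Rabs_eq_0. apply Rle_antisym; [|apply Rabs_pos].
    apply (le_of_half _ _ (4 * (r0 / m))). intros n.
    pose proof (lg_lim n t) as K1. pose proof (lg_lim n (t + 2 * PI)) as K2.
    rewrite (proj1 (proj2 (proj2 (proj2 (iter_good n))))) in K2.
    replace (4 * (r0 / m) / 2 ^ n) with (2 * (r0 / m) / 2 ^ n + 2 * (r0 / m) / 2 ^ n)
      by (field; repeat split; first [lra | apply pow2_neq0]).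
    apply Rabs_le_between in K1. apply Rabs_le_between in K2. apply Rabs_le_between. lra.
  - intros t. split.
    + apply (le_of_half _ _ (2 * r0)). intros n. pose proof (lf_lim n t) as K1.
      destruct (proj2 (proj2 (proj2 (proj2 (iter_good n)))) t) as [K2 _].
      apply Rabs_le_between in K1. apply Rabs_le_between in K2. apply Rabs_le_between. lra.
    + apply (le_of_half _ _ (2 * (r0 / m))). intros n. pose proof (lg_lim n t) as K1.
      destruct (proj2 (proj2 (proj2 (proj2 (iter_good n)))) t) as [_ K2].
      apply Rabs_le_between in K1. apply Rabs_le_between in K2. apply Rabs_le_between. lra.
Qed.

(** The limit is within [4 r0 / 2 ^ n] of the [n]-th iterate, so its image is within half of that of
    the next iterate, which again is close to the limit. All errors vanish as [n] grows. *)
Let lim_fixed t : fst (F (lf, lg)) t = lf t /\ snd (F (lf, lg)) t = lg t.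
Proof.
  assert (H : Rabs (fst (F (lf, lg)) t - lf t) + m * Rabs (snd (F (lf, lg)) t - lg t) <= 0).
  { apply (le_of_half _ _ (4 * r0)). intros n.
    assert (K : forall s, Rabs (fst (lf, lg) s - fst (iter n) s) + m * Rabs (snd (lf, lg) s - snd (iter n) s)
                <= 4 * r0 / 2 ^ n).
    { intros s. simpl. rewrite Rabs_minus_sym, (Rabs_minus_sym (lg s)).
      pose proof (lf_lim n s) as K1. pose proof (lg_lim n s) as K2.
      apply (Rmult_le_compat_l m) in K2; [|lra].
      replace (m * (2 * (r0 / m) / 2 ^ n)) with (2 * r0 / 2 ^ n) in K2
        by (field; repeat split; first [lra | apply pow2_neq0]).
      replace (4 * r0 / 2 ^ n) with (2 * r0 / 2 ^ n + 2 * r0 / 2 ^ n) by (field; repeat split; first [lra | apply pow2_neq0]). lra. }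
    pose proof (F_contract _ _ _ lim_good (iter_good n) K t) as K3.
    pose proof (lf_lim (S n) t) as K1. pose proof (lg_lim (S n) t) as K2.
    replace (iter (S n)) with (F (iter n)) in K1, K2 by reflexivity.
    apply (Rmult_le_compat_l m) in K2; [|lra].
    replace (m * (2 * (r0 / m) / 2 ^ S n)) with (r0 / 2 ^ n) in K2
      by (simpl; field; repeat split; first [lra | apply pow2_neq0]).
    replace (2 * r0 / 2 ^ S n) with (r0 / 2 ^ n) in K1 by (simpl; field; repeat split; first [lra | apply pow2_neq0]).
    replace (4 * r0 / 2 ^ n / 2) with (2 * (r0 / 2 ^ n)) in K3 by (field; repeat split; first [lra | apply pow2_neq0]).
    replace (4 * r0 / 2 ^ n) with (4 * (r0 / 2 ^ n)) by (field; repeat split; first [lra | apply pow2_neq0]).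
    assert (T : forall a b c, Rabs (a - c) <= Rabs (a - b) + Rabs (b - c)).
    { intros a b c. replace (a - c) with (a - b + (b - c)) by ring. apply Rabs_triang. }
    pose proof (T (fst (F (lf, lg)) t) (fst (F (iter n)) t) (lf t)).
    pose proof (T (snd (F (lf, lg)) t) (snd (F (iter n)) t) (lg t)). nra. }
  pose proof (Rabs_pos (fst (F (lf, lg)) t - lf t)). pose proof (Rabs_pos (snd (F (lf, lg)) t - lg t)).
  split; apply Rminus_diag_uniq, Rabs_eq_0; nra.
Qed.

(** Differentiability is obtained for [rh + E] and not for [rh]: the fixed point equation identifies
    only this sum with an image of the Green operator. It is also the quantity that later equals [W]
    along the curve. *)
Lemma periodic_solution : exists rh ss : R -> R,
  (forall t, rh (t + 2 * PI) = rh t) /\ (forall t, ss (t + 2 * PI) = ss t) /\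
  (forall t, tube t (rh t) (ss t)) /\
  (forall t, is_derive (fun t => rh t + E t (rh t) (ss t)) t
     (- kw * (rh t + E t (rh t) (ss t) - w0) + A t (rh t) (ss t))) /\
  (forall t, is_derive ss t (- ks * ss t + B t (rh t) (ss t))).
Proof.
  exists lf, lg. destruct lim_good as [H1 [H2 [H3 [H4 H5]]]]. simpl in *.
  assert (Ew : forall t, w0 + green kw (fun t => A t (lf t) (lg t)) t = lf t + E t (lf t) (lg t)).
  { intros t. destruct (lim_fixed t) as [K _]. simpl in K. lra. }
  assert (Es : forall t, green ks (fun t => B t (lf t) (lg t)) t = lg t).
  { intros t. destruct (lim_fixed t) as [_ K]. exact K. }
  split; [exact H3|split; [exact H4|split; [exact H5|split]]].
  - intros t. apply (is_derive_ext (fun t => w0 + green kw (fun t => A t (lf t) (lg t)) t)); [exact Ew|].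
    rewrite <- Ew. eapply is_derive_eq.
    + apply der_plus; [apply der_const|]. apply green_derive; auto.
      * exact (cont_comp A _ LA lim_good).
      * exact (comp_periodic A _ lim_good PA).
    + simpl. ring.
  - intros t. apply (is_derive_ext (fun t => green ks (fun t => B t (lf t) (lg t)) t)); [exact Es|].
    rewrite <- (Es t) at 1. apply (green_derive ks Hks (fun t => B t (lf t) (lg t))).
    + exact (cont_comp B _ LB lim_good).
    + exact (comp_periodic B _ lim_good PB).
Qed.

End PeriodicSolution.

(** * Dynamics near a closed curve *)

Lemma gronwall_le_ex (V : R -> R) (c a b : R) : a <= b ->
  (forall t, a <= t <= b -> exists l, is_derive V t l /\ l <= c * V t) ->
  V b <= V a * exp (c * (b - a)).
Proof.
  intros Hab H. apply (gronwall_le V (Derive V)); auto.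
  - intros t Ht. destruct (H t Ht) as [l [Hl _]]. apply Derive_correct. exists l; auto.
  - intros t Ht. destruct (H t Ht) as [l [Hl Hc]]. rewrite (is_derive_unique _ _ _ Hl). auto.
Qed.

Lemma gronwall_ge_ex (V : R -> R) (c a b : R) : a <= b ->
  (forall t, a <= t <= b -> exists l, is_derive V t l /\ c * V t <= l) ->
  V a * exp (c * (b - a)) <= V b.
Proof.
  intros Hab H. apply (gronwall_ge V (Derive V)); auto.
  - intros t Ht. destruct (H t Ht) as [l [Hl _]]. apply Derive_correct. exists l; auto.
  - intros t Ht. destruct (H t Ht) as [l [Hl Hc]]. rewrite (is_derive_unique _ _ _ Hl). auto.
Qed.

Definition loc_lipschitz (f : R -> R -> R -> R) : Prop := forall b, exists C, BL (box b) C f.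

Lemma loc_lipschitz_continuous (f : R -> R -> R -> R) (x y z : R -> R) (t : R) :
  loc_lipschitz f -> continuous x t -> continuous y t -> continuous z t ->
  continuous (fun s => f (x s) (y s) (z s)) t.
Proof.
  intros Hf Hx Hy Hz.
  set (b := Rabs (x t) + Rabs (y t) + Rabs (z t) + 1).
  pose proof (Rabs_pos (x t)) as px. pose proof (Rabs_pos (y t)) as py. pose proof (Rabs_pos (z t)) as pz.
  destruct (Hf b) as [C [_ HC]]. apply continuous_of_eps. intros e He.
  set (r := Rmin 1 (e / (3 * (Rabs C + 1)))). pose proof (Rabs_pos C) as HC0.
  assert (Hr : 0 < r) by (apply Rmin_glb_lt; [lra|apply Rdiv_lt_0_compat; lra]).
  destruct (continuous_eps _ _ Hx r Hr) as [d1 [Hd1 K1]].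
  destruct (continuous_eps _ _ Hy r Hr) as [d2 [Hd2 K2]].
  destruct (continuous_eps _ _ Hz r Hr) as [d3 [Hd3 K3]].
  exists (Rmin d1 (Rmin d2 d3)). split; [repeat apply Rmin_glb_lt; auto|].
  intros s Hs.
  pose proof (Rmin_l d1 (Rmin d2 d3)). pose proof (Rmin_r d1 (Rmin d2 d3)).
  pose proof (Rmin_l d2 d3). pose proof (Rmin_r d2 d3).
  specialize (K1 s ltac:(lra)). specialize (K2 s ltac:(lra)). specialize (K3 s ltac:(lra)).
  assert (Hr1 : r <= 1) by apply Rmin_l.
  assert (Hr2 : r <= e / (3 * (Rabs C + 1))) by apply Rmin_r.
  assert (T : forall a a', Rabs (a - a') < r -> Rabs a <= Rabs a' + 1).
  { intros a a' Ha. replace a with (a - a' + a') by ring. eapply Rle_trans; [apply Rabs_triang|]. lra. }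
  eapply Rle_lt_trans; [apply HC|].
  - pose proof (T _ _ K1). pose proof (T _ _ K2). pose proof (T _ _ K3). unfold b; repeat split; lra.
  - unfold b; repeat split; lra.
  - pose proof (Rle_abs C).
    pose proof (dist1_pos (x s) (y s) (z s) (x t) (y t) (z t)).
    apply Rle_lt_trans with ((Rabs C + 1) * (Rabs (x s - x t) + Rabs (y s - y t) + Rabs (z s - z t))).
    + apply Rmult_le_compat_r; auto; lra.
    + apply Rlt_le_trans with ((Rabs C + 1) * (r + r + r)); [apply Rmult_lt_compat_l; lra|].
      assert (E3 : e = (Rabs C + 1) * (e / (3 * (Rabs C + 1)) * 3)) by (field; lra).
      apply Rle_trans with ((Rabs C + 1) * (e / (3 * (Rabs C + 1)) * 3)); [apply Rmult_le_compat_l|]; lra.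
Qed.

Lemma continuous_Rmax0 (t : R) : continuous (fun s => Rmax s 0) t.
Proof.
  apply continuous_lipschitz with 1. intros x. rewrite Rmult_1_l.
  unfold Rmax. destruct (Rle_dec x 0), (Rle_dec t 0); apply Rabs_le_between';
    destruct (Rle_dec 0 (x - t)); try (rewrite Rabs_right by lra; lra); rewrite Rabs_left by lra; lra.
Qed.

Lemma continuous_Rmax (f g : R -> R) (t : R) : continuous f t -> continuous g t ->
  continuous (fun s => Rmax (f s) (g s)) t.
Proof.
  intros Hf Hg. apply continuous_of_eps. intros e He.
  destruct (continuous_eps _ _ Hf e He) as [d1 [Hd1 K1]].
  destruct (continuous_eps _ _ Hg e He) as [d2 [Hd2 K2]].
  exists (Rmin d1 d2). split; [apply Rmin_glb_lt; auto|].
  intros s Hs. pose proof (Rmin_l d1 d2). pose proof (Rmin_r d1 d2).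
  specialize (K1 s ltac:(lra)). specialize (K2 s ltac:(lra)).
  apply Rabs_def2 in K1. apply Rabs_def2 in K2.
  unfold Rmax. destruct (Rle_dec (f s) (g s)), (Rle_dec (f t) (g t)); apply Rabs_def1; lra.
Qed.

Lemma exp_le_1 (x : R) : x <= 0 -> exp x <= 1.
Proof.
  intros H. rewrite <- exp_0. destruct (Req_dec x 0) as [->|]; [lra|]. left; apply exp_increasing; lra.
Qed.

Lemma atan_le (x : R) : Rabs (atan x) <= Rabs x.
Proof.
  pose proof (mvt_lipschitz atan (fun x => / (1 + Rsqr x)) 1) as K.
  specialize (K ltac:(intros; apply is_derive_atan)).
  specialize (K ltac:(intros t; pose proof (Rle_0_sqr t);
    rewrite Rabs_right by (left; apply Rinv_0_lt_compat; lra);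
    rewrite <- Rinv_1; apply Rinv_le_contravar; lra)).
  specialize (K x 0). rewrite atan_0, !Rminus_0_r in K. lra.
Qed.

(** Rotating by [- th0] puts the point at [(x, y)] with [x >= rho / 2] and [|y| <= 2 h], so
    [th0 + atan (y / x)] is an angle for it, and the correction is at most [|y / x|]. This selects
    the branch near [th0] without a global argument function. *)
Lemma polar_near (p q r0 th0 h rho : R) : 0 < rho <= r0 -> 0 <= h <= rho / 4 ->
  Rabs (p - r0 * cos th0) <= h -> Rabs (q - r0 * sin th0) <= h ->
  exists th, p = sqrt (p ^ 2 + q ^ 2) * cos th /\ q = sqrt (p ^ 2 + q ^ 2) * sin th /\
    Rabs (th - th0) <= 4 * h / rho.
Proof.
  intros Hr Hh Hp Hq.
  pose proof (sin2_cos2 th0) as SC. unfold Rsqr in SC.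
  pose proof (COS_bound th0) as CB. pose proof (SIN_bound th0) as SB.
  set (c := cos th0) in *. set (s := sin th0) in *.
  set (x := p * c + q * s). set (y := - p * s + q * c).
  apply Rabs_le_between in Hp. apply Rabs_le_between in Hq.
  assert (Ex : x = r0 + (p - r0 * c) * c + (q - r0 * s) * s).
  { unfold x. transitivity (r0 * (s * s + c * c) + (p - r0 * c) * c + (q - r0 * s) * s); [ring|].
    rewrite SC; ring. }
  assert (Ey : y = - (p - r0 * c) * s + (q - r0 * s) * c) by (unfold y; ring).
  assert (B : forall a e, - h <= a <= h -> -1 <= e <= 1 -> - h <= a * e <= h) by (intros; nra).
  pose proof (B _ c Hp ltac:(lra)). pose proof (B _ s Hq ltac:(lra)).
  pose proof (B _ s Hp ltac:(lra)). pose proof (B _ c Hq ltac:(lra)).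
  assert (Hx : rho / 2 <= x) by lra.
  assert (Hy : Rabs y <= 2 * h) by (apply Rabs_le_between; lra).
  assert (ER : p ^ 2 + q ^ 2 = x ^ 2 + y ^ 2).
  { unfold x, y. transitivity ((p ^ 2 + q ^ 2) * (s * s + c * c)); [rewrite SC; ring|ring]. }
  set (t := y / x).
  assert (Es : sqrt (p ^ 2 + q ^ 2) = x * sqrt (1 + t ^ 2)).
  { rewrite ER. replace (x ^ 2 + y ^ 2) with (x ^ 2 * (1 + t ^ 2)) by (unfold t; field; lra).
    rewrite sqrt_mult by nra. rewrite sqrt_pow2; lra. }
  assert (Hs : 0 < sqrt (1 + t ^ 2)) by (apply sqrt_lt_R0; nra).
  assert (EC : sqrt (p ^ 2 + q ^ 2) * cos (atan t) = x).
  { rewrite Es, cos_atan. unfold Rsqr. replace (t * t) with (t ^ 2) by ring. field. lra. }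
  assert (ES : sqrt (p ^ 2 + q ^ 2) * sin (atan t) = y).
  { rewrite Es, sin_atan. unfold Rsqr. replace (t * t) with (t ^ 2) by ring. replace y with (t * x) at 1 by (unfold t; field; lra). field. lra. }
  exists (th0 + atan t). rewrite cos_plus, sin_plus. fold c s. repeat split.
  - transitivity (x * c - y * s); [unfold x, y; transitivity (p * (s * s + c * c)); [rewrite SC|]; ring|].
    rewrite <- EC at 1. rewrite <- ES at 1. ring.
  - transitivity (x * s + y * c); [unfold x, y; transitivity (q * (s * s + c * c)); [rewrite SC|]; ring|].
    rewrite <- EC at 1. rewrite <- ES at 1. ring.
  - replace (th0 + atan t - th0) with (atan t) by ring. eapply Rle_trans; [apply atan_le|].
    unfold t, Rdiv. rewrite Rabs_mult, Rabs_inv, (Rabs_right x) by lra.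
    apply Rle_trans with (2 * h * / (rho / 2)).
    + apply Rmult_le_compat; auto using Rabs_pos. left; apply Rinv_0_lt_compat; lra.
      apply Rinv_le_contravar; lra.
    + right. field. lra.
Qed.

Lemma dist3_coord (X Y : R3) (i : nat) : Rabs (coord i X - coord i Y) <= dist3 X Y.
Proof.
  assert (K : forall a b c, Rabs a <= sqrt (a ^ 2 + b ^ 2 + c ^ 2)).
  { intros a b c. rewrite <- sqrt_Rsqr_abs. apply sqrt_le_1_alt. unfold Rsqr. nra. }
  unfold dist3. destruct i as [|[|i]]; simpl.
  - apply K.
  - rewrite (Rplus_comm ((fst (fst X) - fst (fst Y)) * _)). apply K.
  - match goal with |- _ <= sqrt (?x + ?y + ?z) => replace (x + y + z) with (z + x + y) by ring end. apply K.
Qed.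

Lemma dist3_le (X Y : R3) :
  dist3 X Y <= Rabs (coord 0 X - coord 0 Y) + Rabs (coord 1 X - coord 1 Y) + Rabs (coord 2 X - coord 2 Y).
Proof.
  unfold dist3. set (a := coord 0 X - coord 0 Y). set (b := coord 1 X - coord 1 Y).
  set (c := coord 2 X - coord 2 Y).
  pose proof (Rabs_pos a). pose proof (Rabs_pos b). pose proof (Rabs_pos c).
  rewrite <- (sqrt_pow2 (Rabs a + Rabs b + Rabs c)) by lra. apply sqrt_le_1_alt.
  rewrite <- (pow2_abs a), <- (pow2_abs b), <- (pow2_abs c). nra.
Qed.

Lemma dist3_sym (X Y : R3) : dist3 X Y = dist3 Y X.
Proof. unfold dist3. f_equal. ring. Qed.

Lemma dist3_pos (X Y : R3) : 0 <= dist3 X Y.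
Proof. apply sqrt_pos. Qed.

Lemma polar_sq (rho th : R) : 0 <= rho -> (sqrt (2 * rho) * cos th) ^ 2 + (sqrt (2 * rho) * sin th) ^ 2 = 2 * rho.
Proof.
  intros H. pose proof (sin2_cos2 th) as SC. unfold Rsqr in SC.
  rewrite !Rpow_mult_distr, pow2_sqrt by lra.
  transitivity (2 * rho * (sin th * sin th + cos th * cos th)); [ring|]. rewrite SC; ring.
Qed.

Lemma polar_box (b th rho s : R) : 0 < b -> 0 <= 2 * rho <= b ^ 2 -> Rabs s <= b ->
  box b (sqrt (2 * rho) * cos th) (sqrt (2 * rho) * sin th) s.
Proof.
  intros Hb Hr Hs.
  assert (sqrt (2 * rho) <= b).
  { rewrite <- (sqrt_pow2 b) by lra. apply sqrt_le_1_alt. lra. }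
  pose proof (sqrt_pos (2 * rho)).
  pose proof (COS_bound th). pose proof (SIN_bound th).
  repeat split; [| |lra]; rewrite Rabs_mult, Rabs_right by lra.
  - assert (Rabs (cos th) <= 1) by (apply Rabs_le_between; lra). pose proof (Rabs_pos (cos th)). nra.
  - assert (Rabs (sin th) <= 1) by (apply Rabs_le_between; lra). pose proof (Rabs_pos (sin th)). nra.
Qed.

(** Rationalising the difference leaves the sum of the two roots in the denominator, at least
    [2 sqrt w0]. Keeping away from the origin is what makes polar coordinates Lipschitz. *)
Lemma sqrt_diff (w0 rho rho' : R) : 0 < w0 -> w0 / 2 <= rho -> w0 / 2 <= rho' ->
  Rabs (sqrt (2 * rho) - sqrt (2 * rho')) <= Rabs (rho - rho') / sqrt w0.
Proof.
  intros Hw0 H H'. assert (Hs : 0 < sqrt w0) by (apply sqrt_lt_R0; auto).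
  assert (S1 : sqrt w0 <= sqrt (2 * rho)) by (apply sqrt_le_1_alt; lra).
  assert (S2 : sqrt w0 <= sqrt (2 * rho')) by (apply sqrt_le_1_alt; lra).
  replace (sqrt (2 * rho) - sqrt (2 * rho')) with (2 * (rho - rho') / (sqrt (2 * rho) + sqrt (2 * rho'))).
  - unfold Rdiv. rewrite !Rabs_mult, Rabs_inv, (Rabs_right 2), (Rabs_right (_ + _)) by lra.
    replace (Rabs (rho - rho') * / sqrt w0) with (2 * Rabs (rho - rho') * / (2 * sqrt w0)) by (field; lra).
    apply Rmult_le_compat_l; [pose proof (Rabs_pos (rho - rho')); lra|]. apply Rinv_le_contravar; lra.
  - replace (2 * (rho - rho')) with (sqrt (2 * rho) ^ 2 - sqrt (2 * rho') ^ 2)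
      by (rewrite !pow2_sqrt by lra; ring). field. lra.
Qed.

Lemma dist_polar (w0 th rho s rho' s' : R) : 0 < w0 -> w0 / 2 <= rho -> w0 / 2 <= rho' ->
  dist3 (sqrt (2 * rho) * cos th, sqrt (2 * rho) * sin th, s)
        (sqrt (2 * rho') * cos th, sqrt (2 * rho') * sin th, s')
  <= 2 * (Rabs (rho - rho') / sqrt w0) + Rabs (s - s').
Proof.
  intros Hw0 H H'. eapply Rle_trans; [apply dist3_le|]. simpl.
  rewrite <- !Rmult_minus_distr_r, !Rabs_mult.
  pose proof (sqrt_diff w0 rho rho' Hw0 H H') as B.
  pose proof (COS_bound th). pose proof (SIN_bound th).
  assert (Rabs (cos th) <= 1) by (apply Rabs_le_between; lra).
  assert (Rabs (sin th) <= 1) by (apply Rabs_le_between; lra).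
  pose proof (Rabs_pos (cos th)). pose proof (Rabs_pos (sin th)).
  pose proof (Rabs_pos (sqrt (2 * rho) - sqrt (2 * rho'))). nra.
Qed.

Section OrbitDynamics.
Variables f1 f2 f3 wv Mv : R -> R -> R -> R.
Variables w0 rad sig kw ks K th0 th1 b Cd Cw : R.
Variables rh ss : R -> R.

Definition vf3 (Y : R3) : R3 :=
  (f1 (coord 0 Y) (coord 1 Y) (coord 2 Y), f2 (coord 0 Y) (coord 1 Y) (coord 2 Y),
   f3 (coord 0 Y) (coord 1 Y) (coord 2 Y)).
Definition angv (p q s : R) : R := (p * f2 p q s - q * f1 p q s) / (p ^ 2 + q ^ 2).
(** The radial variable [rho] is half the squared radius, so that the leading part of [W] is [rho]
    itself. *)
Definition at_polar (f : R -> R -> R -> R) (th rho s : R) : R :=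
  f (sqrt (2 * rho) * cos th) (sqrt (2 * rho) * sin th) s.
Definition in_tube (rho s : R) : Prop := Rabs (rho - w0) <= rad /\ Rabs s <= sig.
Definition wcurve (th : R) : R := at_polar wv th (rh th) (ss th).
Definition pcurve (th : R) : R3 :=
  (sqrt (2 * rh th) * cos th, sqrt (2 * rh th) * sin th, ss th).

Hypothesis Hw0 : 0 < w0.
Hypothesis Hrad : 0 < rad <= w0 / 2.
Hypothesis Hsig : 0 < sig.
Hypothesis Hks : 0 < ks.
Hypothesis HK : 0 < K.
Hypothesis Hth0 : 0 < th0.
Hypothesis Hkw : kw <> 0.
Hypothesis Lf1 : loc_lipschitz f1.
Hypothesis Lf2 : loc_lipschitz f2.
Hypothesis Hang : forall th rho s, in_tube rho s -> th0 <= at_polar angv th rho s <= th1.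
Hypothesis Prh : forall th, rh (th + 2 * PI) = rh th.
Hypothesis Pss : forall th, ss (th + 2 * PI) = ss th.
Hypothesis Hin : forall th, Rabs (rh th - w0) <= rad / 2 /\ Rabs (ss th) <= sig / 2.
Hypothesis Dw : forall th, is_derive wcurve th
  (at_polar Mv th (rh th) (ss th) / at_polar angv th (rh th) (ss th)).
Hypothesis Ds : forall th, is_derive ss th
  (at_polar f3 th (rh th) (ss th) / at_polar angv th (rh th) (ss th)).
(** With the angle as independent variable, everything beyond the linear rates [kw] and [ks] is
    charged to at most half of these rates. This one inequality drives the decay of [Vp] and, for
    negative [kw], the growth of [Vm]. *)
Hypothesis Hdiff : forall th rho s rho' s', in_tube rho s -> in_tube rho' s' ->
  let dw := at_polar wv th rho s - at_polar wv th rho' s' in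
  let ds := s - s' in
  Rabs dw * Rabs (at_polar Mv th rho s / at_polar angv th rho s
                  - at_polar Mv th rho' s' / at_polar angv th rho' s' + kw * dw)
  + K * (Rabs ds * Rabs (at_polar f3 th rho s / at_polar angv th rho s
                  - at_polar f3 th rho' s' / at_polar angv th rho' s' + ks * ds))
  <= Rabs kw / 2 * dw ^ 2 + K * ks / 2 * ds ^ 2.
Hypothesis Hrho : forall th rho s rho' s', in_tube rho s -> in_tube rho' s' ->
  Rabs (rho - rho') <= 2 * (Rabs (at_polar wv th rho s - at_polar wv th rho' s') + Rabs (s - s')).
Hypothesis Hbd : forall th rho s, in_tube rho s ->
  Rabs (at_polar Mv th rho s / at_polar angv th rho s) <= Cd /\
  Rabs (at_polar f3 th rho s / at_polar angv th rho s) <= Cd.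
Hypothesis Hbox : 2 * (w0 + rad) <= b ^ 2 /\ sig <= b /\ 0 < b.
Hypothesis Lwv : BL (box b) Cw wv.
Hypothesis HW : forall (p q s : R -> R) (t : R),
  is_derive p t (f1 (p t) (q t) (s t)) -> is_derive q t (f2 (p t) (q t) (s t)) ->
  is_derive s t (f3 (p t) (q t) (s t)) ->
  is_derive (fun t => wv (p t) (q t) (s t)) t (Mv (p t) (q t) (s t)).

Lemma tube_curve th : in_tube (rh th) (ss th).
Proof. destruct (Hin th). split; lra. Qed.

Lemma tube_rho rho s : in_tube rho s -> w0 / 2 <= rho.
Proof. intros [H _]. apply Rabs_le_between in H. lra. Qed.

Lemma tube_box th rho s : in_tube rho s -> box b (sqrt (2 * rho) * cos th) (sqrt (2 * rho) * sin th) s.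
Proof.
  intros HT. pose proof (tube_rho _ _ HT). destruct HT as [H1 H2]. destruct Hbox as [B1 [B2 B3]].
  apply Rabs_le_between in H1. apply polar_box; lra.
Qed.

Section AlongSolution.
Variable phi : R -> R3.
Hypothesis Hphi : is_fsol vf3 phi.
Variable thz : R.

Definition xx (t : R) : R := coord 0 (phi t).
Definition yy (t : R) : R := coord 1 (phi t).
Definition zz (t : R) : R := coord 2 (phi t).
Definition rhoc (t : R) : R := (xx t ^ 2 + yy t ^ 2) / 2.

Hypothesis Hx0 : xx 0 = sqrt (2 * rhoc 0) * cos thz.
Hypothesis Hy0 : yy 0 = sqrt (2 * rhoc 0) * sin thz.

Let dx t : 0 <= t -> is_derive xx t (f1 (xx t) (yy t) (zz t)).
Proof. intros Ht. exact (Hphi t Ht 0%nat ltac:(lia)). Qed.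
Let dy t : 0 <= t -> is_derive yy t (f2 (xx t) (yy t) (zz t)).
Proof. intros Ht. exact (Hphi t Ht 1%nat ltac:(lia)). Qed.
Let dz t : 0 <= t -> is_derive zz t (f3 (xx t) (yy t) (zz t)).
Proof. intros Ht. exact (Hphi t Ht 2%nat ltac:(lia)). Qed.

(* The angular velocity, frozen for negative times and cut off away from the tube, so that
   the angle below is defined for every solution. *)
Definition angt (t : R) : R :=
  let u := Rmax t 0 in
  (xx u * f2 (xx u) (yy u) (zz u) - yy u * f1 (xx u) (yy u) (zz u)) / (Rmax (xx u ^ 2 + yy u ^ 2 - w0) 0 + w0).

(** Integrating the angular velocity gives a continuous lift of the angle defined for all times, so
    no argument function has to be continued along the solution. *)
Definition angle (t : R) : R := thz + RInt angt 0 t.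

Let cont_clip (g : R -> R) : (forall t, 0 <= t -> continuous g t) -> forall t, continuous (fun s => g (Rmax s 0)) t.
Proof.
  intros Hg t. apply (continuous_comp (fun s => Rmax s 0) g); [apply continuous_Rmax0|].
  apply Hg. apply Rmax_r.
Qed.

Let angt_cont t : continuous angt t.
Proof.
  assert (cx := cont_clip xx (fun t h => is_derive_continuous _ _ _ (dx t h))).
  assert (cy := cont_clip yy (fun t h => is_derive_continuous _ _ _ (dy t h))).
  assert (cz := cont_clip zz (fun t h => is_derive_continuous _ _ _ (dz t h))).
  pose proof (loc_lipschitz_continuous f1 _ _ _ t Lf1 (cx t) (cy t) (cz t)) as c1.
  pose proof (loc_lipschitz_continuous f2 _ _ _ t Lf2 (cx t) (cy t) (cz t)) as c2.
  assert (cR : continuous (fun t => xx (Rmax t 0) ^ 2 + yy (Rmax t 0) ^ 2 - w0) t).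
  { simpl. apply (continuous_minus (fun t => _ + _)); [|apply continuous_const].
    apply (continuous_plus (fun t => _ * _)).
    - apply (continuous_mult (fun t => xx (Rmax t 0))); auto.
      apply (continuous_mult (fun t => xx (Rmax t 0)) (fun _ => 1)); auto. apply continuous_const.
    - apply (continuous_mult (fun t => yy (Rmax t 0))); auto.
      apply (continuous_mult (fun t => yy (Rmax t 0)) (fun _ => 1)); auto. apply continuous_const. }
  unfold angt, Rdiv.
  apply (continuous_mult (fun t => xx (Rmax t 0) * f2 _ _ _ - yy (Rmax t 0) * f1 _ _ _)).
  - apply (continuous_minus (fun t => xx (Rmax t 0) * f2 _ _ _)).
    + apply (continuous_mult (fun t => xx (Rmax t 0))); auto.
    + apply (continuous_mult (fun t => yy (Rmax t 0))); auto.
  - assert (c4 : continuous (fun t => Rmax (xx (Rmax t 0) ^ 2 + yy (Rmax t 0) ^ 2 - w0) 0 + w0) t).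
    { apply (continuous_plus (fun t => Rmax (xx (Rmax t 0) ^ 2 + yy (Rmax t 0) ^ 2 - w0) 0));
        [|apply continuous_const].
      apply (continuous_comp (fun t => xx (Rmax t 0) ^ 2 + yy (Rmax t 0) ^ 2 - w0) (fun x => Rmax x 0)); auto.
      apply continuous_Rmax0. }
    apply (continuous_comp (fun t => Rmax (xx (Rmax t 0) ^ 2 + yy (Rmax t 0) ^ 2 - w0) 0 + w0) Rinv); auto.
    apply continuous_Rinv. pose proof (Rmax_r (xx (Rmax t 0) ^ 2 + yy (Rmax t 0) ^ 2 - w0) 0). lra.
Qed.

Lemma angle_derive t : is_derive angle t (angt t).
Proof.
  eapply is_derive_eq.
  - apply (der_plus (fun _ => thz) (fun t => RInt angt 0 t)); [apply der_const|].
    apply (is_derive_RInt angt (fun t => RInt angt 0 t) 0 t); [|apply angt_cont].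
    apply filter_forall. intros y. apply (RInt_correct (V := R_CompleteNormedModule)).
    apply (ex_RInt_continuous (V := R_CompleteNormedModule)). intros; apply angt_cont.
  - ring.
Qed.

Lemma angle_0 : angle 0 = thz.
Proof. unfold angle. rewrite RInt_point. unfold zero; simpl. ring. Qed.

Section UpTo.
Variable T : R.
Hypothesis HT : forall t, 0 <= t <= T -> in_tube (rhoc t) (zz t).

Let sq_pos t : 0 <= t <= T -> w0 <= xx t ^ 2 + yy t ^ 2.
Proof. intros Ht. pose proof (tube_rho _ _ (HT t Ht)) as H. unfold rhoc in H. lra. Qed.

Let angt_eq t : 0 <= t <= T -> angt t = angv (xx t) (yy t) (zz t).
Proof.
  intros Ht. pose proof (sq_pos t Ht). unfold angt, angv. rewrite !(Rmax_left t 0) by lra.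
  rewrite (Rmax_left (_ - w0)) by lra. f_equal. ring.
Qed.

(** The component of the position along the direction [angle t], divided by the radius, has zero
    derivative because [angle] turns at the angular velocity. It starts at 1, hence stays 1, and
    Pythagoras then kills the perpendicular component. *)
Lemma along_polar t : 0 <= t <= T ->
  xx t = sqrt (2 * rhoc t) * cos (angle t) /\ yy t = sqrt (2 * rhoc t) * sin (angle t).
Proof.
  intros Ht.
  set (R2 := fun t => xx t ^ 2 + yy t ^ 2).
  assert (E2 : forall t, 2 * rhoc t = R2 t) by (intros; unfold rhoc, R2; field).
  rewrite E2.
  set (n := fun t => xx t * cos (angle t) + yy t * sin (angle t)).
  assert (C : n t / sqrt (R2 t) = n 0 / sqrt (R2 0)).
  { apply (derive_zero_const (fun t => n t / sqrt (R2 t)) 0 t); [lra|].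
    intros u Hu. pose proof (sq_pos u ltac:(lra)) as Hp. fold (R2 u) in Hp.
    assert (Hs : 0 < sqrt (R2 u)) by (apply sqrt_lt_R0; lra).
    assert (DR : is_derive R2 u (2 * (xx u * f1 (xx u) (yy u) (zz u) + yy u * f2 (xx u) (yy u) (zz u)))).
    { apply (der_ext (fun u => xx u * xx u + yy u * yy u)); [intros; unfold R2; ring|].
      eapply is_derive_eq.
      - apply (der_plus (fun u => xx u * xx u)); apply der_mult;
          [apply dx|apply dx|apply dy|apply dy]; lra.
      - ring. }
    assert (Dn : is_derive n u ((f1 (xx u) (yy u) (zz u) * cos (angle u) + xx u * (- sin (angle u) * angt u))
       + (f2 (xx u) (yy u) (zz u) * sin (angle u) + yy u * (cos (angle u) * angt u)))).
    { apply (der_plus (fun u => xx u * cos (angle u)) (fun u => yy u * sin (angle u)));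
        [apply (der_mult xx (fun u => cos (angle u)))|apply (der_mult yy (fun u => sin (angle u)))].
      - apply dx; lra.
      - apply der_cos, angle_derive.
      - apply dy; lra.
      - apply der_sin, angle_derive. }
    assert (Dq : is_derive (fun u => / sqrt (R2 u)) u
      (- (2 * (xx u * f1 (xx u) (yy u) (zz u) + yy u * f2 (xx u) (yy u) (zz u)) * / (2 * sqrt (R2 u)))
        / sqrt (R2 u) ^ 2)).
    { apply (is_derive_inv (fun u => sqrt (R2 u))); [|lra].
      apply (is_derive_sqrt R2 u _ DR). lra. }
    eapply is_derive_eq; [exact (der_mult n (fun u => / sqrt (R2 u)) u _ _ Dn Dq)|].
    rewrite (angt_eq u) by lra. unfold angv. fold (R2 u). unfold n.
    assert (ES : sqrt (R2 u) ^ 2 = R2 u) by (apply pow2_sqrt; lra).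
    set (g1 := f1 (xx u) (yy u) (zz u)). set (g2 := f2 (xx u) (yy u) (zz u)).
    set (r := sqrt (R2 u)) in *. rewrite <- ES.
    assert (ER : r ^ 2 = xx u ^ 2 + yy u ^ 2) by exact ES.
    set (cc := cos (angle u)). set (sc := sin (angle u)).
    apply Rmult_eq_reg_l with (r ^ 3); [|apply pow_nonzero; lra].
    transitivity (r ^ 2 * (g1 * cc + g2 * sc) + (xx u * g2 - yy u * g1) * (- xx u * sc + yy u * cc)
      - (xx u * cc + yy u * sc) * (xx u * g1 + yy u * g2)); [field; lra|].
    rewrite ER. ring. }
  assert (P0' : 0 < R2 0) by (pose proof (sq_pos 0 ltac:(lra)); unfold R2; lra).
  assert (Pt : 0 < R2 t) by (pose proof (sq_pos t ltac:(lra)); unfold R2; lra).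
  pose proof (sqrt_lt_R0 _ P0') as S0. pose proof (sqrt_lt_R0 _ Pt) as St.
  assert (N0 : n 0 = sqrt (R2 0)).
  { unfold n. rewrite angle_0, Hx0, Hy0, !E2. pose proof (sin2_cos2 thz) as SC. unfold Rsqr in SC.
    transitivity (sqrt (R2 0) * (sin thz * sin thz + cos thz * cos thz)); [ring|rewrite SC; ring]. }
  rewrite N0, Rdiv_diag in C by lra.
  assert (Nt : n t = sqrt (R2 t)).
  { apply (f_equal (fun x => x * sqrt (R2 t))) in C. unfold Rdiv in C.
    rewrite Rmult_assoc, Rinv_l, Rmult_1_r, Rmult_1_l in C by lra. exact C. }
  assert (M0 : xx t * sin (angle t) - yy t * cos (angle t) = 0).
  { assert (E : (xx t * sin (angle t) - yy t * cos (angle t)) ^ 2 = 0).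
    { pose proof (sin2_cos2 (angle t)) as SC. unfold Rsqr in SC.
      transitivity (R2 t * (sin (angle t) * sin (angle t) + cos (angle t) * cos (angle t)) - n t ^ 2);
        [unfold R2, n; ring|].
      rewrite SC, Nt, pow2_sqrt by lra. ring. }
    nra. }
  pose proof (sin2_cos2 (angle t)) as SC. unfold Rsqr in SC. rewrite <- Nt. unfold n. split.
  - transitivity (xx t * (sin (angle t) * sin (angle t) + cos (angle t) * cos (angle t))
      - (xx t * sin (angle t) - yy t * cos (angle t)) * sin (angle t) + 0).
    + rewrite SC, M0. ring. + ring.
  - transitivity (yy t * (sin (angle t) * sin (angle t) + cos (angle t) * cos (angle t))
      + (xx t * sin (angle t) - yy t * cos (angle t)) * cos (angle t)).
    + rewrite SC, M0. ring. + ring.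
Qed.

Lemma along_at (f : R -> R -> R -> R) t : 0 <= t <= T ->
  f (xx t) (yy t) (zz t) = at_polar f (angle t) (rhoc t) (zz t).
Proof. intros Ht. destruct (along_polar t Ht) as [E1 E2]. unfold at_polar. rewrite <- E1, <- E2. reflexivity. Qed.

Lemma angle_speed t : 0 <= t <= T -> exists l, is_derive angle t l /\ th0 <= l <= th1.
Proof.
  intros Ht. exists (angt t). split; [apply angle_derive|].
  rewrite angt_eq, along_at by auto. apply Hang, HT; auto.
Qed.

End UpTo.

Definition dwc (t : R) : R := wv (xx t) (yy t) (zz t) - wcurve (angle t).
Definition dsc (t : R) : R := zz t - ss (angle t).

(** The solution is compared with the point of the curve at its own current angle. Both then move
    through angles at the same speed [Th], which factors out of the two equations; no phase
    difference has to be controlled, and the resulting stability is orbital. *)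
Lemma along_diff T t : (forall t, 0 <= t <= T -> in_tube (rhoc t) (zz t)) -> 0 <= t <= T ->
  exists Th a c, th0 <= Th <= th1 /\
    is_derive dwc t (Th * (- kw * dwc t + a)) /\ is_derive dsc t (Th * (- ks * dsc t + c)) /\
    Rabs (dwc t) * Rabs a + K * (Rabs (dsc t) * Rabs c) <= Rabs kw / 2 * dwc t ^ 2 + K * ks / 2 * dsc t ^ 2.
Proof.
  intros HT Ht.
  pose proof (HT t Ht) as Tt. pose proof (tube_curve (angle t)) as Tc.
  set (A := at_polar angv (angle t) (rhoc t) (zz t)).
  assert (EA : angt t = A).
  { pose proof (tube_rho _ _ Tt) as H. unfold rhoc in H. unfold A.
    rewrite <- (along_at T HT angv t Ht). unfold angt, angv. rewrite !(Rmax_left t 0) by lra.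
    rewrite (Rmax_left (_ - w0)) by lra. f_equal. ring. }
  destruct (Hang (angle t) _ _ Tt) as [A1 A2]. fold A in A1, A2.
  set (X := angle t) in *.
  exists A.
  exists (at_polar Mv X (rhoc t) (zz t) / A - at_polar Mv X (rh X) (ss X) / at_polar angv X (rh X) (ss X)
     + kw * dwc t).
  exists (at_polar f3 X (rhoc t) (zz t) / A - at_polar f3 X (rh X) (ss X) / at_polar angv X (rh X) (ss X)
     + ks * dsc t).
  split; [auto|]. split; [|split].
  - eapply is_derive_eq.
    + apply der_minus.
      * apply HW; [apply dx|apply dy|apply dz]; lra.
      * apply (der_comp wcurve angle); [apply Dw|apply angle_derive].
    + rewrite (along_at T HT Mv t Ht), EA. fold X. field. split; [|lra].
      destruct (Hang X _ _ Tc). lra.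
  - eapply is_derive_eq.
    + apply der_minus; [apply dz; lra|].
      apply (der_comp ss angle); [apply Ds|apply angle_derive].
    + rewrite (along_at T HT f3 t Ht), EA. fold X. field. split; [|lra].
      destruct (Hang X _ _ Tc). lra.
  - pose proof (Hdiff X _ _ _ _ Tt Tc) as H. simpl in H. fold A in H.
    replace (at_polar wv X (rhoc t) (zz t) - at_polar wv X (rh X) (ss X)) with (dwc t) in H.
    + exact H.
    + unfold dwc, wcurve. rewrite (along_at T HT wv t Ht). reflexivity.
Qed.

Definition Vp (t : R) : R := dwc t ^ 2 + K * dsc t ^ 2.
Definition Vm (t : R) : R := dwc t ^ 2 - K * dsc t ^ 2.

Let der_sq (f : R -> R) t l : is_derive f t l -> is_derive (fun t => f t ^ 2) t (2 * (f t * l)).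
Proof.
  intros H. apply (der_ext (fun t => f t * f t)); [intros; ring|].
  eapply is_derive_eq; [apply der_mult; exact H|ring].
Qed.

Let mul_abs (x y : R) : - (Rabs x * Rabs y) <= x * y <= Rabs x * Rabs y.
Proof. rewrite <- Rabs_mult. apply Rabs_le_between. lra. Qed.

(** A crude rate valid for both signs of [kw]. Its purpose is the case [Vp 0 = 0]: a solution
    starting on the curve stays on it, even when the curve is repelling. *)
Lemma Vp_growth T : 0 <= T -> (forall t, 0 <= t <= T -> in_tube (rhoc t) (zz t)) ->
  Vp T <= Vp 0 * exp (3 * Rabs kw * th1 * T).
Proof.
  intros HT0 HT. rewrite <- (Rminus_0_r T) at 2. apply gronwall_le_ex; [lra|].
  intros t Ht. destruct (along_diff T t HT Ht) as [Th [a [c [HTh [D1 [D2 H]]]]]].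
  exists (2 * (dwc t * (Th * (- kw * dwc t + a))) + K * (2 * (dsc t * (Th * (- ks * dsc t + c))))).
  split.
  - apply der_plus; [apply der_sq, D1|]. apply (der_scal (fun t => dsc t ^ 2)). apply der_sq, D2.
  - pose proof (mul_abs (dwc t) a). pose proof (mul_abs (dsc t) c).
    pose proof (Rabs_pos_lt _ Hkw) as Pk. pose proof (Rle_abs (- kw)) as Pk2. rewrite Rabs_Ropp in Pk2.
    unfold Vp. set (x := dwc t) in *. set (y := dsc t) in *.
    set (k := Rabs kw) in *.
    assert (0 <= x ^ 2) by nra. assert (0 <= y ^ 2) by nra.
    assert (B : x * (- kw * x + a) + K * (y * (- ks * y + c)) <= 3 / 2 * k * x ^ 2).
    { assert (- kw * x ^ 2 <= k * x ^ 2) by (apply Rmult_le_compat_r; lra).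
      assert (K * (y * c) <= K * (Rabs y * Rabs c)) by (apply Rmult_le_compat_l; lra).
      assert (0 <= K * ks * y ^ 2) by (apply Rmult_le_pos; [nra|lra]). nra. }
    assert (0 <= 3 / 2 * k * x ^ 2) by nra.
    assert (0 <= K * y ^ 2) by nra.
    apply Rle_trans with (2 * Th * (3 / 2 * k * x ^ 2)).
    + replace (2 * (x * (Th * (- kw * x + a))) + K * (2 * (y * (Th * (- ks * y + c)))))
        with (2 * Th * (x * (- kw * x + a) + K * (y * (- ks * y + c)))) by ring.
      apply Rmult_le_compat_l; lra.
    + apply Rle_trans with (2 * th1 * (3 / 2 * k * x ^ 2)).
      * apply Rmult_le_compat_r; lra.
      * assert (0 <= k * th1) by (apply Rmult_le_pos; lra). nra.
Qed.

Lemma Vp_decay T : 0 < kw -> 0 <= T -> (forall t, 0 <= t <= T -> in_tube (rhoc t) (zz t)) ->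
  Vp T <= Vp 0 * exp (- Rmin kw ks * th0 * T).
Proof.
  intros Pk HT0 HT. rewrite <- (Rminus_0_r T) at 2. apply gronwall_le_ex; [lra|].
  intros t Ht. destruct (along_diff T t HT Ht) as [Th [a [c [HTh [D1 [D2 H]]]]]].
  exists (2 * (dwc t * (Th * (- kw * dwc t + a))) + K * (2 * (dsc t * (Th * (- ks * dsc t + c))))).
  split.
  - apply der_plus; [apply der_sq, D1|]. apply (der_scal (fun t => dsc t ^ 2)). apply der_sq, D2.
  - pose proof (mul_abs (dwc t) a). pose proof (mul_abs (dsc t) c).
    rewrite (Rabs_right kw) in H by lra.
    unfold Vp. set (x := dwc t) in *. set (y := dsc t) in *.
    pose proof (Rmin_l kw ks). pose proof (Rmin_r kw ks).
    assert (0 < Rmin kw ks) by (apply Rmin_glb_lt; lra). set (mk := Rmin kw ks) in *.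
    assert (0 <= x ^ 2) by nra. assert (0 <= y ^ 2) by nra.
    assert (B : x * (- kw * x + a) + K * (y * (- ks * y + c)) <= - (mk / 2) * (x ^ 2 + K * y ^ 2)).
    { assert (K * (y * c) <= K * (Rabs y * Rabs c)) by (apply Rmult_le_compat_l; lra).
      assert (mk * x ^ 2 <= kw * x ^ 2) by (apply Rmult_le_compat_r; lra).
      assert (mk * (K * y ^ 2) <= ks * (K * y ^ 2)) by (apply Rmult_le_compat_r; nra). nra. }
    assert (0 <= x ^ 2 + K * y ^ 2) by nra.
    replace (2 * (x * (Th * (- kw * x + a))) + K * (2 * (y * (Th * (- ks * y + c)))))
        with (2 * Th * (x * (- kw * x + a) + K * (y * (- ks * y + c)))) by ring.
    apply Rle_trans with (2 * Th * (- (mk / 2) * (x ^ 2 + K * y ^ 2))); [apply Rmult_le_compat_l; lra|].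
    assert (0 <= mk * (x ^ 2 + K * y ^ 2)) by (apply Rmult_le_pos; lra). nra.
Qed.

(** The minus sign in front of [K * dsc t ^ 2] turns the contraction of [S] into a gain, so both
    terms push [Vm] upwards when the radial direction is expanding. *)
Lemma Vm_growth T : kw < 0 -> 0 <= T -> (forall t, 0 <= t <= T -> in_tube (rhoc t) (zz t)) ->
  Vm 0 * exp (- kw * th0 * T) <= Vm T.
Proof.
  intros Pk HT0 HT. rewrite <- (Rminus_0_r T) at 1. apply gronwall_ge_ex; [lra|].
  intros t Ht. destruct (along_diff T t HT Ht) as [Th [a [c [HTh [D1 [D2 H]]]]]].
  exists (2 * (dwc t * (Th * (- kw * dwc t + a))) - K * (2 * (dsc t * (Th * (- ks * dsc t + c))))).
  split.
  - apply der_minus; [apply der_sq, D1|]. apply (der_scal (fun t => dsc t ^ 2)). apply der_sq, D2.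
  - pose proof (mul_abs (dwc t) a). pose proof (mul_abs (dsc t) c).
    rewrite (Rabs_left kw) in H by lra.
    unfold Vm. set (x := dwc t) in *. set (y := dsc t) in *.
    assert (0 <= x ^ 2) by nra. assert (0 <= y ^ 2) by nra.
    assert (B : - kw / 2 * x ^ 2 <= x * (- kw * x + a) - K * (y * (- ks * y + c))).
    { assert (K * (y * c) <= K * (Rabs y * Rabs c)) by (apply Rmult_le_compat_l; lra).
      assert (0 <= K * ks * y ^ 2) by (apply Rmult_le_pos; [nra|lra]). nra. }
    assert (0 <= K * y ^ 2) by nra.
    replace (2 * (x * (Th * (- kw * x + a))) - K * (2 * (y * (Th * (- ks * y + c)))))
        with (2 * Th * (x * (- kw * x + a) - K * (y * (- ks * y + c)))) by ring.
    apply Rle_trans with (2 * Th * (- kw / 2 * x ^ 2)); [|apply Rmult_le_compat_l; lra].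
    assert (0 <= - kw * x ^ 2) by nra. assert (0 <= - kw * (K * y ^ 2)) by nra. nra.
Qed.

Lemma Vp_bounds (v t : R) : Vp t <= v -> Rabs (dwc t) <= sqrt v /\ Rabs (dsc t) <= sqrt (v / K).
Proof.
  intros H. unfold Vp in H. pose proof (pow2_ge_0 (dwc t)). pose proof (pow2_ge_0 (dsc t)).
  rewrite <- !sqrt_Rsqr_abs. unfold Rsqr. split; apply sqrt_le_1_alt.
  - nra.
  - apply (Rmult_le_reg_l K); [lra|]. replace (K * (v / K)) with v by (field; lra). nra.
Qed.

Lemma along_close (v T : R) : 0 <= T -> (forall t, 0 <= t <= T -> in_tube (rhoc t) (zz t)) -> Vp T <= v ->
  Rabs (rhoc T - rh (angle T)) <= 2 * (sqrt v + sqrt (v / K)) /\ Rabs (zz T - ss (angle T)) <= sqrt (v / K).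
Proof.
  intros HT0 HT Hv. destruct (Vp_bounds v T Hv) as [B1 B2]. split; [|exact B2].
  eapply Rle_trans; [apply (Hrho (angle T) _ _ _ _ (HT T ltac:(lra)) (tube_curve (angle T)))|].
  rewrite <- (along_at T HT wv T ltac:(lra)). fold (wcurve (angle T)). fold (dwc T). fold (dsc T). lra.
Qed.

(** A bootstrap on the larger of the two excesses over the tube. Inside the tube [Vp] does not
    exceed its initial value, so the solution remains within half the tube's size of the curve,
    while the curve lies in the half-size tube; together this is strict. *)
Lemma trapped : Rabs (rhoc 0 - w0) < rad -> Rabs (zz 0) < sig ->
  Vp 0 = 0 \/ 0 < kw -> 2 * (sqrt (Vp 0) + sqrt (Vp 0 / K)) < rad / 2 -> sqrt (Vp 0 / K) < sig / 2 ->
  forall t, 0 <= t -> in_tube (rhoc t) (zz t) /\ Vp t <= Vp 0.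
Proof.
  intros T1 T2 HV M1 M2.
  assert (HV' : forall T, 0 <= T -> (forall t, 0 <= t <= T -> in_tube (rhoc t) (zz t)) -> Vp T <= Vp 0).
  { intros T HT0 HT. destruct HV as [HV|HV].
    - pose proof (Vp_growth T HT0 HT) as H. rewrite HV, Rmult_0_l in H. lra.
    - pose proof (Vp_decay T HV HT0 HT) as H.
      assert (0 <= Vp 0) by (unfold Vp; pose proof (pow2_ge_0 (dwc 0)); pose proof (pow2_ge_0 (dsc 0)); nra).
      assert (exp (- Rmin kw ks * th0 * T) <= 1).
      { apply exp_le_1. assert (0 < Rmin kw ks) by (apply Rmin_glb_lt; lra).
        assert (0 <= Rmin kw ks * th0 * T) by (repeat apply Rmult_le_pos; lra). lra. }
      nra. }
  set (f := fun t => Rmax (Rabs (rhoc t - w0) - rad) (Rabs (zz t) - sig)).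
  assert (Hf : forall t, 0 <= t -> f t < 0).
  { apply first_exit.
    - intros t Ht. apply continuous_Rmax.
      + apply (continuous_minus (fun t => Rabs (rhoc t - w0))); [|apply continuous_const].
        apply (continuous_comp (fun t => rhoc t - w0) Rabs); [|apply continuous_Rabs].
        apply (continuous_minus rhoc); [|apply continuous_const].
        eapply is_derive_continuous.
        apply (der_ext (fun t => / 2 * (xx t * xx t + yy t * yy t))); [intros; unfold rhoc; field|].
        apply der_scal. apply (der_plus (fun t => xx t * xx t)); apply der_mult;
          [apply dx|apply dx|apply dy|apply dy]; auto.
      + apply (continuous_minus (fun t => Rabs (zz t))); [|apply continuous_const].
        apply (continuous_comp zz Rabs); [|apply continuous_Rabs].
        eapply is_derive_continuous. apply dz; auto.
    - unfold f. apply Rmax_lub_lt; lra.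
    - intros T HT0 HT.
      assert (HT' : forall t, 0 <= t <= T -> in_tube (rhoc t) (zz t)).
      { intros t Ht. specialize (HT t Ht). unfold f in HT. split.
        - pose proof (Rmax_l (Rabs (rhoc t - w0) - rad) (Rabs (zz t) - sig)). lra.
        - pose proof (Rmax_r (Rabs (rhoc t - w0) - rad) (Rabs (zz t) - sig)). lra. }
      destruct (along_close (Vp 0) T HT0 HT' (HV' T HT0 HT')) as [B1 B2].
      destruct (Hin (angle T)) as [B3 B4]. unfold f.
      assert (T3 : forall x y z, Rabs (x - z) <= Rabs (x - y) + Rabs (y - z)).
      { intros x y z. replace (x - z) with (x - y + (y - z)) by ring. apply Rabs_triang. }
      pose proof (T3 (rhoc T) (rh (angle T)) w0). pose proof (T3 (zz T) (ss (angle T)) 0).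
      rewrite !Rminus_0_r in *. apply Rmax_lub_lt; lra. }
  assert (Hf' : forall t, 0 <= t -> in_tube (rhoc t) (zz t)).
  { intros t Ht. specialize (Hf t Ht). unfold f in Hf. split.
    - pose proof (Rmax_l (Rabs (rhoc t - w0) - rad) (Rabs (zz t) - sig)). lra.
    - pose proof (Rmax_r (Rabs (rhoc t - w0) - rad) (Rabs (zz t) - sig)). lra. }
  intros t Ht. split; [auto|]. apply HV'; auto. intros u Hu; apply Hf'; lra.
Qed.

Lemma along_dist (v T : R) : 0 <= T -> (forall t, 0 <= t <= T -> in_tube (rhoc t) (zz t)) -> Vp T <= v ->
  dist3 (phi T) (pcurve (angle T)) <= 2 * (2 * (sqrt v + sqrt (v / K)) / sqrt w0) + sqrt (v / K).
Proof.
  intros HT0 HT Hv. destruct (along_close v T HT0 HT Hv) as [B1 B2].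
  destruct (along_polar T HT T ltac:(lra)) as [E1 E2].
  replace (phi T) with (xx T, yy T, zz T).
  2:{ unfold xx, yy, zz. destruct (phi T) as [[x y] z]; reflexivity. }
  rewrite E1, E2. unfold pcurve. eapply Rle_trans; [apply (dist_polar w0)|].
  - exact Hw0.
  - apply (tube_rho _ (zz T)). apply HT; lra.
  - apply (tube_rho _ (ss (angle T))). apply tube_curve.
  - assert (0 < / sqrt w0) by (apply Rinv_0_lt_compat, sqrt_lt_R0; auto).
    apply Rplus_le_compat; auto. apply Rmult_le_compat_l; [lra|].
    apply Rmult_le_compat_r; lra.
Qed.

End AlongSolution.

Hypothesis Hex : forall Y0, exists phi, is_sol vf3 phi /\ phi 0 = Y0.
Hypothesis Huniq : forall phi psi, is_sol vf3 phi -> is_sol vf3 psi -> phi 0 = psi 0 -> forall t, phi t = psi t.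

Lemma sol_fsol phi : is_sol vf3 phi -> is_fsol vf3 phi.
Proof. intros H t _ i Hi. apply H; auto. Qed.

Lemma pcurve_periodic th : pcurve (th + 2 * PI) = pcurve th.
Proof. unfold pcurve. rewrite Prh, Pss, cos_plus, sin_plus, cos_2PI, sin_2PI. apply f_equal2; [apply f_equal2|]; ring. Qed.

Lemma pcurve_periodic_nat th (n : nat) : pcurve (th + INR n * (2 * PI)) = pcurve th.
Proof.
  induction n as [|n IH]; [simpl; f_equal; ring|].
  rewrite S_INR. replace (th + (INR n + 1) * (2 * PI)) with (th + INR n * (2 * PI) + 2 * PI) by ring.
  rewrite pcurve_periodic; auto.
Qed.

Lemma rh_pos th : w0 / 2 <= rh th.
Proof. apply (tube_rho _ (ss th)). apply tube_curve. Qed.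

(* A solution that starts on the closed curve runs along it, and passes through all angles. *)
Lemma follow_curve phi : is_fsol vf3 phi -> phi 0 = pcurve 0 ->
  exists A : R -> R, A 0 = 0 /\ continuity A /\ (forall t, 0 <= t -> th0 * t <= A t) /\
    forall t, 0 <= t -> phi t = pcurve (A t).
Proof.
  intros Hphi H0.
  assert (Er : rhoc phi 0 = rh 0).
  { unfold rhoc, xx, yy. rewrite H0. unfold pcurve, coord, fst, snd. rewrite polar_sq; [field|].
    pose proof (rh_pos 0). lra. }
  assert (Hx : xx phi 0 = sqrt (2 * rhoc phi 0) * cos 0) by (rewrite Er; unfold xx; rewrite H0; reflexivity).
  assert (Hy : yy phi 0 = sqrt (2 * rhoc phi 0) * sin 0) by (rewrite Er; unfold yy; rewrite H0; reflexivity).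
  assert (Hz : zz phi 0 = ss 0) by (unfold zz; rewrite H0; reflexivity).
  (* The two deviations vanish at the start, so [trapped] applies through its first alternative
     whatever the sign of [kw], and [Vp] is zero at all later times. *)
  assert (V0 : Vp phi 0 0 = 0).
  { unfold Vp, dwc, dsc. rewrite !angle_0, Hx, Hy, Hz, Er. unfold wcurve, at_polar. ring. }
  assert (S0 : sqrt (Vp phi 0 0) = 0) by (rewrite V0; apply sqrt_0).
  assert (S1 : sqrt (Vp phi 0 0 / K) = 0) by (rewrite V0; unfold Rdiv; rewrite Rmult_0_l; apply sqrt_0).
  destruct (Hin 0) as [I1 I2].
  assert (HT : forall t, 0 <= t -> in_tube (rhoc phi t) (zz phi t) /\ Vp phi 0 t <= Vp phi 0 0).
  { apply trapped; auto; rewrite ?Er, ?Hz, ?S0, ?S1; try lra. }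
  exists (angle phi 0). split; [apply angle_0|]. split; [|split].
  - intros t. apply continuity_pt_filterlim. exact (is_derive_continuous _ _ _ (angle_derive phi Hphi 0 t)).
  - intros t Ht.
    pose proof (derive_lower (angle phi 0) (Derive (angle phi 0)) th0 0 t Ht) as L.
    rewrite angle_0 in L.
    assert (HS : forall u, 0 <= u <= t -> exists l, is_derive (angle phi 0) u l /\ th0 <= l <= th1).
    { intros u Hu. apply (angle_speed phi Hphi 0 Hx Hy t); auto. intros v Hv. apply HT; lra. }
    enough (0 + th0 * (t - 0) <= angle phi 0 t) by lra. apply L.
    + intros u Hu. destruct (HS u Hu) as [l [Hl _]]. apply Derive_correct; exists l; auto.
    + intros u Hu. destruct (HS u Hu) as [l [Hl Hb]]. rewrite (is_derive_unique _ _ _ Hl). lra.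
  - intros t Ht.
    assert (HT' : forall u, 0 <= u <= t -> in_tube (rhoc phi u) (zz phi u)) by (intros; apply HT; lra).
    destruct (HT t Ht) as [_ Vt]. rewrite V0 in Vt.
    destruct (along_close phi Hphi 0 Hx Hy 0 t Ht HT' Vt) as [B1 B2].
    replace (0 / K) with 0 in B1, B2 by (field; lra). rewrite sqrt_0 in B1, B2.
    replace (2 * (0 + 0)) with 0 in B1 by ring.
    assert (E1 : rhoc phi t = rh (angle phi 0 t)).
    { apply Rminus_diag_uniq, Rabs_eq_0. pose proof (Rabs_pos (rhoc phi t - rh (angle phi 0 t))). lra. }
    assert (E2 : zz phi t = ss (angle phi 0 t)).
    { apply Rminus_diag_uniq, Rabs_eq_0. pose proof (Rabs_pos (zz phi t - ss (angle phi 0 t))). lra. }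
    destruct (along_polar phi Hphi 0 Hx Hy t HT' t ltac:(lra)) as [E3 E4].
    replace (phi t) with (xx phi t, yy phi t, zz phi t)
      by (unfold xx, yy, zz; destruct (phi t) as [[x y] z]; reflexivity).
    rewrite E3, E4, E2, E1. reflexivity.
Qed.

(** The angle grows at least at speed [th0], so it attains [2 PI] at some time [T] by the
    intermediate value theorem. There the solution is back at its starting point, and uniqueness of
    solutions propagates this to period [T] for all times. The point at angle [PI] lies on the
    opposite side, so the orbit is not constant. *)
Lemma periodic_orbit_exists : exists (gam : R -> R3) (T : R),
  periodic_orbit vf3 gam T /\ (forall t, exists th, gam t = pcurve th) /\
  (forall th, exists t, gam t = pcurve th).
Proof.
  destruct (Hex (pcurve 0)) as [gam [Hs H0]].
  destruct (follow_curve gam (sol_fsol _ Hs) H0) as [A [A0 [Ac [Al Ag]]]].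
  assert (Hit : forall th, 0 <= th -> exists t, 0 <= t /\ A t = th).
  { intros th Hth.
    assert (Ht : 0 <= th / th0) by (apply Rmult_le_pos; [lra|left; apply Rinv_0_lt_compat; lra]).
    pose proof (Al _ Ht) as Hl. replace (th0 * (th / th0)) with th in Hl by (field; lra).
    destruct (IVT_gen A 0 (th / th0) th Ac) as [t [Ht' E]].
    - rewrite A0, Rmin_left, Rmax_right by lra. lra.
    - rewrite Rmin_left, Rmax_right in Ht' by lra. exists t; split; [lra|auto]. }
  pose proof PI_RGT_0 as HPI.
  destruct (Hit (2 * PI)) as [T [HT0 HT]]; [lra|].
  assert (HTp : 0 < T) by (destruct (Req_dec T 0) as [E|]; [rewrite E, A0 in HT; lra|lra]).
  assert (Per : forall t, gam (t + T) = gam t).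
  { apply (Huniq (fun t => gam (t + T)) gam); auto.
    - intros t i Hi. apply (der_shift (fun s => coord i (gam s))). apply Hs; auto.
    - rewrite Rplus_0_l, (Ag T HT0), HT, H0. rewrite <- (Rplus_0_l (2 * PI)). apply pcurve_periodic. }
  assert (PerN : forall (n : nat) t, gam (t + INR n * T) = gam t).
  { induction n as [|n IH]; intros t; [simpl; f_equal; ring|].
    rewrite S_INR. replace (t + (INR n + 1) * T) with (t + INR n * T + T) by ring. rewrite Per; auto. }
  exists gam, T. split; [|split].
  - split; [exact HTp|split; [exact Hs|split; [exact Per|]]].
    destruct (Hit PI) as [t [Ht E]]; [lra|]. exists t. rewrite (Ag t Ht), E, H0. unfold pcurve.
    intros Eq. injection Eq as E1 _ _. rewrite cos_PI, cos_0 in E1.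
    pose proof (rh_pos PI). pose proof (rh_pos 0).
    assert (0 < sqrt (2 * rh PI)) by (apply sqrt_lt_R0; lra).
    assert (0 < sqrt (2 * rh 0)) by (apply sqrt_lt_R0; lra). lra.
  (* [follow_curve] speaks of nonnegative times only; a negative time is first moved forward by
     whole periods. *)
  - intros t. destruct (INR_archimed T (- t) HTp) as [n Hn].
    exists (A (t + INR n * T)). rewrite <- (PerN n t). apply Ag. lra.
  - intros th. destruct (INR_archimed (2 * PI) (- th)) as [n Hn]; [lra|].
    destruct (Hit (th + INR n * (2 * PI))) as [t [Ht E]]; [lra|].
    exists t. rewrite (Ag t Ht), E. apply pcurve_periodic_nat.
Qed.

(** [2 b + 1] bounds [|a + a0|] when [|a0| <= b] and [|a - a0| <= 1]; it converts a distance into a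
    difference of squares, hence of [rho]. *)
Lemma near_tube (x y z th e : R) : 0 <= e <= 1 -> (2 * b + 1) * e <= rad / 4 -> e <= sig / 4 ->
  dist3 (x, y, z) (pcurve th) <= e ->
  Rabs ((x ^ 2 + y ^ 2) / 2 - rh th) <= (2 * b + 1) * e /\ in_tube ((x ^ 2 + y ^ 2) / 2) z.
Proof.
  intros He He1 He2 Hd.
  pose proof (dist3_coord (x, y, z) (pcurve th) 0) as D0. pose proof (dist3_coord (x, y, z) (pcurve th) 1) as D1.
  pose proof (dist3_coord (x, y, z) (pcurve th) 2) as D2. simpl in D0, D1, D2.
  destruct (tube_box th _ _ (tube_curve th)) as [B0 [B1 _]].
  pose proof (polar_sq (rh th) th ltac:(pose proof (rh_pos th); lra)) as E.
  set (x0 := sqrt (2 * rh th) * cos th) in *. set (y0 := sqrt (2 * rh th) * sin th) in *.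
  assert (Q : forall a a0, Rabs (a - a0) <= e -> Rabs a0 <= b -> Rabs (a ^ 2 - a0 ^ 2) <= (2 * b + 1) * e).
  { intros a a0 H1 H2. replace (a ^ 2 - a0 ^ 2) with ((a - a0) * (2 * a0 + (a - a0))) by ring.
    rewrite Rabs_mult, Rmult_comm. apply Rmult_le_compat; auto using Rabs_pos.
    eapply Rle_trans; [apply Rabs_triang|]. rewrite Rabs_mult, Rabs_right by lra. lra. }
  pose proof (Q x x0 ltac:(lra) B0) as Q0. pose proof (Q y y0 ltac:(lra) B1) as Q1.
  assert (R : Rabs ((x ^ 2 + y ^ 2) / 2 - rh th) <= (2 * b + 1) * e).
  { replace ((x ^ 2 + y ^ 2) / 2 - rh th) with (/ 2 * ((x ^ 2 - x0 ^ 2) + (y ^ 2 - y0 ^ 2)))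
      by (replace (rh th) with ((x0 ^ 2 + y0 ^ 2) / 2) by lra; field).
    rewrite Rabs_mult, Rabs_right by lra. pose proof (Rabs_triang (x ^ 2 - x0 ^ 2) (y ^ 2 - y0 ^ 2)). lra. }
  split; [exact R|]. destruct (Hin th) as [I1 I2].
  assert (T3 : forall x y z, Rabs (x - z) <= Rabs (x - y) + Rabs (y - z)).
  { intros u v w. replace (u - w) with (u - v + (v - w)) by ring. apply Rabs_triang. }
  pose proof (T3 ((x ^ 2 + y ^ 2) / 2) (rh th) w0). pose proof (T3 z (ss th) 0).
  rewrite !Rminus_0_r in *. split; lra.
Qed.

(** Stability would keep every solution starting close to the orbit in the tube for ever. A start
    displaced from the curve in the radial direction alone has [Vm 0 = dw ^ 2 > 0], and [Vm] would
    grow exponentially although it is bounded by [(2 Cw) ^ 2] in the tube. *)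
Lemma orbit_is_unstable (gam : R -> R3) : kw < 0 -> (forall t, exists th, gam t = pcurve th) ->
  (forall th, exists t, gam t = pcurve th) -> orbit_unstable vf3 gam.
Proof.
  intros Hk G1 G2 Hst. destruct Hbox as [B1 [B2 B3]].
  set (e := Rmin 1 (Rmin (rad / 4 / (2 * b + 1)) (sig / 4))).
  assert (He : 0 < e). { repeat apply Rmin_glb_lt; try lra. apply Rdiv_lt_0_compat; lra. }
  assert (He0 : e <= 1) by apply Rmin_l.
  assert (He1 : (2 * b + 1) * e <= rad / 4).
  { assert (H : e <= rad / 4 / (2 * b + 1)) by (eapply Rle_trans; [apply Rmin_r|apply Rmin_l]).
    apply (Rmult_le_compat_l (2 * b + 1)) in H; [|lra].
    replace ((2 * b + 1) * (rad / 4 / (2 * b + 1))) with (rad / 4) in H by (field; lra). exact H. }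
  assert (He2 : e <= sig / 4) by (eapply Rle_trans; [apply Rmin_r|apply Rmin_r]).
  destruct (Hst e He) as [d [Hd Hst']].
  assert (Hs0 : 0 < sqrt w0) by (apply sqrt_lt_R0; auto).
  set (h := Rmin (rad / 2) (d * sqrt w0 / 4)).
  assert (Hh : 0 < h). { apply Rmin_glb_lt; [lra|]. apply Rdiv_lt_0_compat; [nra|lra]. }
  assert (Hh1 : h <= rad / 2) by apply Rmin_l. assert (Hh2 : h <= d * sqrt w0 / 4) by apply Rmin_r.
  set (Y0 := (sqrt (2 * (rh 0 + h)) * cos 0, sqrt (2 * (rh 0 + h)) * sin 0, ss 0)).
  destruct (Hex Y0) as [phi [Hs H0]]. pose proof (sol_fsol _ Hs) as Hphi.
  pose proof (rh_pos 0) as Hr0.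
  assert (Er : rhoc phi 0 = rh 0 + h).
  { unfold rhoc, xx, yy. rewrite H0. unfold Y0, coord, fst, snd. rewrite polar_sq; [field|lra]. }
  assert (Hx : xx phi 0 = sqrt (2 * rhoc phi 0) * cos 0) by (rewrite Er; unfold xx; rewrite H0; reflexivity).
  assert (Hy : yy phi 0 = sqrt (2 * rhoc phi 0) * sin 0) by (rewrite Er; unfold yy; rewrite H0; reflexivity).
  assert (Hz : zz phi 0 = ss 0) by (unfold zz; rewrite H0; reflexivity).
  assert (Hnear : near_orbit gam (phi 0) d).
  { destruct (G2 0) as [s Es]. exists s. rewrite Es, H0. unfold Y0, pcurve.
    eapply Rle_lt_trans; [apply (dist_polar w0); lra|].
    replace (rh 0 + h - rh 0) with h by ring. rewrite Rminus_diag, Rabs_R0, Rabs_right by lra.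
    assert (h / sqrt w0 <= d / 4); [|lra].
    apply (Rmult_le_reg_r (sqrt w0)); auto. unfold Rdiv. rewrite Rmult_assoc, Rinv_l by lra. lra. }
  assert (HT : forall t, 0 <= t -> in_tube (rhoc phi t) (zz phi t)).
  { intros t Ht. destruct (Hst' phi Hphi Hnear t Ht) as [s Hs']. destruct (G1 s) as [th Eth].
    rewrite Eth in Hs'.
    apply (near_tube (xx phi t) (yy phi t) (zz phi t) th e); try lra.
    replace (xx phi t, yy phi t, zz phi t) with (phi t)
      by (unfold xx, yy, zz; destruct (phi t) as [[x y] z]; reflexivity). lra. }
  assert (T0 : in_tube (rh 0 + h) (ss 0)) by (rewrite <- Er, <- Hz; apply HT; lra).
  set (dw := dwc phi 0 0).
  assert (Hdw : 0 < dw ^ 2).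
  { pose proof (Hrho 0 _ _ _ _ T0 (tube_curve 0)) as R. rewrite Rminus_diag, Rabs_R0, Rplus_0_r in R.
    replace (rh 0 + h - rh 0) with h in R by ring. rewrite (Rabs_right h) in R by lra.
    assert (E : at_polar wv 0 (rh 0 + h) (ss 0) - at_polar wv 0 (rh 0) (ss 0) = dw).
    { unfold dw, dwc. rewrite angle_0, Hx, Hy, Hz, Er. reflexivity. }
    rewrite E in R. assert (dw <> 0) by (intros Z; rewrite Z, Rabs_R0 in R; lra).
    rewrite <- Rsqr_pow2. apply Rsqr_pos_lt; auto. }
  assert (EV : Vm phi 0 0 = dw ^ 2).
  { unfold Vm, dsc. rewrite angle_0, Hz. fold dw. ring. }
  assert (HCw : 0 <= Cw).
  { destruct Lwv as [L _]. specialize (L 0 0 0). unfold box in L. rewrite Rabs_R0 in L.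
    specialize (L ltac:(repeat split; lra)). pose proof (Rabs_pos (wv 0 0 0)). lra. }
  assert (Bd : forall t, 0 <= t -> Vm phi 0 t <= (2 * Cw) ^ 2).
  { intros t Ht. unfold Vm. pose proof (pow2_ge_0 (dsc phi 0 t)).
    assert (B : Rabs (dwc phi 0 t) <= 2 * Cw).
    { unfold dwc. destruct Lwv as [L _].
      assert (HTt : forall u, 0 <= u <= t -> in_tube (rhoc phi u) (zz phi u)) by (intros; apply HT; lra).
      rewrite (along_at phi Hphi 0 Hx Hy t HTt wv t ltac:(lra)). unfold wcurve, at_polar.
      pose proof (L _ _ _ (tube_box (angle phi 0 t) _ _ (HT t Ht))).
      pose proof (L _ _ _ (tube_box (angle phi 0 t) _ _ (tube_curve (angle phi 0 t)))).
      match goal with |- Rabs (?x - ?y) <= _ => replace (x - y) with (x + - y) by ring;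
        pose proof (Rabs_triang x (- y)) as Tr; rewrite Rabs_Ropp in Tr end. lra. }
    apply Rabs_le_between in B. nra. }
  (* At this time the exponent equals [(2 Cw) ^ 2 / dw ^ 2], and [1 + x <= exp x] already brings
     [Vm] above its bound by [dw ^ 2]. *)
  set (T := (2 * Cw) ^ 2 / (dw ^ 2) / (- kw * th0)).
  assert (Hkt : 0 < - kw * th0) by nra.
  assert (HT0 : 0 <= T).
  { apply Rmult_le_pos; [apply Rmult_le_pos; [apply pow2_ge_0|]|]; left; apply Rinv_0_lt_compat; auto. }
  pose proof (Vm_growth phi Hphi 0 Hx Hy T Hk HT0 ltac:(intros; apply HT; lra)) as G.
  specialize (Bd T HT0). rewrite EV in G.
  assert (E : - kw * th0 * T = (2 * Cw) ^ 2 / dw ^ 2) by (unfold T; field; split; nra).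
  rewrite E in G.
  assert (X : (2 * Cw) ^ 2 / dw ^ 2 + 1 <= exp ((2 * Cw) ^ 2 / dw ^ 2)).
  { destruct (Req_dec ((2 * Cw) ^ 2 / dw ^ 2) 0) as [Z|Z].
    - rewrite Z, exp_0. lra.
    - left. rewrite Rplus_comm. apply exp_ineq1; auto. }
  apply (Rmult_le_compat_l (dw ^ 2)) in X; [|lra].
  replace (dw ^ 2 * ((2 * Cw) ^ 2 / dw ^ 2 + 1)) with ((2 * Cw) ^ 2 + dw ^ 2) in X
    by (field; intros Z; rewrite Z in Hdw; simpl in Hdw; lra). lra.
Qed.

Let gap (v : R) : R := 2 * (2 * (sqrt v + sqrt (v / K)) / sqrt w0) + sqrt (v / K).

(** Taking [v] to be a square [h ^ 2] makes all the bounds linear in [h]. *)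
Lemma small_gap e : 0 < e -> exists v, 0 < v /\ gap v < e /\
  2 * (sqrt v + sqrt (v / K)) < rad / 2 /\ sqrt (v / K) < sig / 2.
Proof.
  intros He. assert (Hs : 0 < sqrt w0) by (apply sqrt_lt_R0; auto).
  assert (HsK : 0 < sqrt K) by (apply sqrt_lt_R0; auto).
  set (i := / sqrt K). assert (Hi : 0 < i) by (apply Rinv_0_lt_compat; auto).
  set (j := / sqrt w0). assert (Hj : 0 < j) by (apply Rinv_0_lt_compat; auto).
  set (B := 4 * (1 + i) * j + i + 2 * (1 + i)).
  set (m := Rmin e (Rmin (rad / 2) (sig / 2))).
  assert (Hm : 0 < m) by (repeat apply Rmin_glb_lt; lra).
  assert (Hm1 : m <= e) by apply Rmin_l.
  assert (Hm2 : m <= rad / 2) by (eapply Rle_trans; [apply Rmin_r|apply Rmin_l]).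
  assert (Hm3 : m <= sig / 2) by (eapply Rle_trans; [apply Rmin_r|apply Rmin_r]).
  assert (HB : 0 < B) by (unfold B; assert (0 < (1 + i) * j) by nra; nra).
  set (h := m / (1 + B)). assert (Hh : 0 < h) by (apply Rdiv_lt_0_compat; lra).
  assert (HBh : B * h < m).
  { assert (E : m = (1 + B) * h) by (unfold h; field; lra). rewrite E. nra. }
  exists (h ^ 2). unfold gap.
  assert (E1 : sqrt (h ^ 2) = h) by (apply sqrt_pow2; lra).
  assert (E2 : sqrt (h ^ 2 / K) = h * i).
  { unfold Rdiv. rewrite sqrt_mult_alt by nra. rewrite E1, sqrt_inv. reflexivity. }
  rewrite E1, E2. unfold Rdiv. fold j. unfold B in HBh.
  assert (0 < (1 + i) * h) by nra. assert (0 < (1 + i) * h * j) by nra. assert (0 < h * i) by nra.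
  repeat split; nra.
Qed.

(** A point close to the curve at angle [th] has an angle [th'] of its own; [polar_near] keeps [th']
    close to [th], and the slope bound [Cd] of the curve moves the comparison from [th] to [th']. *)
Lemma enter_tube v : 0 < v -> exists d, 0 < d /\ forall x y z th, dist3 (x, y, z) (pcurve th) < d ->
  exists th', x = sqrt (2 * ((x ^ 2 + y ^ 2) / 2)) * cos th' /\
    y = sqrt (2 * ((x ^ 2 + y ^ 2) / 2)) * sin th' /\
    Rabs ((x ^ 2 + y ^ 2) / 2 - w0) < rad /\ Rabs z < sig /\
    (wv x y z - wcurve th') ^ 2 + K * (z - ss th') ^ 2 <= v.
Proof.
  intros Hv. destruct Hbox as [B1 [B2 B3]].
  assert (Hs : 0 < sqrt w0) by (apply sqrt_lt_R0; auto).
  assert (HCw : 0 <= Cw).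
  { destruct Lwv as [L _]. specialize (L 0 0 0). unfold box in L. rewrite Rabs_R0 in L.
    specialize (L ltac:(repeat split; lra)). pose proof (Rabs_pos (wv 0 0 0)). lra. }
  assert (HCd : 0 <= Cd).
  { destruct (Hbd 0 _ _ (tube_curve 0)) as [L _]. eapply Rle_trans; [apply Rabs_pos|exact L]. }
  assert (Lw : forall s t, Rabs (wcurve s - wcurve t) <= Cd * Rabs (s - t)).
  { apply (mvt_lipschitz wcurve _ Cd Dw). intros t. apply (Hbd t _ _ (tube_curve t)). }
  assert (Ls : forall s t, Rabs (ss s - ss t) <= Cd * Rabs (s - t)).
  { apply (mvt_lipschitz ss _ Cd Ds). intros t. apply (Hbd t _ _ (tube_curve t)). }
  (* The summands pay for [wv] under a displacement in three coordinates, for the displacement in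
     [s], and for the change of angle supplied by [polar_near]. *)
  set (c := 3 * Cw + 1 + 4 * Cd / sqrt w0).
  assert (Hj : 0 <= 4 * Cd / sqrt w0) by (apply Rmult_le_pos; [lra|left; apply Rinv_0_lt_compat; auto]).
  assert (Hc : 1 <= c) by (unfold c; lra).
  set (q := (1 + K) * c ^ 2). assert (Hq : 0 < q) by (unfold q; nra).
  set (d := Rmin (Rmin 1 (v / q)) (Rmin (Rmin (rad / 8 / (2 * b + 1)) (sig / 4)) (sqrt w0 / 4))).
  assert (Hd : 0 < d).
  { repeat apply Rmin_glb_lt; try lra; apply Rdiv_lt_0_compat; lra. }
  assert (D1 : d <= 1) by (eapply Rle_trans; [apply Rmin_l|apply Rmin_l]).
  assert (D2 : q * d <= v).
  { assert (H : d <= v / q) by (eapply Rle_trans; [apply Rmin_l|apply Rmin_r]).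
    apply (Rmult_le_compat_l q) in H; [|lra]. replace (q * (v / q)) with v in H by (field; lra). exact H. }
  assert (D3 : (2 * b + 1) * d <= rad / 8).
  { assert (H : d <= rad / 8 / (2 * b + 1))
      by (eapply Rle_trans; [apply Rmin_r|eapply Rle_trans; [apply Rmin_l|apply Rmin_l]]).
    apply (Rmult_le_compat_l (2 * b + 1)) in H; [|lra].
    replace ((2 * b + 1) * (rad / 8 / (2 * b + 1))) with (rad / 8) in H by (field; lra). exact H. }
  assert (D4 : d <= sig / 4) by (eapply Rle_trans; [apply Rmin_r|eapply Rle_trans; [apply Rmin_l|apply Rmin_r]]).
  assert (D5 : d <= sqrt w0 / 4) by (eapply Rle_trans; [apply Rmin_r|apply Rmin_r]).
  exists d. split; [exact Hd|]. intros x y z th Hdist.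
  pose proof (dist3_coord (x, y, z) (pcurve th) 0) as X0. pose proof (dist3_coord (x, y, z) (pcurve th) 1) as X1.
  pose proof (dist3_coord (x, y, z) (pcurve th) 2) as X2. simpl in X0, X1, X2.
  destruct (near_tube x y z th d) as [N1 N2]; try lra.
  pose proof (rh_pos th) as Hr.
  destruct (polar_near x y (sqrt (2 * rh th)) th d (sqrt w0)) as [th' [P1 [P2 P3]]]; try lra.
  { split; auto. apply sqrt_le_1_alt. lra. }
  exists th'. replace (2 * ((x ^ 2 + y ^ 2) / 2)) with (x ^ 2 + y ^ 2) by field.
  destruct (Hin th) as [I1 I2].
  assert (T3 : forall x y z, Rabs (x - z) <= Rabs (x - y) + Rabs (y - z)).
  { intros u w t. replace (u - t) with (u - w + (w - t)) by ring. apply Rabs_triang. }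
  split; [exact P1|split; [exact P2|split; [|split]]].
  - pose proof (T3 ((x ^ 2 + y ^ 2) / 2) (rh th) w0). lra.
  - pose proof (T3 z (ss th) 0). rewrite !Rminus_0_r in *. lra.
  - assert (A1 : Rabs (wv x y z - wcurve th') <= c * d).
    { eapply Rle_trans; [apply (T3 _ (wcurve th))|].
      assert (W1 : Rabs (wv x y z - wcurve th) <= Cw * (3 * d)).
      { destruct Lwv as [_ L]. unfold wcurve, at_polar. eapply Rle_trans; [apply L|].
        - pose proof (tube_box th' _ _ N2) as TB. replace (2 * ((x ^ 2 + y ^ 2) / 2)) with (x ^ 2 + y ^ 2) in TB by field.
          rewrite <- P1, <- P2 in TB. exact TB.
        - apply tube_box, tube_curve.
        - apply Rmult_le_compat_l; auto. lra. }
      pose proof (Lw th th') as W2. rewrite (Rabs_minus_sym th) in W2.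
      assert (Cd * Rabs (th' - th) <= Cd * (4 * d / sqrt w0)) by (apply Rmult_le_compat_l; auto).
      replace (c * d) with (Cw * (3 * d) + d + Cd * (4 * d / sqrt w0)) by (unfold c; field; lra). lra. }
    assert (A2 : Rabs (z - ss th') <= c * d).
    { eapply Rle_trans; [apply (T3 _ (ss th))|].
      pose proof (Ls th th') as W2. rewrite (Rabs_minus_sym th) in W2.
      assert (Cd * Rabs (th' - th) <= Cd * (4 * d / sqrt w0)) by (apply Rmult_le_compat_l; auto).
      replace (c * d) with (Cw * (3 * d) + d + Cd * (4 * d / sqrt w0)) by (unfold c; field; lra).
      assert (0 <= Cw * (3 * d)) by nra. lra. }
    assert (SQ : forall u, Rabs u <= c * d -> u ^ 2 <= (c * d) ^ 2).
    { intros u Hu. rewrite <- (pow2_abs u). apply pow_incr. split; [apply Rabs_pos|auto]. }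
    pose proof (SQ _ A1). pose proof (SQ _ A2).
    apply Rle_trans with ((1 + K) * (c * d) ^ 2); [nra|].
    replace ((1 + K) * (c * d) ^ 2) with (q * d * d) by (unfold q; ring). nra.
Qed.

Lemma orbit_is_asympt_stable (gam : R -> R3) : 0 < kw -> (forall t, exists th, gam t = pcurve th) ->
  (forall th, exists t, gam t = pcurve th) -> orbit_asympt_stable vf3 gam.
Proof.
  intros Hk G1 G2.
  (* One neighbourhood serves both halves: [gap v] bounds the distance at all times, and [gap v']
     bounds it as soon as the exponential has brought [Vp] below [v']. *)
  assert (M : forall e, 0 < e -> exists d v, 0 < d /\ 0 < v /\ gap v < e /\ forall phi, is_fsol vf3 phi ->
    near_orbit gam (phi 0) d -> exists A, forall t, 0 <= t -> 
      (forall v', 0 < v' -> v * exp (- Rmin kw ks * th0 * t) <= v' -> dist3 (phi t) (pcurve (A t)) <= gap v') /\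
      dist3 (phi t) (pcurve (A t)) <= gap v).
  { intros e He. destruct (small_gap e He) as [v [Hv [Hg [M1 M2]]]].
    destruct (enter_tube v Hv) as [d [Hd H]]. exists d, v. repeat split; auto.
    intros phi Hphi [s Hs]. destruct (G1 s) as [th Eth]. rewrite Eth in Hs.
    destruct (H (xx phi 0) (yy phi 0) (zz phi 0) th) as [th' [P1 [P2 [P3 [P4 P5]]]]].
    { unfold xx, yy, zz. destruct (phi 0) as [[x y] z]. exact Hs. }
    fold (rhoc phi 0) in P1, P2, P3.
    assert (V0 : Vp phi th' 0 <= v) by (unfold Vp, dwc, dsc; rewrite angle_0; exact P5).
    assert (S1 : sqrt (Vp phi th' 0) <= sqrt v) by (apply sqrt_le_1_alt; auto).
    assert (S2 : sqrt (Vp phi th' 0 / K) <= sqrt (v / K)).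
    { apply sqrt_le_1_alt. apply Rmult_le_compat_r; auto. left; apply Rinv_0_lt_compat; auto. }
    assert (HT : forall t, 0 <= t -> in_tube (rhoc phi t) (zz phi t) /\ Vp phi th' t <= Vp phi th' 0).
    { apply trapped; auto; lra. }
    exists (angle phi th'). intros t Ht.
    assert (HTt : forall u, 0 <= u <= t -> in_tube (rhoc phi u) (zz phi u)) by (intros; apply HT; lra).
    split.
    - intros v' Hv' Hd'. apply (along_dist phi Hphi th' P1 P2 v' t Ht HTt).
      eapply Rle_trans; [apply (Vp_decay phi Hphi th' P1 P2 t Hk Ht HTt)|].
      eapply Rle_trans; [|exact Hd']. apply Rmult_le_compat_r; auto. left; apply exp_pos.
    - apply (along_dist phi Hphi th' P1 P2 v t Ht HTt). destruct (HT t Ht). lra. }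
  split.
  - intros e He. destruct (M e He) as [d [v [Hd [Hv [Hg H]]]]]. exists d. split; auto.
    intros phi Hphi Hn t Ht. destruct (H phi Hphi Hn) as [A HA]. destruct (HA t Ht) as [_ B].
    destruct (G2 (A t)) as [s Es]. exists s. rewrite Es. lra.
  - destruct (M 1 ltac:(lra)) as [d [v [Hd [Hv [Hg H]]]]]. exists d. split; auto.
    intros phi Hphi Hn e He. destruct (H phi Hphi Hn) as [A HA].
    destruct (small_gap e He) as [v' [Hv' [Hg' _]]].
    set (c := Rmin kw ks * th0).
    assert (Hc : 0 < c) by (apply Rmult_lt_0_compat; [apply Rmin_glb_lt|]; lra).
    exists (v / v' / c). intros t Ht.
    assert (Ht0 : 0 <= t).
    { eapply Rle_trans; [|exact Ht]. repeat apply Rmult_le_pos; try lra; left; apply Rinv_0_lt_compat; auto. }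
    destruct (HA t Ht0) as [B _]. destruct (G2 (A t)) as [s Es]. exists s. rewrite Es.
    eapply Rle_lt_trans; [|exact Hg']. apply B; auto.
    replace (- Rmin kw ks * th0 * t) with (- (c * t)) by (unfold c; ring).
    rewrite exp_Ropp.
    assert (Hct : v / v' <= c * t).
    { apply (Rmult_le_compat_l c) in Ht; [|lra]. replace (c * (v / v' / c)) with (v / v') in Ht by (field; lra). exact Ht. }
    assert (X : c * t <= exp (c * t)).
    { destruct (Req_dec (c * t) 0) as [Z|Z]; [rewrite Z, exp_0; lra|]. pose proof (exp_ineq1 (c * t) Z). lra. }
    pose proof (exp_pos (c * t)).
    apply (Rmult_le_reg_r (exp (c * t))); auto. rewrite Rmult_assoc, Rinv_l, Rmult_1_r by lra.
    apply Rle_trans with (v' * (v / v')); [right; field; lra|]. apply Rmult_le_compat_l; lra.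
Qed.

Lemma closed_curve_orbit : exists (gam : R -> R3) (T : R),
  periodic_orbit vf3 gam T /\ (forall t, exists th, gam t = pcurve th) /\
  (0 < kw -> orbit_asympt_stable vf3 gam) /\ (kw < 0 -> orbit_unstable vf3 gam).
Proof.
  destruct periodic_orbit_exists as [gam [T [H1 [H2 H3]]]]. exists gam, T.
  split; [exact H1|split; [exact H2|split; intros Hk]].
  - apply orbit_is_asympt_stable; auto.
  - apply orbit_is_unstable; auto.
Qed.

End OrbitDynamics.

(** * The rescaled Hopf normal form *)

Definition ev (P : R -> Prop) : Prop := exists d0, 0 < d0 /\ forall d, 0 < d <= d0 -> P d.

Lemma ev_and P Q : ev P -> ev Q -> ev (fun d => P d /\ Q d).
Proof.
  intros [d1 [H1 K1]] [d2 [H2 K2]]. exists (Rmin d1 d2). split; [apply Rmin_glb_lt; auto|].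
  intros d Hd. pose proof (Rmin_l d1 d2). pose proof (Rmin_r d1 d2). split; [apply K1|apply K2]; lra.
Qed.

Lemma ev_imp (P Q : R -> Prop) : (forall d, 0 < d -> P d -> Q d) -> ev P -> ev Q.
Proof. intros H [d1 [H1 K1]]. exists d1. split; auto. intros d Hd. apply H; [lra|auto]. Qed.

Lemma ev_lin c e : 0 < e -> ev (fun d => c * d <= e).
Proof.
  intros He. exists (e / (Rabs c + 1)). pose proof (Rabs_pos c). split; [apply Rdiv_lt_0_compat; lra|].
  intros d Hd. pose proof (Rle_abs c).
  assert (E : e = (Rabs c + 1) * (e / (Rabs c + 1))) by (field; lra).
  assert ((Rabs c + 1) * d <= (Rabs c + 1) * (e / (Rabs c + 1))) by (apply Rmult_le_compat_l; lra). nra.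
Qed.

(** Uniformity in [d] is essential: radii and weights of the contraction are chosen from the
    constant, and only afterwards is [d] made small. *)
Definition UBL (D : R -> R -> R -> Prop) (f : R -> R -> R -> R -> R) : Prop :=
  exists C, 0 <= C /\ ev (fun d => BL D C (f d)).

Section UBLAlgebra.
Variable D : R -> R -> R -> Prop.

Lemma UBL_const c : UBL D (fun _ _ _ _ => c).
Proof.
  exists (Rabs c). split; [apply Rabs_pos|]. exists 1. split; [lra|]. intros. apply BL_const.
Qed.

Lemma UBL_dl : UBL D (fun d _ _ _ => d).
Proof.
  exists 1. split; [lra|]. exists 1. split; [lra|]. intros d Hd.
  apply (BL_weaken _ _ _ _ (BL_const D d)). rewrite Rabs_right; lra.
Qed.

Lemma UBL_fixed C (f : R -> R -> R -> R) : BL D C f -> UBL D (fun _ => f).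
Proof.
  intros H. exists (Rabs C). split; [apply Rabs_pos|]. exists 1. split; [lra|]. intros d _.
  apply (BL_weaken _ _ _ _ H). apply Rle_abs.
Qed.

Lemma UBL_add f g : UBL D f -> UBL D g -> UBL D (fun d x y z => f d x y z + g d x y z).
Proof.
  intros [C [HC H]] [C' [HC' H']]. exists (C + C'). split; [lra|].
  apply (ev_imp _ _ (fun d _ K => BL_add D C C' _ _ (proj1 K) (proj2 K)) (ev_and _ _ H H')).
Qed.

Lemma UBL_opp f : UBL D f -> UBL D (fun d x y z => - f d x y z).
Proof.
  intros [C [HC H]]. exists C. split; [lra|]. apply (ev_imp _ _ (fun d _ K => BL_opp D C _ K) H).
Qed.

Lemma UBL_sub f g : UBL D f -> UBL D g -> UBL D (fun d x y z => f d x y z - g d x y z).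
Proof. intros H1 H2. apply (UBL_add f (fun d x y z => - g d x y z)); auto. apply UBL_opp; auto. Qed.

Lemma UBL_mult f g : UBL D f -> UBL D g -> UBL D (fun d x y z => f d x y z * g d x y z).
Proof.
  intros [C [HC H]] [C' [HC' H']]. exists (2 * (C * C')). split; [nra|].
  apply (ev_imp _ _ (fun d _ K => BL_mult D C C' _ _ (proj1 K) (proj2 K)) (ev_and _ _ H H')).
Qed.

Lemma UBL_inv f m : 0 < m -> UBL D f -> ev (fun d => forall x y z, D x y z -> m <= f d x y z) ->
  UBL D (fun d x y z => / f d x y z).
Proof.
  intros Hm [C [HC H]] Hf. exists (/ m + C / (m * m)). split.
  - assert (0 < / m) by (apply Rinv_0_lt_compat; auto).
    assert (0 <= C / (m * m)); [|lra]. apply Rmult_le_pos; auto. left; apply Rinv_0_lt_compat; nra.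
  - apply (ev_imp _ _ (fun d _ K => BL_inv D C m _ Hm (proj1 K) (proj2 K)) (ev_and _ _ H Hf)).
Qed.

End UBLAlgebra.

(** The discriminant condition for a nonnegative quadratic form: after multiplication by [4 al] the
    difference is a square plus a nonnegative multiple of [y ^ 2]. *)
Lemma young (c al be x y : R) : 0 < al -> c ^ 2 <= 4 * al * be -> c * (x * y) <= al * x ^ 2 + be * y ^ 2.
Proof.
  intros Ha H. assert (0 <= (2 * al * x - c * y) ^ 2 + (4 * al * be - c ^ 2) * y ^ 2).
  { apply Rplus_le_le_0_compat; [apply pow2_ge_0|]. apply Rmult_le_pos; [lra|apply pow2_ge_0]. }
  apply (Rmult_le_reg_l (4 * al)); [lra|]. nra.
Qed.

Section PolarDomain.
Variables w0 b : R.
Hypothesis Hw0 : 0 < w0.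
Hypothesis Hb : 3 * w0 <= b ^ 2 /\ 1 <= b.

Definition pdom (th rho s : R) : Prop := Rabs (rho - w0) <= w0 / 2 /\ Rabs s <= 1.

Lemma pdom_rho th rho s : pdom th rho s -> w0 / 2 <= rho <= 3 * w0 / 2.
Proof. intros [H _]. apply Rabs_le_between in H. lra. Qed.

Lemma pdom_box th rho s : pdom th rho s -> box b (sqrt (2 * rho) * cos th) (sqrt (2 * rho) * sin th) s.
Proof.
  intros H. pose proof (pdom_rho _ _ _ H). destruct H. apply polar_box; lra.
Qed.

Lemma polar_BL C f : BL (box b) C f -> 0 <= C ->
  BL pdom (C * (1 + 2 / sqrt w0 + 2 * b)) (at_polar f).
Proof.
  intros Hf HC. assert (Hs : 0 < / sqrt w0) by (apply Rinv_0_lt_compat, sqrt_lt_R0; auto).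
  apply (BL_comp (box b) pdom C _ f (fun th rho s => sqrt (2 * rho) * cos th)
    (fun th rho s => sqrt (2 * rho) * sin th) (fun th rho s => s)); auto.
  - unfold Rdiv. lra.
  - intros. apply pdom_box; auto.
  - intros th rho s th' rho' s' H H'.
    pose proof (pdom_rho _ _ _ H) as R1. pose proof (pdom_rho _ _ _ H') as R2.
    pose proof (sqrt_diff w0 rho rho' Hw0 ltac:(lra) ltac:(lra)) as SD.
    assert (Bs : 0 <= sqrt (2 * rho') <= b).
    { split; [apply sqrt_pos|]. rewrite <- (sqrt_pow2 b) by lra. apply sqrt_le_1_alt. lra. }
    assert (G : forall g : R -> R, (forall x, Rabs (g x) <= 1) -> (forall x y, Rabs (g x - g y) <= 1 * Rabs (x - y)) ->
      Rabs (sqrt (2 * rho) * g th - sqrt (2 * rho') * g th') <= Rabs (rho - rho') / sqrt w0 + b * Rabs (th - th')).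
    { intros g Hg1 Hg2.
      replace (sqrt (2 * rho) * g th - sqrt (2 * rho') * g th')
        with ((sqrt (2 * rho) - sqrt (2 * rho')) * g th + sqrt (2 * rho') * (g th - g th')) by ring.
      eapply Rle_trans; [apply Rabs_triang|]. rewrite !Rabs_mult, (Rabs_right (sqrt (2 * rho'))) by lra.
      specialize (Hg1 th). specialize (Hg2 th th'). pose proof (Rabs_pos (g th)).
      pose proof (Rabs_pos (g th - g th')). pose proof (Rabs_pos (sqrt (2 * rho) - sqrt (2 * rho'))).
      apply Rplus_le_compat; [nra|]. apply Rmult_le_compat; lra. }
    assert (Gc := G cos ltac:(intros x; pose proof (COS_bound x); apply Rabs_le_between; lra)
      ltac:(apply (mvt_lipschitz cos (fun x => - sin x));
        [intros; apply is_derive_cos|intros x; rewrite Rabs_Ropp; pose proof (SIN_bound x); apply Rabs_le_between; lra])).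
    assert (Gs := G sin ltac:(intros x; pose proof (SIN_bound x); apply Rabs_le_between; lra)
      ltac:(apply (mvt_lipschitz sin cos);
        [intros; apply is_derive_sin|intros x; pose proof (COS_bound x); apply Rabs_le_between; lra])).
    pose proof (Rabs_pos (rho - rho')). pose proof (Rabs_pos (s - s')). pose proof (Rabs_pos (th - th')).
    assert (0 <= / sqrt w0 * Rabs (th - th')) by (apply Rmult_le_pos; lra).
    assert (0 <= / sqrt w0 * Rabs (s - s')) by (apply Rmult_le_pos; lra).
    assert (0 <= b * Rabs (rho - rho')) by (apply Rmult_le_pos; lra).
    assert (0 <= b * Rabs (s - s')) by (apply Rmult_le_pos; lra).
    unfold Rdiv in *. nra.
Qed.

Lemma UBL_polar f : UBL (box b) f -> UBL pdom (fun d => at_polar (f d)).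
Proof.
  intros [C [HC H]]. exists (C * (1 + 2 / sqrt w0 + 2 * b)). split.
  - apply Rmult_le_pos; auto. assert (0 < / sqrt w0) by (apply Rinv_0_lt_compat, sqrt_lt_R0; auto).
    unfold Rdiv; lra.
  - apply (ev_imp _ _ (fun d _ K => polar_BL C _ K HC) H).
Qed.

Lemma UBL_rho : UBL pdom (fun _ _ rho _ => rho).
Proof.
  apply (UBL_fixed pdom (1 + 3 * w0 / 2)). split.
  - intros th rho s H. pose proof (pdom_rho _ _ _ H). rewrite Rabs_right; lra.
  - intros. pose proof (Rabs_pos (x - x')). pose proof (Rabs_pos (y - y')). pose proof (Rabs_pos (z - z')). nra.
Qed.

Lemma UBL_s : UBL pdom (fun _ _ _ s => s).
Proof.
  apply (UBL_fixed pdom 1). split.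
  - intros th rho s [_ H]. lra.
  - intros. pose proof (Rabs_pos (x - x')). pose proof (Rabs_pos (y - y')). lra.
Qed.

Lemma UBL_x : UBL pdom (fun _ th rho _ => sqrt (2 * rho) * cos th).
Proof.
  apply (UBL_polar (fun _ p _ _ => p)). apply (UBL_fixed (box b) (b + 1)). split.
  - intros x y z [H _]. lra.
  - intros. pose proof (Rabs_pos (x - x')). pose proof (Rabs_pos (y - y')). pose proof (Rabs_pos (z - z')). nra.
Qed.

Lemma UBL_y : UBL pdom (fun _ th rho _ => sqrt (2 * rho) * sin th).
Proof.
  apply (UBL_polar (fun _ _ q _ => q)). apply (UBL_fixed (box b) (b + 1)). split.
  - intros x y z [_ [H _]]. lra.
  - intros. pose proof (Rabs_pos (x - x')). pose proof (Rabs_pos (y - y')). pose proof (Rabs_pos (z - z')). nra.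
Qed.

End PolarDomain.

Section ScaledHopf.
Variables om lam k a4 w0 b : R.
Variables nu nv ns w1 cc ee : R -> R -> R -> R -> R.
Hypothesis Hom : 0 < om.
Hypothesis Hlam : 0 < lam.
Hypothesis Hk : k <> 0.
Hypothesis Hw0 : 0 < w0.
Hypothesis Hb : 3 * w0 <= b ^ 2 /\ 1 <= b.
Hypothesis Unu : UBL (box b) nu.
Hypothesis Unv : UBL (box b) nv.
Hypothesis Uns : UBL (box b) ns.
Hypothesis Uw1 : UBL (box b) w1.
Hypothesis Ucc : UBL (box b) cc.
Hypothesis Uee : UBL (box b) ee.

Definition sf1 (d p q s : R) : R := - om * q + d * nu d p q s.
Definition sf2 (d p q s : R) : R := om * p + d * nv d p q s.
Definition sf3 (d p q s : R) : R := - lam * s + d * ns d p q s.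
Definition swv (d p q s : R) : R := (p ^ 2 + q ^ 2) / 2 + d * w1 d p q s.
(** The intended time derivative of [swv]. The first two terms are the radial law [r^2] against
    [r^4] expanded about its nonzero equilibrium [w0], so [k] is the linear rate there and [k > 0]
    means attraction. *)
Definition sMv (d p q s : R) : R :=
  d ^ 2 * (- k * ((p ^ 2 + q ^ 2) / 2 - w0) + a4 * ((p ^ 2 + q ^ 2) / 2 - w0) ^ 2
           + cc d p q s * s + d * ee d p q s).

Let angh (d th rho s : R) : R :=
  (sqrt (2 * rho) * cos th * at_polar (nv d) th rho s
   - sqrt (2 * rho) * sin th * at_polar (nu d) th rho s) * / (2 * rho).
Let Th (d th rho s : R) : R := om + d * angh d th rho s.
Let H0 (d th rho s : R) : R := (a4 * ((rho - w0) * (rho - w0)) + at_polar (cc d) th rho s * s) * / om.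
Let Mh (d th rho s : R) : R := - k * (rho - w0) + om * H0 d th rho s.
(** Replacing [1 / Th] by [1 / om] costs [d angh / (om Th)], which is the second summand. The third
    compensates for writing the linear rate in terms of [rho + E] instead of [rho]. *)
Let H1 (d th rho s : R) : R :=
  at_polar (ee d) th rho s * / Th d th rho s
  - Mh d th rho s * angh d th rho s * (/ om * / Th d th rho s) + k * / om * at_polar (w1 d) th rho s.
Let H2 (d th rho s : R) : R :=
  at_polar (ns d) th rho s * / Th d th rho s + lam * s * angh d th rho s * (/ om * / Th d th rho s).
Let A (d th rho s : R) : R := d * d * (H0 d th rho s + d * H1 d th rho s).
Let B (d th rho s : R) : R := d * H2 d th rho s.
Let E (d th rho s : R) : R := d * at_polar (w1 d) th rho s.

Notation D := (pdom w0).

Let Uang : UBL D angh.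
Proof.
  apply UBL_mult.
  - apply UBL_sub; apply UBL_mult;
      first [apply (UBL_x w0 b Hw0 Hb) | apply (UBL_y w0 b Hw0 Hb) | apply (UBL_polar w0 b Hw0 Hb); auto].
  - apply (UBL_inv D (fun _ _ rho _ => 2 * rho) w0); auto.
    + apply UBL_mult; [apply UBL_const|apply (UBL_rho w0 Hw0)].
    + exists 1. split; [lra|]. intros d _ th rho s H. pose proof (pdom_rho w0 _ _ _ H). lra.
Qed.

Let Th_bounds : ev (fun d => forall th rho s, D th rho s -> om / 2 <= Th d th rho s <= 2 * om).
Proof.
  destruct Uang as [C [HC Ha]].
  refine (ev_imp _ _ _ (ev_and _ _ Ha (ev_lin C (om / 2) ltac:(lra)))).
  intros d Hd [[K _] L] th rho s HD. specialize (K th rho s HD). unfold Th.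
  apply Rabs_le_between in K. nra.
Qed.

Let UTi : UBL D (fun d th rho s => / Th d th rho s).
Proof.
  apply (UBL_inv D Th (om / 2)); [lra| |].
  - apply UBL_add; [apply UBL_const|]. apply UBL_mult; [apply UBL_dl|apply Uang].
  - apply (ev_imp _ _ (fun d _ K th rho s HD => proj1 (K th rho s HD)) Th_bounds).
Qed.

Let UH0 : UBL D H0.
Proof.
  apply UBL_mult; [|apply UBL_const]. apply UBL_add.
  - apply UBL_mult; [apply UBL_const|].
    apply UBL_mult; (apply UBL_sub; [apply (UBL_rho w0 Hw0)|apply UBL_const]).
  - apply UBL_mult; [apply (UBL_polar w0 b Hw0 Hb); auto|apply (UBL_s w0)].
Qed.

Let UH1 : UBL D H1.
Proof.
  apply UBL_add; [apply UBL_sub|].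
  - apply UBL_mult; [apply (UBL_polar w0 b Hw0 Hb); auto|apply UTi].
  - apply UBL_mult; [apply UBL_mult; [|apply Uang]|apply UBL_mult; [apply UBL_const|apply UTi]].
    apply UBL_add; [|apply UBL_mult; [apply UBL_const|apply UH0]].
    apply UBL_mult; [apply UBL_const|]. apply UBL_sub; [apply (UBL_rho w0 Hw0)|apply UBL_const].
  - apply UBL_mult; [apply UBL_const|apply (UBL_polar w0 b Hw0 Hb); auto].
Qed.

Let UH2 : UBL D H2.
Proof.
  apply UBL_add.
  - apply UBL_mult; [apply (UBL_polar w0 b Hw0 Hb); auto|apply UTi].
  - apply UBL_mult; [apply UBL_mult; [|apply Uang]|apply UBL_mult; [apply UBL_const|apply UTi]].
    apply UBL_mult; [apply UBL_const|apply (UBL_s w0)].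
Qed.

Let UE1 : UBL D (fun d => at_polar (w1 d)).
Proof. apply (UBL_polar w0 b Hw0 Hb); auto. Qed.

Let ang_polar d th rho s : 0 < rho -> at_polar (angv (sf1 d) (sf2 d)) th rho s = Th d th rho s.
Proof.
  intros Hr. unfold at_polar at 1, angv, sf1, sf2. rewrite polar_sq by lra. unfold Th, angh, at_polar.
  set (x := sqrt (2 * rho) * cos th). set (y := sqrt (2 * rho) * sin th).
  assert (ER : x ^ 2 + y ^ 2 = 2 * rho) by (apply polar_sq; lra).
  transitivity ((om * (x ^ 2 + y ^ 2) + d * (x * nv d x y s - y * nu d x y s)) / (2 * rho)).
  - f_equal. ring.
  - rewrite ER. field. lra.
Qed.

Let wv_polar d th rho s : 0 < rho -> at_polar (swv d) th rho s = rho + E d th rho s.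
Proof. intros Hr. unfold at_polar at 1, swv. rewrite polar_sq by lra. unfold E, at_polar. field. Qed.

(** In the angle variable the radial equation acquires the exact form [- kw (w - w0) + A] with
    [kw = d ^ 2 k / om], and [A] carries the same factor [d ^ 2]; this is the form which the Green
    operator inverts uniformly in [d]. *)
Let M_polar d th rho s : 0 < rho -> 0 < Th d th rho s ->
  at_polar (sMv d) th rho s / at_polar (angv (sf1 d) (sf2 d)) th rho s
  = - (d ^ 2 * k / om) * (rho + E d th rho s - w0) + A d th rho s.
Proof.
  intros Hr HT. rewrite ang_polar by auto. unfold at_polar at 1, sMv. rewrite polar_sq by lra.
  unfold A, H1, Mh, H0, E, at_polar.
  set (x := sqrt (2 * rho) * cos th). set (y := sqrt (2 * rho) * sin th).
  assert (ET : angh d th rho s * d = Th d th rho s - om) by (unfold Th; ring).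
  set (T := Th d th rho s) in *. set (an := angh d th rho s) in *.
  apply (Rmult_eq_reg_l (om * T)); [|apply Rgt_not_eq; nra].
  transitivity (om * (d ^ 2 * (- k * (rho - w0) + a4 * (rho - w0) ^ 2 + cc d x y s * s + d * ee d x y s))).
  - field. lra.
  - set (Q := a4 * ((rho - w0) * (rho - w0)) + cc d x y s * s).
    transitivity (T * d ^ 2 * (- k * (rho - w0) + Q) + om * d ^ 2 * (d * ee d x y s)
      - d ^ 2 * (- k * (rho - w0) + Q) * (an * d)); [rewrite ET; unfold Q; ring|].
    field. lra.
Qed.

Let S_polar d th rho s : 0 < rho -> 0 < Th d th rho s ->
  at_polar (sf3 d) th rho s / at_polar (angv (sf1 d) (sf2 d)) th rho s = - (lam / om) * s + B d th rho s.
Proof.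
  intros Hr HT. rewrite ang_polar by auto. unfold at_polar at 1, sf3. unfold B, H2, at_polar.
  set (x := sqrt (2 * rho) * cos th). set (y := sqrt (2 * rho) * sin th).
  assert (ET : angh d th rho s * d = Th d th rho s - om) by (unfold Th; ring).
  set (T := Th d th rho s) in *. set (an := angh d th rho s) in *.
  apply (Rmult_eq_reg_l (om * T)); [|apply Rgt_not_eq; nra].
  transitivity (om * (- lam * s + d * ns d x y s)); [field; lra|].
  transitivity (- lam * T * s + om * d * ns d x y s + lam * s * (an * d)); [rewrite ET; ring|field; lra].
Qed.

Let per_polar (f : R -> R -> R -> R) th rho s : at_polar f (th + 2 * PI) rho s = at_polar f th rho s.
Proof.
  unfold at_polar. rewrite cos_plus, sin_plus, cos_2PI, sin_2PI. f_equal; ring.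
Qed.

Let per_ang d th rho s : angh d (th + 2 * PI) rho s = angh d th rho s.
Proof. unfold angh. rewrite !per_polar, cos_plus, sin_plus, cos_2PI, sin_2PI. ring. Qed.

Let per_H1 d th rho s : H1 d (th + 2 * PI) rho s = H1 d th rho s.
Proof. unfold H1, Mh, H0, Th. rewrite !per_polar, !per_ang. reflexivity. Qed.

Let per_A d th rho s : A d (th + 2 * PI) rho s = A d th rho s.
Proof. unfold A. rewrite per_H1. unfold H0. rewrite !per_polar. reflexivity. Qed.

Let per_B d th rho s : B d (th + 2 * PI) rho s = B d th rho s.
Proof. unfold B, H2, Th. rewrite !per_polar, !per_ang. reflexivity. Qed.

Let per_E d th rho s : E d (th + 2 * PI) rho s = E d th rho s.
Proof. unfold E. rewrite per_polar. reflexivity. Qed.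

Let common_constant : exists C, 1 <= C /\ ev (fun d =>
  BL D C (H1 d) /\ BL D C (H2 d) /\ BL D C (at_polar (w1 d)) /\ BL D C (at_polar (cc d))).
Proof.
  destruct UH1 as [C1 [P1 K1]]. destruct UH2 as [C2 [P2 K2]]. destruct UE1 as [C3 [P3 K3]].
  destruct (UBL_polar w0 b Hw0 Hb cc Ucc) as [C4 [P4 K4]].
  exists (C1 + C2 + C3 + C4 + 1). split; [lra|].
  refine (ev_imp _ _ _ (ev_and _ _ K1 (ev_and _ _ K2 (ev_and _ _ K3 K4)))).
  intros d _ [L1 [L2 [L3 L4]]].
  split; [|split; [|split]];
    [apply (BL_weaken _ _ _ _ L1)|apply (BL_weaken _ _ _ _ L2)
    |apply (BL_weaken _ _ _ _ L3)|apply (BL_weaken _ _ _ _ L4)]; lra.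
Qed.

Let UA : UBL D A.
Proof.
  apply UBL_mult; [apply UBL_mult; apply UBL_dl|].
  apply UBL_add; [apply UH0|apply UBL_mult; [apply UBL_dl|apply UH1]].
Qed.

Let UB : UBL D B.
Proof. apply UBL_mult; [apply UBL_dl|apply UH2]. Qed.

Let UE : UBL D E.
Proof. apply UBL_mult; [apply UBL_dl|apply UE1]. Qed.

Let common_lipschitz : exists L, ev (fun d => BL D L (A d) /\ BL D L (B d) /\ BL D L (E d)).
Proof.
  destruct UA as [C1 [P1 K1]]. destruct UB as [C2 [P2 K2]]. destruct UE as [C3 [P3 K3]].
  exists (C1 + C2 + C3).
  refine (ev_imp _ _ _ (ev_and _ _ K1 (ev_and _ _ K2 K3))).
  intros d _ [L1 [L2 L3]].
  split; [|split]; [apply (BL_weaken _ _ _ _ L1)|apply (BL_weaken _ _ _ _ L2)|apply (BL_weaken _ _ _ _ L3)]; lra.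
Qed.

Let speed_bound : exists Cd, ev (fun d => forall th rho s, D th rho s ->
  Rabs (- (d ^ 2 * k / om) * (rho + E d th rho s - w0) + A d th rho s) <= Cd /\
  Rabs (- (lam / om) * s + B d th rho s) <= Cd).
Proof.
  assert (U1 : UBL D (fun d th rho s => - (d * (d * 1) * k * / om) * (rho + E d th rho s - w0) + A d th rho s)).
  { apply UBL_add; [|apply UA]. apply UBL_mult.
    - apply UBL_opp. apply UBL_mult; [|apply UBL_const]. apply UBL_mult; [|apply UBL_const].
      apply UBL_mult; [apply UBL_dl|apply UBL_mult; [apply UBL_dl|apply UBL_const]].
    - apply UBL_sub; [|apply UBL_const]. apply UBL_add; [apply (UBL_rho w0 Hw0)|apply UE]. }
  assert (U2 : UBL D (fun d th rho s => - (lam / om) * s + B d th rho s)).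
  { apply UBL_add; [|apply UB]. apply UBL_mult; [apply UBL_const|apply (UBL_s w0)]. }
  destruct U1 as [C1 [P1 K1]]. destruct U2 as [C2 [P2 K2]]. exists (C1 + C2).
  refine (ev_imp _ _ _ (ev_and _ _ K1 K2)). intros d _ [[L1 _] [L2 _]] th rho s HD.
  specialize (L1 th rho s HD). specialize (L2 th rho s HD).
  split; (eapply Rle_trans; [first [exact L1|exact L2]|lra]).
Qed.

Let wv_lipschitz : exists Cw, ev (fun d => BL (box b) Cw (swv d)).
Proof.
  destruct Uw1 as [C [HC H]].
  assert (Hp : BL (box b) (b + 1) (fun p _ _ => p)).
  { split; [intros x y z [K _]; lra|intros]. pose proof (Rabs_pos (x - x')).
    pose proof (Rabs_pos (y - y')). pose proof (Rabs_pos (z - z')). nra. }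
  assert (Hq : BL (box b) (b + 1) (fun _ q _ => q)).
  { split; [intros x y z [_ [K _]]; lra|intros]. pose proof (Rabs_pos (x - x')).
    pose proof (Rabs_pos (y - y')). pose proof (Rabs_pos (z - z')). nra. }
  assert (U : UBL (box b) (fun d p q s => (p * p + q * q) * / 2 + d * w1 d p q s)).
  { apply UBL_add.
    - apply UBL_mult; [|apply UBL_const]. apply UBL_add; apply UBL_mult;
        first [exact (UBL_fixed _ _ _ Hp)|exact (UBL_fixed _ _ _ Hq)].
    - apply UBL_mult; [apply UBL_dl|]. exists C; auto. }
  destruct U as [C' [_ H']]. exists C'. refine (ev_imp _ _ _ H'). intros d _ K.
  apply (BL_ext _ _ _ _ K). intros. unfold swv. field.
Qed.

(** The order of choices matters: [rad] depends on [a4] and [k], [sig] on [rad] and the uniform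
    constant [C], then come the weights [m] and [K], all free of [d]. Smallness of [d] is imposed
    last, so the tube does not shrink with [d]. *)
Lemma scaled_hopf : ev (fun d =>
  (forall (p q s : R -> R) (t : R),
     is_derive p t (sf1 d (p t) (q t) (s t)) -> is_derive q t (sf2 d (p t) (q t) (s t)) ->
     is_derive s t (sf3 d (p t) (q t) (s t)) ->
     is_derive (fun t => swv d (p t) (q t) (s t)) t (sMv d (p t) (q t) (s t))) ->
  loc_lipschitz (sf1 d) -> loc_lipschitz (sf2 d) ->
  (forall Y0, exists phi, is_sol (vf3 (sf1 d) (sf2 d) (sf3 d)) phi /\ phi 0 = Y0) ->
  (forall phi psi, is_sol (vf3 (sf1 d) (sf2 d) (sf3 d)) phi -> is_sol (vf3 (sf1 d) (sf2 d) (sf3 d)) psi ->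
     phi 0 = psi 0 -> forall t, phi t = psi t) ->
  exists (gam : R -> R3) (T : R), periodic_orbit (vf3 (sf1 d) (sf2 d) (sf3 d)) gam T /\
    (0 < k -> orbit_asympt_stable (vf3 (sf1 d) (sf2 d) (sf3 d)) gam) /\
    (k < 0 -> orbit_unstable (vf3 (sf1 d) (sf2 d) (sf3 d)) gam) /\
    (forall t, box b (coord 0 (gam t)) (coord 1 (gam t)) (coord 2 (gam t)))).
Proof.
  destruct common_constant as [C [HC KC]]. destruct common_lipschitz as [L KL].
  destruct speed_bound as [Cd KCd]. destruct wv_lipschitz as [Cw KCw].
  assert (Hk0 : 0 < Rabs k) by (apply Rabs_pos_lt; auto).
  pose proof (Rabs_pos a4) as Ha4.
  (* On this radius the quadratic term [a4 (rho - w0) ^ 2] has slope small against [|k|], so it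
     neither leaves the tube nor spoils the contraction. *)
  set (rad := Rmin (w0 / 4) (Rmin 1 (Rabs k / (64 * (Rabs a4 + 1))))).
  assert (Hrad : 0 < rad). { repeat apply Rmin_glb_lt; try lra. apply Rdiv_lt_0_compat; lra. }
  assert (Hrad1 : rad <= w0 / 4) by apply Rmin_l.
  assert (Hrad2 : rad <= 1) by (eapply Rle_trans; [apply Rmin_r|apply Rmin_l]).
  assert (Hrad3 : Rabs a4 * rad <= Rabs k / 64).
  { assert (H : rad <= Rabs k / (64 * (Rabs a4 + 1))) by (eapply Rle_trans; [apply Rmin_r|apply Rmin_r]).
    apply (Rmult_le_compat_l (Rabs a4 + 1)) in H; [|lra].
    replace ((Rabs a4 + 1) * (Rabs k / (64 * (Rabs a4 + 1)))) with (Rabs k / 64) in H by (field; lra). nra. }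
  (* The coupling [cc s] enters the radial equation at the same order [d ^ 2] as the linear rate, so
     it is tamed by the size of [s] and not by [d]. *)
  set (sig := Rmin 1 (Rabs k * rad / (64 * C))).
  assert (Hsig : 0 < sig). { apply Rmin_glb_lt; [lra|]. apply Rdiv_lt_0_compat; nra. }
  assert (Hsig1 : sig <= 1) by apply Rmin_l.
  assert (Hsig2 : C * sig <= Rabs k * rad / 64).
  { assert (H : sig <= Rabs k * rad / (64 * C)) by apply Rmin_r.
    apply (Rmult_le_compat_l C) in H; [|lra].
    replace (C * (Rabs k * rad / (64 * C))) with (Rabs k * rad / 64) in H by (field; lra). exact H. }
  (* [A] depends on [s] with a slope comparable to [C] before the factor [d ^ 2 / om]; the identity
     [|k| m = 8 C + |k|] lets this count as at most [|kw| m / 8] in the weighted norm. *)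
  set (m := 8 * C / Rabs k + 1).
  assert (Hm : 1 <= m). { assert (0 < 8 * C / Rabs k) by (apply Rdiv_lt_0_compat; lra). unfold m; lra. }
  assert (Hmk : Rabs k * m = 8 * C + Rabs k) by (unfold m; field; lra).
  set (ks := lam / om). assert (Hks : 0 < ks) by (apply Rdiv_lt_0_compat; auto).
  set (kap := Rabs k / om). assert (Hkap : 0 < kap) by (apply Rdiv_lt_0_compat; auto).
  (* Chosen from the discriminant for the cross term in [Hdiff]. The radial rate is [d ^ 2 kap] and
     the cross coefficient is of order [d], so both sides of the discriminant condition scale like
     [d ^ 2] and [K] can be independent of [d]; the condition then holds with equality in its last
     step. *)
  set (K := kap * ks / (64 * C ^ 2)).
  assert (HK : 0 < K). { apply Rdiv_lt_0_compat; [apply Rmult_lt_0_compat; auto|]. nra. }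
  assert (HKC : 64 * (K * C ^ 2) = kap * ks) by (unfold K; field; lra).
  refine (ev_imp _ _ _ (ev_and _ _ (ev_and _ _ KC (ev_and _ _ KL (ev_and _ _ KCd (ev_and _ _ KCw Th_bounds))))
    (ev_and _ _ (ev_lin (om * C) (Rabs k * rad / 64) ltac:(nra))
    (ev_and _ _ (ev_lin C (rad / 8) ltac:(lra))
    (ev_and _ _ (ev_lin C (sig / 2 * ks) ltac:(nra))
    (ev_and _ _ (ev_lin (8 * m * C) ks Hks)
    (ev_and _ _ (ev_lin (kap * m) (2 * K * C) ltac:(nra)) (ev_lin (12 * C) ks Hks)))))))).
  intros d Hd [[[BH1 [BH2 [Bw1 Bcc]]] [[LA [LB LE]] [Sd [Lwv TB]]]] [e1 [e2 [e3 [e4 [e5 e6]]]]]] HW Lf1 Lf2 Hex Huniq.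
  set (kw := d ^ 2 * k / om).
  assert (Hd2 : 0 < d ^ 2) by (apply pow_lt; auto).
  assert (Hkw : kw <> 0).
  { unfold kw, Rdiv. apply Rmult_integral_contrapositive; split;
      [apply Rmult_integral_contrapositive; split; [lra|auto]|apply Rinv_neq_0_compat; lra]. }
  assert (Akw : Rabs kw = d ^ 2 * kap).
  { unfold kw, kap, Rdiv. rewrite !Rabs_mult, Rabs_inv, (Rabs_right (d ^ 2)), (Rabs_right om) by lra. ring. }
  assert (inD : forall th rho s, in_tube w0 rad sig rho s -> D th rho s).
  { intros th rho s [I1 I2]. split; lra. }
  assert (posR : forall rho s, in_tube w0 rad sig rho s -> 0 < rho).
  { intros rho s H. pose proof (pdom_rho w0 0 rho s (inD 0 rho s H)). lra. }
  assert (posT : forall th rho s, in_tube w0 rad sig rho s -> 0 < Th d th rho s).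
  { intros th rho s H. pose proof (TB th rho s (inD th rho s H)). lra. }
  (* Lipschitz estimates at a common angle *)
  assert (dif : forall f th rho s rho' s', BL D C f -> in_tube w0 rad sig rho s -> in_tube w0 rad sig rho' s' ->
    Rabs (f th rho s - f th rho' s') <= C * (Rabs (rho - rho') + Rabs (s - s'))).
  { intros f th rho s rho' s' [_ Hf] I I'.
    pose proof (Hf _ _ _ _ _ _ (inD th rho s I) (inD th rho' s' I')) as Q.
    rewrite Rminus_diag, Rabs_R0, Rplus_0_l in Q. exact Q. }
  assert (EA : forall th rho s, A d th rho s = d ^ 2 / om * (a4 * (rho - w0) ^ 2 + at_polar (cc d) th rho s * s
                 + om * (d * H1 d th rho s))).
  { intros. unfold A, H0. field. lra. }
  assert (CA : forall th rho s rho' s', in_tube w0 rad sig rho s -> in_tube w0 rad sig rho' s' ->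
    Rabs (A d th rho s - A d th rho' s') <= Rabs kw * (/ 8 * (Rabs (rho - rho') + m * Rabs (s - s')))).
  { intros th rho s rho' s' I I'.
    pose proof (dif _ th _ _ _ _ BH1 I I') as Q1. pose proof (dif _ th _ _ _ _ Bcc I I') as Q2.
    rewrite !EA, <- Rmult_minus_distr_l, Rabs_mult, Akw.
    rewrite (Rabs_right (d ^ 2 / om)) by (left; apply Rdiv_lt_0_compat; lra).
    replace (d ^ 2 * kap * (/ 8 * (Rabs (rho - rho') + m * Rabs (s - s'))))
      with (d ^ 2 / om * (/ 8 * (Rabs k * Rabs (rho - rho') + Rabs k * m * Rabs (s - s'))))
      by (unfold kap; field; lra).
    apply Rmult_le_compat_l; [left; apply Rdiv_lt_0_compat; lra|].
    set (c := at_polar (cc d) th rho s) in *. set (c' := at_polar (cc d) th rho' s') in *.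
    replace (a4 * (rho - w0) ^ 2 + c * s + om * (d * H1 d th rho s)
             - (a4 * (rho' - w0) ^ 2 + c' * s' + om * (d * H1 d th rho' s')))
      with (a4 * ((rho - w0) + (rho' - w0)) * (rho - rho') + (c * (s - s') + (c - c') * s')
            + om * d * (H1 d th rho s - H1 d th rho' s')) by ring.
    destruct I as [I1 I2]. destruct I' as [I1' I2'].
    assert (Bc : Rabs c <= C) by (apply Bcc; split; lra).
    pose proof (Rabs_pos (rho - rho')) as Pr. pose proof (Rabs_pos (s - s')) as Ps.
    set (X := Rabs (rho - rho')) in *. set (Y := Rabs (s - s')) in *.
    assert (T1 : Rabs (a4 * ((rho - w0) + (rho' - w0)) * (rho - rho')) <= Rabs k / 32 * X).
    { rewrite !Rabs_mult. fold X. apply Rmult_le_compat_r; auto.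
      pose proof (Rabs_triang (rho - w0) (rho' - w0)). nra. }
    assert (T2 : Rabs (c * (s - s')) <= C * Y).
    { rewrite Rabs_mult. apply Rmult_le_compat_r; auto. }
    assert (T3 : Rabs ((c - c') * s') <= Rabs k / 64 * (X + Y)).
    { rewrite Rabs_mult. apply Rle_trans with (C * (X + Y) * sig).
      - apply Rmult_le_compat; auto using Rabs_pos.
      - replace (C * (X + Y) * sig) with (C * sig * (X + Y)) by ring. apply Rmult_le_compat_r; [lra|]. nra. }
    assert (T4 : Rabs (om * d * (H1 d th rho s - H1 d th rho' s')) <= Rabs k / 64 * (X + Y)).
    { rewrite Rabs_mult, (Rabs_right (om * d)) by (apply Rle_ge, Rmult_le_pos; lra).
      apply Rle_trans with (om * d * (C * (X + Y))).
      - apply Rmult_le_compat_l; auto. apply Rmult_le_pos; lra.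
      - replace (om * d * (C * (X + Y))) with (om * C * d * (X + Y)) by ring.
        apply Rmult_le_compat_r; [lra|]. nra. }
    eapply Rle_trans; [apply Rabs_triang|]. eapply Rle_trans; [apply Rplus_le_compat_r, Rabs_triang|].
    pose proof (Rabs_triang (c * (s - s')) ((c - c') * s')). rewrite Hmk.
    assert (0 <= Rabs k * X) by (apply Rmult_le_pos; lra). assert (0 <= Rabs k * Y) by (apply Rmult_le_pos; lra). nra. }
  assert (CB : forall th rho s rho' s', in_tube w0 rad sig rho s -> in_tube w0 rad sig rho' s' ->
    Rabs (B d th rho s - B d th rho' s') <= d * C * (Rabs (rho - rho') + Rabs (s - s'))).
  { intros th rho s rho' s' I I'. unfold B. rewrite <- Rmult_minus_distr_l, Rabs_mult, (Rabs_right d) by lra.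
    rewrite Rmult_assoc. apply Rmult_le_compat_l; [lra|]. apply dif; auto. }
  assert (CE : forall th rho s rho' s', in_tube w0 rad sig rho s -> in_tube w0 rad sig rho' s' ->
    Rabs (E d th rho s - E d th rho' s') <= / 8 * (Rabs (rho - rho') + Rabs (s - s'))).
  { intros th rho s rho' s' I I'. unfold E. rewrite <- Rmult_minus_distr_l, Rabs_mult, (Rabs_right d) by lra.
    pose proof (dif _ th _ _ _ _ Bw1 I I') as Q.
    pose proof (Rabs_pos (rho - rho')). pose proof (Rabs_pos (s - s')).
    apply Rle_trans with (d * (C * (Rabs (rho - rho') + Rabs (s - s')))); [apply Rmult_le_compat_l; lra|].
    rewrite <- Rmult_assoc. apply Rmult_le_compat_r; lra. }
  assert (tin : forall th rho s, tube w0 (rad / 2) (sig / 2) th rho s -> in_tube w0 rad sig rho s).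
  { intros th rho s [I1 I2]. split; lra. }
  assert (nk : 0 <= Rabs k * rad) by (apply Rmult_le_pos; lra).
  assert (tD : forall th rho s, tube w0 (rad / 2) (sig / 2) th rho s -> D th rho s) by eauto.
  (* The curve is sought in the tube of half size, which leaves room for neighbouring solutions in
     the full tube. The contraction budget is [1/8] each for [A], [E] and, after weighting by [m],
     [B]. *)
  destruct (periodic_solution (A d) (B d) (E d) kw ks w0 (rad / 2) (sig / 2) L (rad / 4) (rad / 4)
    (/ 8) (/ (8 * m)) (/ 8) m) as [rh [ss [Prh [Pss [Ht [Dw Ds]]]]]].
  { exact Hkw. } { lra. } { lra. } { lra. } { lra. }
  { intros; apply per_A. } { intros; apply per_B. } { intros; apply per_E. }
  { exact (BL_sub D _ _ _ LA tD). } { exact (BL_sub D _ _ _ LB tD). } { exact (BL_sub D _ _ _ LE tD). }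
  { intros th rho s I. pose proof (tin _ _ _ I) as I'. destruct I' as [I1 I2].
    rewrite EA, Rabs_mult, Akw, (Rabs_right (d ^ 2 / om)) by (left; apply Rdiv_lt_0_compat; lra).
    replace (rad / 4 * (d ^ 2 * kap)) with (d ^ 2 / om * (Rabs k * rad / 4)) by (unfold kap; field; lra).
    apply Rmult_le_compat_l; [left; apply Rdiv_lt_0_compat; lra|].
    assert (Bc : Rabs (at_polar (cc d) th rho s) <= C) by (apply Bcc; split; lra).
    assert (Bh : Rabs (H1 d th rho s) <= C) by (apply BH1; split; lra).
    assert (T1 : Rabs (a4 * (rho - w0) ^ 2) <= Rabs k * rad / 64).
    { rewrite Rabs_mult, <- RPow_abs. pose proof (Rabs_pos (rho - w0)).
      apply Rle_trans with (Rabs a4 * (rad * rad)); [|nra]. apply Rmult_le_compat_l; auto. nra. }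
    assert (T2 : Rabs (at_polar (cc d) th rho s * s) <= Rabs k * rad / 64).
    { rewrite Rabs_mult. eapply Rle_trans; [|exact Hsig2]. apply Rmult_le_compat; auto using Rabs_pos. }
    assert (T3 : Rabs (om * (d * H1 d th rho s)) <= Rabs k * rad / 64).
    { rewrite !Rabs_mult, (Rabs_right om), (Rabs_right d) by lra. eapply Rle_trans; [|exact e1].
      replace (om * C * d) with (om * (d * C)) by ring. apply Rmult_le_compat_l; [lra|]. apply Rmult_le_compat_l; lra. }
    eapply Rle_trans; [apply Rabs_triang|]. eapply Rle_trans; [apply Rplus_le_compat_r, Rabs_triang|]. lra. }
  { intros th rho s I. unfold E. rewrite Rabs_mult, (Rabs_right d) by lra.
    assert (Bh : Rabs (at_polar (w1 d) th rho s) <= C) by (apply Bw1, inD; eauto).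
    apply Rle_trans with (d * C); [apply Rmult_le_compat_l; lra|lra]. }
  { lra. }
  { intros th rho s I. unfold B. rewrite Rabs_mult, (Rabs_right d), (Rabs_right ks) by lra.
    assert (Bh : Rabs (H2 d th rho s) <= C) by (apply BH2, inD; eauto).
    apply Rle_trans with (d * C); [apply Rmult_le_compat_l; lra|lra]. }
  { intros th rho s rho' s' I I'. apply CA; eauto. }
  { intros th rho s rho' s' I I'. eapply Rle_trans; [apply CB; eauto|].
    rewrite (Rabs_right ks) by lra. pose proof (Rabs_pos (rho - rho')). pose proof (Rabs_pos (s - s')).
    replace (ks * (/ (8 * m) * (Rabs (rho - rho') + m * Rabs (s - s'))))
      with (ks * / (8 * m) * (Rabs (rho - rho') + m * Rabs (s - s'))) by ring.
    apply Rmult_le_compat; [nra|lra| |nra].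
    apply (Rmult_le_reg_r (8 * m)); [lra|]. rewrite (Rmult_assoc ks), Rinv_l by lra. lra. }
  { intros th rho s rho' s' I I'. eapply Rle_trans; [apply CE; eauto|].
    pose proof (Rabs_pos (rho - rho')). pose proof (Rabs_pos (s - s')).
    apply Rmult_le_compat_l; [lra|]. nra. }
  { repeat split; try lra. left; apply Rinv_0_lt_compat; lra. }
  { replace (m * / (8 * m)) with (/ 8) by (field; lra). lra. }
  assert (Htin : forall th, in_tube w0 rad sig (rh th) (ss th)) by (intros th; apply (tin th); apply Ht).
  destruct (closed_curve_orbit (sf1 d) (sf2 d) (sf3 d) (swv d) (sMv d) w0 rad sig kw ks K (om / 2) (2 * om)
    b Cd Cw rh ss) as [gam [T [G1 [G2 [G3 G4]]]]]; auto.
  { lra. } { lra. }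
  { intros th rho s I. rewrite ang_polar by eauto. apply TB; auto. }
  { intros th. rewrite M_polar by eauto. apply (der_ext (fun t => rh t + E d t (rh t) (ss t))).
    - intros x. unfold wcurve. rewrite wv_polar by eauto. reflexivity.
    - exact (Dw th). }
  { intros th. rewrite S_polar by eauto. exact (Ds th). }
  { intros th rho s rho' s' I I' dw ds. unfold dw, ds. clear dw ds.
    rewrite !M_polar, !S_polar, !wv_polar by eauto. fold kw ks.
    set (X := rho + E d th rho s - (rho' + E d th rho' s')).
    replace (- kw * (rho + E d th rho s - w0) + A d th rho s
             - (- kw * (rho' + E d th rho' s' - w0) + A d th rho' s') + kw * X)
      with (A d th rho s - A d th rho' s') by (unfold X; ring).
    replace (- ks * s + B d th rho s - (- ks * s' + B d th rho' s') + ks * (s - s'))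
      with (B d th rho s - B d th rho' s') by ring.
    pose proof (CA th _ _ _ _ I I') as QA. pose proof (CB th _ _ _ _ I I') as QB. pose proof (CE th _ _ _ _ I I') as QE.
    set (R := Rabs (rho - rho')) in *. rewrite <- (pow2_abs X), <- (pow2_abs (s - s')).
    set (Y := Rabs (s - s')) in *. set (x := Rabs X).
    assert (Px : 0 <= x) by apply Rabs_pos. assert (PY : 0 <= Y) by apply Rabs_pos. assert (PR : 0 <= R) by apply Rabs_pos.
    (* Since [E] has slope at most [1/8], the map from [rho] to [rho + E] can be inverted on
       differences; this bounds the radial difference by those of [w] and [s]. *)
    assert (HR : R <= 8 / 7 * x + / 7 * Y).
    { assert (R <= x + / 8 * (R + Y)); [|lra].
      unfold R at 1. replace (rho - rho') with (X + - (E d th rho s - E d th rho' s')) by (unfold X; ring).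
      eapply Rle_trans; [apply Rabs_triang|]. rewrite Rabs_Ropp. fold x. lra. }
    assert (Pk : 0 < Rabs kw) by (apply Rabs_pos_lt; auto).
    assert (Q1 : x * Rabs (A d th rho s - A d th rho' s') <= Rabs kw / 7 * x ^ 2 + Rabs kw * m * (x * Y)).
    { apply Rle_trans with (x * (Rabs kw * (/ 8 * (R + m * Y)))); [apply Rmult_le_compat_l; auto|].
      apply Rle_trans with (x * (Rabs kw * (/ 8 * (8 / 7 * x + / 7 * Y + m * Y)))).
      - apply Rmult_le_compat_l; auto. apply Rmult_le_compat_l; lra.
      - assert (0 <= Rabs kw * (x * Y)) by (repeat apply Rmult_le_pos; lra).
        assert (0 <= (m - 1) * (Rabs kw * (x * Y))) by (apply Rmult_le_pos; lra). nra. }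
    assert (Q2 : K * (Y * Rabs (B d th rho s - B d th rho' s')) <= 2 * K * d * C * (x * Y) + 2 * K * d * C * Y ^ 2).
    { apply Rle_trans with (K * (Y * (d * C * (R + Y)))).
      - apply Rmult_le_compat_l; [lra|]. apply Rmult_le_compat_l; auto.
      - apply Rle_trans with (K * (Y * (d * C * (2 * x + 2 * Y)))); [|right; ring].
        apply Rmult_le_compat_l; [lra|]. apply Rmult_le_compat_l; auto.
        apply Rmult_le_compat_l; [nra|lra]. }
    assert (YG : (Rabs kw * m + 2 * K * d * C) * (x * Y) <= Rabs kw / 4 * x ^ 2 + K * ks / 4 * Y ^ 2).
    { apply young; [lra|]. rewrite Akw.
      replace ((d ^ 2 * kap * m + 2 * K * d * C) ^ 2) with (d ^ 2 * (kap * m * d + 2 * K * C) ^ 2) by ring.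
      apply Rle_trans with (d ^ 2 * (4 * K * C) ^ 2).
      - apply Rmult_le_compat_l; [lra|]. apply pow_incr. assert (0 <= kap * m * d) by (apply Rmult_le_pos; [apply Rmult_le_pos|]; lra).
        assert (0 <= K * C) by nra. lra.
      - replace (4 * (d ^ 2 * kap / 4) * (K * ks / 4)) with (d ^ 2 * K * (kap * ks) / 4) by field.
        rewrite <- HKC. right. field. }
    assert (Q3 : 2 * K * d * C * Y ^ 2 <= K * ks / 4 * Y ^ 2).
    { apply Rmult_le_compat_r; [apply pow2_ge_0|]. assert (K * (12 * C * d) <= K * ks) by (apply Rmult_le_compat_l; lra).
      assert (0 <= K * ks) by nra. nra. }
    assert (0 <= Rabs kw * x ^ 2) by (apply Rmult_le_pos; [lra|apply pow2_ge_0]). lra. }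
  { intros th rho s rho' s' I I'. rewrite !wv_polar by eauto. pose proof (CE th _ _ _ _ I I') as QE.
    set (X := rho + E d th rho s - (rho' + E d th rho' s')).
    assert (Rabs (rho - rho') <= Rabs X + / 8 * (Rabs (rho - rho') + Rabs (s - s'))).
    { replace (rho - rho') with (X + - (E d th rho s - E d th rho' s')) at 1 by (unfold X; ring).
      eapply Rle_trans; [apply Rabs_triang|]. rewrite Rabs_Ropp. lra. }
    pose proof (Rabs_pos (s - s')). pose proof (Rabs_pos X). lra. }
  { intros th rho s I. rewrite M_polar, S_polar by eauto. apply Sd; auto. }
  { destruct Hb. repeat split; lra. }
  exists gam, T. split; [exact G1|]. split; [|split].
  - intros Pk. apply G3. unfold kw. apply Rdiv_lt_0_compat; auto. apply Rmult_lt_0_compat; auto.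
  - intros Pk. apply G4. unfold kw. apply Ropp_lt_cancel. rewrite Ropp_0.
    replace (- (d ^ 2 * k / om)) with (d ^ 2 * (- k) / om) by (field; lra).
    apply Rdiv_lt_0_compat; auto. apply Rmult_lt_0_compat; lra.
  - intros t. destruct (G2 t) as [th ->]. simpl. apply (pdom_box w0 b Hw0 Hb th). apply inD. apply Htin.
Qed.

End ScaledHopf.

(** * Conjugate vector fields *)

(** Pointwise in time, so that a single conjugacy serves solutions on the whole line and those on
    the half line. *)
Definition sol_at (F : R3 -> R3) (phi : R -> R3) (t : R) : Prop :=
  forall i, (i < 3)%nat -> is_derive (fun s => coord i (phi s)) t (coord i (F (phi t))).
Definition in_ball (b : R) (X : R3) : Prop := forall i, Rabs (coord i X) <= b.
(** Polynomial changes of variables are uniformly continuous on bounded sets only. Requiring just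
    one of the two points to lie in the ball is convenient for neighbourhoods of a bounded orbit. *)
Definition bounded_uc (Phi : R3 -> R3) : Prop := forall b e, 0 < e ->
  exists d, 0 < d /\ forall X Y, in_ball b X -> dist3 X Y < d -> dist3 (Phi X) (Phi Y) < e.

(** Both directions are stated for solution curves, so that the transport of stability needs no
    derivative or inverse function theorem for the maps themselves. *)
Record conj (F G Phi Psi : R3 -> R3) : Prop := {
  conj_l : forall X, Psi (Phi X) = X;
  conj_r : forall Y, Phi (Psi Y) = Y;
  conj_fwd : forall phi t, sol_at F phi t -> sol_at G (fun s => Phi (phi s)) t;
  conj_bwd : forall psi t, sol_at G psi t -> sol_at F (fun s => Psi (psi s)) t;
  conj_ucl : bounded_uc Phi;
  conj_ucr : bounded_uc Psi }.

Lemma conj_sym (F G Phi Psi : R3 -> R3) : conj F G Phi Psi -> conj G F Psi Phi.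
Proof. intros [H1 H2 H3 H4 H5 H6]. constructor; auto. Qed.

Section Conj.
Variables F G Phi Psi : R3 -> R3.
Hypothesis HC : conj F G Phi Psi.

Lemma conj_sol phi : is_sol F phi -> is_sol G (fun s => Phi (phi s)).
Proof. intros H t. apply (conj_fwd _ _ _ _ HC). intros i Hi. apply H; auto. Qed.

Lemma conj_fsol_bwd psi : is_fsol G psi -> is_fsol F (fun s => Psi (psi s)).
Proof. intros H t Ht. apply (conj_bwd _ _ _ _ HC). intros i Hi. apply H; auto. Qed.

Lemma conj_sol_bwd psi : is_sol G psi -> is_sol F (fun s => Psi (psi s)).
Proof. intros H t. apply (conj_bwd _ _ _ _ HC). intros i Hi. apply H; auto. Qed.

Lemma conj_existence : (forall X, exists phi, is_sol F phi /\ phi 0 = X) ->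
  forall Y, exists psi, is_sol G psi /\ psi 0 = Y.
Proof.
  intros H Y. destruct (H (Psi Y)) as [phi [H1 H2]]. exists (fun s => Phi (phi s)).
  split; [apply conj_sol; auto|]. rewrite H2. apply (conj_r _ _ _ _ HC).
Qed.

Lemma conj_uniqueness :
  (forall phi psi, is_sol F phi -> is_sol F psi -> phi 0 = psi 0 -> forall t, phi t = psi t) ->
  forall phi psi, is_sol G phi -> is_sol G psi -> phi 0 = psi 0 -> forall t, phi t = psi t.
Proof.
  intros H phi psi H1 H2 H0 t. rewrite <- (conj_r _ _ _ _ HC (phi t)), <- (conj_r _ _ _ _ HC (psi t)).
  f_equal. apply (H (fun s => Psi (phi s)) (fun s => Psi (psi s))); try apply conj_sol_bwd; auto.
  rewrite H0; reflexivity.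
Qed.

Let point_ball (X : R3) : exists b, in_ball b X.
Proof.
  exists (Rabs (coord 0 X) + Rabs (coord 1 X) + Rabs (coord 2 X)). intros i.
  pose proof (Rabs_pos (coord 0 X)). pose proof (Rabs_pos (coord 1 X)). pose proof (Rabs_pos (coord 2 X)).
  destruct i as [|[|i]]; [| |change (coord (S (S i)) X) with (coord 2 X)]; lra.
Qed.

Let uc_at Q (X : R3) e : bounded_uc Q -> 0 < e ->
  exists d, 0 < d /\ forall Y, dist3 Y X < d -> dist3 (Q Y) (Q X) < e.
Proof.
  intros H He. destruct (point_ball X) as [b Hb]. destruct (H b e He) as [d [Hd K]].
  exists d. split; auto. intros Y HY. rewrite dist3_sym. apply K; auto. rewrite dist3_sym; auto.
Qed.

Lemma conj_lyap x0 : lyap_stable F x0 -> lyap_stable G (Phi x0).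
Proof.
  intros H e He. destruct (uc_at Phi x0 e (conj_ucl _ _ _ _ HC) He) as [e' [He' K1]].
  destruct (H e' He') as [d' [Hd' K2]].
  destruct (uc_at Psi (Phi x0) d' (conj_ucr _ _ _ _ HC) Hd') as [d [Hd K3]].
  exists d. split; auto. intros psi Hpsi H0 t Ht.
  rewrite <- (conj_r _ _ _ _ HC (psi t)). apply K1.
  apply (K2 (fun s => Psi (psi s))); auto; [apply conj_fsol_bwd; auto|].
  specialize (K3 (psi 0) H0). rewrite (conj_l _ _ _ _ HC) in K3. exact K3.
Qed.

Lemma conj_asympt x0 : asympt_stable F x0 -> asympt_stable G (Phi x0).
Proof.
  intros [H [d' [Hd' K2]]]. split; [apply conj_lyap; auto|].
  destruct (uc_at Psi (Phi x0) d' (conj_ucr _ _ _ _ HC) Hd') as [d [Hd K3]].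
  exists d. split; auto. intros psi Hpsi H0.
  specialize (K3 (psi 0) H0). rewrite (conj_l _ _ _ _ HC) in K3.
  specialize (K2 (fun s => Psi (psi s)) (conj_fsol_bwd _ Hpsi) K3).
  apply is_lim_spec in K2. apply is_lim_spec. intros e.
  destruct (uc_at Phi x0 e (conj_ucl _ _ _ _ HC) (cond_pos e)) as [e' [He' K1]].
  destruct (K2 (mkposreal e' He')) as [M HM]. exists M. intros t Ht. specialize (HM t Ht). simpl in HM.
  rewrite Rminus_0_r in *. rewrite Rabs_right in * by (apply Rle_ge, dist3_pos).
  rewrite <- (conj_r _ _ _ _ HC (psi t)). apply K1. exact HM.
Qed.

Variable gam : R -> R3.

Lemma conj_periodic T : periodic_orbit F gam T -> periodic_orbit G (fun s => Phi (gam s)) T.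
Proof.
  intros [H1 [H2 [H3 [t H4]]]]. split; [auto|split; [apply conj_sol; auto|split]].
  - intros s. rewrite H3; reflexivity.
  - exists t. intros E. apply H4. rewrite <- (conj_l _ _ _ _ HC (gam t)), E. apply (conj_l _ _ _ _ HC).
Qed.

Variable b : R.
Hypothesis Hb : forall s, in_ball b (gam s).
Variable b' : R.
Hypothesis Hb' : forall s, in_ball b' (Phi (gam s)).

Let near_fwd e : 0 < e -> exists d, 0 < d /\ forall X, near_orbit gam X d -> near_orbit (fun s => Phi (gam s)) (Phi X) e.
Proof.
  intros He. destruct (conj_ucl _ _ _ _ HC b e He) as [d [Hd K]]. exists d. split; auto.
  intros X [s Hs]. exists s. rewrite dist3_sym. apply K; auto. rewrite dist3_sym; auto.
Qed.

Let near_bwd e : 0 < e -> exists d, 0 < d /\ forall Y, near_orbit (fun s => Phi (gam s)) Y d -> near_orbit gam (Psi Y) e.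
Proof.
  intros He. destruct (conj_ucr _ _ _ _ HC b' e He) as [d [Hd K]]. exists d. split; auto.
  intros X [s Hs]. exists s. rewrite <- (conj_l _ _ _ _ HC (gam s)). rewrite dist3_sym.
  apply K; auto. rewrite dist3_sym; auto.
Qed.

Lemma conj_orbit_stable : orbit_stable F gam -> orbit_stable G (fun s => Phi (gam s)).
Proof.
  intros H e He. destruct (near_fwd e He) as [e' [He' K1]]. destruct (H e' He') as [d' [Hd' K2]].
  destruct (near_bwd d' Hd') as [d [Hd K3]]. exists d. split; auto. intros psi Hpsi H0 t Ht.
  rewrite <- (conj_r _ _ _ _ HC (psi t)). apply K1.
  apply (K2 (fun s => Psi (psi s))); auto. apply conj_fsol_bwd; auto.
Qed.

Lemma conj_orbit_asympt : orbit_asympt_stable F gam -> orbit_asympt_stable G (fun s => Phi (gam s)).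
Proof.
  intros [H [d' [Hd' K2]]]. split; [apply conj_orbit_stable; auto|].
  destruct (near_bwd d' Hd') as [d [Hd K3]]. exists d. split; auto. intros psi Hpsi H0 e He.
  destruct (near_fwd e He) as [e' [He' K1]].
  destruct (K2 (fun s => Psi (psi s)) (conj_fsol_bwd _ Hpsi) (K3 _ H0) e' He') as [T0 HT].
  exists T0. intros t Ht. rewrite <- (conj_r _ _ _ _ HC (psi t)). apply K1. apply HT; auto.
Qed.

End Conj.

Lemma conj_unstable (F G Phi Psi : R3 -> R3) x0 : conj F G Phi Psi -> unstable_eq F x0 -> unstable_eq G (Phi x0).
Proof.
  intros HC H K. apply H. rewrite <- (conj_l _ _ _ _ HC x0).
  apply (conj_lyap G F Psi Phi (conj_sym _ _ _ _ HC)). exact K.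
Qed.

Lemma conj_orbit_unstable (F G Phi Psi : R3 -> R3) (gam : R -> R3) (b b' : R) :
  conj F G Phi Psi -> (forall s, in_ball b (gam s)) -> (forall s, in_ball b' (Phi (gam s))) ->
  orbit_unstable F gam -> orbit_unstable G (fun s => Phi (gam s)).
Proof.
  intros HC Hb Hb' H K. apply H.
  assert (E : forall s, Psi (Phi (gam s)) = gam s) by (intros; apply (conj_l _ _ _ _ HC)).
  pose proof (conj_orbit_stable G F Psi Phi (conj_sym _ _ _ _ HC) (fun s => Phi (gam s)) b' Hb' b
    ltac:(intros s; cbv beta; rewrite E; auto) K) as K'.
  intros e He. destruct (K' e He) as [d [Hd Q]]. exists d. split; auto. intros phi Hphi [s Hs] t Ht.
  destruct (Q phi Hphi) with (t := t) as [s' Hs']; auto.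
  - exists s. cbv beta. rewrite E. auto.
  - exists s'. cbv beta in Hs'. rewrite E in Hs'. auto.
Qed.

(** * Lyapunov and Chetaev functions *)

Definition sqn (u v S : R) : R := u ^ 2 + v ^ 2 + S ^ 2.

Lemma dist3_origin (Y : R3) : dist3 Y (0, 0, 0) = sqrt (sqn (coord 0 Y) (coord 1 Y) (coord 2 Y)).
Proof. unfold dist3, sqn. f_equal. simpl. ring. Qed.

Lemma dist3_origin_lt (Y : R3) (e : R) : 0 < e ->
  (dist3 Y (0, 0, 0) < e <-> sqn (coord 0 Y) (coord 1 Y) (coord 2 Y) < e ^ 2).
Proof.
  intros He. rewrite dist3_origin.
  assert (P : 0 <= sqn (coord 0 Y) (coord 1 Y) (coord 2 Y)) by (unfold sqn; nra).
  split; intros H.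
  - rewrite <- (pow2_sqrt (sqn (coord 0 Y) (coord 1 Y) (coord 2 Y))) by auto.
    pose proof (sqrt_pos (sqn (coord 0 Y) (coord 1 Y) (coord 2 Y))). nra.
  - rewrite <- (sqrt_pow2 e) by lra. apply sqrt_lt_1_alt. lra.
Qed.

Section Lyapunov.
Variables f1 f2 f3 V : R -> R -> R -> R.
Variables r0 c1 c2 c : R.
Hypothesis Hr0 : 0 < r0.
Hypothesis Hc : 0 < c.

Let Vt (phi : R -> R3) t := V (coord 0 (phi t)) (coord 1 (phi t)) (coord 2 (phi t)).
Let nt (phi : R -> R3) t := sqn (coord 0 (phi t)) (coord 1 (phi t)) (coord 2 (phi t)).

Let nt_cont phi t : is_fsol (vf3 f1 f2 f3) phi -> 0 <= t -> continuous (nt phi) t.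
Proof.
  intros H Ht. pose proof (H t Ht 0%nat ltac:(lia)) as D0. pose proof (H t Ht 1%nat ltac:(lia)) as D1.
  pose proof (H t Ht 2%nat ltac:(lia)) as D2.
  eapply is_derive_continuous.
  apply (der_ext (fun t => coord 0 (phi t) * coord 0 (phi t) + coord 1 (phi t) * coord 1 (phi t)
    + coord 2 (phi t) * coord 2 (phi t))); [intros; unfold nt, sqn; ring|].
  apply (der_plus (fun t => coord 0 (phi t) * coord 0 (phi t) + coord 1 (phi t) * coord 1 (phi t)));
    [apply (der_plus (fun t => coord 0 (phi t) * coord 0 (phi t)))|];
    (eapply der_mult; [first [exact D0|exact D1|exact D2]|first [exact D0|exact D1|exact D2]]).
Qed.

(** The rate is [V ^ 2] and not [V], because at the critical parameter [V] is like [r^2] while its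
    derivative is only like [- r^4]. Attraction follows since [V] cannot stay above a level [w]
    longer than [V 0 / (c w ^ 2)]. *)
Lemma lyapunov_asympt : 0 < c1 -> 0 < c2 ->
  (forall u v S, sqn u v S <= r0 ^ 2 -> c1 * sqn u v S <= V u v S <= c2 * sqn u v S) ->
  (forall (u v S : R -> R) (t : R), sqn (u t) (v t) (S t) <= r0 ^ 2 ->
     is_derive u t (f1 (u t) (v t) (S t)) -> is_derive v t (f2 (u t) (v t) (S t)) ->
     is_derive S t (f3 (u t) (v t) (S t)) ->
     exists l, is_derive (fun t => V (u t) (v t) (S t)) t l /\ l <= - c * V (u t) (v t) (S t) ^ 2) ->
  asympt_stable (vf3 f1 f2 f3) (0, 0, 0).
Proof.
  intros Hc1 Hc2 HV HD.
  assert (D : forall phi T, is_fsol (vf3 f1 f2 f3) phi -> (forall t, 0 <= t <= T -> nt phi t <= r0 ^ 2) ->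
    forall t, 0 <= t <= T -> exists l, is_derive (Vt phi) t l /\ l <= - c * Vt phi t ^ 2).
  { intros phi T Hphi HT t Ht. apply (HD (fun t => coord 0 (phi t)) (fun t => coord 1 (phi t)) (fun t => coord 2 (phi t))).
    - apply HT; auto.
    - exact (Hphi t (proj1 Ht) 0%nat ltac:(lia)).
    - exact (Hphi t (proj1 Ht) 1%nat ltac:(lia)).
    - exact (Hphi t (proj1 Ht) 2%nat ltac:(lia)). }
  assert (Mono : forall phi T, 0 <= T -> is_fsol (vf3 f1 f2 f3) phi -> (forall t, 0 <= t <= T -> nt phi t <= r0 ^ 2) ->
    forall a, 0 <= a <= T -> Vt phi T <= Vt phi a).
  { intros phi T HT0 Hphi HT a Ha. apply (derive_nonpos (Vt phi) (Derive (Vt phi))); [lra| |].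
    - intros t Ht. destruct (D phi T Hphi HT t ltac:(lra)) as [l [Hl _]]. apply Derive_correct. exists l; auto.
    - intros t Ht. destruct (D phi T Hphi HT t ltac:(lra)) as [l [Hl Hl']].
      rewrite (is_derive_unique _ _ _ Hl). pose proof (pow2_ge_0 (Vt phi t)). nra. }
  assert (St : forall e, 0 < e -> exists d, 0 < d /\ forall phi, is_fsol (vf3 f1 f2 f3) phi ->
    dist3 (phi 0) (0, 0, 0) < d -> forall t, 0 <= t -> nt phi t < e ^ 2 /\ nt phi t <= r0 ^ 2).
  { intros e He. set (e' := Rmin e r0). assert (He' : 0 < e') by (apply Rmin_glb_lt; auto).
    assert (E1 : e' <= e) by apply Rmin_l. assert (E2 : e' <= r0) by apply Rmin_r.
    assert (E3 : e' ^ 2 <= e ^ 2) by (apply pow_incr; lra). assert (E4 : e' ^ 2 <= r0 ^ 2) by (apply pow_incr; lra).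
    (* With this factor [sqn < (e' q) ^ 2] gives [V 0 < c1 e' ^ 2], which keeps the solution inside
       the ball of radius [e'] through the lower bound on [V]. *)
    set (q := sqrt (c1 / (c1 + c2))).
    assert (Hq : 0 < q) by (apply sqrt_lt_R0, Rdiv_lt_0_compat; lra).
    assert (Hq2 : q ^ 2 = c1 / (c1 + c2)) by (apply pow2_sqrt; left; apply Rdiv_lt_0_compat; lra).
    exists (e' * q). split; [apply Rmult_lt_0_compat; auto|]. intros phi Hphi H0.
    apply dist3_origin_lt in H0; [|apply Rmult_lt_0_compat; auto]. fold (nt phi 0) in H0.
    rewrite Rpow_mult_distr, Hq2 in H0.
    assert (Hq3 : c1 / (c1 + c2) <= 1).
    { apply (Rmult_le_reg_r (c1 + c2)); [lra|]. unfold Rdiv. rewrite Rmult_assoc, Rinv_l by lra. lra. }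
    assert (Hp : 0 < e' ^ 2) by (apply pow_lt; auto).
    assert (H00 : nt phi 0 < e' ^ 2) by nra.
    assert (HV0 : Vt phi 0 < c1 * e' ^ 2).
    { destruct (HV (coord 0 (phi 0)) (coord 1 (phi 0)) (coord 2 (phi 0))) as [_ U]; [fold (nt phi 0); lra|].
      fold (Vt phi 0) in U. fold (nt phi 0) in U.
      apply Rle_lt_trans with (1 := U). apply Rlt_le_trans with (c2 * (e' ^ 2 * (c1 / (c1 + c2)))).
      - apply Rmult_lt_compat_l; auto.
      - replace (c2 * (e' ^ 2 * (c1 / (c1 + c2)))) with (c1 * e' ^ 2 * (c2 / (c1 + c2))) by (field; lra).
        assert (c2 / (c1 + c2) <= 1).
        2:{ rewrite <- (Rmult_1_r (c1 * e' ^ 2)) at 2. apply Rmult_le_compat_l; [apply Rmult_le_pos|]; lra. }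
        apply (Rmult_le_reg_r (c1 + c2)); [lra|]. unfold Rdiv. rewrite Rmult_assoc, Rinv_l by lra. lra. }
    assert (Hf : forall t, 0 <= t -> nt phi t - e' ^ 2 < 0).
    { apply (first_exit (fun t => nt phi t - e' ^ 2)).
      - intros t Ht. apply (continuous_minus (nt phi)); [|apply continuous_const]. apply nt_cont; auto.
      - lra.
      - intros T HT0 HT.
        assert (HT' : forall t, 0 <= t <= T -> nt phi t <= r0 ^ 2) by (intros t Ht; specialize (HT t Ht); lra).
        pose proof (Mono phi T HT0 Hphi HT' 0 ltac:(lra)) as M.
        destruct (HV (coord 0 (phi T)) (coord 1 (phi T)) (coord 2 (phi T))) as [Lo _];
          [fold (nt phi T); apply HT'; lra|].
        fold (Vt phi T) in Lo. fold (nt phi T) in Lo. nra. }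
    intros t Ht. specialize (Hf t Ht). lra. }
  split.
  - intros e He. destruct (St e He) as [d [Hd K]]. exists d. split; auto. intros phi Hphi H0 t Ht.
    apply dist3_origin_lt; auto. apply (K phi Hphi H0 t Ht).
  - destruct (St r0 Hr0) as [d [Hd K]]. exists d. split; auto. intros phi Hphi H0.
    apply is_lim_spec. intros e. pose proof (cond_pos e) as He. set (w := c1 * e ^ 2 / 2).
    assert (He2 : 0 < e ^ 2) by (apply pow_lt; auto).
    assert (Hw : 0 < w) by (unfold w; nra).
    assert (HB : forall t, 0 <= t -> nt phi t <= r0 ^ 2) by (intros t Ht; apply (K phi Hphi H0 t Ht)).
    assert (Pn : forall t, 0 <= nt phi t) by (intros; unfold nt, sqn; nra).
    assert (Lo : forall t, 0 <= t -> c1 * nt phi t <= Vt phi t) by (intros t Ht; apply HV, HB; auto).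
    set (T0 := Vt phi 0 / (c * w ^ 2)).
    assert (HT0 : 0 <= T0).
    { apply Rmult_le_pos; [specialize (Lo 0 ltac:(lra)); specialize (Pn 0); nra|].
      left; apply Rinv_0_lt_compat. apply Rmult_lt_0_compat; auto. apply pow_lt; auto. }
    exists T0. intros t Ht.
    assert (HVt : Vt phi t <= w).
    { destruct (Rle_dec (Vt phi t) w) as [|Hn]; auto. exfalso.
      assert (Up : Vt phi t + c * w ^ 2 * (t - 0) <= Vt phi 0).
      { pose proof (derive_lower (fun t => - Vt phi t) (fun t => - Derive (Vt phi) t) (c * w ^ 2) 0 t ltac:(lra)) as L.
        enough (- Vt phi 0 + c * w ^ 2 * (t - 0) <= - Vt phi t) by lra. apply L.
        - intros u Hu. destruct (D phi t Hphi ltac:(intros; apply HB; lra) u Hu) as [l [Hl _]].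
          apply (is_derive_opp (Vt phi)). apply Derive_correct. exists l; auto.
        - intros u Hu. destruct (D phi t Hphi ltac:(intros; apply HB; lra) u Hu) as [l [Hl Hl']].
          rewrite (is_derive_unique _ _ _ Hl).
          pose proof (Mono phi t ltac:(lra) Hphi ltac:(intros; apply HB; lra) u Hu).
          assert (w ^ 2 <= Vt phi u ^ 2) by (apply pow_incr; lra). nra. }
      assert (E : c * w ^ 2 * T0 = Vt phi 0).
      { unfold T0. field. split; lra. }
      assert (0 < c * w ^ 2) by (apply Rmult_lt_0_compat; auto; apply pow_lt; auto). nra. }
    rewrite Rminus_0_r, Rabs_right by (apply Rle_ge, dist3_pos). apply dist3_origin_lt; auto.
    fold (nt phi t). specialize (Lo t ltac:(lra)). unfold w in HVt. nra.
Qed.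

(** The growth condition is demanded only where [V > 0]. A solution starting there with value [w]
    keeps [V > w / 2] by a bootstrap, hence gains at least [c (w / 2) ^ 2] per unit of time and
    exceeds the bound [c2]. *)
Lemma chetaev_unstable :
  (forall u v S, sqn u v S <= r0 ^ 2 -> V u v S <= c2) ->
  (forall d, 0 < d -> exists u v S, sqn u v S < d ^ 2 /\ 0 < V u v S) ->
  (forall (u v S : R -> R) (t : R), sqn (u t) (v t) (S t) <= r0 ^ 2 ->
     is_derive u t (f1 (u t) (v t) (S t)) -> is_derive v t (f2 (u t) (v t) (S t)) ->
     is_derive S t (f3 (u t) (v t) (S t)) ->
     exists l, is_derive (fun t => V (u t) (v t) (S t)) t l /\
       (0 < V (u t) (v t) (S t) -> c * V (u t) (v t) (S t) ^ 2 <= l)) ->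
  (forall Y0, exists phi, is_sol (vf3 f1 f2 f3) phi /\ phi 0 = Y0) ->
  unstable_eq (vf3 f1 f2 f3) (0, 0, 0).
Proof.
  intros HV Hpt HD Hex Hst. destruct (Hst r0 Hr0) as [d [Hd K]].
  destruct (Hpt d Hd) as [u0 [v0 [S0 [Hn HV0]]]]. destruct (Hex (u0, v0, S0)) as [phi [Hs H0]].
  assert (Hphi : is_fsol (vf3 f1 f2 f3) phi) by (intros t _ i Hi; apply Hs; auto).
  assert (HB : forall t, 0 <= t -> nt phi t <= r0 ^ 2).
  { intros t Ht. left. apply (dist3_origin_lt (phi t)); auto. apply K; auto. rewrite H0.
    apply dist3_origin_lt; auto. }
  assert (D : forall t, 0 <= t -> exists l, is_derive (Vt phi) t l /\ (0 < Vt phi t -> c * Vt phi t ^ 2 <= l)).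
  { intros t Ht. apply (HD (fun t => coord 0 (phi t)) (fun t => coord 1 (phi t)) (fun t => coord 2 (phi t))).
    - apply HB; auto.
    - exact (Hphi t Ht 0%nat ltac:(lia)).
    - exact (Hphi t Ht 1%nat ltac:(lia)).
    - exact (Hphi t Ht 2%nat ltac:(lia)). }
  set (w := Vt phi 0). assert (Hw : 0 < w) by (unfold w, Vt; rewrite H0; exact HV0).
  assert (G : forall m T, 0 <= T -> 0 <= m -> (forall t, 0 <= t <= T -> 0 < Vt phi t /\ m <= c * Vt phi t ^ 2) ->
    w + m * T <= Vt phi T).
  { intros m T HT Hm H. rewrite <- (Rminus_0_r T) at 1. apply (derive_lower (Vt phi) (Derive (Vt phi))); auto.
    - intros t Ht. destruct (D t ltac:(lra)) as [l [Hl _]]. apply Derive_correct. exists l; auto.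
    - intros t Ht. destruct (D t ltac:(lra)) as [l [Hl Hl']]. rewrite (is_derive_unique _ _ _ Hl).
      destruct (H t Ht). specialize (Hl' ltac:(lra)). lra. }
  assert (Hf : forall t, 0 <= t -> w / 2 - Vt phi t < 0).
  { apply (first_exit (fun t => w / 2 - Vt phi t)).
    - intros t Ht. apply (continuous_minus (fun _ => w / 2)); [apply continuous_const|].
      destruct (D t Ht) as [l [Hl _]]. exact (is_derive_continuous _ _ _ Hl).
    - fold w; lra.
    - intros T HT0 HT. pose proof (G 0 T HT0 ltac:(lra)) as Q.
      assert (w + 0 * T <= Vt phi T); [|lra]. apply Q. intros t Ht. specialize (HT t Ht).
      pose proof (pow2_ge_0 (Vt phi t)). split; [lra|nra]. }
  set (m := c * (w / 2) ^ 2). assert (Hm : 0 < m) by (apply Rmult_lt_0_compat; auto; apply pow_lt; lra).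
  set (T := (Rabs c2 + 1) / m). assert (HT : 0 <= T).
  { apply Rmult_le_pos; [pose proof (Rabs_pos c2); lra|left; apply Rinv_0_lt_compat; auto]. }
  pose proof (G m T HT ltac:(lra)) as Q.
  assert (Q' : w + m * T <= Vt phi T).
  { apply Q. intros t Ht. specialize (Hf t ltac:(lra)). split; [lra|].
    unfold m. apply Rmult_le_compat_l; [lra|]. apply pow_incr; lra. }
  pose proof (HV _ _ _ (HB T HT)) as Bd. fold (Vt phi T) in Bd.
  assert (E : m * T = Rabs c2 + 1) by (unfold T; field; lra). pose proof (Rle_abs c2). lra.
Qed.

End Lyapunov.

(** * Hopf bifurcation in normal coordinates *)

Lemma le_zero_of_small (x c : R) : 0 <= c -> (forall e, 0 < e <= 1 -> x <= c * e) -> x <= 0.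
Proof.
  intros Hc H. destruct (Rle_dec x 0) as [|Hp]; auto. exfalso.
  set (e := Rmin 1 (x / (2 * (c + 1)))).
  assert (He : 0 < e) by (apply Rmin_glb_lt; [lra|apply Rdiv_lt_0_compat; lra]).
  assert (He1 : e <= 1) by apply Rmin_l. assert (He2 : e <= x / (2 * (c + 1))) by apply Rmin_r.
  specialize (H e ltac:(lra)). apply (Rmult_le_compat_l (c + 1)) in He2; [|lra].
  replace ((c + 1) * (x / (2 * (c + 1)))) with (x / 2) in He2 by (field; lra). nra.
Qed.

(** Unscaling: the point [(u / d, v / d, S / d ^ 2)] lies in the unit box, and [tau = 0] puts the
    parameter at its critical value. The case [d = 0] is reached as a limit, since the scaled order
    is defined for positive [d] only. *)
Lemma ord_bound_22 (k : nat) f : Ord 2 2 (S k) f -> exists C, 0 <= C /\ forall u v S d,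
  0 <= d <= 1 -> Rabs u <= d -> Rabs v <= d -> Rabs S <= d ^ 2 -> Rabs (f 0 u v S) <= C * d ^ (Datatypes.S k).
Proof.
  intros H. destruct (H 1 ltac:(lra)) as [C [HC K]]. exists C. split; auto.
  assert (P : forall u v S d, 0 < d <= 1 -> Rabs u <= d -> Rabs v <= d -> Rabs S <= d ^ 2 ->
    Rabs (f 0 u v S) <= C * d ^ (Datatypes.S k)).
  { intros u v S d Hd Hu Hv HS. destruct (K d 0 Hd ltac:(rewrite Rabs_R0; lra)) as [B _].
    assert (Hd2 : 0 < d ^ 2) by (apply pow_lt; lra).
    specialize (B (u / d) (v / d) (S / d ^ 2)).
    replace (0 * d ^ 2) with 0 in B by ring. replace (d * (u / d)) with u in B by (field; lra).
    replace (d * (v / d)) with v in B by (field; lra). replace (d ^ 2 * (S / d ^ 2)) with S in B by (field; lra).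
    apply B.
    assert (Q : forall x e, 0 < e -> Rabs x <= e -> Rabs (x / e) <= 1).
    { intros x e He Hx. unfold Rdiv. rewrite Rabs_mult, Rabs_inv, (Rabs_right e) by lra.
      apply (Rmult_le_reg_r e); auto. rewrite Rmult_assoc, Rinv_l by lra. lra. }
    repeat split; apply Q; auto; lra. }
  intros u v S d Hd Hu Hv HS. destruct (Req_dec d 0) as [->|Hn]; [|apply P; auto; lra].
  assert (Z : forall x, Rabs x <= 0 -> x = 0).
  { intros x Hx. apply Rabs_eq_0. pose proof (Rabs_pos x). lra. }
  rewrite (Z u Hu), (Z v Hv), (Z S) by (simpl in HS; lra).
  replace (C * 0 ^ Datatypes.S k) with 0 by (simpl; ring).
  apply (le_zero_of_small _ C HC). intros d Hd1.
  pose proof (P 0 0 0 d ltac:(lra)) as Q. rewrite Rabs_R0 in Q.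
  specialize (Q ltac:(lra) ltac:(lra) ltac:(left; apply pow_lt; lra)).
  eapply Rle_trans; [exact Q|]. apply Rmult_le_compat_l; auto.
  rewrite <- (pow_1 d) at 2. apply pow_le_1_decr; [lra|lia].
Qed.

(** With weight 0 the parameter is held fixed, and with weight 1 for all three coordinates the order
    counts the ordinary degree; this serves the linear stability analysis off criticality. *)
Lemma ord_bound_01 (k : nat) f : Ord 0 1 (S k) f -> exists C, 0 <= C /\ forall n u v S d, Rabs n <= 1 ->
  0 < d <= 1 -> Rabs u <= d -> Rabs v <= d -> Rabs S <= d -> Rabs (f n u v S) <= C * d ^ (Datatypes.S k).
Proof.
  intros H. destruct (H 1 ltac:(lra)) as [C [HC K]]. exists C. split; auto.
  intros n u v S d Hn Hd Hu Hv HS. destruct (K d n Hd Hn) as [B _].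
  specialize (B (u / d) (v / d) (S / d)).
  replace (n * d ^ 0) with n in B by (simpl; ring). replace (d * (u / d)) with u in B by (field; lra).
  replace (d * (v / d)) with v in B by (field; lra). replace (d ^ 1 * (S / d)) with S in B by (field; lra).
  apply B.
  assert (Q : forall x e, 0 < e -> Rabs x <= e -> Rabs (x / e) <= 1).
  { intros x e He Hx. unfold Rdiv. rewrite Rabs_mult, Rabs_inv, (Rabs_right e) by lra.
    apply (Rmult_le_reg_r e); auto. rewrite Rmult_assoc, Rinv_l by lra. lra. }
  repeat split; apply Q; auto; lra.
Qed.

Lemma linear_bound (b1 b2 b3 u v S : R) :
  Rabs (b1 * u + b2 * v + b3 * S) <= (Rabs b1 + Rabs b2 + Rabs b3) * (Rabs u + Rabs v + Rabs S).
Proof.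
  eapply Rle_trans; [apply Rabs_triang|]. eapply Rle_trans; [apply Rplus_le_compat_r, Rabs_triang|].
  rewrite !Rabs_mult.
  pose proof (Rabs_pos b1). pose proof (Rabs_pos b2). pose proof (Rabs_pos b3).
  pose proof (Rabs_pos u). pose proof (Rabs_pos v). pose proof (Rabs_pos S). nra.
Qed.

Lemma sqn_pos (u v S : R) : 0 <= sqn u v S.
Proof. unfold sqn. nra. Qed.

Lemma abs_le_of_sq (x y : R) : x ^ 2 <= y ^ 2 -> 0 <= y -> Rabs x <= y.
Proof. intros H Hy. rewrite <- (Rabs_right y) by lra. apply Rsqr_le_abs_0. unfold Rsqr. nra. Qed.

Lemma sign_abs (sg : R) : sg * sg = 1 -> Rabs sg = 1.
Proof.
  intros H. assert (Rabs sg * Rabs sg = 1) by (rewrite <- Rabs_mult, H; apply Rabs_R1).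
  pose proof (Rabs_pos sg). nra.
Qed.

Lemma abs_mul_le (u v : R) : Rabs u * Rabs v <= u ^ 2 + v ^ 2.
Proof. rewrite <- (pow2_abs u), <- (pow2_abs v). pose proof (pow2_ge_0 (Rabs u - Rabs v)). nra. Qed.

Lemma cross_terms (an M h s T1 T2 : R) : 0 <= an <= 1 -> 1 <= M -> 0 <= h -> 0 <= s ->
  T1 <= 2 * M * (s * (h + s)) -> T2 <= 2 * (an * (M * h)) * (M * (h + s)) ->
  T1 + T2 <= 8 * M ^ 2 * (h * s) + 8 * M ^ 2 * s ^ 2 + 8 * M ^ 2 * an * h ^ 2.
Proof.
  intros Ha HM Hh Hs H1 H2.
  assert (HM2 : M <= M ^ 2) by nra.
  assert (P1 : 0 <= h * s) by nra. assert (P2 : 0 <= s ^ 2) by nra. assert (P3 : 0 <= h ^ 2) by nra.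
  assert (A1 : M * (h * s) <= M ^ 2 * (h * s)) by (apply Rmult_le_compat_r; auto).
  assert (A2 : M * s ^ 2 <= M ^ 2 * s ^ 2) by (apply Rmult_le_compat_r; auto).
  assert (A3 : 0 <= M ^ 2 * (h * s)) by (apply Rmult_le_pos; nra).
  assert (A4 : 0 <= M ^ 2 * s ^ 2) by (apply Rmult_le_pos; nra).
  assert (A5 : 0 <= an * h ^ 2) by (apply Rmult_le_pos; lra).
  assert (A6 : 0 <= M ^ 2 * (an * h ^ 2)) by (apply Rmult_le_pos; nra).
  assert (A7 : an * (M ^ 2 * (h * s)) <= 1 * (M ^ 2 * (h * s))) by (apply Rmult_le_compat_r; lra).
  replace (2 * (an * (M * h)) * (M * (h + s))) with (2 * (M ^ 2 * (an * h ^ 2)) + 2 * (an * (M ^ 2 * (h * s)))) in H2 by ring.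
  lra.
Qed.

Lemma small_region (d0 : R) : 0 < d0 -> exists r0, 0 < r0 <= 1 /\ forall u v S, sqn u v S <= r0 ^ 2 ->
  sqrt (u ^ 2 + v ^ 2 + Rabs S) <= d0 /\ Rabs S <= 1.
Proof.
  intros Hd. set (r0 := Rmin 1 (d0 ^ 2 / 2)).
  assert (Hr : 0 < r0) by (apply Rmin_glb_lt; [lra|]; assert (0 < d0 ^ 2) by (apply pow_lt; lra); lra).
  assert (R1 : r0 <= 1) by apply Rmin_l. assert (R2 : r0 <= d0 ^ 2 / 2) by apply Rmin_r.
  exists r0. split; [lra|]. intros u v S H. unfold sqn in H.
  assert (HS : Rabs S <= r0).
  { rewrite <- (Rabs_right r0) by lra. apply Rsqr_le_abs_0. unfold Rsqr. nra. }
  split; [|lra]. rewrite <- (sqrt_pow2 d0) by lra. apply sqrt_le_1_alt. nra.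
Qed.

Lemma BL_unscale (D : R -> R -> R -> Prop) (C x : R) f : 0 < x -> BL D (C * x) f -> BL D C (fun p q s => f p q s * / x).
Proof.
  intros Hx [H1 H2]. assert (Hi : 0 < / x) by (apply Rinv_0_lt_compat; auto). split; intros.
  - rewrite Rabs_mult, (Rabs_right (/ x)) by lra. specialize (H1 _ _ _ H).
    apply (Rmult_le_reg_r x); auto. rewrite Rmult_assoc, Rinv_l by lra. lra.
  - rewrite <- Rmult_minus_distr_r, Rabs_mult, (Rabs_right (/ x)) by lra. specialize (H2 _ _ _ _ _ _ H H0).
    apply (Rmult_le_reg_r x); auto. rewrite Rmult_assoc, Rinv_l by lra. lra.
Qed.

Lemma Ord_UBL (k : nat) f (tau b : R) : Rabs tau <= 1 -> 0 < b -> Ord 2 2 k f ->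
  UBL (box b) (fun d p q s => f (tau * d ^ 2) (d * p) (d * q) (d ^ 2 * s) * / d ^ k).
Proof.
  intros Ht Hb H. destruct (H b Hb) as [C [HC K]]. exists C. split; auto. exists 1. split; [lra|].
  intros d Hd. apply (BL_unscale (box b) C (d ^ k)
    (fun p q s => f (tau * d ^ 2) (d * p) (d * q) (d ^ 2 * s))); [apply pow_lt; lra|]. apply K; auto.
Qed.

Lemma Ord_loc_lipschitz (k : nat) f (tau d c : R) : Rabs tau <= 1 -> 0 < d <= 1 -> Ord 2 2 k f ->
  loc_lipschitz (fun p q s => c * f (tau * d ^ 2) (d * p) (d * q) (d ^ 2 * s)).
Proof.
  intros Ht Hd H b. destruct (H (Rabs b + 1)) as [C [HC K]]; [pose proof (Rabs_pos b); lra|].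
  specialize (K d tau Hd Ht). exists (2 * (Rabs c * (C * d ^ k))).
  apply (BL_mult (box b) (Rabs c) (C * d ^ k) (fun _ _ _ => c)
    (fun p q s => f (tau * d ^ 2) (d * p) (d * q) (d ^ 2 * s))); [apply BL_const|].
  apply (BL_sub _ _ _ _ K). intros x y z [H1 [H2 H3]]. pose proof (Rle_abs b). repeat split; lra.
Qed.

Lemma loc_lipschitz_add f g : loc_lipschitz f -> loc_lipschitz g -> loc_lipschitz (fun x y z => f x y z + g x y z).
Proof. intros H1 H2 b. destruct (H1 b) as [C1 K1]. destruct (H2 b) as [C2 K2]. exists (C1 + C2). apply BL_add; auto. Qed.

Lemma scaling_conj (f1 f2 f3 g1 g2 g3 : R -> R -> R -> R) (d : R) : 0 < d ->
  (forall p q s, g1 (d * p) (d * q) (d ^ 2 * s) = d * f1 p q s) ->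
  (forall p q s, g2 (d * p) (d * q) (d ^ 2 * s) = d * f2 p q s) ->
  (forall p q s, g3 (d * p) (d * q) (d ^ 2 * s) = d ^ 2 * f3 p q s) ->
  conj (vf3 f1 f2 f3) (vf3 g1 g2 g3)
    (fun Y => (d * coord 0 Y, d * coord 1 Y, d ^ 2 * coord 2 Y))
    (fun Y => (/ d * coord 0 Y, / d * coord 1 Y, / d ^ 2 * coord 2 Y)).
Proof.
  intros Hd E1 E2 E3. assert (Hd2 : 0 < d ^ 2) by (apply pow_lt; auto).
  assert (Luc : forall a b, 0 < a -> 0 < b -> bounded_uc (fun Y => (a * coord 0 Y, a * coord 1 Y, b * coord 2 Y))).
  { intros a b Ha Hb b0 e He. exists (e / (2 * a + b)). split; [apply Rdiv_lt_0_compat; lra|].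
    intros X Y _ HXY. eapply Rle_lt_trans; [apply dist3_le|]. simpl.
    rewrite <- !Rmult_minus_distr_l, !Rabs_mult, (Rabs_right a), (Rabs_right b) by lra.
    pose proof (dist3_coord X Y 0) as D0. pose proof (dist3_coord X Y 1) as D1. pose proof (dist3_coord X Y 2) as D2.
    simpl in D0, D1, D2. assert (E : e = (2 * a + b) * (e / (2 * a + b))) by (field; lra). rewrite E.
    apply Rle_lt_trans with ((2 * a + b) * dist3 X Y); [nra|apply Rmult_lt_compat_l; lra]. }
  constructor.
  - intros [[x y] z]. simpl. apply f_equal2; [apply f_equal2|]; field; lra.
  - intros [[x y] z]. simpl. apply f_equal2; [apply f_equal2|]; field; lra.
  - intros phi t H i Hi.
    pose proof (H 0%nat ltac:(lia)) as D0. pose proof (H 1%nat ltac:(lia)) as D1. pose proof (H 2%nat ltac:(lia)) as D2.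
    unfold vf3 in *. simpl coord in D0, D1, D2.
    destruct i as [|[|[|i]]]; [| | |lia]; cbv beta; cbn [coord fst snd].
    + change (is_derive (fun s => d * coord 0 (phi s)) t (g1 (d * coord 0 (phi t)) (d * coord 1 (phi t)) (d ^ 2 * coord 2 (phi t)))).
      rewrite E1. apply (der_scal (fun s => coord 0 (phi s))). exact D0.
    + change (is_derive (fun s => d * coord 1 (phi s)) t (g2 (d * coord 0 (phi t)) (d * coord 1 (phi t)) (d ^ 2 * coord 2 (phi t)))).
      rewrite E2. apply (der_scal (fun s => coord 1 (phi s))). exact D1.
    + change (is_derive (fun s => d ^ 2 * coord 2 (phi s)) t (g3 (d * coord 0 (phi t)) (d * coord 1 (phi t)) (d ^ 2 * coord 2 (phi t)))).
      rewrite E3. apply (der_scal (fun s => coord 2 (phi s))). exact D2.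
  - intros psi t H i Hi.
    pose proof (H 0%nat ltac:(lia)) as D0. pose proof (H 1%nat ltac:(lia)) as D1. pose proof (H 2%nat ltac:(lia)) as D2.
    set (x := coord 0 (psi t)) in *. set (y := coord 1 (psi t)) in *. set (z := coord 2 (psi t)) in *.
    change (is_derive (fun s => coord 0 (psi s)) t (g1 x y z)) in D0.
    change (is_derive (fun s => coord 1 (psi s)) t (g2 x y z)) in D1.
    change (is_derive (fun s => coord 2 (psi s)) t (g3 x y z)) in D2.
    assert (Ex : x = d * (/ d * x)) by (field; lra). assert (Ey : y = d * (/ d * y)) by (field; lra).
    assert (Ez : z = d ^ 2 * (/ d ^ 2 * z)) by (field; lra).
    destruct i as [|[|[|i]]]; [| | |lia].
    + change (is_derive (fun s => / d * coord 0 (psi s)) t (f1 (/ d * x) (/ d * y) (/ d ^ 2 * z))).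
      eapply is_derive_eq; [apply (der_scal (fun s => coord 0 (psi s))); exact D0|].
      rewrite Ex, Ey, Ez at 1. rewrite E1. field; lra.
    + change (is_derive (fun s => / d * coord 1 (psi s)) t (f2 (/ d * x) (/ d * y) (/ d ^ 2 * z))).
      eapply is_derive_eq; [apply (der_scal (fun s => coord 1 (psi s))); exact D1|].
      rewrite Ex, Ey, Ez at 1. rewrite E2. field; lra.
    + change (is_derive (fun s => / d ^ 2 * coord 2 (psi s)) t (f3 (/ d * x) (/ d * y) (/ d ^ 2 * z))).
      eapply is_derive_eq; [apply (der_scal (fun s => coord 2 (psi s))); exact D2|].
      rewrite Ex, Ey, Ez at 1. rewrite E3. field; lra.
  - apply Luc; auto.
  - apply Luc; apply Rinv_0_lt_compat; auto.
Qed.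

Section HopfNormalForm.
Variables om lam : R.
Variables Nu Nv NS : R -> R -> R -> R -> R.
Variables a11 a12 a13 a21 a22 a23 a31 a32 a33 : R.
Variables p20 p11 p02 p30 p21 p12 p03 pu pv : R.
Variables q20 q11 q02 q30 q21 q12 q03 qu qv : R.
Hypothesis Hom : 0 < om.
Hypothesis Hlam : 0 < lam.

(** [U1] to [US] are the monomials of weight below 4: parameter times linear, quadratic, cubic, and
    [S] times linear. The term [n S] has weight 4 and belongs to the remainder. *)
Definition U1 (n u v : R) : R := n * (a11 * u + a12 * v).
Definition V1 (n u v : R) : R := n * (a21 * u + a22 * v).
Definition U2 (u v : R) : R := p20 * u ^ 2 + p11 * (u * v) + p02 * v ^ 2.
Definition V2 (u v : R) : R := q20 * u ^ 2 + q11 * (u * v) + q02 * v ^ 2.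
Definition U3 (u v : R) : R := p30 * u ^ 3 + p21 * (u ^ 2 * v) + p12 * (u * v ^ 2) + p03 * v ^ 3.
Definition V3 (u v : R) : R := q30 * u ^ 3 + q21 * (u ^ 2 * v) + q12 * (u * v ^ 2) + q03 * v ^ 3.
Definition US (u v S : R) : R := S * (pu * u + pv * v).
Definition VS (u v S : R) : R := S * (qu * u + qv * v).

Hypothesis ONu : Ord 2 2 4 (fun n u v S => Nu n u v S - (U1 n u v + U2 u v + U3 u v + US u v S)).
Hypothesis ONv : Ord 2 2 4 (fun n u v S => Nv n u v S - (V1 n u v + V2 u v + V3 u v + VS u v S)).
Hypothesis ONS : Ord 2 2 3 NS.
(** A second expansion with unscaled parameter. Off criticality the full linear dependence on [n],
    including the coupling to [S], is needed, and the remainder has to be quadratic uniformly in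
    [n]. *)
Hypothesis LNu : Ord 0 1 2 (fun n u v S => Nu n u v S - n * (a11 * u + a12 * v + a13 * S)).
Hypothesis LNv : Ord 0 1 2 (fun n u v S => Nv n u v S - n * (a21 * u + a22 * v + a23 * S)).
Hypothesis LNS : Ord 0 1 2 (fun n u v S => NS n u v S - n * (a31 * u + a32 * v + a33 * S)).

Definition hopf_field (n : R) : R3 -> R3 :=
  vf3 (fun u v S => - om * v + Nu n u v S) (fun u v S => om * u + Nv n u v S) (fun u v S => - lam * S + NS n u v S).

Definition mu1 : R := (a11 + a22) / 2.

(** The rotation derivative is invertible on cubic forms, since all their frequencies are odd
    multiples of [om]; [homological_3] fixes these four coefficients. *)
Definition e21 : R := - p20 / om.
Definition e12 : R := q02 / om.
Definition e30 : R := (2 * e12 + (p11 + q20) / om) / 3.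
Definition e03 : R := (2 * e21 - (p02 + q11) / om) / 3.

(* The coefficients of [W3_u U2 + W3_v V2 + u U3 + v V3]. *)
Definition g40 : R := 3 * e30 * p20 + e21 * q20 + p30.
Definition g31 : R := 3 * e30 * p11 + 2 * e21 * p20 + e21 * q11 + 2 * e12 * q20 + p21 + q30.
Definition g22 : R := 3 * e30 * p02 + 2 * e21 * p11 + e12 * p20 + e21 * q02 + 2 * e12 * q11 + 3 * e03 * q20 + p12 + q21.
Definition g13 : R := 2 * e21 * p02 + e12 * p11 + 2 * e12 * q02 + 3 * e03 * q11 + p03 + q12.
Definition g04 : R := e12 * p02 + 3 * e03 * q02 + q03.

(* The average of that quartic over the circle, i.e. the first Lyapunov coefficient up to a positive factor. *)
Definition hopf_coeff : R := (3 * g40 + g22 + 3 * g04) / 8.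

(** On even forms the rotation derivative has the powers of [r^2] as kernel. The freedom is spent by
    leaving out [u ^ 2 v ^ 2] among the quartic monomials, and [u ^ 2] among the quadratic ones
    below. *)
Definition k31 : R := (hopf_coeff - g40) / om.
Definition k13 : R := (g04 - hopf_coeff) / om.
Definition k40 : R := g31 / (4 * om).
Definition k04 : R := - g13 / (4 * om).
Definition n11 : R := (mu1 - a11) / om.
Definition n02 : R := - (a12 + a21) / (2 * om).

Definition W3u (u v : R) : R := 3 * e30 * u ^ 2 + 2 * e21 * (u * v) + e12 * v ^ 2.
Definition W3v (u v : R) : R := e21 * u ^ 2 + 2 * e12 * (u * v) + 3 * e03 * v ^ 2.
Definition W4u (u v : R) : R := 4 * k40 * u ^ 3 + 3 * k31 * (u ^ 2 * v) + k13 * v ^ 3.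
Definition W4v (u v : R) : R := k31 * u ^ 3 + 3 * k13 * (u * v ^ 2) + 4 * k04 * v ^ 3.
Definition Qu (n u v : R) : R := n * (n11 * v).
Definition Qv (n u v : R) : R := n * (n11 * u + 2 * n02 * v).
Definition Wc (n u v : R) : R :=
  (e30 * u ^ 3 + e21 * (u ^ 2 * v) + e12 * (u * v ^ 2) + e03 * v ^ 3)
  + (k40 * u ^ 4 + k31 * (u ^ 3 * v) + k13 * (u * v ^ 3) + k04 * v ^ 4) + n * (n11 * (u * v) + n02 * v ^ 2).
Definition W (n u v : R) : R := (u ^ 2 + v ^ 2) / 2 + Wc n u v.
Definition Wdot (n u v S : R) : R :=
  (u + (W3u u v + W4u u v + Qu n u v)) * (- om * v + Nu n u v S)
  + (v + (W3v u v + W4v u v + Qv n u v)) * (om * u + Nv n u v S).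
Definition cS (u v : R) : R := pu * u ^ 2 + (pv + qu) * (u * v) + qv * v ^ 2.
Definition Werr (n u v S : R) : R :=
  Wdot n u v S - (n * mu1 * (u ^ 2 + v ^ 2) + hopf_coeff * (u ^ 2 + v ^ 2) ^ 2 + S * cS u v).

Lemma homological_3 u v : om * (u * W3v u v - v * W3u u v) + u * U2 u v + v * V2 u v = 0.
Proof. unfold W3v, W3u, U2, V2, e30, e03, e21, e12. field. lra. Qed.

Lemma homological_2 n u v : om * (u * Qv n u v - v * Qu n u v) + u * U1 n u v + v * V1 n u v = n * mu1 * (u ^ 2 + v ^ 2).
Proof. unfold Qu, Qv, U1, V1, n11, n02, mu1. field. lra. Qed.

(** The quartic with coefficients [g40] to [g04] differs from [hopf_coeff r^4] by a form of zero
    average on circles, and such forms are precisely the rotation derivatives. *)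
Lemma homological_4 u v : om * (u * W4v u v - v * W4u u v)
  + W3u u v * U2 u v + W3v u v * V2 u v + u * U3 u v + v * V3 u v = hopf_coeff * (u ^ 2 + v ^ 2) ^ 2.
Proof.
  assert (E : W3u u v * U2 u v + W3v u v * V2 u v + u * U3 u v + v * V3 u v
    = g40 * u ^ 4 + g31 * (u ^ 3 * v) + g22 * (u ^ 2 * v ^ 2) + g13 * (u * v ^ 3) + g04 * v ^ 4).
  { unfold W3u, W3v, U2, V2, U3, V3, g40, g31, g22, g13, g04. ring. }
  assert (G : g22 = 8 * hopf_coeff - 3 * g40 - 3 * g04) by (unfold hopf_coeff; field).
  transitivity (om * (u * W4v u v - v * W4u u v)
    + (W3u u v * U2 u v + W3v u v * V2 u v + u * U3 u v + v * V3 u v)); [ring|].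
  rewrite E, G. unfold W4u, W4v, k31, k13, k40, k04. field. lra.
Qed.

(** The homological identities remove the terms of weight 3 and account for those of weight 4 in
    [Wdot]. What is left are products of correction terms with parts of the field, each of weight at
    least 5. *)
Lemma Werr_order : Ord 2 2 5 Werr.
Proof.
  apply (ord_ext 2 2 5 (fun n u v S =>
      (u + (W3u u v + W4u u v + Qu n u v)) * (Nu n u v S - (U1 n u v + U2 u v + U3 u v + US u v S))
    + (v + (W3v u v + W4v u v + Qv n u v)) * (Nv n u v S - (V1 n u v + V2 u v + V3 u v + VS u v S))
    + (W3u u v * (U1 n u v + U3 u v + US u v S) + W3v u v * (V1 n u v + V3 u v + VS u v S)
       + (W4u u v + Qu n u v) * (U1 n u v + U2 u v + U3 u v + US u v S)
       + (W4v u v + Qv n u v) * (V1 n u v + V2 u v + V3 u v + VS u v S)))).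
  - unfold W3u, W3v, W4u, W4v, Qu, Qv.
    assert (H1 := ONu). assert (H2 := ONv).
    set (R1 := fun n u v S => Nu n u v S - (U1 n u v + U2 u v + U3 u v + US u v S)) in *.
    set (R2 := fun n u v S => Nv n u v S - (V1 n u v + V2 u v + V3 u v + VS u v S)) in *.
    change (Ord 2 2 5 (fun n u v S =>
      (u + (3 * e30 * u ^ 2 + 2 * e21 * (u * v) + e12 * v ^ 2 + (4 * k40 * u ^ 3 + 3 * k31 * (u ^ 2 * v) + k13 * v ^ 3)
          + n * (n11 * v))) * R1 n u v S
    + (v + (e21 * u ^ 2 + 2 * e12 * (u * v) + 3 * e03 * v ^ 2 + (k31 * u ^ 3 + 3 * k13 * (u * v ^ 2) + 4 * k04 * v ^ 3)
          + n * (n11 * u + 2 * n02 * v))) * R2 n u v S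
    + ((3 * e30 * u ^ 2 + 2 * e21 * (u * v) + e12 * v ^ 2) * (U1 n u v + U3 u v + US u v S)
       + (e21 * u ^ 2 + 2 * e12 * (u * v) + 3 * e03 * v ^ 2) * (V1 n u v + V3 u v + VS u v S)
       + (4 * k40 * u ^ 3 + 3 * k31 * (u ^ 2 * v) + k13 * v ^ 3 + n * (n11 * v)) * (U1 n u v + U2 u v + U3 u v + US u v S)
       + (k31 * u ^ 3 + 3 * k13 * (u * v ^ 2) + 4 * k04 * v ^ 3 + n * (n11 * u + 2 * n02 * v)) * (V1 n u v + V2 u v + V3 u v + VS u v S)))).
    unfold U1, U2, U3, US, V1, V2, V3, VS. ord.
  - intros n u v S. unfold Werr, Wdot.
    pose proof (homological_2 n u v) as E2. pose proof (homological_3 u v) as E3. pose proof (homological_4 u v) as E4.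
    unfold cS. assert (ES : u * US u v S + v * VS u v S = S * (pu * u ^ 2 + (pv + qu) * (u * v) + qv * v ^ 2))
      by (unfold US, VS; ring).
    rewrite <- E2, <- E4, <- ES. revert E3. generalize (W3u u v) (W3v u v) (W4u u v) (W4v u v) (Qu n u v) (Qv n u v)
      (U1 n u v) (V1 n u v) (U2 u v) (V2 u v) (U3 u v) (V3 u v) (US u v S) (VS u v S) (Nu n u v S) (Nv n u v S).
    intros. apply Rminus_diag_uniq.
    match type of E3 with ?l = 0 => transitivity (- l); [ring|rewrite E3; ring] end.
Qed.

Lemma Wc_order : Ord 2 2 3 (fun n u v S => Wc n u v).
Proof. unfold Wc. ord. Qed.

Lemma W_derive (n : R) (u v : R -> R) (t du dv : R) : is_derive u t du -> is_derive v t dv ->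
  is_derive (fun t => W n (u t) (v t)) t
    ((u t + (W3u (u t) (v t) + W4u (u t) (v t) + Qu n (u t) (v t))) * du
     + (v t + (W3v (u t) (v t) + W4v (u t) (v t) + Qv n (u t) (v t))) * dv).
Proof.
  intros Hu Hv. unfold W, Wc.
  auto_derive; [repeat split; eexists; eassumption|].
  replace (Derive (fun x : R => u x) t) with du by (symmetry; apply is_derive_unique; exact Hu).
  replace (Derive (fun x : R => v x) t) with dv by (symmetry; apply is_derive_unique; exact Hv).
  unfold W3u, W3v, W4u, W4v, Qu, Qv. field.
Qed.

(** The sign [sg] treats the Lyapunov and the Chetaev case at once: [sg W'] and the contraction of
    [S] pull in the same direction when [K S ^ 2] is subtracted with the factor [sg]. *)
Lemma critical_estimate (sg : R) : sg * sg = 1 -> 0 < sg * hopf_coeff ->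
  exists K m r0, 0 < K /\ 0 < m /\ 0 < r0 <= 1 /\ forall u v S, sqn u v S <= r0 ^ 2 ->
    (u ^ 2 + v ^ 2) / 4 <= W 0 u v <= u ^ 2 + v ^ 2 /\
    m * ((u ^ 2 + v ^ 2) ^ 2 + S ^ 2) <= sg * (Wdot 0 u v S - sg * K * (2 * S * (- lam * S + NS 0 u v S))).
Proof.
  intros Hsg Ha. set (a := sg * hopf_coeff) in *.
  destruct (ord_bound_22 4 _ Werr_order) as [C1 [HC1 B1]].
  destruct (ord_bound_22 2 _ ONS) as [C2 [HC2 B2]].
  destruct (ord_bound_22 2 _ Wc_order) as [C3 [HC3 B3]].
  set (Cc := Rabs pu + Rabs (pv + qu) + Rabs qv).
  assert (HCc : 0 <= Cc).
  { unfold Cc. pose proof (Rabs_pos pu). pose proof (Rabs_pos (pv + qu)). pose proof (Rabs_pos qv). lra. }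
  (* Young's inequality gives [|S cS| <= a / 4 r^4 + Cc ^ 2 / a S ^ 2]; this [K] makes the
     contribution [2 K lam S ^ 2] of the contraction twice the last term, with [2 S ^ 2] to
     spare. *)
  set (K := (Cc ^ 2 / a + 1) / lam).
  assert (HK : 0 < K).
  { apply Rdiv_lt_0_compat; auto. assert (0 <= Cc ^ 2 / a); [|lra].
    apply Rmult_le_pos; [apply pow2_ge_0|left; apply Rinv_0_lt_compat; auto]. }
  assert (EK : K * lam = Cc ^ 2 / a + 1) by (unfold K; field; lra).
  set (B := 2 * (C1 + 2 * K * C2)). assert (HB : 0 <= B) by (unfold B; nra).
  set (m := Rmin (a / 4) (/ 2)). assert (Hm : 0 < m) by (apply Rmin_glb_lt; lra).
  assert (Hm1 : m <= a / 4) by apply Rmin_l. assert (Hm2 : m <= / 2) by apply Rmin_r.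
  set (d0 := Rmin 1 (Rmin (m / (B + 1)) (/ (4 * (C3 + 1))))).
  assert (Hd0 : 0 < d0).
  { repeat apply Rmin_glb_lt; [lra|apply Rdiv_lt_0_compat; lra|apply Rinv_0_lt_compat; lra]. }
  assert (D1 : d0 <= 1) by apply Rmin_l.
  assert (D2 : B * d0 <= m).
  { assert (H : d0 <= m / (B + 1)) by (eapply Rle_trans; [apply Rmin_r|apply Rmin_l]).
    apply (Rmult_le_compat_l (B + 1)) in H; [|lra].
    replace ((B + 1) * (m / (B + 1))) with m in H by (field; lra). lra. }
  assert (D3 : C3 * d0 <= / 4).
  { assert (H : d0 <= / (4 * (C3 + 1))) by (eapply Rle_trans; [apply Rmin_r|apply Rmin_r]).
    apply (Rmult_le_compat_l (C3 + 1)) in H; [|lra].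
    replace ((C3 + 1) * / (4 * (C3 + 1))) with (/ 4) in H by (field; lra). lra. }
  destruct (small_region d0 Hd0) as [r0 [Hr0 HR]].
  exists K, m, r0. split; [auto|split; [auto|split; [auto|]]]. intros u v S Hn.
  destruct (HR u v S Hn) as [Hd HS1]. set (r2 := u ^ 2 + v ^ 2) in *.
  assert (Hr2 : 0 <= r2) by (unfold r2; nra).
  pose proof (Rabs_pos S) as PS.
  (* The weighted size of the point: [u] and [v] are at most [d], [S] is at most [d ^ 2], and
     [d ^ 4] is controlled by [r^4 + S ^ 2]. *)
  set (d := sqrt (r2 + Rabs S)) in *.
  assert (Hdp : 0 <= d) by apply sqrt_pos.
  assert (Ed : d ^ 2 = r2 + Rabs S) by (apply pow2_sqrt; lra).
  assert (Hu2 : u ^ 2 <= r2) by (unfold r2; pose proof (pow2_ge_0 v); lra).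
  assert (Hv2 : v ^ 2 <= r2) by (unfold r2; pose proof (pow2_ge_0 u); lra).
  assert (Hu : Rabs u <= d) by (apply abs_le_of_sq; lra).
  assert (Hv : Rabs v <= d) by (apply abs_le_of_sq; lra).
  assert (HSd : Rabs S <= d ^ 2) by lra.
  split.
  - set (e := sqrt r2). assert (He : 0 <= e) by apply sqrt_pos.
    assert (Ee : e ^ 2 = r2) by (apply pow2_sqrt; lra).
    assert (Hed : e <= d0).
    { eapply Rle_trans; [|exact Hd]. apply sqrt_le_1_alt. lra. }
    pose proof (B3 u v 0 e ltac:(lra) ltac:(apply abs_le_of_sq; lra)
      ltac:(apply abs_le_of_sq; lra) ltac:(rewrite Rabs_R0; lra)) as Q. simpl in Q.
    replace (C3 * (e * (e * (e * 1)))) with (C3 * e * e ^ 2) in Q by ring. rewrite Ee in Q.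
    assert (C3 * e <= / 4) by (apply Rle_trans with (C3 * d0); [apply Rmult_le_compat_l; lra|lra]).
    assert (C3 * e * r2 <= / 4 * r2) by (apply Rmult_le_compat_r; auto).
    apply Rabs_le_between in Q. unfold W. fold r2. lra.
  - pose proof (B1 u v S d ltac:(lra) Hu Hv HSd) as Q1. pose proof (B2 u v S d ltac:(lra) Hu Hv HSd) as Q2.
    assert (EW : Wdot 0 u v S = hopf_coeff * r2 ^ 2 + S * cS u v + Werr 0 u v S) by (unfold Werr, r2; ring).
    assert (Ed4 : d ^ 4 <= 2 * (r2 ^ 2 + S ^ 2)).
    { replace (d ^ 4) with ((d ^ 2) ^ 2) by ring. rewrite Ed, <- (pow2_abs S).
      pose proof (pow2_ge_0 (r2 - Rabs S)). clear - H. nra. }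
    assert (Q5 : C1 * d ^ 5 + 2 * K * (C2 * d ^ 5) <= m * (r2 ^ 2 + S ^ 2)).
    { replace (C1 * d ^ 5 + 2 * K * (C2 * d ^ 5)) with (B / 2 * d * d ^ 4) by (unfold B; field).
      assert (0 <= d ^ 4) by (apply pow_le; auto).
      assert (B * d <= m) by (apply Rle_trans with (B * d0); [apply Rmult_le_compat_l; lra|lra]).
      assert (B / 2 * d * d ^ 4 <= m / 2 * d ^ 4) by (apply Rmult_le_compat_r; lra).
      assert (m / 2 * d ^ 4 <= m / 2 * (2 * (r2 ^ 2 + S ^ 2))) by (apply Rmult_le_compat_l; lra). lra. }
    assert (Q6 : Rabs (S * NS 0 u v S) <= C2 * d ^ 5).
    { rewrite Rabs_mult. apply Rle_trans with (d ^ 2 * (C2 * d ^ 3)); [|right; ring].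
      apply Rmult_le_compat; auto using Rabs_pos. }
    assert (Q7 : Rabs (S * cS u v) <= a / 4 * r2 ^ 2 + Cc ^ 2 / a * S ^ 2).
    { rewrite Rabs_mult, Rmult_comm.
      assert (Hc : Rabs (cS u v) <= Cc * r2).
      { unfold cS.
        assert (L1 : Rabs (pu * u ^ 2) <= Rabs pu * r2) by (rewrite Rabs_mult; apply Rmult_le_compat_l;
          [apply Rabs_pos|rewrite Rabs_right by (apply Rle_ge, pow2_ge_0); lra]).
        assert (L2 : Rabs ((pv + qu) * (u * v)) <= Rabs (pv + qu) * r2).
        { rewrite !Rabs_mult. apply Rmult_le_compat_l; [apply Rabs_pos|]. apply abs_mul_le. }
        assert (L3 : Rabs (qv * v ^ 2) <= Rabs qv * r2) by (rewrite Rabs_mult; apply Rmult_le_compat_l;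
          [apply Rabs_pos|rewrite Rabs_right by (apply Rle_ge, pow2_ge_0); lra]).
        eapply Rle_trans; [apply Rabs_triang|]. eapply Rle_trans; [apply Rplus_le_compat_r, Rabs_triang|].
        unfold Cc. lra. }
      apply Rle_trans with (Cc * (r2 * Rabs S)).
      - rewrite <- Rmult_assoc. apply Rmult_le_compat_r; auto.
      - rewrite <- (pow2_abs S). apply young; [lra|]. right. field. lra. }
    pose proof (sign_abs sg Hsg) as Sg.
    assert (X1 : - Rabs (Werr 0 u v S) <= sg * Werr 0 u v S).
    { rewrite <- (Rmult_1_l (Rabs _)), <- Sg, <- Rabs_mult. pose proof (Rle_abs (- (sg * Werr 0 u v S))).
      rewrite Rabs_Ropp in H. lra. }
    assert (X2 : - Rabs (S * cS u v) <= sg * (S * cS u v)).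
    { rewrite <- (Rmult_1_l (Rabs _)), <- Sg, <- Rabs_mult. pose proof (Rle_abs (- (sg * (S * cS u v)))).
      rewrite Rabs_Ropp in H. lra. }
    replace (sg * (Wdot 0 u v S - sg * K * (2 * S * (- lam * S + NS 0 u v S))))
      with (a * r2 ^ 2 + sg * (S * cS u v) + sg * Werr 0 u v S + 2 * (K * lam) * S ^ 2 - 2 * K * (S * NS 0 u v S)).
    2:{ rewrite EW. unfold a. transitivity (sg * hopf_coeff * r2 ^ 2 + sg * (S * cS u v) + sg * Werr 0 u v S
          - (sg * sg) * (K * (2 * S * (- lam * S + NS 0 u v S)))); [rewrite Hsg; ring|ring]. }
    rewrite EK. apply Rabs_le_between in Q6.
    assert (2 * K * (S * NS 0 u v S) <= 2 * K * (C2 * d ^ 5)) by (apply Rmult_le_compat_l; lra).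
    assert (0 <= r2 ^ 2) by apply pow2_ge_0. assert (0 <= S ^ 2) by apply pow2_ge_0.
    assert (0 <= Cc ^ 2 / a * S ^ 2) by (apply Rmult_le_pos; auto; apply Rmult_le_pos; [apply pow2_ge_0|left; apply Rinv_0_lt_compat; auto]).
    assert (m * r2 ^ 2 <= a / 4 * r2 ^ 2) by (apply Rmult_le_compat_r; auto).
    assert (m * S ^ 2 <= / 2 * S ^ 2) by (apply Rmult_le_compat_r; auto).
    assert (0 <= a * r2 ^ 2) by (apply Rmult_le_pos; lra). lra.
Qed.

Definition Wq (n u v : R) : R := (u ^ 2 + v ^ 2) / 2 + n * (n11 * (u * v) + n02 * v ^ 2).
Definition Wqdot (n u v S : R) : R :=
  (u + Qu n u v) * (- om * v + Nu n u v S) + (v + Qv n u v) * (om * u + Nv n u v S).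

Lemma Wq_derive (n : R) (u v : R -> R) (t du dv : R) : is_derive u t du -> is_derive v t dv ->
  is_derive (fun t => Wq n (u t) (v t)) t ((u t + Qu n (u t) (v t)) * du + (v t + Qv n (u t) (v t)) * dv).
Proof.
  intros Hu Hv. unfold Wq.
  auto_derive; [repeat split; eexists; eassumption|].
  replace (Derive (fun x : R => u x) t) with du by (symmetry; apply is_derive_unique; exact Hu).
  replace (Derive (fun x : R => v x) t) with dv by (symmetry; apply is_derive_unique; exact Hv).
  unfold Qu, Qv. field.
Qed.

(** The centre directions have the weak rate [|n mu1|] and [S] the rate [lam]. Cross terms carry a
    factor [n]; Young's inequality charges only a fraction of them to the weak rate and the rest to
    [lam]. The nonlinear remainder is absorbed by a radius depending on [n]. *)
Lemma noncritical_estimate : mu1 <> 0 -> exists n0, 0 < n0 /\ forall n sg, 0 < Rabs n < n0 ->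
  sg * sg = 1 -> 0 < sg * (n * mu1) ->
  exists m r0, 0 < m /\ 0 < r0 <= 1 /\ forall u v S, sqn u v S <= r0 ^ 2 ->
    (u ^ 2 + v ^ 2) / 4 <= Wq n u v <= u ^ 2 + v ^ 2 /\
    m * (u ^ 2 + v ^ 2 + S ^ 2) <= sg * (Wqdot n u v S - sg * (2 * S * (- lam * S + NS n u v S))).
Proof.
  intros Hmu. pose proof (Rabs_pos_lt _ Hmu) as Pmu. set (mu := Rabs mu1) in *.
  destruct (ord_bound_01 1 _ LNu) as [C1 [HC1 B1]].
  destruct (ord_bound_01 1 _ LNv) as [C2 [HC2 B2]].
  destruct (ord_bound_01 1 _ LNS) as [C3 [HC3 B3]].
  set (M := 1 + Rabs a11 + Rabs a12 + Rabs a13 + Rabs a21 + Rabs a22 + Rabs a23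
            + Rabs a31 + Rabs a32 + Rabs a33 + Rabs n11 + 2 * Rabs n02).
  pose proof (Rabs_pos a11) as Z1. pose proof (Rabs_pos a12) as Z2. pose proof (Rabs_pos a13) as Z3.
  pose proof (Rabs_pos a21) as Z4. pose proof (Rabs_pos a22) as Z5. pose proof (Rabs_pos a23) as Z6.
  pose proof (Rabs_pos a31) as Z7. pose proof (Rabs_pos a32) as Z8. pose proof (Rabs_pos a33) as Z9.
  pose proof (Rabs_pos n11) as Za. pose proof (Rabs_pos n02) as Zb.
  assert (HM : 1 <= M) by (unfold M; lra).
  set (M' := 8 * M ^ 2). assert (HM' : 1 <= M') by (unfold M'; nra).
  (* Total coefficient of [S ^ 2] produced by the cross terms once Young's inequality has limited
     their share of [h ^ 2] to [mu / 8]. *)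
  set (Z := 2 * M' ^ 2 / mu + M'). 
  assert (HZ : 0 < Z). { assert (0 < 2 * M' ^ 2 / mu) by (apply Rdiv_lt_0_compat; [nra|lra]). unfold Z; lra. }
  set (n0 := Rmin (/ (4 * M)) (Rmin (mu / (8 * M')) (lam / Z))).
  assert (Hn0 : 0 < n0).
  { repeat apply Rmin_glb_lt; [apply Rinv_0_lt_compat; lra|apply Rdiv_lt_0_compat; lra|apply Rdiv_lt_0_compat; lra]. }
  exists n0. split; auto. intros n sg [Hn1 Hn2] Hsg Hpos.
  set (an := Rabs n) in *.
  assert (N1 : M * an <= / 4).
  { assert (H : an <= / (4 * M)) by (left; eapply Rlt_le_trans; [exact Hn2|apply Rmin_l]).
    apply (Rmult_le_compat_l M) in H; [|lra]. replace (M * / (4 * M)) with (/ 4) in H by (field; lra). exact H. }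
  assert (N2 : 2 * M' * an <= mu / 4).
  { assert (H : an <= mu / (8 * M')) by (left; eapply Rlt_le_trans; [exact Hn2|eapply Rle_trans; [apply Rmin_r|apply Rmin_l]]).
    apply (Rmult_le_compat_l (2 * M')) in H; [|lra].
    replace (2 * M' * (mu / (8 * M'))) with (mu / 4) in H by (field; lra). exact H. }
  assert (N3 : Z * an <= lam).
  { assert (H : an <= lam / Z) by (left; eapply Rlt_le_trans; [exact Hn2|eapply Rle_trans; [apply Rmin_r|apply Rmin_r]]).
    apply (Rmult_le_compat_l Z) in H; [|lra]. replace (Z * (lam / Z)) with lam in H by (field; lra). exact H. }
  assert (N4 : an <= 1) by (clear - N1 HM Hn1; nra).
  set (m := Rmin (an * mu / 4) (lam / 2)).
  assert (Hm : 0 < m) by (apply Rmin_glb_lt; [assert (0 < an * mu) by (apply Rmult_lt_0_compat; auto)|]; lra).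
  assert (Hm1 : m <= an * mu / 4) by apply Rmin_l. assert (Hm2 : m <= lam / 2) by apply Rmin_r.
  set (C := 2 * C1 + 2 * C2 + 2 * C3).
  assert (HC : 0 <= C) by (unfold C; lra).
  (* The cubic error [C rho ^ 3] has to stay below [m rho ^ 2], and [m] shrinks with [n]; so does
     this neighbourhood. *)
  set (r0 := Rmin 1 (m / (C + 1))).
  assert (Hr0 : 0 < r0) by (apply Rmin_glb_lt; [lra|apply Rdiv_lt_0_compat; lra]).
  assert (Hr1 : r0 <= 1) by apply Rmin_l.
  assert (Hr2 : C * r0 <= m).
  { assert (H : r0 <= m / (C + 1)) by apply Rmin_r. apply (Rmult_le_compat_l (C + 1)) in H; [|lra].
    replace ((C + 1) * (m / (C + 1))) with m in H by (field; lra). lra. }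
  exists m, r0. split; [auto|split; [lra|]]. intros u v S Hs.
  set (r2 := u ^ 2 + v ^ 2) in *. assert (Pr2 : 0 <= r2) by (unfold r2; pose proof (pow2_ge_0 u); pose proof (pow2_ge_0 v); lra).
  set (h := Rabs u + Rabs v). pose proof (Rabs_pos u) as Pu. pose proof (Rabs_pos v) as Pv. pose proof (Rabs_pos S) as PS.
  assert (Ph : 0 <= h) by (unfold h; lra).
  assert (Hh : h ^ 2 <= 2 * r2).
  { unfold h, r2. rewrite <- (pow2_abs u), <- (pow2_abs v). pose proof (pow2_ge_0 (Rabs u - Rabs v)) as H. clear - H. nra. }
  assert (HQu : Rabs (Qu n u v) <= an * (M * h)).
  { unfold Qu. rewrite !Rabs_mult. fold an. apply Rmult_le_compat_l; [lra|].
    apply Rmult_le_compat; auto; [unfold M; lra|unfold h; lra]. }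
  assert (HQv : Rabs (Qv n u v) <= an * (M * h)).
  { unfold Qv. rewrite Rabs_mult. fold an. apply Rmult_le_compat_l; [lra|].
    pose proof (linear_bound n11 (2 * n02) 0 u v 0) as L. rewrite Rabs_mult, (Rabs_right 2), Rabs_R0 in L by lra.
    replace (n11 * u + 2 * n02 * v + 0 * 0) with (n11 * u + 2 * n02 * v) in L by ring.
    eapply Rle_trans; [exact L|]. rewrite !Rplus_0_r. fold h. apply Rmult_le_compat_r; auto. unfold M; lra. }
  split.
  - assert (E : Rabs (n * (n11 * (u * v) + n02 * v ^ 2)) <= / 4 * r2).
    { rewrite Rabs_mult. fold an.
      assert (Rabs (n11 * (u * v) + n02 * v ^ 2) <= M * r2).
      { eapply Rle_trans; [apply Rabs_triang|]. rewrite !Rabs_mult, (Rabs_right (v ^ 2)) by (apply Rle_ge, pow2_ge_0).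
        assert (Rabs u * Rabs v <= r2) by apply abs_mul_le.
        assert (v ^ 2 <= r2) by (unfold r2; pose proof (pow2_ge_0 u); lra).
        assert (Rabs n11 * (Rabs u * Rabs v) <= Rabs n11 * r2) by (apply Rmult_le_compat_l; auto).
        assert (Rabs n02 * v ^ 2 <= Rabs n02 * r2) by (apply Rmult_le_compat_l; auto).
        assert ((Rabs n11 + Rabs n02) * r2 <= M * r2) by (apply Rmult_le_compat_r; auto; unfold M; lra). lra. }
      apply Rle_trans with (an * (M * r2)); [apply Rmult_le_compat_l; lra|].
      replace (an * (M * r2)) with (M * an * r2) by ring. apply Rmult_le_compat_r; auto. }
    apply Rabs_le_between in E. unfold Wq. fold r2. lra.
  - set (rho := sqrt (sqn u v S)).
    assert (Psq : 0 <= sqn u v S) by apply sqn_pos.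
    assert (Prho : 0 <= rho) by apply sqrt_pos. assert (Erho : rho ^ 2 = sqn u v S) by (apply pow2_sqrt; auto).
    assert (Hrho : rho <= r0).
    { unfold rho. rewrite <- (sqrt_pow2 r0) by lra. apply sqrt_le_1_alt; auto. }
    set (R1 := Nu n u v S - n * (a11 * u + a12 * v + a13 * S)).
    set (R2 := Nv n u v S - n * (a21 * u + a22 * v + a23 * S)).
    set (R3 := NS n u v S - n * (a31 * u + a32 * v + a33 * S)).
    pose proof (pow2_ge_0 u). pose proof (pow2_ge_0 v). pose proof (pow2_ge_0 S).
    assert (Hu : Rabs u <= rho) by (apply abs_le_of_sq; auto; rewrite Erho; unfold sqn; lra).
    assert (Hv : Rabs v <= rho) by (apply abs_le_of_sq; auto; rewrite Erho; unfold sqn; lra).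
    assert (HS : Rabs S <= rho) by (apply abs_le_of_sq; auto; rewrite Erho; unfold sqn; lra).
    assert (QR : Rabs R1 <= C1 * rho ^ 2 /\ Rabs R2 <= C2 * rho ^ 2 /\ Rabs R3 <= C3 * rho ^ 2).
    { assert (P : forall e, 0 < e <= 1 -> rho <= e -> Rabs R1 <= C1 * e ^ 2 /\ Rabs R2 <= C2 * e ^ 2 /\ Rabs R3 <= C3 * e ^ 2).
      { intros e He Hre. repeat split; [apply B1|apply B2|apply B3]; auto; lra. }
      destruct (Req_dec rho 0) as [E0|E0]; [|apply P; lra].
      assert (Zr : forall c x, 0 <= c -> (forall e, 0 < e <= 1 -> Rabs x <= c * e ^ 2) -> Rabs x <= c * rho ^ 2).
      { intros c x Hc Hx. rewrite E0. replace (c * 0 ^ 2) with 0 by ring. apply (le_zero_of_small _ c Hc).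
        intros e He. eapply Rle_trans; [apply (Hx e He)|]. apply Rmult_le_compat_l; auto. clear - He. nra. }
      repeat split; apply Zr; auto; intros e He; apply (P e); lra. }
    destruct QR as [QR1 [QR2 QR3]].
    set (T1 := S * ((a13 - 2 * sg * a31) * u + (a23 - 2 * sg * a32) * v + (- 2 * sg * a33) * S)).
    set (T2 := Qu n u v * (a11 * u + a12 * v + a13 * S) + Qv n u v * (a21 * u + a22 * v + a23 * S)).
    set (T3 := (u + Qu n u v) * R1 + (v + Qv n u v) * R2 - sg * (2 * S * R3)).
    assert (EQ : sg * (Wqdot n u v S - sg * (2 * S * (- lam * S + NS n u v S)))
      = sg * (n * mu1) * r2 + 2 * lam * S ^ 2 + sg * (n * T1) + sg * (n * T2) + sg * T3).
    { pose proof (homological_2 n u v) as E2. unfold U1, V1 in E2. fold r2 in E2.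
      transitivity (sg * (n * mu1 * r2) + 2 * lam * (sg * sg) * S ^ 2 + sg * (n * T1) + sg * (n * T2) + sg * T3);
        [|rewrite Hsg; ring].
      rewrite <- E2. unfold Wqdot, T1, T2, T3, R1, R2, R3. ring. }
    rewrite EQ.
    pose proof (sign_abs sg Hsg) as Sg.
    assert (Esm : sg * (n * mu1) = an * mu).
    { rewrite <- (Rabs_right (sg * (n * mu1))) by lra. rewrite !Rabs_mult, Sg. unfold an, mu. ring. }
    assert (LB : forall x, - Rabs x <= sg * x).
    { intros x. rewrite <- (Rmult_1_l (Rabs x)), <- Sg, <- Rabs_mult. pose proof (Rle_abs (- (sg * x))) as Hx.
      rewrite Rabs_Ropp in Hx. lra. }
    pose proof (LB (n * T1)) as L1. pose proof (LB (n * T2)) as L2. pose proof (LB T3) as L3.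
    rewrite Rabs_mult in L1, L2. fold an in L1, L2.
    assert (QT1 : Rabs T1 <= 2 * M * (Rabs S * (h + Rabs S))).
    { unfold T1. rewrite Rabs_mult.
      eapply Rle_trans; [apply Rmult_le_compat_l; [auto|apply linear_bound]|]. fold h.
      replace (2 * M * (Rabs S * (h + Rabs S))) with (Rabs S * (2 * M * (h + Rabs S))) by ring.
      apply Rmult_le_compat_l; auto. apply Rmult_le_compat_r; [lra|].
      assert (B4 : forall x y, Rabs (x - 2 * sg * y) <= Rabs x + 2 * Rabs y).
      { intros x y. replace (x - 2 * sg * y) with (x + - (2 * (sg * y))) by ring.
        eapply Rle_trans; [apply Rabs_triang|]. rewrite Rabs_Ropp, !Rabs_mult, Sg, (Rabs_right 2) by lra. lra. }
      assert (B5 : Rabs (- 2 * sg * a33) = 2 * Rabs a33).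
      { rewrite !Rabs_mult, Sg, Rabs_left by lra. ring. }
      pose proof (B4 a13 a31). pose proof (B4 a23 a32). unfold M. lra. }
    assert (QT2 : Rabs T2 <= 2 * (an * (M * h)) * (M * (h + Rabs S))).
    { unfold T2. eapply Rle_trans; [apply Rabs_triang|]. rewrite !Rabs_mult.
      assert (LL : forall x y z, Rabs x + Rabs y + Rabs z <= M -> Rabs (x * u + y * v + z * S) <= M * (h + Rabs S)).
      { intros x y z Hxyz. eapply Rle_trans; [apply linear_bound|]. fold h. apply Rmult_le_compat_r; lra. }
      pose proof (LL a11 a12 a13 ltac:(unfold M; lra)). pose proof (LL a21 a22 a23 ltac:(unfold M; lra)).
      assert (Rabs (Qu n u v) * Rabs (a11 * u + a12 * v + a13 * S) <= an * (M * h) * (M * (h + Rabs S)))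
        by (apply Rmult_le_compat; auto using Rabs_pos).
      assert (Rabs (Qv n u v) * Rabs (a21 * u + a22 * v + a23 * S) <= an * (M * h) * (M * (h + Rabs S)))
        by (apply Rmult_le_compat; auto using Rabs_pos). lra. }
    assert (QT3 : Rabs T3 <= m * (r2 + S ^ 2)).
    { assert (HQ1 : Rabs (u + Qu n u v) <= 2 * rho).
      { eapply Rle_trans; [apply Rabs_triang|].
        assert (an * (M * h) <= / 4 * h) by (replace (an * (M * h)) with (M * an * h) by ring; apply Rmult_le_compat_r; auto).
        unfold h in *. lra. }
      assert (HQ2 : Rabs (v + Qv n u v) <= 2 * rho).
      { eapply Rle_trans; [apply Rabs_triang|].
        assert (an * (M * h) <= / 4 * h) by (replace (an * (M * h)) with (M * an * h) by ring; apply Rmult_le_compat_r; auto).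
        unfold h in *. lra. }
      assert (HT3 : Rabs T3 <= C * rho * rho ^ 2).
      { unfold T3. replace (_ - sg * (2 * S * R3)) with ((u + Qu n u v) * R1 + (v + Qv n u v) * R2 + - (sg * (2 * S * R3))) by ring.
        eapply Rle_trans; [apply Rabs_triang|]. eapply Rle_trans; [apply Rplus_le_compat_r, Rabs_triang|].
        rewrite Rabs_Ropp, !Rabs_mult, Sg, (Rabs_right 2) by lra.
        assert (Rabs (u + Qu n u v) * Rabs R1 <= 2 * rho * (C1 * rho ^ 2)) by (apply Rmult_le_compat; auto using Rabs_pos).
        assert (Rabs (v + Qv n u v) * Rabs R2 <= 2 * rho * (C2 * rho ^ 2)) by (apply Rmult_le_compat; auto using Rabs_pos).
        assert (Rabs S * Rabs R3 <= rho * (C3 * rho ^ 2)) by (apply Rmult_le_compat; auto using Rabs_pos).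
        unfold C. lra. }
      replace (r2 + S ^ 2) with (rho ^ 2) by (rewrite Erho; unfold sqn, r2; ring).
      eapply Rle_trans; [exact HT3|]. apply Rmult_le_compat_r; [apply pow2_ge_0|].
      apply Rle_trans with (C * r0); [apply Rmult_le_compat_l; lra|lra]. }
    (* AM-GM on the cross terms between [S] and the centre directions *)
    assert (YG : M' * (h * Rabs S) <= mu / 8 * h ^ 2 + 2 * M' ^ 2 / mu * Rabs S ^ 2).
    { apply young; [lra|]. right. field. lra. }
    assert (F1 : an * Rabs T1 + an * Rabs T2 <= an * (M' * (h * Rabs S) + M' * Rabs S ^ 2 + M' * an * h ^ 2)).
    { rewrite <- Rmult_plus_distr_l. apply Rmult_le_compat_l; [lra|]. apply cross_terms; auto; lra. }
    assert (F2 : an * (M' * (h * Rabs S) + M' * Rabs S ^ 2 + M' * an * h ^ 2) <= an * mu / 2 * r2 + lam * S ^ 2).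
    { assert (G1 : M' * (h * Rabs S) + M' * Rabs S ^ 2 + M' * an * h ^ 2 <= (mu / 8 + M' * an) * h ^ 2 + Z * S ^ 2).
      { unfold Z. rewrite <- (pow2_abs S). lra. }
      assert (G2 : (mu / 8 + M' * an) * h ^ 2 <= (mu / 8 + M' * an) * (2 * r2)).
      { apply Rmult_le_compat_l; auto. assert (0 <= M' * an) by (apply Rmult_le_pos; lra). lra. }
      assert (G3 : (mu / 8 + M' * an) * (2 * r2) <= mu / 2 * r2).
      { replace ((mu / 8 + M' * an) * (2 * r2)) with ((mu / 4 + 2 * M' * an) * r2) by field.
        apply Rmult_le_compat_r; lra. }
      apply Rle_trans with (an * (mu / 2 * r2 + Z * S ^ 2)); [apply Rmult_le_compat_l; lra|].
      assert (Z * an * S ^ 2 <= lam * S ^ 2) by (apply Rmult_le_compat_r; [apply pow2_ge_0|auto]). lra. }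
    rewrite Esm.
    assert (m * r2 <= an * mu / 4 * r2) by (apply Rmult_le_compat_r; auto).
    assert (m * S ^ 2 <= lam / 2 * S ^ 2) by (apply Rmult_le_compat_r; [apply pow2_ge_0|auto]).
    assert (0 <= lam * S ^ 2) by (apply Rmult_le_pos; [lra|apply pow2_ge_0]). lra.
Qed.

Lemma critical_stable : hopf_coeff < 0 -> asympt_stable (hopf_field 0) (0, 0, 0).
Proof.
  intros Ha. destruct (critical_estimate (-1)) as [K [m [r0 [HK [Hm [Hr0 E]]]]]]; [ring|lra|].
  apply (lyapunov_asympt _ _ _ (fun u v S => W 0 u v + K * S ^ 2) r0 (Rmin (/ 4) K) (1 + K) (m / (2 + 2 * K ^ 2))).
  - lra.
  - apply Rdiv_lt_0_compat; nra.
  - apply Rmin_glb_lt; lra.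
  - lra.
  - intros u v S Hs. destruct (E u v S Hs) as [[W1 W2] _]. unfold sqn.
    pose proof (Rmin_l (/ 4) K). pose proof (Rmin_r (/ 4) K). set (c := Rmin (/ 4) K) in *.
    pose proof (pow2_ge_0 u). pose proof (pow2_ge_0 v). pose proof (pow2_ge_0 S).
    assert (c * (u ^ 2 + v ^ 2) <= / 4 * (u ^ 2 + v ^ 2)) by (apply Rmult_le_compat_r; lra).
    assert (c * S ^ 2 <= K * S ^ 2) by (apply Rmult_le_compat_r; lra).
    assert (0 <= K * (u ^ 2 + v ^ 2)) by (apply Rmult_le_pos; lra).
    split; lra.
  - intros u v S t Hs Du Dv DS. destruct (E _ _ _ Hs) as [[W1 W2] D].
    exists (Wdot 0 (u t) (v t) (S t) + K * (2 * S t * (- lam * S t + NS 0 (u t) (v t) (S t)))). split.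
    + apply der_plus; [exact (W_derive 0 u v t _ _ Du Dv)|]. apply (der_scal (fun t => S t ^ 2)).
      apply (der_ext (fun t => S t * S t)); [intros; ring|].
      eapply is_derive_eq; [apply der_mult; exact DS|ring].
    + set (r2 := u t ^ 2 + v t ^ 2) in *. set (Z := S t) in *.
      assert (HZ : Z ^ 2 <= 1).
      { unfold sqn in Hs. fold r2 Z in Hs. pose proof (pow2_ge_0 (u t)). pose proof (pow2_ge_0 (v t)).
        assert (r0 ^ 2 <= 1) by (rewrite <- (pow1 2); apply pow_incr; lra). unfold r2 in *. lra. }
      pose proof (pow2_ge_0 Z). pose proof (pow2_ge_0 r2).
      assert (Pr : 0 <= r2) by (unfold r2; pose proof (pow2_ge_0 (u t)); pose proof (pow2_ge_0 (v t)); lra).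
      set (V := W 0 (u t) (v t) + K * Z ^ 2).
      assert (HV : 0 <= V <= r2 + K * Z ^ 2) by (assert (0 <= K * Z ^ 2) by (apply Rmult_le_pos; lra); unfold V; lra).
      assert (HV2 : V ^ 2 <= (2 + 2 * K ^ 2) * (r2 ^ 2 + Z ^ 2)).
      { apply Rle_trans with ((r2 + K * Z ^ 2) ^ 2); [apply pow_incr; lra|].
        apply Rle_trans with (2 * r2 ^ 2 + 2 * K ^ 2 * (Z ^ 2 * Z ^ 2));
          [pose proof (pow2_ge_0 (r2 - K * Z ^ 2)); lra|].
        assert (Z ^ 2 * Z ^ 2 <= 1 * Z ^ 2) by (apply Rmult_le_compat_r; auto).
        assert (K ^ 2 * (Z ^ 2 * Z ^ 2) <= K ^ 2 * (1 * Z ^ 2)) by (apply Rmult_le_compat_l; auto; apply pow2_ge_0).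
        assert (0 <= K ^ 2 * r2 ^ 2) by (apply Rmult_le_pos; auto; apply pow2_ge_0). lra. }
      assert (Q : m / (2 + 2 * K ^ 2) * V ^ 2 <= m * (r2 ^ 2 + Z ^ 2)).
      { pose proof (pow2_ge_0 K). apply Rle_trans with (m / (2 + 2 * K ^ 2) * ((2 + 2 * K ^ 2) * (r2 ^ 2 + Z ^ 2))).
        - apply Rmult_le_compat_l; auto. left; apply Rdiv_lt_0_compat; lra.
        - right. field. lra. }
      lra.
Qed.

Lemma critical_unstable : (forall Y0, exists phi, is_sol (hopf_field 0) phi /\ phi 0 = Y0) ->
  0 < hopf_coeff -> unstable_eq (hopf_field 0) (0, 0, 0).
Proof.
  intros Hex Ha. destruct (critical_estimate 1) as [K [m [r0 [HK [Hm [Hr0 E]]]]]]; [ring|lra|].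
  apply (chetaev_unstable _ _ _ (fun u v S => W 0 u v - K * S ^ 2) r0 1 m); auto; [lra| | |].
  - intros u v S Hs. destruct (E u v S Hs) as [[W1 W2] _]. unfold sqn in Hs. pose proof (pow2_ge_0 S).
    assert (r0 ^ 2 <= 1) by (rewrite <- (pow1 2); apply pow_incr; lra).
    assert (0 <= K * S ^ 2) by (apply Rmult_le_pos; lra). lra.
  - intros d Hd. set (x := Rmin (d / 2) r0). assert (Hx : 0 < x) by (apply Rmin_glb_lt; lra).
    assert (X1 : x <= d / 2) by apply Rmin_l. assert (X2 : x <= r0) by apply Rmin_r.
    exists x, 0, 0. unfold sqn. split; [nra|].
    destruct (E x 0 0) as [[W1 _] _]; [unfold sqn; assert (x ^ 2 <= r0 ^ 2) by (apply pow_incr; lra); lra|].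
    assert (0 < x ^ 2) by (apply pow_lt; auto). lra.
  - intros u v S t Hs Du Dv DS. destruct (E _ _ _ Hs) as [[W1 W2] D].
    exists (Wdot 0 (u t) (v t) (S t) - K * (2 * S t * (- lam * S t + NS 0 (u t) (v t) (S t)))). split.
    + apply der_minus; [exact (W_derive 0 u v t _ _ Du Dv)|]. apply (der_scal (fun t => S t ^ 2)).
      apply (der_ext (fun t => S t * S t)); [intros; ring|].
      eapply is_derive_eq; [apply der_mult; exact DS|ring].
    + intros HV. set (r2 := u t ^ 2 + v t ^ 2) in *. set (Z := S t) in *.
      set (V := W 0 (u t) (v t) - K * Z ^ 2) in *. pose proof (pow2_ge_0 Z).
      assert (V ^ 2 <= r2 ^ 2).
      { apply pow_incr. assert (0 <= K * Z ^ 2) by (apply Rmult_le_pos; lra). unfold V in *. lra. }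
      assert (m * V ^ 2 <= m * r2 ^ 2) by (apply Rmult_le_compat_l; lra).
      assert (0 <= m * Z ^ 2) by (apply Rmult_le_pos; lra). lra.
Qed.

Lemma noncritical_stability : mu1 <> 0 -> exists n0, 0 < n0 /\ forall n, 0 < Rabs n < n0 ->
  (n * mu1 < 0 -> asympt_stable (hopf_field n) (0, 0, 0)) /\
  (0 < n * mu1 -> (forall Y0, exists phi, is_sol (hopf_field n) phi /\ phi 0 = Y0) ->
     unstable_eq (hopf_field n) (0, 0, 0)).
Proof.
  intros Hmu. destruct (noncritical_estimate Hmu) as [n0 [Hn0 E0]]. exists n0. split; auto. intros n Hn. split.
  - intros Hs. destruct (E0 n (-1) Hn) as [m [r0 [Hm [Hr0 E]]]]; [ring|lra|].
    apply (lyapunov_asympt _ _ _ (fun u v S => Wq n u v + S ^ 2) r0 (/ 4) 1 m); try lra.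
    + intros u v S Hs'. destruct (E u v S Hs') as [[W1 W2] _]. unfold sqn. pose proof (pow2_ge_0 S). lra.
    + intros u v S t Hs' Du Dv DS. destruct (E _ _ _ Hs') as [[W1 W2] D].
      exists (Wqdot n (u t) (v t) (S t) + 2 * S t * (- lam * S t + NS n (u t) (v t) (S t))). split.
      * apply der_plus; [exact (Wq_derive n u v t _ _ Du Dv)|].
        apply (der_ext (fun t => S t * S t)); [intros; ring|].
        eapply is_derive_eq; [apply der_mult; exact DS|ring].
      * set (r2 := u t ^ 2 + v t ^ 2) in *. set (Z := S t) in *.
        pose proof (pow2_ge_0 Z). pose proof (pow2_ge_0 (u t)). pose proof (pow2_ge_0 (v t)).
        set (V := Wq n (u t) (v t) + Z ^ 2).
        assert (HV : 0 <= V <= r2 + Z ^ 2) by (unfold V, r2 in *; lra).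
        assert (r2 + Z ^ 2 <= 1).
        { unfold sqn in Hs'. fold r2 Z in Hs'. assert (r0 ^ 2 <= 1) by (rewrite <- (pow1 2); apply pow_incr; lra). lra. }
        assert (HV2 : V ^ 2 <= r2 + Z ^ 2) by (clear - HV H2; nra).
        assert (m * V ^ 2 <= m * (r2 + Z ^ 2)) by (apply Rmult_le_compat_l; lra). lra.
  - intros Hs Hex. destruct (E0 n 1 Hn) as [m [r0 [Hm [Hr0 E]]]]; [ring|lra|].
    apply (chetaev_unstable _ _ _ (fun u v S => Wq n u v - S ^ 2) r0 1 m); auto; [lra| | |].
    + intros u v S Hs'. destruct (E u v S Hs') as [[W1 W2] _]. unfold sqn in Hs'. pose proof (pow2_ge_0 S).
      assert (r0 ^ 2 <= 1) by (rewrite <- (pow1 2); apply pow_incr; lra). lra.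
    + intros d Hd. set (x := Rmin (d / 2) r0). assert (Hx : 0 < x) by (apply Rmin_glb_lt; lra).
      assert (X1 : x <= d / 2) by apply Rmin_l. assert (X2 : x <= r0) by apply Rmin_r.
      exists x, 0, 0. unfold sqn. split; [clear - X1 Hx; nra|].
      destruct (E x 0 0) as [[W1 _] _]; [unfold sqn; assert (x ^ 2 <= r0 ^ 2) by (apply pow_incr; lra); lra|].
      assert (0 < x ^ 2) by (apply pow_lt; auto). lra.
    + intros u v S t Hs' Du Dv DS. destruct (E _ _ _ Hs') as [[W1 W2] D].
      exists (Wqdot n (u t) (v t) (S t) - 2 * S t * (- lam * S t + NS n (u t) (v t) (S t))). split.
      * apply der_minus; [exact (Wq_derive n u v t _ _ Du Dv)|].
        apply (der_ext (fun t => S t * S t)); [intros; ring|].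
        eapply is_derive_eq; [apply der_mult; exact DS|ring].
      * intros HV. set (r2 := u t ^ 2 + v t ^ 2) in *. set (Z := S t) in *.
        pose proof (pow2_ge_0 Z). set (V := Wq n (u t) (v t) - Z ^ 2) in *.
        assert (HV1 : V <= r2) by (unfold V; lra).
        assert (r2 <= 1).
        { unfold sqn in Hs'. fold r2 Z in Hs'. assert (r0 ^ 2 <= 1) by (rewrite <- (pow1 2); apply pow_incr; lra). lra. }
        assert (HV2 : V ^ 2 <= r2) by (clear - HV HV1 H0; nra).
        assert (m * V ^ 2 <= m * (r2 + Z ^ 2)) by (apply Rmult_le_compat_l; lra). lra.
Qed.

Lemma Nu_order : Ord 2 2 2 Nu.
Proof.
  apply (ord_ext 2 2 2 (fun n u v S => (Nu n u v S - (U1 n u v + U2 u v + U3 u v + US u v S))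
    + (U1 n u v + U2 u v + U3 u v + US u v S))); [|intros; ring].
  apply ord_add; [apply ord_le with 4%nat; [lia|exact ONu]|]. unfold U1, U2, U3, US. ord.
Qed.

Lemma Nv_order : Ord 2 2 2 Nv.
Proof.
  apply (ord_ext 2 2 2 (fun n u v S => (Nv n u v S - (V1 n u v + V2 u v + V3 u v + VS u v S))
    + (V1 n u v + V2 u v + V3 u v + VS u v S))); [|intros; ring].
  apply ord_add; [apply ord_le with 4%nat; [lia|exact ONv]|]. unfold V1, V2, V3, VS. ord.
Qed.

(** [tau] is the sign of [n] on the side where the cycle exists, and [d = sqrt (tau n)]. The scaled
    radial rate is [k = 2 tau mu1]; as [mu1] is negative, [tau < 0] means an attracting cycle and
    [tau > 0] a repelling one. *)
Lemma hopf_orbit (tau : R) : tau * tau = 1 -> mu1 < 0 -> 0 < tau * hopf_coeff ->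
  (forall n Y0, exists phi, is_sol (hopf_field n) phi /\ phi 0 = Y0) ->
  (forall n phi psi, is_sol (hopf_field n) phi -> is_sol (hopf_field n) psi ->
     phi 0 = psi 0 -> forall t, phi t = psi t) ->
  forall eta, 0 < eta -> exists dl, 0 < dl /\ forall n, 0 < tau * n < dl ->
    exists (gam : R -> R3) (T : R), periodic_orbit (hopf_field n) gam T /\
      (tau < 0 -> orbit_asympt_stable (hopf_field n) gam) /\
      (0 < tau -> orbit_unstable (hopf_field n) gam) /\
      (exists b, forall t, in_ball b (gam t)) /\
      forall t, dist3 (gam t) (0, 0, 0) < eta.
Proof.
  intros Ht Hmu Ha Hex Huniq eta Heta.
  assert (At : Rabs tau <= 1) by (rewrite (sign_abs tau Ht); lra).
  set (a := hopf_coeff) in *.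
  assert (Hat : a <> 0) by (intros E; rewrite E in Ha; lra).
  (* The nonzero root of [2 tau mu1 rho + 4 a rho ^ 2], the scaled radial law in [rho = r^2 / 2],
     rewritten with [tau * tau = 1]. *)
  set (w0 := - mu1 / (2 * (tau * a))).
  assert (Hw0 : 0 < w0) by (apply Rdiv_lt_0_compat; lra).
  assert (Ew0 : 2 * a * w0 = - tau * mu1).
  { assert (tau <> 0) by (intros E; rewrite E in Ht; lra). apply (Rmult_eq_reg_l tau); auto.
    transitivity (- mu1); [unfold w0; field; split; auto|].
    transitivity (- (tau * tau) * mu1); [rewrite Ht; ring|ring]. }
  set (b := 1 + 3 * w0). assert (Hb : 3 * w0 <= b ^ 2 /\ 1 <= b) by (unfold b; split; nra).
  set (nuF := fun d p q s => Nu (tau * d ^ 2) (d * p) (d * q) (d ^ 2 * s) * / d ^ 2).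
  set (nvF := fun d p q s => Nv (tau * d ^ 2) (d * p) (d * q) (d ^ 2 * s) * / d ^ 2).
  set (nsF := fun d p q s => NS (tau * d ^ 2) (d * p) (d * q) (d ^ 2 * s) * / d ^ 3).
  set (w1F := fun d p q s : R => Wc (tau * d ^ 2) (d * p) (d * q) * / d ^ 3).
  set (eeF := fun d p q s => Werr (tau * d ^ 2) (d * p) (d * q) (d ^ 2 * s) * / d ^ 5).
  set (ccF := fun d p q s : R => cS p q).
  assert (Hk : 2 * tau * mu1 <> 0).
  { intros E. assert (tau <> 0) by (intros E'; rewrite E' in Ht; lra). apply Rmult_integral in E. lra. }
  destruct (scaled_hopf om lam (2 * tau * mu1) (4 * a) w0 b nuF nvF nsF w1F ccF eeF) as [d0 [Hd0 HS]]; auto.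
  - apply (Ord_UBL 2 Nu); [auto|lra|apply Nu_order].
  - apply (Ord_UBL 2 Nv); [auto|lra|apply Nv_order].
  - apply (Ord_UBL 3 NS); [auto|lra|exact ONS].
  - apply (Ord_UBL 3 (fun n u v S => Wc n u v)); [auto|lra|exact Wc_order].
  - assert (Hp : UBL (box b) (fun _ p _ _ => p)).
    { apply (UBL_fixed (box b) (b + 1)). split; [intros x y z [K _]; lra|intros]. pose proof (Rabs_pos (x - x')).
      pose proof (Rabs_pos (y - y')). pose proof (Rabs_pos (z - z')). destruct Hb. nra. }
    assert (Hq : UBL (box b) (fun _ _ q _ => q)).
    { apply (UBL_fixed (box b) (b + 1)). split; [intros x y z [_ [K _]]; lra|intros]. pose proof (Rabs_pos (x - x')).
      pose proof (Rabs_pos (y - y')). pose proof (Rabs_pos (z - z')). destruct Hb. nra. }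
    unfold ccF, cS. repeat apply UBL_add; (apply UBL_mult; [apply UBL_const|]).
    + apply UBL_mult; [exact Hp|apply UBL_mult; [exact Hp|apply UBL_const]].
    + apply UBL_mult; [exact Hp|exact Hq].
    + apply UBL_mult; [exact Hq|apply UBL_mult; [exact Hq|apply UBL_const]].
  - apply (Ord_UBL 5 Werr); [auto|lra|exact Werr_order].
  (* The scaled orbit lies in the box of size [b]; undoing the scaling gives coordinates of size at
     most [d b], so [d < eta / (4 b)] makes the sum of the three smaller than [eta]. *)
  - set (q := eta / (4 * b)). assert (Hq : 0 < q) by (apply Rdiv_lt_0_compat; destruct Hb; lra).
    set (D := Rmin (Rmin 1 d0) q).
    assert (HD : 0 < D) by (repeat apply Rmin_glb_lt; auto; lra).
    assert (D1 : D <= 1) by (eapply Rle_trans; [apply Rmin_l|apply Rmin_l]).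
    assert (D2 : D <= d0) by (eapply Rle_trans; [apply Rmin_l|apply Rmin_r]).
    assert (D3 : D <= q) by apply Rmin_r.
    exists (D ^ 2). split; [apply pow_lt; auto|]. intros n [Hn1 Hn2].
    set (d := sqrt (tau * n)).
    assert (Hd : 0 < d) by (apply sqrt_lt_R0; auto).
    assert (Ed : d ^ 2 = tau * n) by (apply pow2_sqrt; lra).
    assert (HdD : d < D) by (unfold d; rewrite <- (sqrt_pow2 D) by lra; apply sqrt_lt_1_alt; lra).
    assert (En : n = tau * d ^ 2) by (rewrite Ed; transitivity (tau * tau * n); [rewrite Ht; ring|ring]).
    assert (CJ : conj (vf3 (sf1 om nuF d) (sf2 om nvF d) (sf3 lam nsF d)) (hopf_field n)
      (fun Y => (d * coord 0 Y, d * coord 1 Y, d ^ 2 * coord 2 Y))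
      (fun Y => (/ d * coord 0 Y, / d * coord 1 Y, / d ^ 2 * coord 2 Y))).
    { apply scaling_conj; auto; intros p0 q0 s0; rewrite En; unfold sf1, sf2, sf3, nuF, nvF, nsF; field; lra. }
    destruct (HS d ltac:(lra)) as [gam [T [G1 [G2 [G3 G4]]]]].
    + intros p0 q0 s0 t Dp Dq Ds.
      assert (Du : is_derive (fun t => d * p0 t) t (- om * (d * q0 t) + Nu n (d * p0 t) (d * q0 t) (d ^ 2 * s0 t))).
      { eapply is_derive_eq; [apply (der_scal p0); exact Dp|]. rewrite En. unfold sf1, nuF. field. lra. }
      assert (Dv : is_derive (fun t => d * q0 t) t (om * (d * p0 t) + Nv n (d * p0 t) (d * q0 t) (d ^ 2 * s0 t))).
      { eapply is_derive_eq; [apply (der_scal q0); exact Dq|]. rewrite En. unfold sf2, nvF. field. lra. }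
      pose proof (W_derive n _ _ t _ _ Du Dv) as DW. cbv beta in DW.
      apply (der_ext (fun t => / d ^ 2 * W n (d * p0 t) (d * q0 t))).
      { intros x. unfold swv, w1F, W. rewrite <- En. field. lra. }
      eapply is_derive_eq; [apply (der_scal (fun t => W n (d * p0 t) (d * q0 t))); exact DW|].
      fold (Wdot n (d * p0 t) (d * q0 t) (d ^ 2 * s0 t)).
      unfold sMv, ccF, eeF. rewrite <- En.
      set (P := p0 t). set (Q := q0 t). set (Z := s0 t). set (er := Werr n (d * P) (d * Q) (d ^ 2 * Z)).
      assert (EW : Wdot n (d * P) (d * Q) (d ^ 2 * Z) = n * mu1 * ((d * P) ^ 2 + (d * Q) ^ 2)
        + a * ((d * P) ^ 2 + (d * Q) ^ 2) ^ 2 + d ^ 2 * Z * cS (d * P) (d * Q) + er)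
        by (unfold er, Werr, a; ring).
      rewrite EW, En. unfold cS.
      transitivity (d ^ 2 * (2 * (tau * mu1) * ((P ^ 2 + Q ^ 2) / 2) + 4 * a * ((P ^ 2 + Q ^ 2) / 2) ^ 2
        + (pu * P ^ 2 + (pv + qu) * (P * Q) + qv * Q ^ 2) * Z + d * (er * / d ^ 5))); [field; lra|].
      assert (E2 : tau * mu1 = - 2 * a * w0) by lra.
      replace (2 * tau * mu1) with (2 * (tau * mu1)) by ring. rewrite E2. ring.
    + apply loc_lipschitz_add.
      * intros b0. exists (Rabs om * (Rabs b0 + 1)). pose proof (Rabs_pos om). pose proof (Rabs_pos b0). pose proof (Rle_abs b0).
        split; intros; [|].
        -- destruct H2 as [_ [H2 _]]. rewrite Rabs_mult, Rabs_Ropp. apply Rmult_le_compat_l; lra.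
        -- rewrite <- Rmult_minus_distr_l, Rabs_mult, Rabs_Ropp, Rmult_assoc. apply Rmult_le_compat_l; auto.
           pose proof (Rabs_pos (x - x')). pose proof (Rabs_pos (y - y')). pose proof (Rabs_pos (z - z')).
           assert (0 <= Rabs b0 * (Rabs (x - x') + Rabs (y - y') + Rabs (z - z'))) by (apply Rmult_le_pos; lra). lra.
      * pose proof (Ord_loc_lipschitz 2 Nu tau d (d * / d ^ 2) At ltac:(lra) Nu_order) as L.
        intros b0. destruct (L b0) as [C0 K0]. exists C0. apply (BL_ext _ _ _ _ K0). intros; unfold nuF; ring.
    + apply loc_lipschitz_add.
      * intros b0. exists (Rabs om * (Rabs b0 + 1)). pose proof (Rabs_pos om). pose proof (Rabs_pos b0). pose proof (Rle_abs b0).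
        split; intros; [|].
        -- destruct H2 as [H2 _]. rewrite Rabs_mult. apply Rmult_le_compat_l; lra.
        -- rewrite <- Rmult_minus_distr_l, Rabs_mult, Rmult_assoc. apply Rmult_le_compat_l; auto.
           pose proof (Rabs_pos (x - x')). pose proof (Rabs_pos (y - y')). pose proof (Rabs_pos (z - z')).
           assert (0 <= Rabs b0 * (Rabs (x - x') + Rabs (y - y') + Rabs (z - z'))) by (apply Rmult_le_pos; lra). lra.
      * pose proof (Ord_loc_lipschitz 2 Nv tau d (d * / d ^ 2) At ltac:(lra) Nv_order) as L.
        intros b0. destruct (L b0) as [C0 K0]. exists C0. apply (BL_ext _ _ _ _ K0). intros; unfold nvF; ring.
    + apply (conj_existence _ _ _ _ (conj_sym _ _ _ _ CJ)). apply Hex.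
    + apply (conj_uniqueness _ _ _ _ (conj_sym _ _ _ _ CJ)). apply Huniq.
    + assert (B1 : forall t, in_ball b (gam t)).
      { intros t i. destruct (G4 t) as [K0 [K1 K2]].
        destruct i as [|[|i]]; [exact K0|exact K1|exact K2]. }
      assert (Hdb : d ^ 2 <= d) by nra.
      assert (B2 : forall t i, Rabs (coord i (d * coord 0 (gam t), d * coord 1 (gam t), d ^ 2 * coord 2 (gam t))) <= d * b).
      { intros t i. destruct (G4 t) as [K0 [K1 K2]]. destruct Hb.
        destruct i as [|[|i]]; cbn [coord fst snd]; rewrite Rabs_mult.
        - rewrite (Rabs_right d) by lra. apply Rmult_le_compat_l; [lra|exact K0].
        - rewrite (Rabs_right d) by lra. apply Rmult_le_compat_l; [lra|exact K1].
        - rewrite (Rabs_right (d ^ 2)) by (apply Rle_ge, pow2_ge_0).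
          apply Rmult_le_compat; [apply pow2_ge_0|apply Rabs_pos|exact Hdb|exact K2]. }
      exists (fun t => (d * coord 0 (gam t), d * coord 1 (gam t), d ^ 2 * coord 2 (gam t))), T.
      split; [|split; [|split; [|split]]].
      * apply (conj_periodic _ _ _ _ CJ gam T G1).
      * intros Hneg. apply (conj_orbit_asympt _ _ _ _ CJ gam b B1 (d * b) B2). apply G2. nra.
      * intros Hpos. apply (conj_orbit_unstable _ _ _ _ gam b (d * b) CJ B1 B2). apply G3. nra.
      * exists (d * b). exact B2.
      * intros t. eapply Rle_lt_trans; [apply dist3_le|].
        pose proof (B2 t 0%nat) as C0. pose proof (B2 t 1%nat) as C1. pose proof (B2 t 2%nat) as C2.
        cbn [coord fst snd] in *. rewrite !Rminus_0_r.
        assert (4 * (d * b) < eta).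
        { destruct Hb. apply Rlt_le_trans with (4 * (q * b)); [|right; unfold q; field; lra].
          assert (d * b < q * b) by (apply Rmult_lt_compat_r; lra). lra. }
        assert (0 <= d * b) by (destruct Hb; apply Rmult_le_pos; lra). lra.
Qed.

End HopfNormalForm.

(** * Existence and uniqueness of global solutions *)

Lemma one_le_exp (x : R) : 0 <= x -> 1 <= exp x.
Proof. intros H. pose proof (exp_ineq1_le x). lra. Qed.

(** The estimate behind exponentially weighted norms: integration gains a factor [1 / k], so a large
    [k] makes Picard iteration a contraction on any bounded time interval. Negative times are
    treated by reflection. *)
Lemma primitive_bound (G f : R -> R) (c k T : R) : 0 <= c -> 0 < k -> G 0 = 0 ->
  (forall t, Rabs t <= T -> is_derive G t (f t)) ->
  (forall t, Rabs t <= T -> Rabs (f t) <= c * exp (k * Rabs t)) ->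
  forall t, Rabs t <= T -> Rabs (G t) <= c / k * exp (k * Rabs t).
Proof.
  intros Hc Hk H0 HG Hf.
  assert (K : forall (H h : R -> R), H 0 = 0 ->
    (forall t, 0 <= t <= T -> is_derive H t (h t)) -> (forall t, 0 <= t <= T -> h t <= c * exp (k * t)) ->
    forall t, 0 <= t <= T -> H t <= c / k * exp (k * t)).
  { intros H h HH0 HH Hh t Ht.
    pose proof (derive_nonpos (fun t => H t - c / k * exp (k * t)) (fun t => h t - c * exp (k * t)) 0 t ltac:(lra)) as Q.
    assert (Q' : H t - c / k * exp (k * t) <= H 0 - c / k * exp (k * 0)).
    { apply Q.
      - intros s Hs. apply der_minus; [apply HH; lra|].
        eapply is_derive_eq; [apply (der_scal (fun t => exp (k * t))); apply (der_exp (fun t => k * t));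
          apply (der_scal (fun t => t)); apply is_derive_id|]. unfold one; simpl. field. lra.
      - intros s Hs. specialize (Hh s ltac:(lra)). lra. }
    rewrite HH0, Rmult_0_r, exp_0 in Q'.
    assert (0 <= c / k) by (apply Rmult_le_pos; auto; left; apply Rinv_0_lt_compat; auto). lra. }
  intros t Ht. destruct (Rle_dec 0 t) as [Hp|Hp].
  - rewrite (Rabs_right t) in * by lra. apply Rabs_le_between. split.
    + assert (- G t <= c / k * exp (k * t)); [|lra].
      apply (K (fun t => - G t) (fun t => - f t)); [rewrite H0; ring| | |lra].
      * intros s Hs. apply (is_derive_opp G). apply HG. rewrite Rabs_right; lra.
      * intros s Hs. specialize (Hf s ltac:(rewrite Rabs_right; lra)). rewrite (Rabs_right s) in Hf by lra.
        apply Rabs_le_between in Hf. lra.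
    + apply (K G f H0); [| |lra].
      * intros s Hs. apply HG. rewrite Rabs_right; lra.
      * intros s Hs. specialize (Hf s ltac:(rewrite Rabs_right; lra)). rewrite (Rabs_right s) in Hf by lra.
        apply Rabs_le_between in Hf. lra.
  - assert (DR : forall s, 0 <= s <= T -> is_derive (fun s => G (- s)) s (- f (- s))).
    { intros s Hs. eapply is_derive_eq.
      - apply (der_comp G (fun s => - s) s (f (- s)) (-1)); [apply HG; rewrite Rabs_Ropp, Rabs_right; lra|].
        auto_derive; [exact I|ring].
      - ring. }
    assert (FR : forall s, 0 <= s <= T -> Rabs (f (- s)) <= c * exp (k * s)).
    { intros s Hs. specialize (Hf (- s)). rewrite Rabs_Ropp, (Rabs_right s) in Hf by lra. apply Hf; lra. }
    assert (Et : Rabs t = - t) by (apply Rabs_left; lra). rewrite Et in *.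
    apply Rabs_le_between. split.
    + assert (- G (- - t) <= c / k * exp (k * - t)); [|rewrite Ropp_involutive in *; lra].
      apply (K (fun s => - G (- s)) (fun s => - - f (- s))); [rewrite Ropp_0, H0; ring| | |lra].
      * intros s Hs. apply (is_derive_opp (fun s => G (- s))). apply DR; auto.
      * intros s Hs. specialize (FR s Hs). apply Rabs_le_between in FR. lra.
    + assert (G (- - t) <= c / k * exp (k * - t)); [|rewrite Ropp_involutive in *; lra].
      apply (K (fun s => G (- s)) (fun s => - f (- s))); [rewrite Ropp_0; exact H0| | |lra].
      * intros s Hs. apply DR; auto.
      * intros s Hs. specialize (FR s Hs). apply Rabs_le_between in FR. lra.
Qed.

Definition dist_l1 (X Y : R3) : R :=
  Rabs (coord 0 X - coord 0 Y) + Rabs (coord 1 X - coord 1 Y) + Rabs (coord 2 X - coord 2 Y).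

Section Picard.
Variable F : R -> R3 -> R3.
Variable X0 : R3.
Hypothesis HL : forall T, exists L, 0 < L /\ forall t X Y i, Rabs t <= T ->
  Rabs (coord i (F t X) - coord i (F t Y)) <= L * dist_l1 X Y.
Hypothesis HB : forall T, exists B, 0 <= B /\ forall t i, Rabs t <= T -> Rabs (coord i (F t X0)) <= B.
Hypothesis HC : forall phi : R -> R3, (forall i t, continuous (fun s => coord i (phi s)) t) ->
  forall i t, continuous (fun s => coord i (F s (phi s))) t.

Let prim (phi : R -> R3) (i : nat) (t : R) : R := coord i X0 + RInt (fun s => coord i (F s (phi s))) 0 t.
Let step (phi : R -> R3) (t : R) : R3 := (prim phi 0 t, prim phi 1 t, prim phi 2 t).
Let cont (phi : R -> R3) : Prop := forall i t, continuous (fun s => coord i (phi s)) t.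

(** [coord] reads every index from 2 on as the third coordinate; truncating the index by [Nat.min]
    makes the statements hold for all indices. *)
Let coord_step phi i t : coord i (step phi t) = prim phi (Nat.min i 2) t.
Proof. destruct i as [|[|[|i]]]; reflexivity. Qed.

Let coord_min X i : coord (Nat.min i 2) X = coord i X.
Proof. destruct i as [|[|[|i]]]; reflexivity. Qed.

Let step_derive phi i t : cont phi -> is_derive (fun s => coord i (step phi s)) t (coord i (F t (phi t))).
Proof.
  intros Hc. apply (der_ext (fun s => prim phi (Nat.min i 2) s)); [intros; symmetry; apply coord_step|].
  rewrite <- (coord_min (F t (phi t))). set (j := Nat.min i 2).
  eapply is_derive_eq; [apply (der_plus (fun _ => coord j X0)); [apply der_const|]|].
  - apply (is_derive_RInt (fun s => coord j (F s (phi s))) (fun t => RInt (fun s => coord j (F s (phi s))) 0 t) 0 t).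
    + apply filter_forall. intros y. apply (RInt_correct (V := R_CompleteNormedModule)).
      apply (ex_RInt_continuous (V := R_CompleteNormedModule)). intros; apply HC; auto.
    + apply HC; auto.
  - ring.
Qed.

Let step_cont phi : cont phi -> cont (step phi).
Proof. intros Hc i t. eapply is_derive_continuous. apply step_derive; auto. Qed.

Let step_0 phi i : coord i (step phi 0) = coord i X0.
Proof. rewrite coord_step. unfold prim. rewrite RInt_point, coord_min. unfold zero; simpl. ring. Qed.

Let it (n : nat) : R -> R3 := Nat.iter n step (fun _ => X0).

Let it_cont n : cont (it n).
Proof. induction n as [|n IH]; [intros i t; apply continuous_const|exact (step_cont _ IH)]. Qed.

Let step_diff phi psi L T c k : cont phi -> cont psi -> 0 <= c -> 0 < k ->
  (forall t X Y i, Rabs t <= T -> Rabs (coord i (F t X) - coord i (F t Y)) <= L * dist_l1 X Y) ->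
  (forall t, Rabs t <= T -> L * dist_l1 (phi t) (psi t) <= c * exp (k * Rabs t)) ->
  forall i t, Rabs t <= T -> Rabs (coord i (step phi t) - coord i (step psi t)) <= c / k * exp (k * Rabs t).
Proof.
  intros Hp Hq Hc Hk HLip H i.
  apply (primitive_bound (fun t => coord i (step phi t) - coord i (step psi t))
    (fun t => coord i (F t (phi t)) - coord i (F t (psi t)))); auto.
  - rewrite !step_0. ring.
  - intros t _. apply der_minus; apply step_derive; auto.
  - intros t Ht. eapply Rle_trans; [apply HLip; auto|]. apply H; auto.
Qed.

Let it_bound T : exists C, 0 <= C /\ forall n i t, Rabs t <= T ->
  Rabs (coord i (it (S n) t) - coord i (it n t)) <= C / 2 ^ n.
Proof.
  destruct (HL T) as [L [PL HLip]]. destruct (HB T) as [B [PB HBd]].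
  (* Three coordinates with Lipschitz constant [L] give [3 L], and doubling this makes the
     contraction factor one half. *)
  set (k := 6 * L). assert (Hk : 0 < k) by (unfold k; lra).
  assert (Q : forall n i t, Rabs t <= T -> Rabs (coord i (it (S n) t) - coord i (it n t)) <= B / k / 2 ^ n * exp (k * Rabs t)).
  { induction n as [|n IH]; intros i.
    - replace (B / k / 2 ^ 0) with (B / k) by (simpl; field; lra).
      apply (primitive_bound (fun t => coord i (it 1 t) - coord i (it 0 t)) (fun t => coord i (F t X0))); auto.
      + change (coord i (step (it 0) 0) - coord i X0 = 0). rewrite step_0. ring.
      + intros t _. pose proof (step_derive (it 0) i t (it_cont 0)) as D0.
        pose proof (der_minus _ _ t _ _ D0 (der_const (coord i X0) t)) as D1. rewrite Rminus_0_r in D1. exact D1.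
      + intros t Ht. eapply Rle_trans; [apply HBd; auto|]. rewrite <- (Rmult_1_r B) at 1. apply Rmult_le_compat_l; auto.
        apply one_le_exp. apply Rmult_le_pos; [lra|apply Rabs_pos].
    - intros t Ht.
      replace (B / k / 2 ^ S n * exp (k * Rabs t)) with (3 * L * (B / k / 2 ^ n) / k * exp (k * Rabs t))
        by (unfold k; simpl; field; repeat split; first [lra | apply pow2_neq0]).
      assert (PC : 0 <= B / k / 2 ^ n).
      { repeat apply Rmult_le_pos; auto; left; apply Rinv_0_lt_compat; auto. apply pow_lt; lra. }
      apply (step_diff (it (S n)) (it n) L T); auto; [nra|].
      intros s Hs. unfold dist_l1. pose proof (IH 0%nat s Hs). pose proof (IH 1%nat s Hs). pose proof (IH 2%nat s Hs).
      replace (3 * L * (B / k / 2 ^ n) * exp (k * Rabs s)) with (L * (3 * (B / k / 2 ^ n * exp (k * Rabs s)))) by ring.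
      apply Rmult_le_compat_l; lra. }
  exists (B / k * exp (k * T)). split.
  - apply Rmult_le_pos; [|left; apply exp_pos]. apply Rmult_le_pos; auto. left; apply Rinv_0_lt_compat; auto.
  - intros n i t Ht. eapply Rle_trans; [apply Q; auto|].
    replace (B / k * exp (k * T) / 2 ^ n) with (B / k / 2 ^ n * exp (k * T)) by (field; repeat split; first [lra | apply pow2_neq0]).
    apply Rmult_le_compat_l.
    + repeat apply Rmult_le_pos; auto; left; apply Rinv_0_lt_compat; auto. apply pow_lt; lra.
    + destruct (Req_dec (Rabs t) T) as [->|]; [lra|]. left; apply exp_increasing. apply Rmult_lt_compat_l; lra.
Qed.

(** A limit obtained separately on each interval [[-T, T]] would be a different function for each
    [T]. [Lim_seq] names one limit for all, which [limc_bound] then identifies with each local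
    one. *)
Let limc (i : nat) (t : R) : R := real (Lim_seq (fun n => coord i (it n t))).

Let limc_bound T : exists C, 0 <= C /\ forall n i t, Rabs t <= T -> Rabs (coord i (it n t) - limc i t) <= C / 2 ^ n.
Proof.
  destruct (it_bound T) as [C [HC0 H]]. exists (2 * C). split; [lra|]. intros n i t Ht.
  destruct (geometric_limit (fun n => coord i (it n t)) C (fun n => H n i t Ht)) as [l Hl].
  replace (limc i t) with l; [apply Hl|].
  symmetry. unfold limc. assert (L : is_lim_seq (fun n => coord i (it n t)) l).
  { apply is_lim_seq_spec. intros e. destruct (pow_half_small (2 * C) e (cond_pos e)) as [N HN].
    exists N. intros m Hm. eapply Rle_lt_trans; [apply Hl|]. eapply Rle_lt_trans; [|exact HN].
    apply Rmult_le_compat_l; [lra|]. apply Rinv_le_contravar; [apply pow_lt; lra|]. apply Rle_pow; [lra|auto]. }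
  rewrite (is_lim_seq_unique _ _ L). reflexivity.
Qed.

Let lim (t : R) : R3 := (limc 0 t, limc 1 t, limc 2 t).

Let coord_lim i t : coord i (lim t) = limc (Nat.min i 2) t.
Proof. destruct i as [|[|[|i]]]; reflexivity. Qed.

Let lim_bound T : exists C, 0 <= C /\ forall n i t, Rabs t <= T -> Rabs (coord i (it n t) - coord i (lim t)) <= C / 2 ^ n.
Proof.
  destruct (limc_bound T) as [C [H0 H]]. exists C. split; auto. intros n i t Ht.
  rewrite coord_lim, <- coord_min. apply H; auto.
Qed.

Let lim_cont : cont lim.
Proof.
  intros i t. destruct (lim_bound (Rabs t + 1)) as [C [H0 H]]. apply continuous_of_eps. intros e He.
  destruct (pow_half_small C (e / 3)) as [n Hn]; [lra|].
  destruct (continuous_eps _ _ (it_cont n i t) (e / 3)) as [d [Hd Hd']]; [lra|].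
  exists (Rmin d 1). split; [apply Rmin_glb_lt; lra|]. intros x Hx.
  pose proof (Rmin_l d 1). pose proof (Rmin_r d 1). specialize (Hd' x ltac:(lra)).
  assert (Rabs x <= Rabs t + 1).
  { replace x with (x - t + t) by ring. eapply Rle_trans; [apply Rabs_triang|]. lra. }
  pose proof (H n i x ltac:(lra)) as Q1. pose proof (H n i t ltac:(lra)) as Q2.
  apply Rabs_le_between in Q1. apply Rabs_le_between in Q2. apply Rabs_def2 in Hd'. apply Rabs_def1; lra.
Qed.

Let lim_fixed i t : coord i (step lim t) = coord i (lim t).
Proof.
  set (T := Rabs t). destruct (lim_bound T) as [C [H0 H]]. destruct (HL T) as [L [PL HLip]].
  apply Rminus_diag_uniq, Rabs_eq_0, Rle_antisym; [|apply Rabs_pos].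
  assert (Hn : forall n, Rabs (coord i (step lim t) - coord i (lim t)) <= (3 * L * C * exp T + C) / 2 ^ n).
  { intros n.
    assert (PCn : 0 <= C / 2 ^ n) by (apply Rmult_le_pos; auto; left; apply Rinv_0_lt_compat, pow_lt; lra).
    pose proof (step_diff lim (it n) L T (3 * L * (C / 2 ^ n)) 1 lim_cont (it_cont n) ltac:(nra) ltac:(lra) HLip) as Q.
    assert (Q' : Rabs (coord i (step lim t) - coord i (step (it n) t)) <= 3 * L * (C / 2 ^ n) / 1 * exp (1 * Rabs t)).
    { apply Q; [|unfold T; lra]. intros s Hs. unfold dist_l1.
      pose proof (H n 0%nat s Hs) as A0. pose proof (H n 1%nat s Hs) as A1. pose proof (H n 2%nat s Hs) as A2.
      rewrite Rabs_minus_sym in A0, A1, A2.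
      assert (1 <= exp (1 * Rabs s)).
      { apply one_le_exp. pose proof (Rabs_pos s). lra. }
      apply Rle_trans with (3 * L * (C / 2 ^ n) * 1).
      - rewrite Rmult_1_r. replace (3 * L * (C / 2 ^ n)) with (L * (3 * (C / 2 ^ n))) by ring. apply Rmult_le_compat_l; lra.
      - apply Rmult_le_compat_l; [nra|auto]. }
    pose proof (H (S n) i t ltac:(unfold T; lra)) as Q2. change (it (S n) t) with (step (it n) t) in Q2.
    replace (3 * L * (C / 2 ^ n) / 1 * exp (1 * Rabs t)) with (3 * L * C * exp T / 2 ^ n) in Q'
      by (unfold T; rewrite Rmult_1_l; field; apply pow2_neq0).
    assert (C / 2 ^ S n <= C / 2 ^ n).
    { apply Rmult_le_compat_l; auto. apply Rinv_le_contravar; [apply pow_lt; lra|]. apply Rle_pow; [lra|lia]. }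
    replace (coord i (step lim t) - coord i (lim t)) with ((coord i (step lim t) - coord i (step (it n) t))
      + (coord i (step (it n) t) - coord i (lim t))) by ring.
    eapply Rle_trans; [apply Rabs_triang|].
    replace ((3 * L * C * exp T + C) / 2 ^ n) with (3 * L * C * exp T / 2 ^ n + C / 2 ^ n) by (field; apply pow2_neq0). lra. }
  destruct (Rle_dec (Rabs (coord i (step lim t) - coord i (lim t))) 0) as [|h]; auto. exfalso.
  destruct (pow_half_small (3 * L * C * exp T + C) (Rabs (coord i (step lim t) - coord i (lim t)))) as [n Hn']; [lra|].
  specialize (Hn n). lra.
Qed.

Lemma picard : exists phi : R -> R3, phi 0 = X0 /\
  forall i t, is_derive (fun s => coord i (phi s)) t (coord i (F t (phi t))).
Proof.
  exists lim. split.
  - pose proof (lim_fixed 0 0) as E0. pose proof (lim_fixed 1 0) as E1. pose proof (lim_fixed 2 0) as E2.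
    rewrite step_0 in E0, E1, E2. destruct (lim 0) as [[x y] z]. destruct X0 as [[x0 y0] z0]. simpl in *. congruence.
  - intros i t. apply (der_ext (fun s => coord i (step lim s))); [intros; apply lim_fixed|].
    apply step_derive. exact lim_cont.
Qed.

End Picard.

Lemma sin_abs_le_1 (x : R) : Rabs (sin x) <= 1.
Proof. pose proof (SIN_bound x). apply Rabs_le_between. lra. Qed.

Lemma cos_abs_le_1 (x : R) : Rabs (cos x) <= 1.
Proof. pose proof (COS_bound x). apply Rabs_le_between. lra. Qed.

Lemma sin_lipschitz (x y : R) : Rabs (sin x - sin y) <= Rabs (x - y).
Proof.
  rewrite <- (Rmult_1_l (Rabs (x - y))). apply (mvt_lipschitz sin cos); [intros; apply is_derive_sin|apply cos_abs_le_1].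
Qed.

Lemma cos_lipschitz (x y : R) : Rabs (cos x - cos y) <= Rabs (x - y).
Proof.
  rewrite <- (Rmult_1_l (Rabs (x - y))). apply (mvt_lipschitz cos (fun x => - sin x)); [intros; apply is_derive_cos|].
  intros t. rewrite Rabs_Ropp. apply sin_abs_le_1.
Qed.

(** Truncation to [[-M, M]], built from [Rmax] and negation so that continuity in [M] as well as in
    [z] comes from [continuous_Rmax]. *)
Definition clamp (M z : R) : R := Rmax (- M) (- Rmax (- M) (- z)).

Lemma clamp_bound (M z : R) : 0 <= M -> Rabs (clamp M z) <= M.
Proof. intros HM. unfold clamp, Rmax. repeat destruct Rle_dec; apply Rabs_le_between; lra. Qed.

Lemma clamp_id (M z : R) : Rabs z <= M -> clamp M z = z.
Proof. intros H. apply Rabs_le_between in H. unfold clamp, Rmax. repeat destruct Rle_dec; lra. Qed.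

Lemma clamp_lipschitz (M z z' : R) : Rabs (clamp M z - clamp M z') <= Rabs (z - z').
Proof.
  apply Rabs_le_between. pose proof (Rle_abs (z - z')). pose proof (Rle_abs (- (z - z'))). rewrite Rabs_Ropp in *.
  pose proof (Rabs_pos (z - z')).
  unfold clamp, Rmax. repeat destruct Rle_dec; lra.
Qed.

Section GlobalSolutions.
Variables al be ka ep : R.
Hypothesis Hal : 0 < al.
Hypothesis Hbe : 0 < be < 1.

Let fz_bound x : Rabs (al * (cos x - be)) <= 2 * al.
Proof.
  rewrite Rabs_mult, (Rabs_right al) by lra. pose proof (COS_bound x).
  assert (Rabs (cos x - be) <= 2) by (apply Rabs_le_between; lra). nra.
Qed.

Let fy_lip M x y z x' y' z' : 0 <= M -> Rabs z <= M -> Rabs z' <= M ->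
  Rabs ((z ^ 2 + ka) * sin x * cos x - sin x - ep * y - ((z' ^ 2 + ka) * sin x' * cos x' - sin x' - ep * y'))
  <= (2 * M + 2 * (M ^ 2 + Rabs ka) + 1 + Rabs ep) * (Rabs (x - x') + Rabs (y - y') + Rabs (z - z')).
Proof.
  intros HM Hz Hz'.
  replace (_ - _) with ((z + z') * (sin x * cos x) * (z - z')
    + (z' ^ 2 + ka) * ((sin x - sin x') * cos x + sin x' * (cos x - cos x')) + - (sin x - sin x') + - (ep * (y - y'))) by ring.
  pose proof (sin_lipschitz x x') as S1. pose proof (cos_lipschitz x x') as C1.
  pose proof (sin_abs_le_1 x) as S2. pose proof (sin_abs_le_1 x') as S3. pose proof (cos_abs_le_1 x) as C2.
  pose proof (Rabs_pos (x - x')) as Px. pose proof (Rabs_pos (y - y')) as Py. pose proof (Rabs_pos (z - z')) as Pz.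
  pose proof (Rabs_pos ka) as Pk. pose proof (Rabs_pos ep) as Pe. pose proof (Rabs_pos z) as Pz1. pose proof (Rabs_pos z') as Pz2.
  set (dx := Rabs (x - x')) in *. set (dy := Rabs (y - y')) in *. set (dz := Rabs (z - z')) in *.
  assert (T1 : Rabs ((z + z') * (sin x * cos x) * (z - z')) <= 2 * M * dz).
  { rewrite !Rabs_mult. fold dz. apply Rmult_le_compat_r; auto.
    assert (Rabs (z + z') <= 2 * M) by (eapply Rle_trans; [apply Rabs_triang|lra]).
    assert (Rabs (sin x) * Rabs (cos x) <= 1 * 1) by (apply Rmult_le_compat; auto using Rabs_pos).
    rewrite <- (Rmult_1_r (2 * M)). apply Rmult_le_compat; auto using Rabs_pos; [|lra].
    apply Rmult_le_pos; apply Rabs_pos. }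
  assert (T2 : Rabs ((z' ^ 2 + ka) * ((sin x - sin x') * cos x + sin x' * (cos x - cos x'))) <= (M ^ 2 + Rabs ka) * (2 * dx)).
  { rewrite Rabs_mult. apply Rmult_le_compat; auto using Rabs_pos.
    - eapply Rle_trans; [apply Rabs_triang|]. apply Rplus_le_compat_r. rewrite <- RPow_abs. apply pow_incr. lra.
    - eapply Rle_trans; [apply Rabs_triang|]. rewrite !Rabs_mult.
      assert (Rabs (sin x - sin x') * Rabs (cos x) <= dx * 1) by (apply Rmult_le_compat; auto using Rabs_pos).
      assert (Rabs (sin x') * Rabs (cos x - cos x') <= 1 * dx) by (apply Rmult_le_compat; auto using Rabs_pos). lra. }
  eapply Rle_trans; [apply Rabs_triang|]. eapply Rle_trans; [apply Rplus_le_compat_r, Rabs_triang|].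
  eapply Rle_trans; [apply Rplus_le_compat_r, Rplus_le_compat_r, Rabs_triang|].
  rewrite !Rabs_Ropp, (Rabs_mult ep). fold dy.
  assert (0 <= M ^ 2) by apply pow2_ge_0.
  assert (0 <= M * (dx + dy)) by (apply Rmult_le_pos; lra).
  assert (0 <= (M ^ 2 + Rabs ka) * (dy + dz)) by (apply Rmult_le_pos; lra).
  assert (0 <= Rabs ep * (dx + dz)) by (apply Rmult_le_pos; lra). lra.
Qed.

(** The term in [z ^ 2] is not globally Lipschitz, but [|z'| <= 2 al] along any solution. Clamping
    [z] at [|z(0)| + 2 al |t|] makes the field Lipschitz on bounded times, and the a priori bound
    shows that the solution never meets the clamp. *)
Lemma fam_existence (X0 : R3) : exists phi, is_sol (fam al be ka 0 ep) phi /\ phi 0 = X0.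
Proof.
  set (M := fun t => Rabs (coord 2 X0) + 2 * al * Rabs t).
  set (F := fun t (X : R3) => let x := coord 0 X in let y := coord 1 X in let z := clamp (M t) (coord 2 X) in
    (y, (z ^ 2 + ka) * sin x * cos x - sin x - ep * y, al * (cos x - be)) : R3).
  assert (PM : forall t, 0 <= M t).
  { intros t. unfold M. pose proof (Rabs_pos (coord 2 X0)). pose proof (Rabs_pos t).
    assert (0 <= 2 * al * Rabs t) by (apply Rmult_le_pos; lra). lra. }
  assert (MM : forall t T, Rabs t <= T -> M t <= M T).
  { intros t T Ht. unfold M. apply Rplus_le_compat_l. apply Rmult_le_compat_l; [lra|].
    pose proof (Rle_abs T). lra. }
  destruct (picard F X0) as [phi [H0 HD]].
  - intros T. exists (2 * M T + 2 * (M T ^ 2 + Rabs ka) + 1 + Rabs ep + al).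
    pose proof (PM T). pose proof (Rabs_pos ka). pose proof (Rabs_pos ep). pose proof (pow2_ge_0 (M T)).
    split; [lra|]. intros t X Y i Ht. unfold dist_l1.
    pose proof (Rabs_pos (coord 0 X - coord 0 Y)). pose proof (Rabs_pos (coord 1 X - coord 1 Y)).
    pose proof (Rabs_pos (coord 2 X - coord 2 Y)).
    set (D := Rabs (coord 0 X - coord 0 Y) + Rabs (coord 1 X - coord 1 Y) + Rabs (coord 2 X - coord 2 Y)).
    assert (PD : 0 <= D) by (unfold D; lra).
    destruct i as [|[|i]].
    + change (Rabs (coord 1 X - coord 1 Y) <= (2 * M T + 2 * (M T ^ 2 + Rabs ka) + 1 + Rabs ep + al) * D).
      apply Rle_trans with (1 * D); [unfold D; lra|]. apply Rmult_le_compat_r; lra.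
    + pose proof (clamp_bound (M t) (coord 2 X) (PM t)). pose proof (clamp_bound (M t) (coord 2 Y) (PM t)).
      pose proof (MM t T Ht). pose proof (clamp_lipschitz (M t) (coord 2 X) (coord 2 Y)).
      pose proof (fy_lip (M T) (coord 0 X) (coord 1 X) (clamp (M t) (coord 2 X))
        (coord 0 Y) (coord 1 Y) (clamp (M t) (coord 2 Y)) ltac:(lra) ltac:(lra) ltac:(lra)) as K.
      eapply Rle_trans; [exact K|]. apply Rmult_le_compat; [lra| |lra|unfold D; lra].
      pose proof (Rabs_pos (clamp (M t) (coord 2 X) - clamp (M t) (coord 2 Y))). lra.
    + change (Rabs (al * (cos (coord 0 X) - be) - al * (cos (coord 0 Y) - be)) <= (2 * M T + 2 * (M T ^ 2 + Rabs ka) + 1 + Rabs ep + al) * D).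
      replace (al * (cos (coord 0 X) - be) - al * (cos (coord 0 Y) - be)) with (al * (cos (coord 0 X) - cos (coord 0 Y))) by ring.
      rewrite Rabs_mult, (Rabs_right al) by lra. pose proof (cos_lipschitz (coord 0 X) (coord 0 Y)).
      apply Rmult_le_compat; [lra|apply Rabs_pos|lra|unfold D; lra].
  - intros T. exists (Rabs (coord 1 X0) + (M T ^ 2 + Rabs ka) + 1 + Rabs ep * Rabs (coord 1 X0) + 2 * al).
    pose proof (PM T). pose proof (Rabs_pos ka). pose proof (Rabs_pos ep). pose proof (pow2_ge_0 (M T)).
    pose proof (Rabs_pos (coord 1 X0)).
    assert (0 <= Rabs ep * Rabs (coord 1 X0)) by (apply Rmult_le_pos; auto).
    split; [lra|]. intros t i Ht.
    destruct i as [|[|i]].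
    + change (Rabs (coord 1 X0) <= Rabs (coord 1 X0) + (M T ^ 2 + Rabs ka) + 1 + Rabs ep * Rabs (coord 1 X0) + 2 * al). lra.
    + set (z := clamp (M t) (coord 2 X0)). set (x := coord 0 X0). set (y := coord 1 X0) in *.
      change (Rabs ((z ^ 2 + ka) * sin x * cos x - sin x - ep * y) <= Rabs y + (M T ^ 2 + Rabs ka) + 1 + Rabs ep * Rabs y + 2 * al).
      assert (Hz : Rabs z <= M T) by (eapply Rle_trans; [apply clamp_bound, PM|apply MM; auto]).
      assert (Hz2 : Rabs (z ^ 2 + ka) <= M T ^ 2 + Rabs ka).
      { eapply Rle_trans; [apply Rabs_triang|]. apply Rplus_le_compat_r. rewrite <- RPow_abs. apply pow_incr.
        split; [apply Rabs_pos|auto]. }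
      pose proof (sin_abs_le_1 x). pose proof (cos_abs_le_1 x).
      replace ((z ^ 2 + ka) * sin x * cos x - sin x - ep * y) with ((z ^ 2 + ka) * (sin x * cos x) + - sin x + - (ep * y)) by ring.
      eapply Rle_trans; [apply Rabs_triang|]. eapply Rle_trans; [apply Rplus_le_compat_r, Rabs_triang|].
      rewrite !Rabs_Ropp, !Rabs_mult.
      assert (Rabs (sin x) * Rabs (cos x) <= 1 * 1) by (apply Rmult_le_compat; auto using Rabs_pos).
      assert (Rabs (z ^ 2 + ka) * (Rabs (sin x) * Rabs (cos x)) <= (M T ^ 2 + Rabs ka) * 1).
      { apply Rmult_le_compat; auto using Rabs_pos; [|lra]. apply Rmult_le_pos; apply Rabs_pos. }
      lra.
    + change (Rabs (al * (cos (coord 0 X0) - be)) <= Rabs (coord 1 X0) + (M T ^ 2 + Rabs ka) + 1 + Rabs ep * Rabs (coord 1 X0) + 2 * al).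
      pose proof (fz_bound (coord 0 X0)). lra.
  - intros phi Hc i t.
    pose proof (Hc 0%nat) as cx. pose proof (Hc 1%nat) as cy. pose proof (Hc 2%nat) as cz.
    assert (csin : continuous (fun s => sin (coord 0 (phi s))) t)
      by (apply (continuous_comp (fun s => coord 0 (phi s)) sin); [apply cx|apply continuous_sin]).
    assert (ccos : continuous (fun s => cos (coord 0 (phi s))) t)
      by (apply (continuous_comp (fun s => coord 0 (phi s)) cos); [apply cx|apply continuous_cos]).
    assert (cM : continuous (fun s => - M s) t).
    { apply (continuous_opp M). unfold M. apply (continuous_plus (fun _ => Rabs (coord 2 X0))); [apply continuous_const|].
      apply (continuous_mult (fun _ => 2 * al)); [apply continuous_const|apply continuous_Rabs]. }
    assert (cc : continuous (fun s => clamp (M s) (coord 2 (phi s))) t).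
    { unfold clamp. apply continuous_Rmax; auto. apply (continuous_opp (fun s => Rmax (- M s) (- coord 2 (phi s)))).
      apply continuous_Rmax; auto. apply (continuous_opp (fun s => coord 2 (phi s))). apply cz. }
    destruct i as [|[|i]].
    + apply cy.
    + change (continuous (fun s => (clamp (M s) (coord 2 (phi s)) ^ 2 + ka) * sin (coord 0 (phi s)) * cos (coord 0 (phi s))
        - sin (coord 0 (phi s)) - ep * coord 1 (phi s)) t).
      apply (continuous_minus (fun s => _ - _)).
      * apply (continuous_minus (fun s => _ * _)); auto.
        apply (continuous_mult (fun s => _ * _)); auto. apply (continuous_mult (fun s => _ + _)); auto.
        apply (continuous_plus (fun s => _ ^ 2)); [|apply continuous_const]. simpl.
        apply (continuous_mult (fun s => clamp (M s) (coord 2 (phi s)))); auto.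
        apply (continuous_mult (fun s => clamp (M s) (coord 2 (phi s))) (fun _ => 1)); auto. apply continuous_const.
      * apply (continuous_mult (fun _ => ep)); [apply continuous_const|apply cy].
    + change (continuous (fun s => al * (cos (coord 0 (phi s)) - be)) t).
      apply (continuous_mult (fun _ => al)); [apply continuous_const|].
      apply (continuous_minus (fun s => cos (coord 0 (phi s)))); [auto|apply continuous_const].
  - exists phi. split; auto.
    assert (Hz : forall t, Rabs (coord 2 (phi t)) <= M t).
    { intros t. pose proof (mvt_lipschitz (fun s => coord 2 (phi s)) (fun t => coord 2 (F t (phi t))) (2 * al)
        (fun t => HD 2%nat t) (fun t => fz_bound (coord 0 (phi t))) t 0) as L.
      cbv beta in L. rewrite H0, Rminus_0_r in L. unfold M.
      replace (coord 2 (phi t)) with (coord 2 X0 + (coord 2 (phi t) - coord 2 X0)) by ring.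
      eapply Rle_trans; [apply Rabs_triang|]. lra. }
    intros t i Hi. specialize (HD i t). eapply is_derive_eq; [exact HD|].
    unfold F. cbv zeta. rewrite (clamp_id _ _ (Hz t)). unfold fam. cbv zeta.
    destruct i as [|[|[|i]]]; simpl; ring.
Qed.

(** The same a priori bound on [z] confines both solutions to a region with one Lipschitz constant,
    and Gronwall applies to their squared distance. The rate [6 L] combines the factor 2 of the
    derivative of a square with [(x + y + z) ^ 2 <= 3 (x ^ 2 + y ^ 2 + z ^ 2)]. *)
Lemma fam_uniqueness (phi psi : R -> R3) : is_sol (fam al be ka 0 ep) phi -> is_sol (fam al be ka 0 ep) psi ->
  phi 0 = psi 0 -> forall t, phi t = psi t.
Proof.
  intros Hphi Hpsi H0.
  (* it is enough to treat nonnegative times, for both signs of the field *)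
  assert (K : forall (sg : R) (f g : R -> R3), Rabs sg = 1 -> f 0 = g 0 ->
    (forall t i, (i < 3)%nat -> is_derive (fun s => coord i (f s)) t (sg * coord i (fam al be ka 0 ep (f t)))) ->
    (forall t i, (i < 3)%nat -> is_derive (fun s => coord i (g s)) t (sg * coord i (fam al be ka 0 ep (g t)))) ->
    forall t, 0 <= t -> f t = g t).
  { intros sg f g Hsg E0 Df Dg T HT.
    assert (Hz : forall h, (forall t i, (i < 3)%nat -> is_derive (fun s => coord i (h s)) t (sg * coord i (fam al be ka 0 ep (h t)))) ->
      h 0 = f 0 -> forall t, 0 <= t <= T -> Rabs (coord 2 (h t)) <= Rabs (coord 2 (f 0)) + 2 * al * T).
    { intros h Dh Eh t Ht.
      pose proof (mvt_lipschitz (fun s => coord 2 (h s)) (fun t => sg * coord 2 (fam al be ka 0 ep (h t))) (2 * al)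
        (fun t => Dh t 2%nat ltac:(lia))) as L.
      specialize (L ltac:(intros s; cbv beta; rewrite Rabs_mult, Hsg, Rmult_1_l; apply fz_bound) t 0).
      cbv beta in L. rewrite Eh, Rminus_0_r, (Rabs_right t) in L by lra.
      replace (coord 2 (h t)) with (coord 2 (f 0) + (coord 2 (h t) - coord 2 (f 0))) by ring.
      eapply Rle_trans; [apply Rabs_triang|].
      assert (2 * al * t <= 2 * al * T) by (apply Rmult_le_compat_l; lra). lra. }
    set (M := Rabs (coord 2 (f 0)) + 2 * al * T).
    assert (PM : 0 <= M).
    { unfold M. pose proof (Rabs_pos (coord 2 (f 0))). assert (0 <= 2 * al * T) by (apply Rmult_le_pos; lra). lra. }
    set (L := 2 * M + 2 * (M ^ 2 + Rabs ka) + 1 + Rabs ep + al).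
    assert (PL : 1 <= L).
    { unfold L. pose proof (pow2_ge_0 M). pose proof (Rabs_pos ka). pose proof (Rabs_pos ep). lra. }
    set (d := fun i t => coord i (f t) - coord i (g t)).
    set (V := fun t => d 0%nat t ^ 2 + d 1%nat t ^ 2 + d 2%nat t ^ 2).
    set (r := fun i t => sg * coord i (fam al be ka 0 ep (f t)) - sg * coord i (fam al be ka 0 ep (g t))).
    assert (HV : V T <= V 0 * exp (6 * L * (T - 0))).
    { apply gronwall_le_ex; auto. intros t Ht.
      exists (2 * (d 0%nat t * r 0%nat t) + 2 * (d 1%nat t * r 1%nat t) + 2 * (d 2%nat t * r 2%nat t)). split.
      - assert (Dd : forall i, (i < 3)%nat -> is_derive (fun t => d i t ^ 2) t (2 * (d i t * r i t))).
        { intros i Hi. apply (der_ext (fun t => d i t * d i t)); [intros; ring|].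
          assert (Di : is_derive (d i) t (r i t)) by (apply der_minus; auto).
          eapply is_derive_eq; [apply der_mult; exact Di|ring]. }
        apply (der_plus (fun t => d 0%nat t ^ 2 + d 1%nat t ^ 2)); [apply (der_plus (fun t => d 0%nat t ^ 2))|];
          apply Dd; lia.
      - assert (Rb : forall i, (i < 3)%nat -> Rabs (r i t) <= L * (Rabs (d 0%nat t) + Rabs (d 1%nat t) + Rabs (d 2%nat t))).
        { intros i Hi. unfold r. rewrite <- Rmult_minus_distr_l, Rabs_mult, Hsg, Rmult_1_l.
          pose proof (Rabs_pos (d 0%nat t)). pose proof (Rabs_pos (d 1%nat t)). pose proof (Rabs_pos (d 2%nat t)).
          set (D := Rabs (d 0%nat t) + Rabs (d 1%nat t) + Rabs (d 2%nat t)).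
          assert (PD : 0 <= D) by (unfold D; lra).
          destruct i as [|[|[|i]]]; [| | |lia].
          - change (Rabs (d 1%nat t) <= L * D). apply Rle_trans with (1 * D); [unfold D; lra|]. apply Rmult_le_compat_r; auto.
          - pose proof (fy_lip M (coord 0 (f t)) (coord 1 (f t)) (coord 2 (f t)) (coord 0 (g t)) (coord 1 (g t)) (coord 2 (g t))
              PM (Hz f Df eq_refl t Ht) (Hz g Dg (eq_sym E0) t Ht)) as Q.
            unfold fam. cbn [coord fst snd] in *. rewrite !Rmult_0_l, !Rplus_0_l. eapply Rle_trans; [exact Q|].
            apply Rmult_le_compat_r; [exact PD|]. unfold L. lra.
          - change (Rabs (al * (cos (coord 0 (f t)) - be) - al * (cos (coord 0 (g t)) - be)) <= L * D).
            replace (al * (cos (coord 0 (f t)) - be) - al * (cos (coord 0 (g t)) - be)) with (al * (cos (coord 0 (f t)) - cos (coord 0 (g t)))) by ring.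
            rewrite Rabs_mult, (Rabs_right al) by lra. pose proof (cos_lipschitz (coord 0 (f t)) (coord 0 (g t))) as CL.
            apply Rmult_le_compat; [lra|apply Rabs_pos| |].
            + unfold L. pose proof (pow2_ge_0 M). pose proof (Rabs_pos ka). pose proof (Rabs_pos ep). lra.
            + eapply Rle_trans; [exact CL|]. fold (d 0%nat t). unfold D. lra. }
        assert (Pb : forall i, (i < 3)%nat -> d i t * r i t <= Rabs (d i t) * (L * (Rabs (d 0%nat t) + Rabs (d 1%nat t) + Rabs (d 2%nat t)))).
        { intros i Hi. eapply Rle_trans; [apply Rle_abs|]. rewrite Rabs_mult. apply Rmult_le_compat_l; [apply Rabs_pos|auto]. }
        pose proof (Pb 0%nat ltac:(lia)) as Q0. pose proof (Pb 1%nat ltac:(lia)) as Q1. pose proof (Pb 2%nat ltac:(lia)) as Q2.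
        unfold V. rewrite <- (pow2_abs (d 0%nat t)), <- (pow2_abs (d 1%nat t)), <- (pow2_abs (d 2%nat t)).
        set (x := Rabs (d 0%nat t)) in *. set (y := Rabs (d 1%nat t)) in *. set (z := Rabs (d 2%nat t)) in *.
        apply Rle_trans with (2 * L * (x + y + z) ^ 2); [lra|].
        replace (6 * L * (x ^ 2 + y ^ 2 + z ^ 2)) with (2 * L * (3 * (x ^ 2 + y ^ 2 + z ^ 2))) by ring.
        apply Rmult_le_compat_l; [lra|].
        pose proof (pow2_ge_0 (x - y)). pose proof (pow2_ge_0 (y - z)). pose proof (pow2_ge_0 (x - z)). lra. }
    assert (V0 : V 0 = 0) by (unfold V, d; rewrite E0; ring).
    rewrite V0, Rmult_0_l in HV. unfold V in HV.
    pose proof (pow2_ge_0 (d 0%nat T)). pose proof (pow2_ge_0 (d 1%nat T)). pose proof (pow2_ge_0 (d 2%nat T)).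
    assert (Z : forall i, d i T ^ 2 = 0 -> coord i (f T) = coord i (g T)).
    { intros i Hi. apply Rminus_diag_uniq. fold (d i T). rewrite <- Rsqr_pow2 in Hi. apply Rsqr_eq_0. exact Hi. }
    pose proof (Z 0%nat ltac:(lra)) as Z0. pose proof (Z 1%nat ltac:(lra)) as Z1. pose proof (Z 2%nat ltac:(lra)) as Z2.
    destruct (f T) as [[x y] z]. destruct (g T) as [[x' y'] z']. simpl in *. congruence. }
  intros t. destruct (Rle_dec 0 t) as [Ht|Ht].
  - apply (K 1 phi psi); auto; [apply Rabs_R1| |]; intros s i Hi; rewrite Rmult_1_l; auto.
  - rewrite <- (Ropp_involutive t).
    assert (Rev : forall h : R -> R3, is_sol (fam al be ka 0 ep) h -> forall s i, (i < 3)%nat ->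
      is_derive (fun s => coord i (h (- s))) s (-1 * coord i (fam al be ka 0 ep (h (- s))))).
    { intros h Hh s i Hi. eapply is_derive_eq.
      - apply (der_comp (fun s => coord i (h s)) (fun s => - s) s (coord i (fam al be ka 0 ep (h (- s)))) (-1)); [apply Hh; auto|].
        auto_derive; [exact I|ring].
      - ring. }
    apply (K (-1) (fun s => phi (- s)) (fun s => psi (- s))); [rewrite Rabs_left; lra|rewrite Ropp_0; auto| | |lra].
    + apply Rev; auto.
    + apply Rev; auto.
Qed.

End GlobalSolutions.

(** * The equations in normal coordinates *)

Definition sin_rem (a x : R) : R :=
  sin (a + x) - (sin a + cos a * x - sin a * x ^ 2 / 2 - cos a * x ^ 3 / 6).

Lemma power_bound (f df : R -> R) (k : nat) : f 0 = 0 -> (forall x, is_derive f x (df x)) ->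
  (forall x, Rabs (df x) <= Rabs x ^ k) -> forall x, Rabs (f x) <= Rabs x ^ S k.
Proof.
  intros H0 HD HB x.
  assert (K : exists c, Rabs c <= Rabs x /\ f x = df c * x).
  { destruct (Rle_dec 0 x) as [h|h].
    - destruct (mvt f df 0 x h) as [c [Hc E]]; [auto|]. exists c. split; [rewrite !Rabs_right; lra|]. rewrite H0 in E. lra.
    - destruct (mvt f df x 0) as [c [Hc E]]; [lra|auto|]. exists c.
      split; [rewrite !Rabs_left1; lra|]. rewrite H0 in E. lra. }
  destruct K as [c [Hc ->]]. rewrite Rabs_mult. simpl. rewrite Rmult_comm. apply Rmult_le_compat_l; [apply Rabs_pos|].
  eapply Rle_trans; [apply HB|]. apply pow_incr. split; [apply Rabs_pos|auto].
Qed.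

(** The first three derivatives of the remainder vanish at 0 and the fourth is a sine, bounded by 1.
    Each application of [power_bound] raises the exponent by one, up to the cubic bound on the
    derivative. *)
Lemma sin_rem_lipschitz (a M x y : R) : Rabs x <= M -> Rabs y <= M ->
  Rabs (sin_rem a x - sin_rem a y) <= 1 * M ^ 3 * Rabs (x - y).
Proof.
  set (r3 := fun x => cos (a + x) - (cos a - sin a * x - cos a * x ^ 2 / 2)).
  set (r2 := fun x => - sin (a + x) - (- sin a - cos a * x)).
  set (r1 := fun x => - cos (a + x) + cos a).
  assert (D4 : forall x, is_derive (sin_rem a) x (r3 x)).
  { intros t. unfold sin_rem, r3. auto_derive; [exact I|field]. }
  assert (D3 : forall x, is_derive r3 x (r2 x)).
  { intros t. unfold r3, r2. auto_derive; [exact I|field]. }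
  assert (D2 : forall x, is_derive r2 x (r1 x)).
  { intros t. unfold r2, r1. auto_derive; [exact I|field]. }
  assert (D1 : forall x, is_derive r1 x (sin (a + x))).
  { intros t. unfold r1. auto_derive; [exact I|ring]. }
  assert (B1 : forall x, Rabs (r1 x) <= Rabs x ^ 1).
  { apply (power_bound r1 (fun x => sin (a + x))); auto; [unfold r1; rewrite Rplus_0_r; ring|].
    intros t. simpl. apply sin_abs_le_1. }
  assert (B2 : forall x, Rabs (r2 x) <= Rabs x ^ 2).
  { apply (power_bound r2 r1); auto. unfold r2; rewrite Rplus_0_r; ring. }
  assert (B3 : forall x, Rabs (r3 x) <= Rabs x ^ 3).
  { apply (power_bound r3 r2); auto. unfold r3; rewrite Rplus_0_r; field. }
  assert (K : forall x y, x <= y -> Rabs x <= M -> Rabs y <= M -> Rabs (sin_rem a x - sin_rem a y) <= M ^ 3 * Rabs (x - y)).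
  { intros u v Huv Hu Hv. destruct (mvt (sin_rem a) r3 u v Huv) as [c [Hc E]]; [auto|].
    rewrite Rabs_minus_sym, E, Rabs_mult, (Rabs_minus_sym v). apply Rmult_le_compat_r; [apply Rabs_pos|].
    eapply Rle_trans; [apply B3|]. apply pow_incr. split; [apply Rabs_pos|].
    apply Rabs_le_between in Hu. apply Rabs_le_between in Hv. apply Rabs_le_between. lra. }
  intros Hx Hy. rewrite Rmult_1_l. destruct (Rle_dec x y) as [h|h]; [auto|].
  rewrite Rabs_minus_sym, (Rabs_minus_sym x). apply K; auto; lra.
Qed.

Lemma ord_sin_rem (wn wS : nat) (a : R) f : Ord wn wS 1 f -> Ord wn wS 4 (fun n u v S => sin_rem a (f n u v S)).
Proof.
  intros H. apply (ord_comp wn wS 3 (sin_rem a) 1); auto; [lra| |].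
  - unfold sin_rem. rewrite Rplus_0_r. field.
  - intros M x y. apply sin_rem_lipschitz.
Qed.

Lemma loc_lipschitz_const (c : R) : loc_lipschitz (fun _ _ _ => c).
Proof. intros b. exists (Rabs c). apply BL_const. Qed.

Lemma loc_lipschitz_mult f g : loc_lipschitz f -> loc_lipschitz g -> loc_lipschitz (fun x y z => f x y z * g x y z).
Proof. intros H1 H2 b. destruct (H1 b) as [C1 K1]. destruct (H2 b) as [C2 K2]. eexists. apply BL_mult; eauto. Qed.

Lemma loc_lipschitz_sub f g : loc_lipschitz f -> loc_lipschitz g -> loc_lipschitz (fun x y z => f x y z - g x y z).
Proof.
  intros H1 H2. apply (loc_lipschitz_add f (fun x y z => - g x y z)); auto.
  intros b. destruct (H2 b) as [C K]. exists C. apply BL_opp; auto.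
Qed.

Lemma loc_lipschitz_coord (i : nat) : loc_lipschitz (fun x y z => coord i (x, y, z)).
Proof.
  intros b. exists (Rabs b + 1). pose proof (Rle_abs b). pose proof (Rabs_pos b). split.
  - intros x y z [H1 [H2 H3]]. destruct i as [|[|i]]; simpl; lra.
  - intros. pose proof (Rabs_pos (x - x')). pose proof (Rabs_pos (y - y')). pose proof (Rabs_pos (z - z')).
    assert (0 <= Rabs b * (Rabs (x - x') + Rabs (y - y') + Rabs (z - z'))) by (apply Rmult_le_pos; lra).
    destruct i as [|[|i]]; simpl; lra.
Qed.

Ltac loc_lip :=
  lazymatch goal with
  | |- loc_lipschitz (fun _ _ _ => ?c) => apply loc_lipschitz_const
  | |- loc_lipschitz (fun x y z => x) => exact (loc_lipschitz_coord 0)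
  | |- loc_lipschitz (fun x y z => y) => exact (loc_lipschitz_coord 1)
  | |- loc_lipschitz (fun x y z => z) => exact (loc_lipschitz_coord 2)
  | |- loc_lipschitz (fun x y z => @?f x y z + @?g x y z) => refine (loc_lipschitz_add f g _ _); loc_lip
  | |- loc_lipschitz (fun x y z => @?f x y z - @?g x y z) => refine (loc_lipschitz_sub f g _ _); loc_lip
  | |- loc_lipschitz (fun x y z => @?f x y z * @?g x y z) => refine (loc_lipschitz_mult f g _ _); loc_lip
  | |- loc_lipschitz (fun x y z => @?f x y z / ?c) =>
      refine (loc_lipschitz_mult f (fun _ _ _ => / c) _ (loc_lipschitz_const _)); loc_lip
  | |- loc_lipschitz (fun x y z => @?f x y z ^ 2) =>
      refine (loc_lipschitz_mult f (fun x y z => f x y z * 1) _ (loc_lipschitz_mult f _ _ (loc_lipschitz_const 1))); loc_lip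
  end.

Lemma loc_lipschitz_bounded_uc (f1 f2 f3 : R -> R -> R -> R) :
  loc_lipschitz f1 -> loc_lipschitz f2 -> loc_lipschitz f3 -> bounded_uc (vf3 f1 f2 f3).
Proof.
  intros H1 H2 H3 b e He.
  destruct (H1 (Rabs b + 1)) as [C1 [_ K1]]. destruct (H2 (Rabs b + 1)) as [C2 [_ K2]]. destruct (H3 (Rabs b + 1)) as [C3 [_ K3]].
  set (C := Rabs C1 + Rabs C2 + Rabs C3).
  pose proof (Rabs_pos C1). pose proof (Rabs_pos C2). pose proof (Rabs_pos C3).
  pose proof (Rle_abs C1). pose proof (Rle_abs C2). pose proof (Rle_abs C3). pose proof (Rle_abs b).
  set (d := Rmin 1 (e / (3 * C + 1))).
  assert (HC : 0 <= C) by (unfold C; lra).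
  assert (Hd : 0 < d) by (apply Rmin_glb_lt; [lra|apply Rdiv_lt_0_compat; lra]).
  exists d. split; auto. intros X Y HX HXY.
  assert (D1 : d <= 1) by apply Rmin_l. assert (D2 : d <= e / (3 * C + 1)) by apply Rmin_r.
  pose proof (dist3_coord X Y 0) as E0. pose proof (dist3_coord X Y 1) as E1. pose proof (dist3_coord X Y 2) as E2.
  assert (BX : box (Rabs b + 1) (coord 0 X) (coord 1 X) (coord 2 X)).
  { pose proof (HX 0%nat). pose proof (HX 1%nat). pose proof (HX 2%nat). repeat split; lra. }
  assert (BY : box (Rabs b + 1) (coord 0 Y) (coord 1 Y) (coord 2 Y)).
  { pose proof (HX 0%nat). pose proof (HX 1%nat). pose proof (HX 2%nat).
    assert (T : forall x y, Rabs (x - y) <= 1 -> Rabs x <= b -> Rabs y <= Rabs b + 1).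
    { intros x y Hxy Hx. replace y with (x + - (x - y)) by ring. eapply Rle_trans; [apply Rabs_triang|]. rewrite Rabs_Ropp. lra. }
    repeat split; [apply (T (coord 0 X)) | apply (T (coord 1 X)) | apply (T (coord 2 X))]; auto; lra. }
  eapply Rle_lt_trans; [apply dist3_le|].
  specialize (K1 _ _ _ _ _ _ BX BY). specialize (K2 _ _ _ _ _ _ BX BY). specialize (K3 _ _ _ _ _ _ BX BY).
  set (s := Rabs (coord 0 X - coord 0 Y) + Rabs (coord 1 X - coord 1 Y) + Rabs (coord 2 X - coord 2 Y)) in *.
  assert (Hs : 0 <= s <= 3 * dist3 X Y).
  { pose proof (Rabs_pos (coord 0 X - coord 0 Y)). pose proof (Rabs_pos (coord 1 X - coord 1 Y)).
    pose proof (Rabs_pos (coord 2 X - coord 2 Y)). unfold s. lra. }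
  assert (C1 * s + C2 * s + C3 * s <= C * s).
  { replace (C1 * s + C2 * s + C3 * s) with ((C1 + C2 + C3) * s) by ring. apply Rmult_le_compat_r; unfold C; lra. }
  assert (C * s <= C * (3 * dist3 X Y)) by (apply Rmult_le_compat_l; lra).
  assert ((3 * C + 1) * d <= e).
  { apply (Rmult_le_compat_l (3 * C + 1)) in D2; [|lra].
    replace ((3 * C + 1) * (e / (3 * C + 1))) with e in D2 by (field; lra). exact D2. }
  assert (C * dist3 X Y <= C * d) by (apply Rmult_le_compat_l; lra).
  pose proof (dist3_pos X Y).
  change (Rabs (f1 (coord 0 X) (coord 1 X) (coord 2 X) - f1 (coord 0 Y) (coord 1 Y) (coord 2 Y))
    + Rabs (f2 (coord 0 X) (coord 1 X) (coord 2 X) - f2 (coord 0 Y) (coord 1 Y) (coord 2 Y))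
    + Rabs (f3 (coord 0 X) (coord 1 X) (coord 2 X) - f3 (coord 0 Y) (coord 1 Y) (coord 2 Y)) < e).
  lra.
Qed.

Section NormalCoordinates.
Variables b om al z0 x0 eta lam D : R.
Hypothesis Hb : 0 < b.
Hypothesis Hom : 0 < om.
Hypothesis Hal : 0 < al.
Hypothesis Hz0 : 0 < z0.
Hypothesis Hrel : om ^ 2 * b ^ 2 = 1 - b ^ 4.
Hypothesis Hcos : cos x0 = b ^ 2.
Hypothesis Hsin : sin x0 = om * b.
Hypothesis Heta : eta = al * b.
Hypothesis Hlam : lam = 2 * al * z0 * b ^ 4.
Hypothesis HD : D = lam ^ 2 + om ^ 2.

(** The equilibrium condition [z0 ^ 2 + kappa = 1 / beta] with [beta = b ^ 2], solved for [kappa];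
    this keeps all later expressions rational in [b], [om], [z0]. *)
Definition kap : R := 1 / b ^ 2 - z0 ^ 2.

Lemma eta_pos : 0 < eta.
Proof. rewrite Heta. apply Rmult_lt_0_compat; auto. Qed.
Lemma lam_pos : 0 < lam.
Proof. rewrite Hlam. repeat apply Rmult_lt_0_compat; auto; try lra. Qed.
Lemma D_pos : 0 < D.
Proof. rewrite HD. pose proof (pow2_ge_0 lam). assert (0 < om ^ 2) by (apply pow_lt; auto). lra. Qed.

(** From here to [gxzz]: the second and third partial derivatives of the [y] component at the
    equilibrium, reduced with [sin x0 = om b] and [cos x0 = b ^ 2]. *)
Definition gxx : R := - 3 * (om * b).
Definition gxz : R := 2 * z0 * (2 * b ^ 4 - 1).
Definition gzz : R := 2 * (om * b) * b ^ 2.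
Definition gxxx : R := - 7 * b ^ 2 + 4 / b ^ 2.
Definition gxxz : R := - 8 * z0 * (om * b) * b ^ 2.
Definition gxzz : R := 2 * (2 * b ^ 4 - 1).

Definition g2 (x z : R) : R := gxx / 2 * x ^ 2 + gxz * (x * z) + gzz / 2 * z ^ 2.
Definition g3 (x z : R) : R := gxxx / 6 * x ^ 3 + gxxz / 2 * (x ^ 2 * z) + gxzz / 2 * (x * z ^ 2).
Definition t3 : R := - (2 / 3) * (2 * b ^ 4 - 1).
(** The product of sine and cosine is half a sine of the double angle, so its Taylor remainder is
    again an instance of [sin_rem]; [t3] is the matching cubic coefficient. *)
Definition remT (x : R) : R := / 2 * sin_rem (2 * x0) (2 * x).
Definition remg (x z : R) : R :=
  (1 / b ^ 2 + 2 * z0 * z + z ^ 2) * remT x - sin_rem x0 x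
  + 2 * z0 * t3 * (z * x ^ 3) - 2 * (om * b) * b ^ 2 * (z ^ 2 * x ^ 2) + t3 * (z ^ 2 * x ^ 3).
(** The cosine is a sine shifted by [PI / 2], which lets one remainder estimate cover all
    trigonometric terms. *)
Definition remc (x : R) : R := al * sin_rem (x0 + PI / 2) x.

Definition gy (x z : R) : R :=
  ((z0 + z) ^ 2 + kap) * sin (x0 + x) * cos (x0 + x) - sin (x0 + x) + om ^ 2 * x - 2 * z0 * (om * b) * b ^ 2 * z.
Definition gz (x : R) : R := al * (cos (x0 + x) - b ^ 2) + al * (om * b) * x.

Lemma gy_taylor x z : gy x z = g2 x z + g3 x z + remg x z.
Proof.
  assert (E1 : sin (x0 + x) * cos (x0 + x) = om * b * b ^ 2 + (2 * b ^ 4 - 1) * x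
    - 2 * (om * b) * b ^ 2 * x ^ 2 + t3 * x ^ 3 + remT x).
  { unfold remT, sin_rem, t3.
    replace (2 * x0 + 2 * x) with (2 * (x0 + x)) by ring. rewrite !sin_2a, cos_2a_cos, Hsin, Hcos. field. }
  assert (E2 : sin (x0 + x) = om * b + b ^ 2 * x - om * b * x ^ 2 / 2 - b ^ 2 * x ^ 3 / 6 + sin_rem x0 x).
  { unfold sin_rem. rewrite Hsin, Hcos. ring. }
  assert (E3 : om ^ 2 = (1 - b ^ 4) / b ^ 2) by (rewrite <- Hrel; field; lra).
  unfold gy, kap. rewrite (Rmult_assoc ((z0 + z) ^ 2 + _)), E1, E2, E3.
  unfold g2, g3, remg, gxx, gxz, gzz, gxxx, gxxz, gxzz, t3. field. lra.
Qed.

Lemma gz_taylor x : gz x = - (al * b ^ 2 / 2) * x ^ 2 + al * (om * b) / 6 * x ^ 3 + remc x.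
Proof.
  unfold gz, remc, sin_rem.
  replace (x0 + PI / 2 + x) with (PI / 2 + (x0 + x)) by ring. replace (x0 + PI / 2) with (PI / 2 + x0) by ring.
  rewrite <- !cos_sin. rewrite (cos_plus (PI / 2) x0), cos_PI2, sin_PI2, Hsin, Hcos. field.
Qed.

(* Coefficients of the projections of [(0, y, z)] on the eigendirections. *)
Definition cu (z y : R) : R := z / eta - om * ((om * z / eta - y) / D).
Definition cv (z y : R) : R := - lam * ((om * z / eta - y) / D).
Definition cs (z y : R) : R := (om * z / eta - y) / D.

Definition y20 : R := gzz / 2 * eta ^ 2.
Definition y11 : R := gxz * eta.
Definition y02 : R := gxx / 2.
Definition z02 : R := - (al * b ^ 2 / 2).

(** Solution of the linear system in [h_homological]. On quadratic forms the operator has the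
    eigenvalues [- lam] and [- lam] shifted by [2 i om] and [- 2 i om], whence the denominators
    [lam] and [lam ^ 2 + 4 om ^ 2]. *)
Definition hb : R := (lam * cs 0 y11 + 2 * om * (cs 0 y20 - cs z02 y02)) / (lam ^ 2 + 4 * om ^ 2).
Definition ha : R := (cs 0 y20 - om * hb) / lam.
Definition hc : R := (cs z02 y02 + om * hb) / lam.
Definition h (u v : R) : R := ha * u ^ 2 + hb * (u * v) + hc * v ^ 2.
Definition hu (u v : R) : R := 2 * ha * u + hb * v.
Definition hv (u v : R) : R := hb * u + 2 * hc * v.

(* The quadratic part of the centre manifold. *)
Lemma h_homological u v : - lam * h u v + (cs 0 y20 * u ^ 2 + cs 0 y11 * (u * v) + cs z02 y02 * v ^ 2)
  + om * (hu u v * v - hv u v * u) = 0.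
Proof.
  pose proof lam_pos. assert (0 < lam ^ 2 + 4 * om ^ 2) by (pose proof (pow2_ge_0 lam); assert (0 < om ^ 2) by (apply pow_lt; auto); lra).
  unfold h, hu, hv, ha, hc, hb.
  generalize (cs 0 y20) (cs 0 y11) (cs z02 y02). intros k2 k1 k0. field. split; lra.
Qed.

(** [YU], [YV], [ZV] are the coefficients of [s u] and [s v] in the two nonlinear components. As
    [s = S + h], they send [h] into the cubic coefficients below and [S] into the coupling terms. *)
Definition YU : R := gxz * lam * eta + gzz * eta * (eta * om).
Definition YV : R := gxx * lam + gxz * (eta * om).
Definition ZV : R := - (al * b ^ 2) * lam.

Definition y30 : R := YU * ha.
Definition y21 : R := YU * hb + YV * ha + gxzz / 2 * eta ^ 2.
Definition y12 : R := YU * hc + YV * hb + gxxz / 2 * eta.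
Definition y03 : R := YV * hc + gxxx / 6.
Definition z21 : R := ZV * ha.
Definition z12 : R := ZV * hb.
Definition z03 : R := ZV * hc + al * (om * b) / 6.

(** Coordinates along the eigenvectors: [(lam, - lam ^ 2, eta om)] for [- lam], and the real and
    imaginary directions of the critical pair for [u] and [v], preceded by the shear by [h]. *)
Definition sX (u v S : R) : R := S + h u v.
Definition xX (u v S : R) : R := v + lam * sX u v S.
Definition yX (u v S : R) : R := om * u - lam ^ 2 * sX u v S.
Definition zX (u v S : R) : R := eta * u + eta * om * sX u v S.

Definition Ny (n u v S : R) : R := gy (xX u v S) (zX u v S) - n * yX u v S.
Definition Nz (u v S : R) : R := gz (xX u v S).
Definition Nu (n u v S : R) : R := cu (Nz u v S) (Ny n u v S).
Definition Nv (n u v S : R) : R := cv (Nz u v S) (Ny n u v S).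
(** The rate of [S = s - h(u, v)] beyond [- lam S]; the leading [- lam h] appears because the stable
    rate acts on [s], and the chain rule supplies the last two terms. *)
Definition NS (n u v S : R) : R :=
  - lam * h u v + cs (Nz u v S) (Ny n u v S) - hu u v * (- om * v + Nu n u v S) - hv u v * (om * u + Nv n u v S).

Let Oh a c : Ord a c 2 (fun n u v S => h u v).
Proof. unfold h. ord. Qed.

Lemma Ny_expansion : Ord 2 2 4 (fun n u v S => Ny n u v S - (n * (- om * u)
  + (y20 * u ^ 2 + y11 * (u * v) + y02 * v ^ 2)
  + (y30 * u ^ 3 + y21 * (u ^ 2 * v) + y12 * (u * v ^ 2) + y03 * v ^ 3) + S * (YU * u + YV * v))).
Proof.
  assert (Os : Ord 2 2 2 (fun n u v S => sX u v S)) by (unfold sX; pose proof (Oh 2 2); ord).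
  assert (Ox : Ord 2 2 1 (fun n u v S => xX u v S)) by (unfold xX; ord).
  assert (Oz : Ord 2 2 1 (fun n u v S => zX u v S)) by (unfold zX; ord).
  assert (Ox2 : Ord 2 2 1 (fun n u v S => 2 * xX u v S)) by ord.
  assert (OT : Ord 2 2 4 (fun n u v S => remT (xX u v S))).
  { unfold remT. apply ord_scal. apply (ord_sin_rem 2 2 (2 * x0) (fun n u v S => 2 * xX u v S)). exact Ox2. }
  assert (OS : Ord 2 2 4 (fun n u v S => sin_rem x0 (xX u v S))).
  { apply (ord_sin_rem 2 2 x0 (fun n u v S => xX u v S)). exact Ox. }
  assert (Og : Ord 2 2 4 (fun n u v S => remg (xX u v S) (zX u v S))).
  { unfold remg. ord. }
  (* The remainder in explicit form: powers of [x] and [z] minus those of [v] and [eta u] are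
     factored through [s], which has weight 2, so that each summand visibly reaches weight 4. *)
  apply (ord_ext 2 2 4 (fun n u v S => remg (xX u v S) (zX u v S) + n * (lam ^ 2 * sX u v S)
    + sX u v S ^ 2 * g2 lam (eta * om)
    + gxxx / 6 * (lam * sX u v S * (xX u v S ^ 2 + xX u v S * v + v ^ 2))
    + gxxz / 2 * (xX u v S ^ 2 * (eta * om * sX u v S) + eta * u * (lam * sX u v S) * (xX u v S + v))
    + gxzz / 2 * (lam * sX u v S * zX u v S ^ 2 + v * (eta * om * sX u v S) * (zX u v S + eta * u)))).
  - ord.
  - intros n u v S. unfold Ny. rewrite gy_taylor. generalize (remg (xX u v S) (zX u v S)). intros r.
    unfold yX, y30, y21, y12, y03, y20, y11, y02, g2, g3, xX, zX.
    assert (Eh : sX u v S = S + (ha * u ^ 2 + hb * (u * v) + hc * v ^ 2)) by reflexivity.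
    unfold YU, YV. rewrite Eh. generalize ha hb hc. intros. field.
Qed.

Lemma Nz_expansion : Ord 2 2 4 (fun n u v S => Nz u v S -
  (z02 * v ^ 2 + (z21 * (u ^ 2 * v) + z12 * (u * v ^ 2) + z03 * v ^ 3) + S * (ZV * v))).
Proof.
  assert (Os : Ord 2 2 2 (fun n u v S => sX u v S)) by (unfold sX; pose proof (Oh 2 2); ord).
  assert (Ox : Ord 2 2 1 (fun n u v S => xX u v S)) by (unfold xX; ord).
  assert (OC : Ord 2 2 4 (fun n u v S => remc (xX u v S))).
  { unfold remc. apply ord_scal. apply (ord_sin_rem 2 2 (x0 + PI / 2) (fun n u v S => xX u v S)). exact Ox. }
  apply (ord_ext 2 2 4 (fun n u v S => remc (xX u v S) + z02 * (lam ^ 2 * sX u v S ^ 2)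
    + al * (om * b) / 6 * (lam * sX u v S * (xX u v S ^ 2 + xX u v S * v + v ^ 2)))).
  - ord.
  - intros n u v S. unfold Nz. rewrite gz_taylor. generalize (remc (xX u v S)). intros r.
    unfold z21, z12, z03, z02, xX, ZV.
    assert (Eh : sX u v S = S + (ha * u ^ 2 + hb * (u * v) + hc * v ^ 2)) by reflexivity.
    rewrite Eh. generalize ha hb hc. intros. field.
Qed.

Let nz_eta : eta <> 0.
Proof. pose proof eta_pos. lra. Qed.
Let nz_D : D <> 0.
Proof. pose proof D_pos. lra. Qed.

Lemma Nu_expansion : Ord 2 2 4 (fun n u v S => Nu n u v S - (U1 (cu 0 (- om)) 0 n u v
  + U2 (cu 0 y20) (cu 0 y11) (cu z02 y02) u v + U3 (cu 0 y30) (cu z21 y21) (cu z12 y12) (cu z03 y03) u v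
  + US (cu 0 YU) (cu ZV YV) u v S)).
Proof.
  pose proof Ny_expansion as Hy. pose proof Nz_expansion as Hz.
  apply (ord_ext 2 2 4 (fun n u v S => (1 / eta - om ^ 2 / (eta * D)) * (Nz u v S -
  (z02 * v ^ 2 + (z21 * (u ^ 2 * v) + z12 * (u * v ^ 2) + z03 * v ^ 3) + S * (ZV * v)))
   + om / D * (Ny n u v S - (n * (- om * u)
  + (y20 * u ^ 2 + y11 * (u * v) + y02 * v ^ 2)
  + (y30 * u ^ 3 + y21 * (u ^ 2 * v) + y12 * (u * v ^ 2) + y03 * v ^ 3) + S * (YU * u + YV * v))))).
  - apply ord_add; apply ord_scal; [exact Hz|exact Hy].
  - intros n u v S. unfold Nu, cu, U1, U2, U3, US. generalize (Nz u v S) (Ny n u v S). intros.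
    generalize z02 z21 z12 z03 ZV y20 y11 y02 y30 y21 y12 y03 YU YV. intros. field. auto.
Qed.

Lemma Nv_expansion : Ord 2 2 4 (fun n u v S => Nv n u v S - (V1 (cv 0 (- om)) 0 n u v
  + V2 (cv 0 y20) (cv 0 y11) (cv z02 y02) u v + V3 (cv 0 y30) (cv z21 y21) (cv z12 y12) (cv z03 y03) u v
  + VS (cv 0 YU) (cv ZV YV) u v S)).
Proof.
  pose proof Ny_expansion as Hy. pose proof Nz_expansion as Hz.
  apply (ord_ext 2 2 4 (fun n u v S => - (lam * om / (eta * D)) * (Nz u v S -
  (z02 * v ^ 2 + (z21 * (u ^ 2 * v) + z12 * (u * v ^ 2) + z03 * v ^ 3) + S * (ZV * v)))
   + lam / D * (Ny n u v S - (n * (- om * u)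
  + (y20 * u ^ 2 + y11 * (u * v) + y02 * v ^ 2)
  + (y30 * u ^ 3 + y21 * (u ^ 2 * v) + y12 * (u * v ^ 2) + y03 * v ^ 3) + S * (YU * u + YV * v))))).
  - apply ord_add; apply ord_scal; [exact Hz|exact Hy].
  - intros n u v S. unfold Nv, cv, V1, V2, V3, VS. generalize (Nz u v S) (Ny n u v S). intros.
    generalize z02 z21 z12 z03 ZV y20 y11 y02 y30 y21 y12 y03 YU YV. intros. field. auto.
Qed.

(** The quadratic terms of the forcing of [s] are exactly what [h_homological] cancels; all that
    remains has weight at least 3. This is where the choice of [h] pays off. *)
Lemma NS_order : Ord 2 2 3 NS.
Proof.
  pose proof Ny_expansion as Hy. pose proof Nz_expansion as Hz.
  assert (HNu : Ord 2 2 2 Nu).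
  { eapply Nu_order. exact Nu_expansion. }
  assert (HNv : Ord 2 2 2 Nv).
  { eapply Nv_order. exact Nv_expansion. }
  set (RY := fun n u v S => Ny n u v S - (n * (- om * u)
  + (y20 * u ^ 2 + y11 * (u * v) + y02 * v ^ 2)
  + (y30 * u ^ 3 + y21 * (u ^ 2 * v) + y12 * (u * v ^ 2) + y03 * v ^ 3) + S * (YU * u + YV * v))) in *.
  set (RZ := fun n u v S : R => Nz u v S -
  (z02 * v ^ 2 + (z21 * (u ^ 2 * v) + z12 * (u * v ^ 2) + z03 * v ^ 3) + S * (ZV * v))) in *.
  apply (ord_ext 2 2 3 (fun n u v S =>
    om / (eta * D) * (RZ n u v S + (z21 * (u ^ 2 * v) + z12 * (u * v ^ 2) + z03 * v ^ 3) + S * (ZV * v))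
    - 1 / D * (RY n u v S + n * (- om * u) + (y30 * u ^ 3 + y21 * (u ^ 2 * v) + y12 * (u * v ^ 2) + y03 * v ^ 3)
               + S * (YU * u + YV * v))
    - (2 * ha * u + hb * v) * Nu n u v S - (hb * u + 2 * hc * v) * Nv n u v S)).
  - ord.
  - intros n u v S. pose proof (h_homological u v) as E. unfold NS, RY, RZ.
    assert (E1 : - lam * h u v = - (cs 0 y20 * u ^ 2 + cs 0 y11 * (u * v) + cs z02 y02 * v ^ 2)
      - om * (hu u v * v - hv u v * u)) by lra.
    rewrite E1. unfold cs, hu, hv. generalize (Nz u v S) (Ny n u v S) (Nu n u v S) (Nv n u v S). intros.
    generalize z02 z21 z12 z03 ZV y20 y11 y02 y30 y21 y12 y03 YU YV ha hb hc. intros. field. auto.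
Qed.

Let Ox01 : Ord 0 1 1 (fun n u v S => xX u v S).
Proof. unfold xX, sX, h. ord. Qed.
Let Oz01 : Ord 0 1 1 (fun n u v S => zX u v S).
Proof. unfold zX, sX, h. ord. Qed.

Lemma Ny_linear : Ord 0 1 2 (fun n u v S => Ny n u v S - n * (- om * u + lam ^ 2 * S)).
Proof.
  assert (Ox := Ox01). assert (Oz := Oz01). assert (H := Oh 0 1).
  assert (Ox2 : Ord 0 1 1 (fun n u v S => 2 * xX u v S)) by ord.
  assert (OT : Ord 0 1 4 (fun n u v S => remT (xX u v S))).
  { unfold remT. apply ord_scal. apply (ord_sin_rem 0 1 (2 * x0) (fun n u v S => 2 * xX u v S)). exact Ox2. }
  assert (OS : Ord 0 1 4 (fun n u v S => sin_rem x0 (xX u v S))).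
  { apply (ord_sin_rem 0 1 x0 (fun n u v S => xX u v S)). exact Ox. }
  apply (ord_ext 0 1 2 (fun n u v S => g2 (xX u v S) (zX u v S) + g3 (xX u v S) (zX u v S) + remg (xX u v S) (zX u v S)
    + n * (lam ^ 2 * h u v))).
  - unfold g2, g3, remg. ord.
  - intros n u v S. unfold Ny, yX, sX. rewrite gy_taylor. ring.
Qed.

Lemma Nz_linear : Ord 0 1 2 (fun n u v S => Nz u v S).
Proof.
  assert (Ox := Ox01).
  assert (OC : Ord 0 1 4 (fun n u v S => remc (xX u v S))).
  { unfold remc. apply ord_scal. apply (ord_sin_rem 0 1 (x0 + PI / 2) (fun n u v S => xX u v S)). exact Ox. }
  apply (ord_ext 0 1 2 (fun n u v S => - (al * b ^ 2 / 2) * xX u v S ^ 2 + al * (om * b) / 6 * xX u v S ^ 3 + remc (xX u v S))).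
  - ord.
  - intros n u v S. unfold Nz. rewrite gz_taylor. reflexivity.
Qed.

Lemma Nu_linear : Ord 0 1 2 (fun n u v S => Nu n u v S - n * (cu 0 (- om) * u + 0 * v + cu 0 (lam ^ 2) * S)).
Proof.
  pose proof Ny_linear as Hy. pose proof Nz_linear as Hz.
  apply (ord_ext 0 1 2 (fun n u v S => (1 / eta - om ^ 2 / (eta * D)) * Nz u v S
    + om / D * (Ny n u v S - n * (- om * u + lam ^ 2 * S)))).
  - apply ord_add; apply ord_scal; [exact Hz|exact Hy].
  - intros n u v S. unfold Nu, cu. generalize (Nz u v S) (Ny n u v S). intros. field. auto.
Qed.

Lemma Nv_linear : Ord 0 1 2 (fun n u v S => Nv n u v S - n * (cv 0 (- om) * u + 0 * v + cv 0 (lam ^ 2) * S)).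
Proof.
  pose proof Ny_linear as Hy. pose proof Nz_linear as Hz.
  apply (ord_ext 0 1 2 (fun n u v S => - (lam * om / (eta * D)) * Nz u v S
    + lam / D * (Ny n u v S - n * (- om * u + lam ^ 2 * S)))).
  - apply ord_add; apply ord_scal; [exact Hz|exact Hy].
  - intros n u v S. unfold Nv, cv. generalize (Nz u v S) (Ny n u v S). intros. field. auto.
Qed.

Lemma NS_linear : Ord 0 1 2 (fun n u v S => NS n u v S - n * (cs 0 (- om) * u + 0 * v + cs 0 (lam ^ 2) * S)).
Proof.
  pose proof Ny_linear as Hy. pose proof Nz_linear as Hz. assert (H := Oh 0 1).
  pose proof Nu_linear as HU. pose proof Nv_linear as HV.
  set (RU := fun n u v S => Nu n u v S - n * (cu 0 (- om) * u + 0 * v + cu 0 (lam ^ 2) * S)) in *.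
  set (RV := fun n u v S => Nv n u v S - n * (cv 0 (- om) * u + 0 * v + cv 0 (lam ^ 2) * S)) in *.
  set (RY := fun n u v S => Ny n u v S - n * (- om * u + lam ^ 2 * S)) in *.
  apply (ord_ext 0 1 2 (fun n u v S => - lam * h u v + om / (eta * D) * Nz u v S - 1 / D * RY n u v S
    - (2 * ha * u + hb * v) * (- om * v + (RU n u v S + n * (cu 0 (- om) * u + 0 * v + cu 0 (lam ^ 2) * S)))
    - (hb * u + 2 * hc * v) * (om * u + (RV n u v S + n * (cv 0 (- om) * u + 0 * v + cv 0 (lam ^ 2) * S))))).
  - ord.
  - intros n u v S. unfold NS, RU, RV, RY, cs, hu, hv.
    generalize (Nz u v S) (Ny n u v S) (Nu n u v S) (Nv n u v S) (h u v) ha hb hc. intros. field. auto.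
Qed.

Definition toX (Y : R3) : R3 :=
  let u := coord 0 Y in let v := coord 1 Y in let S := coord 2 Y in
  (x0 + xX u v S, yX u v S, z0 + zX u v S).
(** Projection on the stable direction by the left eigenvector. With [uY] and [vY] it inverts the
    linear part, and subtracting [h] undoes the shear, so the inverse is polynomial as well. *)
Definition sY (y z : R) : R := (om * (z - z0) / eta - y) / D.
Definition uY (y z : R) : R := (z - z0) / eta - om * sY y z.
Definition vY (x y z : R) : R := x - x0 - lam * sY y z.
Definition ofX (X : R3) : R3 :=
  let x := coord 0 X in let y := coord 1 X in let z := coord 2 X in
  (uY y z, vY x y z, sY y z - h (uY y z) (vY x y z)).

Lemma ofX_toX (Y : R3) : ofX (toX Y) = Y.
Proof.
  destruct Y as [[u v] S]. unfold ofX, toX, coord, fst, snd. unfold xX, yX, zX.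
  set (s := sX u v S).
  assert (Es : sY (om * u - lam ^ 2 * s) (z0 + (eta * u + eta * om * s)) = s).
  { unfold sY. replace (om * (z0 + (eta * u + eta * om * s) - z0) / eta) with (om * (u + om * s)) by (field; auto).
    rewrite HD. field. rewrite <- HD. auto. }
  assert (Eu : uY (om * u - lam ^ 2 * s) (z0 + (eta * u + eta * om * s)) = u).
  { unfold uY. rewrite Es. field. auto. }
  assert (Ev : vY (x0 + (v + lam * s)) (om * u - lam ^ 2 * s) (z0 + (eta * u + eta * om * s)) = v).
  { unfold vY. rewrite Es. ring. }
  rewrite Es, Eu, Ev. apply f_equal2; [reflexivity|]. unfold s, sX. ring.
Qed.

Lemma toX_ofX (X : R3) : toX (ofX X) = X.
Proof.
  destruct X as [[x y] z]. unfold ofX, toX, coord, fst, snd. unfold xX, yX, zX, sX.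
  replace (sY y z - h (uY y z) (vY x y z) + h (uY y z) (vY x y z)) with (sY y z) by ring.
  apply f_equal2; [apply f_equal2|].
  - unfold vY. ring.
  - unfold uY, sY. rewrite HD. field. rewrite <- HD. auto.
  - unfold uY. field. auto.
Qed.

Lemma toX_uc : bounded_uc toX.
Proof.
  apply (loc_lipschitz_bounded_uc (fun u v S => x0 + xX u v S) yX (fun u v S => z0 + zX u v S));
    unfold xX, yX, zX, sX, h; loc_lip.
Qed.

Lemma ofX_uc : bounded_uc ofX.
Proof.
  apply (loc_lipschitz_bounded_uc (fun x y z => uY y z) vY (fun x y z => sY y z - h (uY y z) (vY x y z)));
    unfold h, uY, vY, sY; loc_lip.
Qed.

Let dd_eta : 2 * z0 * (om * b) * b ^ 2 * eta = lam * om.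
Proof. rewrite Heta, Hlam. ring. Qed.

Lemma fam_toX (n u v S : R) : fam al (b ^ 2) kap 0 (lam + n) (toX (u, v, S))
  = (yX u v S, Ny n u v S - om ^ 2 * xX u v S + lam * om * (u + om * sX u v S) - lam * yX u v S,
     Nz u v S - eta * om * xX u v S).
Proof.
  unfold fam, toX, coord, fst, snd. apply f_equal2; [apply f_equal2|].
  - reflexivity.
  - unfold Ny, gy. replace (lam * om * (u + om * sX u v S)) with (2 * z0 * (om * b) * b ^ 2 * zX u v S).
    + ring.
    + rewrite <- dd_eta. unfold zX. ring.
  - unfold Nz, gz. rewrite Heta. ring.
Qed.

(** Both directions are differentiated explicitly. For the backward one the current point is written
    as [toX (u, v, S)], after which the rates of [sY], [uY], [vY] are linear algebra with
    [D = lam ^ 2 + om ^ 2]. *)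
Lemma normal_conj (n : R) : conj (hopf_field om lam Nu Nv NS n) (fam al (b ^ 2) kap 0 (lam + n)) toX ofX.
Proof.
  pose proof eta_pos as Pe. pose proof D_pos as PD.
  constructor; [exact ofX_toX|exact toX_ofX| | |exact toX_uc|exact ofX_uc].
  - intros phi t H.
    pose proof (H 0%nat ltac:(lia)) as Du. pose proof (H 1%nat ltac:(lia)) as Dv. pose proof (H 2%nat ltac:(lia)) as DS.
    set (u := fun s => coord 0 (phi s)) in *. set (v := fun s => coord 1 (phi s)) in *. set (S := fun s => coord 2 (phi s)) in *.
    change (is_derive u t (- om * v t + Nu n (u t) (v t) (S t))) in Du.
    change (is_derive v t (om * u t + Nv n (u t) (v t) (S t))) in Dv.
    change (is_derive S t (- lam * S t + NS n (u t) (v t) (S t))) in DS.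
    assert (Ds : is_derive (fun s => sX (u s) (v s) (S s)) t
      (- lam * sX (u t) (v t) (S t) + cs (Nz (u t) (v t) (S t)) (Ny n (u t) (v t) (S t)))).
    { unfold sX, h. auto_derive; [repeat split; eexists; eassumption|].
      replace (Derive (fun x : R => u x) t) with (- om * v t + Nu n (u t) (v t) (S t)) by (symmetry; apply is_derive_unique; exact Du).
      replace (Derive (fun x : R => v x) t) with (om * u t + Nv n (u t) (v t) (S t)) by (symmetry; apply is_derive_unique; exact Dv).
      replace (Derive (fun x : R => S x) t) with (- lam * S t + NS n (u t) (v t) (S t)) by (symmetry; apply is_derive_unique; exact DS).
      unfold NS, hu, hv, h. ring. }
    assert (EF : fam al (b ^ 2) kap 0 (lam + n) (toX (phi t)) = fam al (b ^ 2) kap 0 (lam + n) (toX (u t, v t, S t))).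
    { unfold u, v, S. destruct (phi t) as [[p q] s]. reflexivity. }
    set (nz := Nz (u t) (v t) (S t)) in *. set (ny := Ny n (u t) (v t) (S t)) in *. set (s := sX (u t) (v t) (S t)) in *.
    intros i Hi. rewrite EF, fam_toX. fold nz ny s.
    assert (ECV : Nv n (u t) (v t) (S t) = - lam * cs nz ny) by reflexivity.
    assert (ECU : Nu n (u t) (v t) (S t) = nz / eta - om * cs nz ny) by reflexivity.
    assert (ECS : D * cs nz ny = om * nz / eta - ny) by (unfold cs; field; split; lra).
    destruct i as [|[|[|i]]]; [| | |lia].
    + change (is_derive (fun s => x0 + xX (u s) (v s) (S s)) t (yX (u t) (v t) (S t))).
      eapply is_derive_eq; [apply (der_plus (fun _ => x0)); [apply der_const|];
        apply (der_plus v); [exact Dv|apply (der_scal (fun s => sX (u s) (v s) (S s))); exact Ds]|].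
      rewrite ECV. unfold yX. fold s. ring.
    + change (is_derive (fun s => yX (u s) (v s) (S s)) t
        (ny - om ^ 2 * xX (u t) (v t) (S t) + lam * om * (u t + om * s) - lam * yX (u t) (v t) (S t))).
      eapply is_derive_eq; [apply (der_minus (fun s => om * u s)); [apply (der_scal u); exact Du|
        apply (der_scal (fun s => sX (u s) (v s) (S s))); exact Ds]|].
      rewrite ECU. unfold xX, yX. fold s.
      transitivity (- om ^ 2 * v t + lam ^ 3 * s + om * nz / eta - (lam ^ 2 + om ^ 2) * cs nz ny); [field; lra|].
      rewrite <- HD, ECS. ring.
    + change (is_derive (fun s => z0 + zX (u s) (v s) (S s)) t (nz - eta * om * xX (u t) (v t) (S t))).
      eapply is_derive_eq; [apply (der_plus (fun _ => z0)); [apply der_const|];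
        apply (der_plus (fun s => eta * u s)); [apply (der_scal u); exact Du|
        apply (der_scal (fun s => sX (u s) (v s) (S s))); exact Ds]|].
      rewrite ECU. unfold xX. fold s. field. lra.
  - intros psi t H.
    pose proof (H 0%nat ltac:(lia)) as Dx. pose proof (H 1%nat ltac:(lia)) as Dy. pose proof (H 2%nat ltac:(lia)) as Dz.
    set (x := fun s => coord 0 (psi s)) in *. set (y := fun s => coord 1 (psi s)) in *. set (z := fun s => coord 2 (psi s)) in *.
    set (u := uY (y t) (z t)). set (v := vY (x t) (y t) (z t)). set (s := sY (y t) (z t)). set (S := s - h u v).
    assert (EX : psi t = toX (u, v, S)).
    { rewrite <- (toX_ofX (psi t)). reflexivity. }
    rewrite EX, fam_toX in Dx, Dy, Dz.
    assert (Es : sX u v S = s) by (unfold sX, S; ring).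
    unfold xX, yX in Dx, Dy, Dz. rewrite Es in Dx, Dy, Dz.
    set (nz := Nz u v S) in *. set (ny := Ny n u v S) in *.
    change (is_derive x t (om * u - lam ^ 2 * s)) in Dx.
    change (is_derive y t (ny - om ^ 2 * (v + lam * s) + lam * om * (u + om * s) - lam * (om * u - lam ^ 2 * s))) in Dy.
    change (is_derive z t (nz - eta * om * (v + lam * s))) in Dz.
    assert (Ds : is_derive (fun r => sY (y r) (z r)) t (- lam * s + cs nz ny)).
    { unfold sY. auto_derive; [repeat split; eexists; eassumption|].
      replace (Derive (fun x : R => y x) t) with (ny - om ^ 2 * (v + lam * s) + lam * om * (u + om * s) - lam * (om * u - lam ^ 2 * s))
        by (symmetry; apply is_derive_unique; exact Dy).
      replace (Derive (fun x : R => z x) t) with (nz - eta * om * (v + lam * s)) by (symmetry; apply is_derive_unique; exact Dz).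
      unfold cs. apply (Rmult_eq_reg_l D); [|lra].
      transitivity (om * nz / eta - ny - lam * s * (lam ^ 2 + om ^ 2)); [field; split; lra|].
      rewrite <- HD. field. split; lra. }
    assert (Du : is_derive (fun r => uY (y r) (z r)) t (- om * v + Nu n u v S)).
    { unfold uY. eapply is_derive_eq.
      - apply (der_minus (fun r => (z r - z0) / eta)); [|apply (der_scal (fun r => sY (y r) (z r))); exact Ds].
        apply (der_mult (fun r => z r - z0) (fun _ => / eta)); [|apply der_const].
        apply (der_minus z); [exact Dz|apply der_const].
      - unfold Nu, cu. fold nz ny. unfold cs. field. split; lra. }
    assert (Dv : is_derive (fun r => vY (x r) (y r) (z r)) t (om * u + Nv n u v S)).
    { unfold vY. eapply is_derive_eq.
      - apply (der_minus (fun r => x r - x0)); [|apply (der_scal (fun r => sY (y r) (z r))); exact Ds].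
        apply (der_minus x); [exact Dx|apply der_const].
      - unfold Nv, cv. fold nz ny. unfold cs. field. split; lra. }
    assert (DSS : is_derive (fun r => sY (y r) (z r) - h (uY (y r) (z r)) (vY (x r) (y r) (z r))) t (- lam * S + NS n u v S)).
    { set (uu := fun r => uY (y r) (z r)) in *. set (vv := fun r => vY (x r) (y r) (z r)) in *.
      assert (Dh : is_derive (fun r => h (uu r) (vv r)) t (hu u v * (- om * v + Nu n u v S) + hv u v * (om * u + Nv n u v S))).
      { unfold h. auto_derive; [repeat split; eexists; eassumption|].
        replace (Derive (fun x : R => uu x) t) with (- om * v + Nu n u v S) by (symmetry; apply is_derive_unique; exact Du).
        replace (Derive (fun x : R => vv x) t) with (om * u + Nv n u v S) by (symmetry; apply is_derive_unique; exact Dv).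
        change (uu t) with u. change (vv t) with v. unfold hu, hv. ring. }
      eapply is_derive_eq; [apply (der_minus (fun r => sY (y r) (z r))); [exact Ds|exact Dh]|].
      unfold NS. fold nz ny. unfold S. ring. }
    intros i Hi. destruct i as [|[|[|i]]]; [| | |lia].
    + exact Du.
    + exact Dv.
    + exact DSS.
Qed.

End NormalCoordinates.

(** * Transport of the bifurcation picture to the original family *)

Section BifurcationAtEquilibrium.
Variables b om al z0 x0 eta lam D : R.
Hypothesis Hb : 0 < b < 1.
Hypothesis Hom : 0 < om.
Hypothesis Hal : 0 < al.
Hypothesis Hz0 : 0 < z0.
Hypothesis Hrel : om ^ 2 * b ^ 2 = 1 - b ^ 4.
Hypothesis Hcos : cos x0 = b ^ 2.
Hypothesis Hsin : sin x0 = om * b.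
Hypothesis Heta : eta = al * b.
Hypothesis Hlam : lam = 2 * al * z0 * b ^ 4.
Hypothesis HD : D = lam ^ 2 + om ^ 2.

(** Only four cubic coefficients enter, since averaging over the circle keeps the monomials [u ^ 4],
    [u ^ 2 v ^ 2], [v ^ 4]. *)
Definition lyap_coeff : R := hopf_coeff om
  (cu om eta D 0 (y20 b om eta)) (cu om eta D 0 (y11 b z0 eta)) (cu om eta D (z02 b al) (y02 b om))
  (cu om eta D 0 (y30 b om al z0 eta lam D)) (cu om eta D (z12 b om al z0 eta lam D) (y12 b om al z0 eta lam D))
  (cv om eta lam D 0 (y20 b om eta)) (cv om eta lam D 0 (y11 b z0 eta)) (cv om eta lam D (z02 b al) (y02 b om))
  (cv om eta lam D (z21 b om al z0 eta lam D) (y21 b om al z0 eta lam D))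
  (cv om eta lam D (z03 b om al z0 eta lam D) (y03 b om al z0 eta lam D)).

Let F (n : R) : R3 -> R3 := fam al (b ^ 2) (kap b z0) 0 (lam + n).
Let G (n : R) : R3 -> R3 := hopf_field om lam (Nu b om al z0 x0 eta lam D)
  (Nv b om al z0 x0 eta lam D) (NS b om al z0 x0 eta lam D) n.
Let tX := toX b om al z0 x0 eta lam D.

Let Hbp : 0 < b.
Proof. lra. Qed.
Let Hb2 : 0 < b ^ 2 < 1.
Proof. split; [apply pow_lt; lra|]. simpl. nra. Qed.
Let Hlamp : 0 < lam.
Proof. apply (lam_pos b al z0); auto. Qed.
Let HDp : 0 < D.
Proof. apply (D_pos om lam D Hom HD). Qed.

Let HC n : conj (G n) (F n) tX (ofX b om al z0 x0 eta lam D).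
Proof. apply normal_conj; auto. Qed.
Let Hex n Y0 : exists phi, is_sol (G n) phi /\ phi 0 = Y0.
Proof. eapply conj_existence; [apply conj_sym, HC|]. apply fam_existence; auto. Qed.
Let Huniq n phi psi : is_sol (G n) phi -> is_sol (G n) psi -> phi 0 = psi 0 -> forall t, phi t = psi t.
Proof. eapply conj_uniqueness; [apply conj_sym, HC|]. apply fam_uniqueness; auto. Qed.

Let tX0 : tX (0, 0, 0) = (x0, 0, z0).
Proof.
  unfold tX, toX, xX, yX, zX, sX, h. cbn [coord fst snd].
  f_equal; [f_equal|]; ring.
Qed.

(** Half the trace of the parameter perturbation on the centre directions. It agrees with the
    derivative of the real part of the eigenvalue at [lam], found independently in
    [eigenvalue_continuation]. *)
Let Hmu1 : mu1 (cu om eta D 0 (- om)) 0 = - om ^ 2 / (2 * D).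
Proof. pose proof (eta_pos b al eta Hbp Hal Heta). unfold mu1, cu, cs. field. lra. Qed.

Let Hmu1n : mu1 (cu om eta D 0 (- om)) 0 < 0.
Proof.
  rewrite Hmu1. assert (0 < om ^ 2 / (2 * D)) by (apply Rdiv_lt_0_compat; [apply pow_lt; auto|lra]).
  unfold Rdiv in *. lra.
Qed.

Lemma critical_equilibrium_stable : lyap_coeff < 0 -> asympt_stable (fam al (b ^ 2) (kap b z0) 0 lam) (x0, 0, z0).
Proof.
  intros H. replace lam with (lam + 0) by ring. rewrite <- tX0. apply (conj_asympt _ _ _ _ (HC 0)).
  eapply critical_stable; [auto|auto|apply Nu_expansion; auto|apply Nv_expansion; auto|apply NS_order; auto|exact H].
Qed.

Lemma critical_equilibrium_unstable : 0 < lyap_coeff -> unstable_eq (fam al (b ^ 2) (kap b z0) 0 lam) (x0, 0, z0).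
Proof.
  intros H. replace lam with (lam + 0) by ring. rewrite <- tX0. eapply conj_unstable; [apply (HC 0)|].
  eapply critical_unstable; [auto|auto|apply Nu_expansion; auto|apply Nv_expansion; auto|apply NS_order; auto|apply (Hex 0)|exact H].
Qed.

Lemma noncritical_equilibrium : exists n0, 0 < n0 /\ forall eps, Rabs (eps - lam) < n0 ->
  (lam < eps -> asympt_stable (fam al (b ^ 2) (kap b z0) 0 eps) (x0, 0, z0)) /\
  (eps < lam -> unstable_eq (fam al (b ^ 2) (kap b z0) 0 eps) (x0, 0, z0)).
Proof.
  edestruct (noncritical_stability om lam (Nu b om al z0 x0 eta lam D)
    (Nv b om al z0 x0 eta lam D) (NS b om al z0 x0 eta lam D)) as [n0 [Hn0 H]];
    [auto|auto|apply Nu_linear; auto|apply Nv_linear; auto|apply NS_linear; auto|apply Rlt_not_eq, Hmu1n|].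
  exists n0. split; auto. intros eps He. rewrite <- tX0. replace eps with (lam + (eps - lam)) by ring.
  split; intros Hs.
  - apply (conj_asympt _ _ _ _ (HC (eps - lam))). apply H.
    + split; auto. apply Rabs_pos_lt. lra.
    + apply Rmult_pos_neg; [lra|exact Hmu1n].
  - eapply conj_unstable; [apply (HC (eps - lam))|]. apply H.
    + split; auto. apply Rabs_pos_lt. lra.
    + apply Rmult_neg_neg; [lra|exact Hmu1n].
    + apply Hex.
Qed.

Lemma bifurcating_orbit (tau : R) : tau * tau = 1 -> 0 < tau * lyap_coeff -> forall r, 0 < r ->
  exists dl, 0 < dl /\ forall eps, 0 < tau * (eps - lam) < dl ->
    exists (gam : R -> R3) (T : R), periodic_orbit (fam al (b ^ 2) (kap b z0) 0 eps) gam T /\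
      (tau < 0 -> orbit_asympt_stable (fam al (b ^ 2) (kap b z0) 0 eps) gam) /\
      (0 < tau -> orbit_unstable (fam al (b ^ 2) (kap b z0) 0 eps) gam) /\
      forall t, dist3 (gam t) (x0, 0, z0) < r.
Proof.
  intros Ht Hl r Hr.
  destruct (toX_uc b om al z0 x0 eta lam D 0 r Hr) as [d [Hd Huc]].
  edestruct (hopf_orbit om lam (Nu b om al z0 x0 eta lam D) (Nv b om al z0 x0 eta lam D) (NS b om al z0 x0 eta lam D))
    as [dl [Hdl H]];
    [auto|auto|apply Nu_expansion; auto|apply Nv_expansion; auto|apply NS_order; auto|exact Ht|exact Hmu1n|exact Hl
    |exact Hex|exact Huniq|exact Hd|].
  exists dl. split; auto. intros eps He.
  destruct (H _ He) as [gam [T [Hp [Hs [Hu [[bb Hbb] Hnear]]]]]].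
  assert (Hnear' : forall t, dist3 (tX (gam t)) (x0, 0, z0) < r).
  { intros t. rewrite dist3_sym, <- tX0. apply Huc.
    - intros i. destruct i as [|[|i]]; simpl; rewrite Rabs_R0; lra.
    - rewrite dist3_sym. apply Hnear. }
  assert (Hbb' : forall t, in_ball (r + Rabs x0 + Rabs z0) (tX (gam t))).
  { intros t i. pose proof (dist3_coord (tX (gam t)) (x0, 0, z0) i) as E. specialize (Hnear' t).
    pose proof (Rabs_pos x0). pose proof (Rabs_pos z0).
    assert (T0 : forall a c, Rabs (a - c) < r -> Rabs c <= Rabs x0 + Rabs z0 -> Rabs a <= r + Rabs x0 + Rabs z0).
    { intros a c Ha Hc. replace a with (a - c + c) by ring. eapply Rle_trans; [apply Rabs_triang|]. lra. }
    apply (T0 _ (coord i (x0, 0, z0))); [lra|]. destruct i as [|[|i]]; simpl; try rewrite Rabs_R0; lra. }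
  replace eps with (lam + (eps - lam)) by ring.
  exists (fun t => tX (gam t)), T. split; [|split; [|split]].
  - apply (conj_periodic _ _ _ _ (HC _)). exact Hp.
  - intros Hneg. eapply conj_orbit_asympt; [apply HC|exact Hbb|exact Hbb'|]. apply Hs, Hneg.
  - intros Hpos. eapply conj_orbit_unstable; [apply HC|exact Hbb|exact Hbb'|]. apply Hu, Hpos.
  - exact Hnear'.
Qed.

End BifurcationAtEquilibrium.

(** * Partial derivatives of the vector field up to order three *)

Section FamilyDerivatives.
Variables al be ka ep : R.

(** Given for all indices and at every point, with the pattern [S (S _)] following the convention of
    [coord]; equality as functions allows rewriting under the nested [pd] of the next order. *)
Definition fam_d1 (i k : nat) (v : R3) : R :=
  let x := coord 0 v in let z := coord 2 v in
  match i, k with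
  | 0%nat, 1%nat => 1
  | 1%nat, 0%nat => (z ^ 2 + ka) * (cos x ^ 2 - sin x ^ 2) - cos x
  | 1%nat, 1%nat => - ep
  | 1%nat, S (S _) => 2 * z * (sin x * cos x)
  | S (S _), 0%nat => - al * sin x
  | _, _ => 0
  end.

Definition fam_d2 (i j k : nat) (v : R3) : R :=
  let x := coord 0 v in let z := coord 2 v in
  match i, j, k with
  | 1%nat, 0%nat, 0%nat => sin x - 4 * (z ^ 2 + ka) * (sin x * cos x)
  | 1%nat, 0%nat, S (S _) | 1%nat, S (S _), 0%nat => 2 * z * (cos x ^ 2 - sin x ^ 2)
  | 1%nat, S (S _), S (S _) => 2 * (sin x * cos x)
  | S (S _), 0%nat, 0%nat => - al * cos x
  | _, _, _ => 0
  end.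

Definition fam_d3 (i j k l : nat) (v : R3) : R :=
  let x := coord 0 v in let z := coord 2 v in
  match i, j, k, l with
  | 1%nat, 0%nat, 0%nat, 0%nat => cos x - 4 * (z ^ 2 + ka) * (cos x ^ 2 - sin x ^ 2)
  | 1%nat, 0%nat, 0%nat, S (S _) | 1%nat, 0%nat, S (S _), 0%nat | 1%nat, S (S _), 0%nat, 0%nat =>
      - 8 * z * (sin x * cos x)
  | 1%nat, 0%nat, S (S _), S (S _) | 1%nat, S (S _), 0%nat, S (S _) | 1%nat, S (S _), S (S _), 0%nat =>
      2 * (cos x ^ 2 - sin x ^ 2)
  | S (S _), 0%nat, 0%nat, 0%nat => al * sin x
  | _, _, _, _ => 0
  end.

Lemma jac_fam (v : R3) (i k : nat) : jac (fam al be ka 0 ep) v i k = fam_d1 i k v.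
Proof.
  destruct v as [[x y] z]. unfold jac, pd.
  destruct i as [|[|i]], k as [|[|k]]; apply is_derive_unique; simpl; auto_derive; auto; ring.
Qed.

Lemma d2_fam (v : R3) (i j k : nat) : Defs.d2 (fam al be ka 0 ep) v i j k = fam_d2 i j k v.
Proof.
  unfold Defs.d2. replace (fun w => pd k (fun v => coord i (fam al be ka 0 ep v)) w) with (fam_d1 i k)
    by (apply functional_extensionality; intros w; symmetry; apply jac_fam).
  destruct v as [[x y] z]. unfold pd.
  destruct i as [|[|i]], j as [|[|j]], k as [|[|k]]; apply is_derive_unique; simpl; auto_derive; auto; ring.
Qed.

Lemma d3_fam (v : R3) (i j k l : nat) : Defs.d3 (fam al be ka 0 ep) v i j k l = fam_d3 i j k l v.
Proof.
  unfold Defs.d3.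
  replace (fun u => pd k (fun w => pd l (fun v => coord i (fam al be ka 0 ep v)) w) u) with (fam_d2 i k l)
    by (apply functional_extensionality; intros w; symmetry; apply d2_fam).
  destruct v as [[x y] z]. unfold pd.
  destruct i as [|[|i]], j as [|[|j]], k as [|[|k]], l as [|[|l]];
    apply is_derive_unique; simpl; auto_derive; auto; ring.
Qed.

End FamilyDerivatives.

(** Applying the inverse is replaced by checking a proposed solution of the linear system, so the
    resolvents in [G21] are never expanded. *)
Lemma inv3_solve (M : CM) (v w : CV) : det3 M <> RtoC 0 -> (forall i, (i < 3)%nat -> mv M w i = v i) ->
  forall i, (i < 3)%nat -> mv (inv3 M) v i = w i.
Proof.
  intros HM H.
  assert (E0 := H 0%nat ltac:(lia)). assert (E1 := H 1%nat ltac:(lia)). assert (E2 := H 2%nat ltac:(lia)).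
  intros i Hi. unfold mv, sum3. rewrite <- E0, <- E1, <- E2. unfold mv, sum3, det3 in *.
  destruct i as [|[|[|i]]]; [| | |lia]; unfold inv3, det3; cbn [Nat.modulo Nat.add Nat.divmod fst snd Nat.sub];
    revert HM; generalize (M 0 0)%nat (M 0 1)%nat (M 0 2)%nat (M 1 0)%nat (M 1 1)%nat (M 1 2)%nat (M 2 0)%nat (M 2 1)%nat (M 2 2)%nat;
    intros a b c d e f g h k HM; field; exact HM.
Qed.

(** * Closed form of the real part of [G21] and its comparison with the averaged coefficient *)

Section NormalFormCoefficient.
Variables om lam eta dd D gxx gxz gzz gxxx gxxz gxzz k2 k3 : R.
Hypothesis Hom : 0 < om.
Hypothesis Hlam : 0 < lam.
Hypothesis Heta : 0 < eta.
Hypothesis Hdd : dd * eta = om * lam.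
Hypothesis HD : D = lam ^ 2 + om ^ 2.

Definition lin_mat (eps : R) (i j : nat) : R :=
  match i, j with
  | 0%nat, 1%nat => 1
  | 1%nat, 0%nat => - om ^ 2
  | 1%nat, 1%nat => - eps
  | 1%nat, S (S _) => dd
  | S (S _), 0%nat => - (eta * om)
  | _, _ => 0
  end.

(** The derivatives are kept as free symbols, [k2] and [k3] being those of the third component; no
    trigonometric relation is needed for the comparison of the two coefficients. *)
Definition Bq (u v : CV) : CV := fun i =>
  match i with
  | 0%nat => RtoC 0
  | 1%nat => (gxx * (u 0%nat * v 0%nat) + gxz * (u 0%nat * v 2%nat + u 2%nat * v 0%nat) + gzz * (u 2%nat * v 2%nat))%C
  | _ => (k2 * (u 0%nat * v 0%nat))%C
  end.

Definition Cq (u v w : CV) : CV := fun i =>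
  match i with
  | 0%nat => RtoC 0
  | 1%nat => (gxxx * (u 0%nat * v 0%nat * w 0%nat)
      + gxxz * (u 0%nat * v 0%nat * w 2%nat + u 0%nat * v 2%nat * w 0%nat + u 2%nat * v 0%nat * w 0%nat)
      + gxzz * (u 0%nat * v 2%nat * w 2%nat + u 2%nat * v 0%nat * w 2%nat + u 2%nat * v 2%nat * w 0%nat))%C
  | _ => (k3 * (u 0%nat * v 0%nat * w 0%nat))%C
  end.

Definition vec_q : CV := fun i => match i with 0%nat => Copp Ci | 1%nat => RtoC om | _ => RtoC eta end.

Let A : CM := realM (lin_mat lam).
Let E := lam ^ 2 + 4 * om ^ 2.
Let Nr := gzz * eta ^ 2 - gxx.
Let Ni := k2 * lam / (2 * eta) - 2 * gxz * eta.
Let w0r := - 2 * (2 * om * Nr - lam * Ni) / (3 * om * E).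
Let w0i := - 2 * (2 * om * Ni + lam * Nr) / (3 * om * E).
Let w2r := - eta * w0i / 2.
Let w2i := (k2 + eta * om * w0r) / (2 * om).
Let m0 := - k2 / (eta * om).
Let m2 := (gxx + gzz * eta ^ 2 + om ^ 2 * m0) * eta / (om * lam).

(** The first row of the resolvent system says that the second entry is [2 i om] times the first.
    For [res_h11] the matrix [A] replaces the resolvent, and the second entry is 0. *)
Definition res_h20 : CV := fun i =>
  match i with 0%nat => (w0r, w0i) | 1%nat => (- 2 * om * w0i, 2 * om * w0r) | _ => (w2r, w2i) end.
Definition res_h11 : CV := fun i => match i with 0%nat => RtoC m0 | 1%nat => RtoC 0 | _ => RtoC m2 end.

Let T1r := gxxz * eta + (- gxx * w0i + gxz * (eta * w0r - w2i) + gzz * eta * w2r) - 2 * (gxz * eta * m0 + gzz * eta * m2).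
Let T1i := - gxxx - gxzz * eta ^ 2 + (gxx * w0r + gxz * (w2r + eta * w0i) + gzz * eta * w2i) + 2 * (gxx * m0 + gxz * m2).
Let T2r := - k2 * w0i.
Let T2i := - k3 + k2 * w0r + 2 * (k2 * m0).

Definition reG21 : R := / 2 * ((om * T1r - lam * T1i) / D + (lam ^ 2 * T2r + lam * om * T2i) / (eta * D)).

Let HDp : 0 < D.
Proof. rewrite HD. pose proof (pow2_ge_0 lam). assert (0 < om ^ 2) by (apply pow_lt; auto). lra. Qed.
Let HE : 0 < E.
Proof. unfold E. pose proof (pow2_ge_0 lam). assert (0 < om ^ 2) by (apply pow_lt; auto). lra. Qed.
Let Hdd' : dd = om * lam / eta.
Proof. rewrite <- Hdd. field. lra. Qed.

Let A2 : CM := cMadd (cMscal (Cmult (RtoC (2 * om)) Ci) idM) (cMopp A).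

Lemma h20_eq (i : nat) : (i < 3)%nat -> mv (inv3 A2) (Bq vec_q vec_q) i = res_h20 i.
Proof.
  revert i. apply inv3_solve.
  - replace (det3 A2) with ((- 3 * lam * om ^ 2, - 6 * om ^ 3) : C).
    + intros H. injection H. intros H1 H2. assert (0 < om ^ 3) by (apply pow_lt; auto). lra.
    + unfold det3, A2, A, cMadd, cMscal, cMopp, realM, idM. simpl.
      apply injective_projections; simpl; rewrite Hdd'; field; lra.
  - intros i Hi. destruct i as [|[|[|i]]]; [| | |lia]; unfold mv, sum3, A2, A, cMadd, cMscal, cMopp, realM, idM; simpl;
    apply injective_projections; simpl; unfold w2r, w2i, w0r, w0i, Nr, Ni; rewrite ?Hdd'; 
    assert (E <> 0) by lra; unfold E in *; field; repeat split; lra.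
Qed.

Lemma h11_eq (i : nat) : (i < 3)%nat -> mv (inv3 A) (Bq vec_q (cconjv vec_q)) i = res_h11 i.
Proof.
  revert i. apply inv3_solve.
  - replace (det3 A) with (RtoC (- (om ^ 2 * lam))).
    + intros H. injection H. assert (0 < om ^ 2 * lam) by (apply Rmult_lt_0_compat; auto; apply pow_lt; auto). lra.
    + unfold det3, A, realM. simpl. apply injective_projections; simpl; rewrite Hdd'; field; lra.
  - intros i Hi. destruct i as [|[|[|i]]]; [| | |lia]; unfold mv, sum3, A, realM; simpl;
    apply injective_projections; simpl; unfold m2, m0; rewrite ?Hdd'; field; repeat split; lra.
Qed.

(** The last two rows express [p] through its second entry, and the normalisation fixes that entry.
    The first entry is not recorded because [Bq] and [Cq] vanish in the first component. *)
Lemma adjoint_eigenvector (p : CV) :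
  (forall i, (i < 3)%nat -> mv (trM A) p i = Cmult (Copp (Cmult (RtoC om) Ci)) (p i)) ->
  cinner p vec_q = RtoC 1 ->
  Cconj (p 1%nat) = (om / (2 * D), lam / (2 * D)) /\
  Cconj (p 2%nat) = (lam ^ 2 / (2 * eta * D), - (lam * om) / (2 * eta * D)).
Proof.
  intros H H1.
  assert (E1 := H 1%nat ltac:(lia)). assert (E2 := H 2%nat ltac:(lia)). clear H.
  unfold mv, sum3, trM, A, realM in E1, E2. unfold cinner, sum3, vec_q in H1. simpl in E1, E2, H1.
  revert E1 E2 H1. destruct (p 0%nat) as [a1 a2], (p 1%nat) as [b1 b2], (p 2%nat) as [c1 c2].
  intros E1 E2 H1. injection E1; intros P1 P2. injection E2; intros P3 P4. injection H1; intros P5 P6. clear E1 E2 H1.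
  simpl in *. ring_simplify in P1. ring_simplify in P2. ring_simplify in P3. ring_simplify in P4.
  ring_simplify in P5. ring_simplify in P6.
  assert (C1 : c1 * eta = - lam * b2).
  { apply (Rmult_eq_reg_l om); [|lra]. transitivity (b2 * 0 - eta * (- om * c1)); [ring|].
    replace (- om * c1) with (dd * b2) by lra. transitivity (- (dd * eta) * b2); [ring|]. rewrite Hdd. ring. }
  assert (C2 : c2 * eta = lam * b1).
  { apply (Rmult_eq_reg_l om); [|lra]. transitivity (eta * (om * c2)); [ring|].
    replace (om * c2) with (dd * b1) by lra. transitivity ((dd * eta) * b1); [ring|]. rewrite Hdd. ring. }
  assert (A1 : a1 = lam * b1 + om * b2) by lra.
  assert (A2' : a2 = lam * b2 - om * b1) by lra.
  assert (Q1 : om * b1 - lam * b2 = / 2) by (rewrite A2' in *; lra).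
  assert (Q2 : om * b2 + lam * b1 = 0) by (rewrite A1 in *; lra).
  assert (B1 : b1 = om / (2 * D)).
  { apply (Rmult_eq_reg_r D); [|lra]. transitivity (om / 2); [|field; lra]. rewrite HD.
    transitivity (om * (om * b1 - lam * b2) + lam * (om * b2 + lam * b1)); [ring|]. rewrite Q1, Q2. field. }
  assert (B2 : b2 = - lam / (2 * D)).
  { apply (Rmult_eq_reg_r D); [|lra]. transitivity (- lam / 2); [|field; lra]. rewrite HD.
    transitivity (- lam * (om * b1 - lam * b2) + om * (om * b2 + lam * b1)); [ring|]. rewrite Q1, Q2. field. }
  unfold Cconj; simpl. split; f_equal.
  - exact B1.
  - rewrite B2. field. lra.
  - apply (Rmult_eq_reg_r eta); [|lra]. rewrite C1, B2. field. lra.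
  - apply (Rmult_eq_reg_r eta); [|lra]. transitivity (- (c2 * eta)); [ring|]. rewrite C2, B1. field. lra.
Qed.

Lemma re_normal_form_coeff (p : CV) :
  (forall i, (i < 3)%nat -> mv (trM A) p i = Cmult (Copp (Cmult (RtoC om) Ci)) (p i)) ->
  cinner p vec_q = RtoC 1 ->
  Re (cinner p (cvadd (cvadd (Cq vec_q vec_q (cconjv vec_q)) (Bq (cconjv vec_q) (mv (inv3 A2) (Bq vec_q vec_q))))
                  (cvopp (cscal (RtoC 2) (Bq vec_q (mv (inv3 A) (Bq vec_q (cconjv vec_q)))))))) = reG21.
Proof.
  intros H1 H2. destruct (adjoint_eigenvector p H1 H2) as [P1 P2].
  unfold cinner, sum3. rewrite P1, P2. unfold cvadd, cvopp, cscal.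
  set (h20 := mv (inv3 A2) (Bq vec_q vec_q)). set (h11 := mv (inv3 A) (Bq vec_q (cconjv vec_q))).
  assert (X0 := h20_eq 0 ltac:(lia)). assert (X2 := h20_eq 2 ltac:(lia)). fold h20 in X0, X2.
  assert (Y0 := h11_eq 0 ltac:(lia)). assert (Y2 := h11_eq 2 ltac:(lia)). fold h11 in Y0, Y2.
  simpl in X0, X2, Y0, Y2. unfold Bq, Cq. rewrite X0, X2, Y0, Y2. clearbody h20 h11.
  unfold vec_q, cconjv. simpl. unfold reG21, T1r, T1i, T2r, T2i. clearbody w0r w0i w2r w2i m0 m2. field. split; lra.
Qed.

End NormalFormCoefficient.

(** Origin of the factor 8: writing the centre part as [z q] plus its conjugate gives
    [u + i v = 2 z], so [r = 2 |z|]. The normal form [|z|' = Re G21 / 2 |z|^3] becomes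
    [r' = Re G21 / 8 r^3], to be compared with [W' = a r^4] for [W] near [r^2 / 2]. *)
Lemma reG21_lyap_coeff (b om al z0 eta lam D : R) : 0 < om -> 0 < lam -> 0 < eta -> D = lam ^ 2 + om ^ 2 ->
  reG21 om lam eta D (gxx b om) (gxz b z0) (gzz b om) (gxxx b) (gxxz b om z0) (gxzz b) (- (al * b ^ 2)) (al * (om * b))
  = 8 * lyap_coeff b om al z0 eta lam D.
Proof.
  intros Hom Hlam Heta HD.
  assert (0 < D) by (rewrite HD; pose proof (pow2_ge_0 lam); assert (0 < om ^ 2) by (apply pow_lt; auto); lra).
  assert (0 < lam ^ 2 + 4 * om ^ 2) by (pose proof (pow2_ge_0 lam); assert (0 < om ^ 2) by (apply pow_lt; auto); lra).
  unfold reG21, lyap_coeff, hopf_coeff, g40, g22, g04, e30, e03, e21, e12, y30, y12, y21, y03, z12, z21, z03, YU, YV, ZV, ha, hc.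
  unfold hb. unfold y20, y11, y02. set (k2 := - (al * b ^ 2)). replace (z02 b al) with (k2 / 2) by (unfold k2, z02; field).
  generalize (al * (om * b)) (gxx b om) (gxz b z0) (gzz b om) (gxxx b) (gxxz b om z0) (gxzz b). clearbody k2.
  intros k3 g1 g2 g3 g4 g5 g6.
  unfold cu, cv, cs. rewrite HD in *. clear HD D.
  field. repeat split; lra.
Qed.

(** * Spectrum at the critical parameter and continuation of the complex pair *)

Section EigenvalueContinuation.
Variables om lam eta dd : R.
Hypothesis Hom : 0 < om.
Hypothesis Hlam : 0 < lam.
Hypothesis Heta : 0 < eta.
Hypothesis Hdd : dd * eta = om * lam.

Let A := lin_mat om eta dd.

(** The hypotheses are the real and imaginary parts of [l^3 + e l^2 + om^2 l + om^2 lam = 0], and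
    [(l, l^2, - eta om)] is an eigenvector for any root [l]. *)
Lemma eigenvalue_of_root (e x y : R) :
  x ^ 3 - 3 * x * y ^ 2 + e * (x ^ 2 - y ^ 2) + om ^ 2 * x + om ^ 2 * lam = 0 ->
  3 * x ^ 2 * y - y ^ 3 + 2 * e * x * y + om ^ 2 * y = 0 ->
  is_eigenvalue (A e) (x, y).
Proof.
  intros H1 H2.
  exists (fun i => match i with 0%nat => (x, y) | 1%nat => Cmult (x, y) (x, y) | _ => RtoC (- (eta * om)) end).
  split.
  - exists 2%nat. split; [lia|]. intros H. injection H. assert (0 < eta * om) by (apply Rmult_lt_0_compat; auto). lra.
  - intros i Hi. unfold mv, sum3, realM. destruct i as [|[|[|i]]]; [| | |lia]; simpl; apply injective_projections; simpl.
    1-2,5-6: ring.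
    + transitivity (- om ^ 2 * x - e * (x ^ 2 - y ^ 2) - (dd * eta) * om); [ring|]. rewrite Hdd. lra.
    + lra.
Qed.

(** At [e = lam] the characteristic polynomial factors as [(l + lam) (l^2 + om^2)]. Elimination
    gives [(om^2 - w^2) (lam + i w)] times the first entry equal to 0; without the first factor
    vanishing the whole eigenvector would be 0. *)
Lemma imaginary_eigenvalue (l : C) : is_eigenvalue (A lam) l -> Re l = 0 -> l = (0, om) \/ l = (0, - om).
Proof.
  intros [v [[i [Hi Hv]] H]] Hl.
  assert (E0 := H 0%nat ltac:(lia)). assert (E1 := H 1%nat ltac:(lia)). assert (E2 := H 2%nat ltac:(lia)). clear H.
  unfold mv, sum3, realM in E0, E1, E2. simpl in E0, E1, E2.
  assert (Hz : v 0%nat <> RtoC 0 \/ v 1%nat <> RtoC 0 \/ v 2%nat <> RtoC 0) by (destruct i as [|[|[|i]]]; auto; lia).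
  clear i Hi Hv. destruct l as [x w]. simpl in Hl. subst x.
  revert E0 E1 E2 Hz. destruct (v 0%nat) as [a1 a2], (v 1%nat) as [b1 b2], (v 2%nat) as [c1 c2].
  intros E0 E1 E2 Hz. injection E0; intros P1 P2. injection E1; intros P3 P4. injection E2; intros P5 P6. clear E0 E1 E2.
  ring_simplify in P1. ring_simplify in P2. ring_simplify in P3. ring_simplify in P4. ring_simplify in P5. ring_simplify in P6.
  assert (B1 : b1 = - w * a2) by lra. assert (B2 : b2 = w * a1) by lra. clear P1 P2. subst b1 b2.
  assert (C1 : dd * (w * c1) = - (om ^ 2 * lam) * a2) by (replace (w * c1) with (- (eta * om) * a2) by lra; transitivity (- (dd * eta) * om * a2); [ring|rewrite Hdd; ring]).
  assert (C2 : dd * (w * c2) = om ^ 2 * lam * a1) by (replace (w * c2) with (eta * om * a1) by lra; transitivity ((dd * eta) * om * a1); [ring|rewrite Hdd; ring]).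
  assert (Q1 : (om ^ 2 - w ^ 2) * (lam * a1 - w * a2) = 0).
  { assert (w * (- om ^ 2 * a2 - lam * (w * a1) + dd * c2) = w * (- w ^ 2 * a2)) by (f_equal; lra). lra. }
  assert (Q2 : (om ^ 2 - w ^ 2) * (lam * a2 + w * a1) = 0).
  { assert (w * (- om ^ 2 * a1 + lam * (w * a2) + dd * c1) = w * (- w ^ 2 * a1)) by (f_equal; lra). lra. }
  assert (Hw : om ^ 2 - w ^ 2 = 0).
  { destruct (Req_dec (om ^ 2 - w ^ 2) 0) as [|Hn]; auto. exfalso.
    apply Rmult_integral in Q1, Q2. destruct Q1 as [Q1|Q1]; [contradiction|]. destruct Q2 as [Q2|Q2]; [contradiction|].
    assert (L : 0 < lam ^ 2 + w ^ 2) by (pose proof (pow2_ge_0 w); assert (0 < lam ^ 2) by (apply pow_lt; auto); lra).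
    assert (A1 : a1 = 0).
    { apply (Rmult_eq_reg_l (lam ^ 2 + w ^ 2)); [|lra].
      transitivity (lam * (lam * a1 - w * a2) + w * (lam * a2 + w * a1)); [ring|]. rewrite Q1, Q2. ring. }
    assert (A2 : a2 = 0).
    { apply (Rmult_eq_reg_l (lam ^ 2 + w ^ 2)); [|lra].
      transitivity (lam * (lam * a2 + w * a1) - w * (lam * a1 - w * a2)); [ring|]. rewrite Q1, Q2. ring. }
    subst a1 a2. assert (Hd : dd <> 0) by (intros E; rewrite E in Hdd; assert (0 < om * lam) by (apply Rmult_lt_0_compat; auto); lra).
    assert (c1 = 0) by (apply (Rmult_eq_reg_l dd); lra). assert (c2 = 0) by (apply (Rmult_eq_reg_l dd); lra). subst c1 c2.
    destruct Hz as [Hz|[Hz|Hz]]; apply Hz; unfold RtoC; f_equal; ring. }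
  assert (Hf : (om - w) * (om + w) = 0) by (rewrite <- Hw; ring).
  apply Rmult_integral in Hf. destruct Hf; [left|right]; f_equal; lra.
Qed.

(** Inserting [l = - r] and [e = lam + n] in the characteristic polynomial gives
    [(r - lam) (r^2 + om^2) = n r^2]. The bounds of [g] by 0 and 1 and its slope bound [1 / om]
    replace the implicit function theorem. *)
Let g (r : R) := r ^ 2 / (r ^ 2 + om ^ 2).

Let den_pos r : 0 < r ^ 2 + om ^ 2.
Proof. pose proof (pow2_ge_0 r). assert (0 < om ^ 2) by (apply pow_lt; auto). lra. Qed.

Let g_range r : 0 <= g r <= 1.
Proof.
  pose proof (den_pos r). pose proof (pow2_ge_0 r). pose proof (pow2_ge_0 om). unfold g. split.
  - apply Rle_div_r; lra.
  - apply Rle_div_l; lra.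
Qed.

Let g_lip r s : Rabs (g r - g s) <= / om * Rabs (r - s).
Proof.
  pose proof (den_pos r) as Hr. pose proof (den_pos s) as Hs.
  replace (g r - g s) with ((r - s) * (om * (om * (r + s)) / ((r ^ 2 + om ^ 2) * (s ^ 2 + om ^ 2)))) by (unfold g; field; lra).
  rewrite Rabs_mult, Rmult_comm. apply Rmult_le_compat_r; [apply Rabs_pos|].
  assert (Hp : 0 < (r ^ 2 + om ^ 2) * (s ^ 2 + om ^ 2)) by (apply Rmult_lt_0_compat; auto).
  unfold Rdiv. rewrite Rabs_mult, (Rabs_pos_eq (/ _)) by (left; apply Rinv_0_lt_compat; auto).
  apply Rle_div_l; [lra|]. apply (Rmult_le_reg_l om); [auto|]. rewrite <- (Rmult_assoc om (/ om)), Rinv_r, Rmult_1_l by lra.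
  rewrite !Rabs_mult, (Rabs_pos_eq om) by lra.
  assert (Ht : om * Rabs (r + s) <= r ^ 2 + s ^ 2 + om ^ 2).
  { pose proof (pow2_ge_0 (om - (r + s))). pose proof (pow2_ge_0 (om + (r + s))). pose proof (pow2_ge_0 (r - s)).
    pose proof (pow2_ge_0 om). unfold Rabs. destruct (Rcase_abs (r + s)); lra. }
  apply Rle_trans with (om ^ 2 * (om * Rabs (r + s))); [right; ring|].
  apply Rle_trans with (om ^ 2 * (r ^ 2 + s ^ 2 + om ^ 2)); [apply Rmult_le_compat_l; [apply pow2_ge_0|auto]|].
  assert (0 <= r ^ 2 * s ^ 2) by (apply Rmult_le_pos; apply pow2_ge_0). lra.
Qed.

(* For [e = lam + n] the real eigenvalue is [- r] with [r = lam + n g(r)]. *)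
Lemma real_root : exists r : R -> R, forall n, r n = lam + n * g (r n).
Proof.
  (* [IVT_gen] returns its witness in a sigma type, so the roots form a function of [n] without
     choice; the bounds on [g] confine the root to the interval of radius [|n|] about [lam]. *)
  assert (X : forall n, {r : R | Rmin (lam - Rabs n) (lam + Rabs n) <= r <= Rmax (lam - Rabs n) (lam + Rabs n) /\ r - n * g r = lam}).
  { intros n. apply IVT_gen.
    - intros x. apply continuity_pt_filterlim.
      apply (ex_derive_continuous (fun r => r - n * g r) x). unfold g. auto_derive. pose proof (den_pos x). simpl in *. lra.
    - pose proof (g_range (lam - Rabs n)) as G1. pose proof (g_range (lam + Rabs n)) as G2. pose proof (Rabs_pos n).
      assert (T : forall y, 0 <= y <= 1 -> - Rabs n <= n * y <= Rabs n).
      { intros y Hy. assert (K : Rabs (n * y) <= Rabs n).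
        { rewrite Rabs_mult, (Rabs_pos_eq y) by lra. rewrite <- (Rmult_1_r (Rabs n)) at 2. apply Rmult_le_compat_l; lra. }
        apply Rabs_le_between. exact K. }
      apply T in G1. apply T in G2. split.
      + eapply Rle_trans; [apply Rmin_l|]. lra.
      + eapply Rle_trans; [|apply Rmax_r]. lra. }
  exists (fun n => proj1_sig (X n)). intros n. destruct (X n) as [r [Hrb Hr]]. simpl. lra.
Qed.

(** At the zero of the linear factor the difference quotient is [k] itself, so continuity of [k]
    suffices. Thus the real part can be differentiated at [lam] with only continuity of the root
    [r]. *)
Lemma derive_linear_times (k : R -> R) (c : R) : continuous k c -> is_derive (fun e => (e - c) * k e) c (k c).
Proof.
  intros H. apply is_derive_Reals. intros eps Heps. apply continuity_pt_filterlim in H.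
  destruct (H eps Heps) as [d [Hd K]]. exists (mkposreal d Hd). intros h Hh Hhd. simpl in Hhd.
  replace (((c + h - c) * k (c + h) - (c - c) * k c) / h - k c) with (k (c + h) - k c) by (field; auto).
  apply K. split; [split; [exact I|]|].
  - intros E. apply Hh. lra.
  - simpl. unfold Rdist. replace (c + h - c) with h by ring. exact Hhd.
Qed.

(** The complex pair is recovered from the real root by Vieta's relations: the sum of the roots is
    [- e] and their product is [- om^2 lam]. *)
Lemma eigenvalue_continuation : exists dl (mu w : R -> R), 0 < dl /\ mu lam = 0 /\ w lam = om /\
  (forall e, Rabs (e - lam) < dl -> continuous mu e /\ continuous w e /\ is_eigenvalue (A e) (mu e, w e)) /\
  ex_derive mu lam /\ Derive mu lam <> 0.
Proof.
  destruct real_root as [r Hr].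
  (* [|m| < om / 2] halves the slope of [g] and makes [r] Lipschitz with constant 2; it also keeps
     the real part below [om / 2]. [|n| < lam / 2] keeps [r] positive. *)
  set (dl := Rmin (lam / 2) (om / 2)).
  assert (D1 : dl <= lam / 2) by apply Rmin_l. assert (D2 : dl <= om / 2) by apply Rmin_r.
  assert (Hdl : 0 < dl) by (apply Rmin_glb_lt; lra).
  assert (Rn : forall n, Rabs (r n - lam) <= Rabs n).
  { intros n. replace (r n - lam) with (n * g (r n)) by (pose proof (Hr n); lra).
    pose proof (g_range (r n)). rewrite Rabs_mult, (Rabs_pos_eq (g _)) by lra.
    rewrite <- (Rmult_1_r (Rabs n)) at 2. apply Rmult_le_compat_l; [apply Rabs_pos|lra]. }
  assert (RL : forall n m, Rabs m < dl -> Rabs (r n - r m) <= 2 * Rabs (n - m)).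
  { intros n m Hm. pose proof (g_range (r n)). pose proof (g_lip (r n) (r m)) as K.
    pose proof (Rabs_pos (r n - r m)). pose proof (Rabs_pos (n - m)). pose proof (Rabs_pos m).
    assert (E : r n - r m = (n - m) * g (r n) + m * (g (r n) - g (r m))).
    { transitivity (lam + n * g (r n) - (lam + m * g (r m))); [rewrite <- !Hr; reflexivity|ring]. }
    assert (K1 : Rabs ((n - m) * g (r n)) <= Rabs (n - m)).
    { rewrite Rabs_mult, (Rabs_pos_eq (g _)) by lra. rewrite <- (Rmult_1_r (Rabs (n - m))) at 2. apply Rmult_le_compat_l; lra. }
    assert (K2 : Rabs (m * (g (r n) - g (r m))) <= om / 2 * (/ om * Rabs (r n - r m))).
    { rewrite Rabs_mult. apply Rmult_le_compat; auto; [apply Rabs_pos|lra]. }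
    replace (om / 2 * (/ om * Rabs (r n - r m))) with (Rabs (r n - r m) / 2) in K2 by (field; lra).
    pose proof (Rabs_triang ((n - m) * g (r n)) (m * (g (r n) - g (r m)))) as K3. rewrite <- E in K3. lra. }
  assert (RC : forall e, Rabs (e - lam) < dl -> continuous (fun e => r (e - lam)) e).
  { intros e He. apply continuity_pt_filterlim. intros eps Heps. exists (eps / 2). split; [lra|].
    intros x [_ Hx]. simpl in *. unfold Rdist in *. eapply Rle_lt_trans; [apply RL; auto|].
    replace (x - lam - (e - lam)) with (x - e) by ring. lra. }
  assert (Rp : forall n, Rabs n < dl -> lam / 2 <= r n <= 3 * lam / 2).
  { intros n Hn. specialize (Rn n). apply Rabs_le_between in Rn. lra. }
  assert (R0 : r 0 = lam) by (rewrite Hr; ring).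
  (* Half of [r - e] is the real part by the sum of the roots; the product [om^2 lam / r] of the
     pair is the squared modulus, which gives the imaginary part. *)
  set (mu := fun e => (r (e - lam) - e) / 2).
  set (w := fun e => sqrt (om ^ 2 * lam / r (e - lam) - mu e ^ 2)).
  assert (MC : forall e, Rabs (e - lam) < dl -> continuous mu e).
  { intros e He. apply (continuous_mult (fun e => r (e - lam) - e) (fun _ => / 2)); [|apply continuous_const].
    apply (continuous_minus (fun e => r (e - lam)) (fun e => e)); [auto|apply continuous_id]. }
  assert (M0 : mu lam = 0) by (unfold mu; rewrite Rminus_diag, R0; field).
  assert (GC : continuous (fun e => g (r (e - lam))) lam).
  { apply (continuous_comp (fun e => r (e - lam)) g).
    - apply RC. rewrite Rminus_diag, Rabs_R0. exact Hdl.
    - apply (ex_derive_continuous g). unfold g. auto_derive. pose proof (den_pos (r (lam - lam))). simpl in *. lra. }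
  assert (MD : is_derive mu lam ((g lam - 1) / 2)).
  { apply (is_derive_ext (fun e => (lam + (e - lam) * g (r (e - lam)) - e) / 2)).
    { intros e. unfold mu. rewrite <- Hr. reflexivity. }
    eapply is_derive_eq.
    - apply (der_mult (fun e => lam + (e - lam) * g (r (e - lam)) - e) (fun _ => / 2)); [|apply der_const].
      apply (der_minus (fun e => lam + (e - lam) * g (r (e - lam))) (fun e => e)); [|apply (is_derive_id lam)].
      apply (der_plus (fun _ => lam)); [apply der_const|]. apply (derive_linear_times (fun e => g (r (e - lam)))). exact GC.
    - rewrite Rminus_diag, R0. unfold one. simpl. field. }
  exists dl, mu, w. split; [exact Hdl|]. split; [exact M0|]. split.
  { unfold w. rewrite M0, Rminus_diag, R0. replace (om ^ 2 * lam / lam - 0 ^ 2) with (om ^ 2) by (field; lra). apply sqrt_pow2. lra. }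
  split; [|split].
  - intros e He. specialize (Rp _ He). split; [auto|]. split.
    + apply (continuous_comp (fun e => om ^ 2 * lam / r (e - lam) - mu e ^ 2) sqrt); [|apply continuous_sqrt].
      apply (continuous_minus (fun e => om ^ 2 * lam / r (e - lam)) (fun e => mu e ^ 2)).
      * apply (continuous_mult (fun _ => om ^ 2 * lam) (fun e => / r (e - lam))); [apply continuous_const|].
        apply (continuous_comp (fun e => r (e - lam)) Rinv); [auto|]. apply continuous_Rinv. lra.
      * apply (continuous_comp mu (fun x => x ^ 2)); [auto|]. apply (ex_derive_continuous (fun x => x ^ 2)). auto_derive. auto.
    + pose proof (Hr (e - lam)) as E. unfold w. set (s := r (e - lam)) in *. pose proof (den_pos s) as Hs.
      assert (Ee : e * s ^ 2 = s ^ 3 + om ^ 2 * s - om ^ 2 * lam).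
      { assert (E' : (s - lam) * (s ^ 2 + om ^ 2) = (e - lam) * s ^ 2).
        { replace (s - lam) with ((e - lam) * g s) by lra. unfold g. field. lra. }
        lra. }
      assert (Em : om ^ 2 * lam / s - (s - e) * s = om ^ 2).
      { apply (Rmult_eq_reg_r s); [|lra]. transitivity (om ^ 2 * lam - s ^ 3 + e * s ^ 2); [field; lra|]. rewrite Ee. ring. }
      assert (Hmu : e = s - 2 * mu e) by (unfold mu; fold s; field).
      assert (Hm : mu e ^ 2 <= (om / 2) ^ 2).
      { apply pow_maj_Rabs. unfold mu. fold s. specialize (Rn (e - lam)). fold s in Rn.
        replace ((s - e) / 2) with ((s - lam - (e - lam)) / 2) by field.
        apply Rabs_le_between. apply Rabs_le_between in Rn. assert (K := Rabs_le_between (e - lam) (om / 2)).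
        assert (- (om / 2) <= e - lam <= om / 2) by (apply K; lra). lra. }
      assert (Hq : om ^ 2 * 2 / 3 <= om ^ 2 * lam / s).
      { apply (Rle_div_r (om ^ 2 * 2 / 3) (om ^ 2 * lam) s); [lra|]. assert (0 < om ^ 2) by (apply pow_lt; auto).
        replace (om ^ 2 * 2 / 3 * s) with (om ^ 2 * (2 / 3 * s)) by field. apply Rmult_le_compat_l; lra. }
      assert (Hsq : sqrt (om ^ 2 * lam / s - mu e ^ 2) ^ 2 = om ^ 2 * lam / s - mu e ^ 2).
      { apply pow2_sqrt. assert (0 < om ^ 2) by (apply pow_lt; auto). lra. }
      set (y := sqrt (om ^ 2 * lam / s - mu e ^ 2)) in *. set (m := mu e) in *.
      assert (Hq' : om ^ 2 * lam = s * (y ^ 2 + m ^ 2)) by (rewrite Hsq; field; lra).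
      assert (Hom2 : om ^ 2 = y ^ 2 + m ^ 2 - 2 * m * s).
      { rewrite Hsq. transitivity (om ^ 2 * lam / s - (s - e) * s); [symmetry; exact Em|]. replace (s - e) with (2 * m) by lra. ring. }
      apply eigenvalue_of_root; rewrite ?Hq', ?Hom2, Hmu; ring.
  - eexists. exact MD.
  - rewrite (is_derive_unique _ _ _ MD). pose proof (den_pos lam) as Hs.
    replace ((g lam - 1) / 2) with (- (om ^ 2 / (2 * (lam ^ 2 + om ^ 2)))) by (unfold g; field; lra).
    assert (0 < om ^ 2 / (2 * (lam ^ 2 + om ^ 2))) by (apply Rdiv_lt_0_compat; [apply pow_lt; auto|lra]). lra.
Qed.

End EigenvalueContinuation.

(** * Specialisation to the equilibrium [P0] and the sign of [l1] *)

Section FamilyAtP0.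
Variables alpha beta kappa : R.
Hypothesis hbeta : 0 < beta < 1.
Hypothesis halpha : 0 < alpha.
Hypothesis hkappa : 0 <= kappa < 1.

Let b := sqrt beta.
Let om := omega0 beta.
Let z0 := sqrt (1 / beta - kappa).
Let x0 := acos beta.
Let eta := alpha * b.
Let lam := eps_c alpha beta kappa.
Let D := lam ^ 2 + om ^ 2.
Let dd := 2 * z0 * om * b ^ 3.

Let Hb : 0 < b < 1.
Proof.
  unfold b. split; [apply sqrt_lt_R0; lra|]. rewrite <- sqrt_1. apply sqrt_lt_1; lra.
Qed.
Let Hb2 : b ^ 2 = beta.
Proof. apply pow2_sqrt. lra. Qed.
Let Hr : 0 < 1 / beta - kappa.
Proof.
  assert (1 < 1 / beta); [|lra]. apply (Rlt_div_r 1 1 beta); lra.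
Qed.
Let Hz0 : 0 < z0.
Proof. apply sqrt_lt_R0. exact Hr. Qed.
Let Hz02 : z0 ^ 2 = 1 / beta - kappa.
Proof. apply pow2_sqrt. lra. Qed.
Let Hq : 0 < (1 - beta ^ 2) / beta.
Proof. apply Rdiv_lt_0_compat; [|lra]. assert (beta * beta < 1 * 1) by (apply Rmult_le_0_lt_compat; lra). lra. Qed.
Let Hom : 0 < om.
Proof. apply sqrt_lt_R0. exact Hq. Qed.
Let Hom2 : om ^ 2 = (1 - beta ^ 2) / beta.
Proof. apply pow2_sqrt. lra. Qed.
Let Hrel : om ^ 2 * b ^ 2 = 1 - b ^ 4.
Proof. replace (b ^ 4) with ((b ^ 2) ^ 2) by ring. rewrite Hom2, Hb2. field. lra. Qed.
Let Hcos : cos x0 = b ^ 2.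
Proof. rewrite Hb2. apply cos_acos. lra. Qed.
Let Hsin : sin x0 = om * b.
Proof.
  unfold x0. rewrite sin_acos by lra. unfold om, omega0, b. rewrite <- sqrt_mult by lra. f_equal. unfold Rsqr. field. lra.
Qed.
Let Hlam : lam = 2 * alpha * z0 * b ^ 4.
Proof.
  assert (E : sqrt (1 - kappa * beta) = z0 * b).
  { unfold z0, b. rewrite <- sqrt_mult by lra. f_equal. field. lra. }
  unfold lam, eps_c. rewrite E. fold b. rewrite <- Hb2. ring.
Qed.
Let Hlamp : 0 < lam.
Proof. apply (lam_pos b alpha z0); auto. lra. Qed.
Let Hetap : 0 < eta.
Proof. apply Rmult_lt_0_compat; lra. Qed.
Let Hkap : kap b z0 = kappa.
Proof. unfold kap. rewrite Hb2, Hz02. ring. Qed.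
Let Hdd : dd * eta = om * lam.
Proof. rewrite Hlam. unfold dd, eta. ring. Qed.
Let HP0 : P0 beta kappa = (x0, 0, z0).
Proof. reflexivity. Qed.
Let Hzk : z0 ^ 2 + kappa = 1 / b ^ 2.
Proof. rewrite Hz02, Hb2. ring. Qed.

Lemma equilibrium_P0 (e : R) : equilibrium (fam alpha beta kappa 0 e) (P0 beta kappa).
Proof.
  rewrite HP0. unfold equilibrium, fam. cbn [coord fst snd]. rewrite Hzk, Hcos, Hsin, <- Hb2.
  f_equal; [f_equal|]; field; lra.
Qed.

Lemma jac_P0 (e : R) : jac (fam alpha beta kappa 0 e) (P0 beta kappa) = lin_mat om eta dd e.
Proof.
  apply functional_extensionality. intros i. apply functional_extensionality. intros j.
  rewrite jac_fam, HP0.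
  destruct i as [|[|i]], j as [|[|j]]; cbn [fam_d1 lin_mat coord fst snd]; rewrite ?Hzk, ?Hcos, ?Hsin; try ring.
  - replace ((om * b) ^ 2) with (om ^ 2 * b ^ 2) by ring. field. lra.
  - unfold dd. ring.
  - unfold eta. ring.
Qed.

Lemma Bform_P0 (e : R) (u v : CV) : Bform (fam alpha beta kappa 0 e) (P0 beta kappa) u v
  = Bq (gxx b om) (gxz b z0) (gzz b om) (- (alpha * b ^ 2)) u v.
Proof.
  apply functional_extensionality. intros i. unfold Bform, sum3. rewrite !d2_fam, HP0.
  assert (E1 : om * b - 4 * (1 / b ^ 2) * (om * b * b ^ 2) = gxx b om) by (unfold gxx; field; lra).
  assert (E2 : 2 * z0 * ((b ^ 2) ^ 2 - (om * b) ^ 2) = gxz b z0).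
  { unfold gxz. replace ((om * b) ^ 2) with (om ^ 2 * b ^ 2) by ring. rewrite Hrel. ring. }
  assert (E3 : 2 * (om * b * b ^ 2) = gzz b om) by (unfold gzz; ring).
  destruct i as [|[|i]]; cbn [fam_d2 Bq coord fst snd]; rewrite ?Hzk, ?Hcos, ?Hsin, ?E1, ?E2, ?E3.
  - apply injective_projections; simpl; ring.
  - apply injective_projections; simpl; ring.
  - apply injective_projections; simpl; ring.
Qed.

Lemma Cform_P0 (e : R) (u v w : CV) : Cform (fam alpha beta kappa 0 e) (P0 beta kappa) u v w
  = Cq (gxxx b) (gxxz b om z0) (gxzz b) (alpha * (om * b)) u v w.
Proof.
  apply functional_extensionality. intros i. unfold Cform, sum3. rewrite !d3_fam, HP0.
  assert (Eo : (om * b) ^ 2 = 1 - b ^ 4) by (rewrite <- Hrel; ring).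
  assert (E1 : b ^ 2 - 4 * (1 / b ^ 2) * ((b ^ 2) ^ 2 - (om * b) ^ 2) = gxxx b).
  { unfold gxxx. rewrite Eo. field. lra. }
  assert (E2 : - 8 * z0 * (om * b * b ^ 2) = gxxz b om z0) by (unfold gxxz; ring).
  assert (E3 : 2 * ((b ^ 2) ^ 2 - (om * b) ^ 2) = gxzz b) by (unfold gxzz; rewrite Eo; ring).
  destruct i as [|[|i]]; cbn [fam_d3 Cq coord fst snd]; rewrite ?Hzk, ?Hcos, ?Hsin, ?E1, ?E2, ?E3;
    apply injective_projections; simpl; ring.
Qed.

Lemma qvec_vec_q : qvec alpha beta = vec_q om eta.
Proof.
  apply functional_extensionality. intros [|[|i]]; try reflexivity.
  simpl. f_equal. fold b om. unfold eta. field. lra.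
Qed.

(** The factor 8 between the two coefficients divided by [2 om] from the definition of [l1]. It is
    positive, so the sign of [l1] decides the case whichever normalised [p] is used. *)
Lemma l1_lyap_coeff (p : CV) : adjoint_normalized alpha beta kappa p ->
  l1 alpha beta kappa p = 4 / om * lyap_coeff b om alpha z0 eta lam D.
Proof.
  unfold adjoint_normalized, l1, G21, Amat. fold lam om. rewrite jac_P0, qvec_vec_q. intros [H1 H2].
  rewrite !Bform_P0, Cform_P0.
  rewrite (re_normal_form_coeff om lam eta dd D) by auto.
  rewrite reG21_lyap_coeff by auto. field. lra.
Qed.

Lemma transversal_hopf_P0 : transversal_hopf_point (fam alpha beta kappa 0) lam (P0 beta kappa).
Proof.
  assert (E1 : is_eigenvalue (jac (fam alpha beta kappa 0 lam) (P0 beta kappa)) (0, om)).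
  { rewrite jac_P0. apply (eigenvalue_of_root om lam); auto; ring. }
  split.
  - split; [apply equilibrium_P0|]. exists om. split; [exact Hom|]. split; [exact E1|]. rewrite jac_P0. split.
    + apply (eigenvalue_of_root om lam); auto; ring.
    + apply imaginary_eigenvalue; auto.
  - destruct (eigenvalue_continuation om lam eta dd Hom Hlamp Hetap Hdd) as [dl [mu [w [Hdl [M0 [W0 [H [M1 M2]]]]]]]].
    exists om, dl, mu, w. repeat split; auto; try apply H; auto.
    + apply equilibrium_P0.
    + rewrite jac_P0. apply H. auto.
Qed.

Let L := lyap_coeff b om alpha z0 eta lam D.

Lemma supercritical_branch : L < 0 ->
  asympt_stable (fam alpha beta kappa 0 lam) (P0 beta kappa) /\
  forall r, 0 < r -> exists dl, 0 < dl /\ forall eps, lam - dl < eps < lam ->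
    unstable_eq (fam alpha beta kappa 0 eps) (P0 beta kappa) /\
    exists (gam : R -> R3) (T : R), periodic_orbit (fam alpha beta kappa 0 eps) gam T /\
      orbit_asympt_stable (fam alpha beta kappa 0 eps) gam /\ forall t, dist3 (gam t) (P0 beta kappa) < r.
Proof.
  intros HL. rewrite HP0, <- Hkap, <- Hb2. split.
  - apply (critical_equilibrium_stable b om alpha z0 x0 eta lam D); auto.
  - intros r Hr0.
    destruct (noncritical_equilibrium b om alpha z0 x0 eta lam D) as [n0 [Hn0 H1]]; auto.
    (* With a negative coefficient the cycle exists for [eps < lam], which is the side
       [tau = -1]. *)
    destruct (bifurcating_orbit b om alpha z0 x0 eta lam D Hb Hom halpha Hz0 Hrel Hcos Hsin eq_refl Hlam eq_refl (-1)
      ltac:(ring) ltac:(fold L; lra) r Hr0) as [dl [Hdl H2]].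
    exists (Rmin n0 dl). split; [apply Rmin_glb_lt; auto|]. intros eps He.
    pose proof (Rmin_l n0 dl). pose proof (Rmin_r n0 dl). split.
    + apply H1; [|lra]. apply Rabs_lt_between. lra.
    + destruct (H2 eps ltac:(lra)) as [gam [T [K1 [K2 [_ K3]]]]]. exists gam, T. split; [exact K1|]. split; [apply K2; lra|exact K3].
Qed.

Lemma subcritical_branch : 0 < L ->
  unstable_eq (fam alpha beta kappa 0 lam) (P0 beta kappa) /\
  forall r, 0 < r -> exists dl, 0 < dl /\ forall eps, lam < eps < lam + dl ->
    asympt_stable (fam alpha beta kappa 0 eps) (P0 beta kappa) /\
    exists (gam : R -> R3) (T : R), periodic_orbit (fam alpha beta kappa 0 eps) gam T /\
      orbit_unstable (fam alpha beta kappa 0 eps) gam /\ forall t, dist3 (gam t) (P0 beta kappa) < r.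
Proof.
  intros HL. rewrite HP0, <- Hkap, <- Hb2. split.
  - apply (critical_equilibrium_unstable b om alpha z0 x0 eta lam D); auto.
  - intros r Hr0.
    destruct (noncritical_equilibrium b om alpha z0 x0 eta lam D) as [n0 [Hn0 H1]]; auto.
    destruct (bifurcating_orbit b om alpha z0 x0 eta lam D Hb Hom halpha Hz0 Hrel Hcos Hsin eq_refl Hlam eq_refl 1
      ltac:(ring) ltac:(fold L; lra) r Hr0) as [dl [Hdl H2]].
    exists (Rmin n0 dl). split; [apply Rmin_glb_lt; auto|]. intros eps He.
    pose proof (Rmin_l n0 dl). pose proof (Rmin_r n0 dl). split.
    + apply H1; [|lra]. apply Rabs_lt_between. lra.
    + destruct (H2 eps ltac:(lra)) as [gam [T [K1 [_ [K2 K3]]]]]. exists gam, T. split; [exact K1|]. split; [apply K2; lra|exact K3].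
Qed.

Lemma l1_sign (p : CV) : adjoint_normalized alpha beta kappa p ->
  (l1 alpha beta kappa p < 0 -> L < 0) /\ (0 < l1 alpha beta kappa p -> 0 < L).
Proof.
  intros Hp. rewrite (l1_lyap_coeff p Hp). fold L.
  assert (H4 : 0 < 4 / om) by (apply Rdiv_lt_0_compat; lra). split; intros H.
  - apply (Rmult_lt_reg_l (4 / om)); lra.
  - apply (Rmult_lt_reg_l (4 / om)); lra.
Qed.

End FamilyAtP0.

Theorem theorem3p5 (alpha beta kappa : R)
  (hbeta : 0 < beta < 1) (halpha : 0 < alpha) (hkappa : 0 <= kappa < 1)
  (p : CV) (hp : adjoint_normalized alpha beta kappa p)
  (hl1 : l1 alpha beta kappa p <> 0) :
  transversal_hopf_point (fam alpha beta kappa 0) (eps_c alpha beta kappa) (P0 beta kappa) /\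
  (l1 alpha beta kappa p < 0 ->
     asympt_stable (fam alpha beta kappa 0 (eps_c alpha beta kappa)) (P0 beta kappa) /\
     forall eta, 0 < eta -> exists dl, 0 < dl /\
       forall eps, eps_c alpha beta kappa - dl < eps < eps_c alpha beta kappa ->
         unstable_eq (fam alpha beta kappa 0 eps) (P0 beta kappa) /\
         exists (gam : R -> R3) (T : R),
           periodic_orbit (fam alpha beta kappa 0 eps) gam T /\
           orbit_asympt_stable (fam alpha beta kappa 0 eps) gam /\
           forall t, dist3 (gam t) (P0 beta kappa) < eta) /\
  (0 < l1 alpha beta kappa p ->
     unstable_eq (fam alpha beta kappa 0 (eps_c alpha beta kappa)) (P0 beta kappa) /\
     forall eta, 0 < eta -> exists dl, 0 < dl /\
       forall eps, eps_c alpha beta kappa < eps < eps_c alpha beta kappa + dl ->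
         asympt_stable (fam alpha beta kappa 0 eps) (P0 beta kappa) /\
         exists (gam : R -> R3) (T : R),
           periodic_orbit (fam alpha beta kappa 0 eps) gam T /\
           orbit_unstable (fam alpha beta kappa 0 eps) gam /\
           forall t, dist3 (gam t) (P0 beta kappa) < eta).
Proof.
  split; [apply transversal_hopf_P0; auto|].
  destruct (l1_sign alpha beta kappa hbeta halpha hkappa p hp) as [Hneg Hpos].
  split; intros H; [apply supercritical_branch | apply subcritical_branch]; auto.
Qed.
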